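(* Assume that the random environment $\omega=(\omega_{x,y})_{x,y\in\mathbb{Z}}$ is stationary and ergodic and satisfies Conditions E and K. Let $\hat\tau=\inf\{k\ge1:X_k\le 0\}$, $\hat\tau_n=\inf\{k\ge0:X_k\ge n\}$, $\Lambda'_n=\{\hat\tau_n<\hat\tau\}$, $T_n=\inf\{t>0:Z^{n^2}_t=\sigma^{-1}\}$, and let $Y^n$ be the stopped process $Y^n_t=Z^{n^2}_{t\wedge T_n}$, $t\ge0$. Let $B_3$ be a three-dimensional Bessel process started at $0$ and $\varrho_1=\inf\{t>0:B_3(t)=\sigma^{-1}\}$. Then, for $\mathbb{P}$-almost every $\omega$, under the law $\mathtt{P}_\omega[\,\cdot\mid\Lambda'_n]$, the couple $(Y^n,T_n)$ converges in law to $(B_3(\cdot\wedge\varrho_1),\varrho_1)$ as $n\to\infty$.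
   Context: Environment: for $x,y\in\mathbb{Z}$, $\omega_{x,y}=\omega_{y,x}\ge 0$ is the (random) conductance between $x$ and $y$; $\omega=(\omega_{x,y})_{x,y\in\mathbb{Z}}$ is the environment and $\mathbb{P}$ is its law. The shifts are $(\theta_z\omega)_{x,y}=\omega_{x+z,y+z}$, $z\in\mathbb{Z}$. It is assumed that the sequence of random vectors $(\omega_{x,\cdot})_{x\in\mathbb{Z}}$ is stationary and ergodic with respect to the family of shifts $\theta$. Condition E: there exists $\kappa>0$ such that, $\mathbb{P}$-a.s., $\omega_{0,1}\ge\kappa$. Condition K: there exist constants $K,\beta>0$ such that, $\mathbb{P}$-a.s., $\omega_{0,y}\le \frac{K}{1+y^{3+\beta}}$ for all $y\ge 0$. Random walk: let $C_x=\sum_{y}\omega_{x,y}$ (finite under Condition K). Given $\omega$, $\mathtt{P}_\omega^x$ is the (quenched) law of the Markov chain $(X_k)_{k\ge0}$ on $\mathbb{Z}$ with $X_0=x$ and transition probabilities $p_\omega(y,z)=\omega_{y,z}/C_y$; $\mathtt{P}_\omega=\mathtt{P}_\omega^0$. Rescaled path: for $m\ge1$, $Z^m=(Z^m_t)_{t\ge 0}$ is the continuous polygonal interpolation of $k/m\mapsto \sigma^{-1}m^{-1/2}X_k$, i.e. $\sigma\sqrt m\,Z^m_t=X_{\lfloor mt\rfloor}+(mt-\lfloor mt\rfloor)(X_{\lfloor mt\rfloor+1}-X_{\lfloor mt\rfloor})$. Here $\sigma\in(0,\infty)$ is the deterministic constant of the known quenched invariance principle for this model: under Conditions E and K, $\sigma$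 is the (unique) constant, not depending on $\omega$, such that for $\mathbb{P}$-a.e. $\omega$, $Z^m$ converges in law under $\mathtt{P}_\omega$, as $m\to\infty$, to standard Brownian motion. Bessel process: $B_3(t)=\sqrt{W_1^2(t)+W_2^2(t)+W_3^2(t)}$, where $(W_1,W_2,W_3)$ is a standard three-dimensional Brownian motion started at the origin. Topology: paths are elements of the space $C_0(\mathbb{R}_+)$ of continuous $f:\mathbb{R}_+\to\mathbb{R}$ with $f(0)=0$, with the metric $\mathtt{d}(f,g)=\sum_{n\ge1}2^{-n+1}\min\{1,\sup_{x\in[0,n]}|f(x)-g(x)|\}$ (uniform convergence on compacts); convergence in law of the couple is on $C_0(\mathbb{R}_+)\times\mathbb{R}_+$. *)

(* Defs.v *)
From HB Require Import structures.
From mathcomp Require Import all_boot all_order all_algebra.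
From mathcomp Require Import all_classical all_reals all_analysis.

Set Implicit Arguments.
Unset Strict Implicit.
Unset Printing Implicit Defensive.

Import Order.TTheory GRing.Theory Num.Theory.
Import numFieldNormedType.Exports.

Local Open Scope classical_set_scope.
Local Open Scope ring_scope.

(* Random environments: a law on the space of all arrays of conductances, with
   the product sigma-algebra. *)

Definition env_cylinders (R : realType) : set (set (int -> int -> R)) :=
  \bigcup_(xy in [set: int * int])
    preimage_set_system setT (fun w : int -> int -> R => w xy.1 xy.2)
      measurable.

Arguments env_cylinders R : clear implicits.

Notation environment R := (g_sigma_algebraType (env_cylinders R)).

Definition env_shift (R : realType) (z : int) (w : int -> int -> R) :
    int -> int -> R :=
  fun x y => w (x + z) (y + z).

Definition conductances (R : realType) (P : probability (environment R) R) :=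
  {ae P, forall w, forall x y : int, 0 <= w x y /\ w x y = w y x}.

Definition stationary (R : realType) (P : probability (environment R) R) :=
  forall (z : int) (A : set (environment R)), measurable A ->
    P (env_shift z @^-1` A) = P A.

Definition ergodic (R : realType) (P : probability (environment R) R) :=
  forall A : set (environment R), measurable A ->
    (forall z : int, env_shift z @^-1` A = A) -> P A = 0%E \/ P A = 1%E.

Definition condition_E (R : realType) (P : probability (environment R) R) :=
  exists2 kappa : R, 0 < kappa & {ae P, forall w, kappa <= w 0 1}.

Definition condition_K (R : realType) (P : probability (environment R) R) :=
  exists K beta : R, [/\ 0 < K, 0 < beta &
    {ae P, forall w, forall y : nat,
      w 0 (Posz y) <= K / (1 + y%:R `^ (3 + beta))}].

(* Quenched random walk: the law of the Markov chain is a probability on the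
   space of trajectories with the product sigma-algebra, where it is determined
   by its finite-dimensional distributions. *)

Definition total_conductance (R : realType) (w : int -> int -> R) (x : int) : R :=
  fine (\esum_(y in [set: int]) (w x y)%:E).

Definition transition (R : realType) (w : int -> int -> R) (x y : int) : R :=
  w x y / total_conductance w x.

HB.instance Definition _ := isPointed.Build int 0.

Definition walk_cylinders : set (set (nat -> int)) :=
  \bigcup_k preimage_set_system setT (fun X : nat -> int => X k) setT.

Notation trajectory := (g_sigma_algebraType walk_cylinders).

Definition quenched_law (R : realType) (w : int -> int -> R) (x : int)
    (Q : probability trajectory R) :=
  forall (k : nat) (s : nat -> int),
    Q [set X : trajectory | forall i, (i <= k)%N -> X i = s i] =
      ((s 0%N == x)%:R * \prod_(i < k) transition w (s i) (s i.+1))%:E.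

Definition tau_hat (R : realType) (X : nat -> int) : \bar R :=
  ereal_inf [set (k%:R)%:E | k in [set k | (1 <= k)%N /\ X k <= 0]].

Definition tau_hat_level (R : realType) (n : nat) (X : nat -> int) : \bar R :=
  ereal_inf [set (k%:R)%:E | k in [set k | Posz n <= X k]].

Definition Lambda' (R : realType) (n : nat) : set trajectory :=
  [set X | (tau_hat_level R n X < tau_hat R X)%E].

Definition conditional_law d (T : measurableType d) (R : realType)
    (Q : probability T R) (L : set T) : set T -> \bar R :=
  fun A => (fine (Q (A `&` L)) / fine (Q L))%:E.

Definition rescaled_path (R : realType) (sigma : R) (m : nat) (X : nat -> int) :
    R -> R :=
  fun t => let k := Num.truncn (m%:R * t) in
    ((X k)%:~R + (m%:R * t - k%:R) * ((X k.+1)%:~R - (X k)%:~R))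
      / (sigma * Num.sqrt m%:R).

(* Path space. A path is represented by any function on R with the right
   restriction to [0, +oo[: [path_dist], and hence every functional that is
   continuous for it, only sees that restriction. *)

Definition C0 (R : realType) : set (R -> R) :=
  [set f : R -> R | {within [set t : R | 0 <= t], continuous f} /\ f 0 = 0].

Definition path_dist (R : realType) (f g : R -> R) : R :=
  limn (fun N => \sum_(1 <= n < N)
    2 ^- n.-1 * Num.min 1 (sup [set `|f x - g x| | x in `[0, n%:R]])).

Definition C0_Rplus (R : realType) : set ((R -> R) * R) :=
  [set p | C0 p.1 /\ 0 <= p.2].

Definition couple_dist (R : realType) (p q : (R -> R) * R) : R :=
  Num.max (path_dist p.1 q.1) `|p.2 - q.2|.

Definition continuous_for (R : realType) (E : Type) (S : set E)
    (dist : E -> E -> R) (F : E -> R) :=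
  forall x, S x -> forall eps : R, 0 < eps -> exists2 delta : R, 0 < delta &
    forall y, S y -> dist x y < delta -> `|F x - F y| < eps.

(* Convergence in law of random elements of the metric space (S, dist). The
   random elements need only belong to S almost surely; the bounded continuous
   functions on S are extended arbitrarily (but boundedly) to E. *)
Definition cvg_in_law (R : realType) (E : Type) (S : set E)
    (dist : E -> E -> R)
    d (T : measurableType d) (mu : nat -> set T -> \bar R) (X : nat -> T -> E)
    d' (T' : measurableType d') (nu : set T' -> \bar R) (Y : T' -> E) :=
  forall F : E -> R, (exists M : R, forall x, `|F x| <= M) ->
    continuous_for S dist F ->
    (\int[mu n]_w (F (X n w))%:E)%E @[n --> \oo] -->
      (\int[nu]_w (F (Y w))%:E)%E.

Definition mutually_independent d (T : measurableType d) (R : realType)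
    (P : probability T R) (I : finType) (X : I -> T -> R) :=
  forall B : I -> set R, (forall i, measurable (B i)) ->
    P (\bigcap_i (X i @^-1` B i)) = (\prod_i fine (P (X i @^-1` B i)))%:E.

(* Standard Brownian motion in dimension n started at the origin: increments
   over disjoint intervals are independent with law N(0, (t - s) I_n), which is
   written as joint independence over both coordinates and intervals. The second
   parameter of [normal_prob] is the standard deviation. *)
Definition brownian_motion d (T : measurableType d) (R : realType)
    (P : probability T R) (n : nat) (W : 'I_n -> R -> T -> R) :=
  [/\ forall i t, 0 <= t -> measurable_fun setT (W i t),
      {ae P, forall b, forall i, W i 0 b = 0},
      forall i (s t : R) (B : set R), 0 <= s -> s < t -> measurable B ->
        P [set b | B (W i t b - W i s b)] = normal_prob 0 (Num.sqrt (t - s)) B,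
      forall (k : nat) (t : nat -> R), 0 <= t 0%N ->
        {homo t : i j / (i < j)%N >-> i < j} ->
        mutually_independent P (fun (p : 'I_n * 'I_k) (b : T) =>
          W p.1 (t p.2.+1) b - W p.1 (t p.2) b) &
      {ae P, forall b, forall i,
        {within [set t : R | 0 <= t], continuous (fun t : R => W i t b)}}].

Definition bessel3 (T : Type) (R : realType) (W : 'I_3 -> R -> T -> R) (b : T) :
    R -> R :=
  fun t => Num.sqrt (\sum_(i < 3) W i t b ^+ 2).

(* The deterministic constant of the quenched invariance principle. *)
Definition diffusion_constant (R : realType) (P : probability (environment R) R)
    (sigma : R) :=
  0 < sigma /\
  {ae P, forall w, forall Q : probability trajectory R, quenched_law w 0 Q ->
    forall (d : measure_display) (T : measurableType d) (PB : probability T R)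
      (W : 'I_1 -> R -> T -> R), brownian_motion PB W ->
    cvg_in_law (@C0 R) (@path_dist R)
      (fun _ => Q) (fun m X => rescaled_path sigma m X)
      PB (fun b t => W ord0 t b)}.

Definition hitting_time (R : realType) (a : R) (f : R -> R) : \bar R :=
  ereal_inf [set t%:E | t in [set t | 0 < t /\ f t = a]].

(* The couple (f stopped at T, T) for T the hitting time of a. In the uses below
   T is finite almost surely; otherwise the second component is 0. *)
Definition stopped_couple (R : realType) (a : R) (f : R -> R) : (R -> R) * R :=
  let T := hitting_time a f in
  (fun t => f (fine (Order.min t%:E T)), fine T).

(* Main.v *)
(* Let a = 1 / sigma. It suffices to bound the conditional expectations of a
   continuous functional F with values in [0, 1] from below, and to apply the
   bound to F and 1 - F.

   By the Markov property at time n^2 and Lipschitz dependence on the starting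
   point, the quenched invariance principle from 0 gives one which is uniform
   over the starting points at distance of order n. The walk conditioned on
   Lambda'_n is cut at its first entry into [N, N + V], where N ~ eps sigma n and
   V << N. Dirichlet forms and reversibility show that the walk reaches N before
   (-oo, 0] with probability at least c / N, that given this event it enters
   [N, N + V] with high probability and in a time at most e n^2, and that from
   there it reaches n before (-oo, 0] with probability about eps / a; the unknown
   probability of the entry cancels.

   For Brownian motion the h-transform is proved by computation. Let R^x be the
   radial part of the three-dimensional Brownian motion W started at (x, 0, 0).
   On a time grid, x E[H(R^x_1, ..., R^x_k)] = E[(x + b_k) H(|x + b_1|, ...,
   |x + b_k|)] when H is the exponential of - (1/2) sum_j lam_j r_j^2, because
   both sides satisfy the same Gaussian recursion; Bernstein polynomials in the
   variables exp (- r_j^2 / 2) extend it to all Lipschitz H, and a soft first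
   passage weight then gives
     x E[Phi(R^x)] <~ a E[Phi(x + b); x + b reaches a before 0].
   Finally R^x tends to R^0 as x tends to 0, and almost surely the stopped couple
   is a continuous functional at R^0 because R^0 crosses the level a. *)
From HB Require Import structures.
Require Import Defs.
From mathcomp Require Import all_boot all_order all_algebra.
From mathcomp Require Import all_classical all_reals all_analysis.
From mathcomp Require Import measurable_realfun.
From mathcomp Require Import ring lra zify.

Set Implicit Arguments.
Unset Strict Implicit.
Unset Printing Implicit Defensive.

Import Order.TTheory GRing.Theory Num.Theory.
Import numFieldNormedType.Exports.

Local Open Scope classical_set_scope.
Local Open Scope ring_scope.

(** * Expectations and lower integrals *)

(** The functional F is continuous only for [path_dist], and its composition with stopping is never
    shown to be measurable on trajectories. Integrals are therefore treated as lower integrals: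
    expectations of functionals are bounded from below only, and the one upper bound concerns the
    probability of [Lambda']. To this end F is replaced by lower envelopes. [gfun] takes the infimum
    over all paths beginning with a short, small, otherwise arbitrary piece; this absorbs the
    uncontrolled part of the walk before its entry in [N, N + V]. [reg] then makes the envelope
    Lipschitz for the uniform norm on a compact interval; for this class, [lipf], measurability,
    discretization in time and the invariance principle are all available. Each passage between
    envelopes costs a margin, whence the radii 16 r, 8 r, r / 4. The window [N, N + V] must be
    narrow because exit probabilities are known only up to constant factors: the walk has to restart
    from a nearly deterministic point, so that the factor eps / a is the same in the numerator and
    in the denominator. *)

Lemma continuous_lip (R : realType) (g : R -> R) (L : R) :
  (forall x y, `|g x - g y| <= L * `|x - y|) -> continuous g.
Proof.
move=> gL x; apply/cvgrPdist_le => e e0.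
have L1 : 0 < `|L| + 1 by rewrite ltr_wpDl.
have e1 : 0 < (`|L| + 1)^-1 * e by rewrite mulr_gt0// invr_gt0.
have /(_ (nbhs_filter x)) h := @cvgr_dist_le R R _ (nbhs x) _ id x cvg_id _ e1.
apply: (@filterS _ (nbhs x) (nbhs_filter x) _ _ _ h) => y yx; rewrite (le_trans (gL _ _))//.
rewrite (@le_trans _ _ ((`|L| + 1) * `|x - y|))//.
  by rewrite ler_wpM2r// (le_trans (ler_norm _))// lerDl.
by rewrite -ler_pdivlMl.
Qed.

Lemma measurable_lip (R : realType) (g : R -> R) (L : R) :
  (forall x y, `|g x - g y| <= L * `|x - y|) -> measurable_fun setT g.
Proof. by move=> /continuous_lip; exact: continuous_measurable_fun. Qed.

Section expectation.
Context d (T : measurableType d) (R : realType) (mu : probability T R).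
Implicit Types f g : T -> R.

Definition bounded_meas f :=
  measurable_fun setT f /\ exists M : R, forall x, `|f x| <= M.

Definition expect f : R := fine (\int[mu]_x (f x)%:E).

Lemma bounded_meas_integrable f :
  bounded_meas f -> mu.-integrable setT (EFin \o f).
Proof.
move=> [mf [M fM]]; apply: measurable_bounded_integrable => //.
  by rewrite -ge0_fin_numE ?fin_num_measure.
exists M; split; first exact: num_real.
by move=> x Mx y _; exact: le_trans (fM y) (ltW Mx).
Qed.

Lemma expectE f : bounded_meas f -> (\int[mu]_x (f x)%:E)%E = (expect f)%:E.
Proof.
by move=> /bounded_meas_integrable bf; rewrite /expect fineK// integrable_fin_num.
Qed.

Lemma bounded_meas_cst c : bounded_meas (fun=> c).
Proof. by split => //; exists `|c|. Qed.

Lemma bounded_measD f g :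
  bounded_meas f -> bounded_meas g -> bounded_meas (fun x => f x + g x).
Proof.
move=> [mf [M fM]] [mg [N gN]]; split; first exact: measurable_funD.
by exists (M + N) => x; rewrite (le_trans (ler_normD _ _))// lerD.
Qed.

Lemma bounded_measM f g :
  bounded_meas f -> bounded_meas g -> bounded_meas (fun x => f x * g x).
Proof.
move=> [mf [M fM]] [mg [N gN]]; split; first exact: measurable_funM.
by exists (M * N) => x; rewrite normrM ler_pM.
Qed.

Lemma bounded_measZ c f : bounded_meas f -> bounded_meas (fun x => c * f x).
Proof. by move=> bf; apply: bounded_measM bf; exact: bounded_meas_cst. Qed.

Lemma bounded_measB f g :
  bounded_meas f -> bounded_meas g -> bounded_meas (fun x => f x - g x).
Proof.
move=> bf bg; have -> : (fun x => f x - g x) = (fun x => f x + (-1) * g x).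
  by apply/funext => x; rewrite mulN1r.
by apply: bounded_measD => //; exact: bounded_measZ.
Qed.

Lemma bounded_meas_sum (I : Type) (s : seq I) (F : I -> T -> R) :
  (forall i, bounded_meas (F i)) -> bounded_meas (fun x => \sum_(i <- s) F i x).
Proof.
move=> bF; elim: s => [|i s ih].
  by under eq_fun do rewrite big_nil; exact: bounded_meas_cst.
by under eq_fun do rewrite big_cons; exact: bounded_measD.
Qed.

Lemma expect_cst c : expect (fun=> c) = c.
Proof. by rewrite /expect integral_cst//= probability_setT mule1. Qed.

Lemma expectD f g : bounded_meas f -> bounded_meas g ->
  expect (fun x => f x + g x) = expect f + expect g.
Proof.
move=> /bounded_meas_integrable bf /bounded_meas_integrable bg.
exact: RintegralD.
Qed.

Lemma expectB f g : bounded_meas f -> bounded_meas g ->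
  expect (fun x => f x - g x) = expect f - expect g.
Proof.
move=> /bounded_meas_integrable bf /bounded_meas_integrable bg.
exact: RintegralB.
Qed.

Lemma expectZ c f : bounded_meas f -> expect (fun x => c * f x) = c * expect f.
Proof. by move=> /bounded_meas_integrable bf; exact: RintegralZl. Qed.

Lemma expect_sum (I : Type) (s : seq I) (F : I -> T -> R) :
  (forall i, bounded_meas (F i)) ->
  expect (fun x => \sum_(i <- s) F i x) = \sum_(i <- s) expect (F i).
Proof.
move=> bF; elim: s => [|i s ih].
  by under eq_fun do rewrite big_nil; rewrite expect_cst big_nil.
under eq_fun do rewrite big_cons; rewrite expectD ?ih ?big_cons//.
exact: bounded_meas_sum.
Qed.

Lemma le_expect f g : bounded_meas f -> bounded_meas g ->
  (forall x, f x <= g x) -> expect f <= expect g.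
Proof.
move=> /bounded_meas_integrable bf /bounded_meas_integrable bg fg.
by apply: le_Rintegral => // x _; exact: fg.
Qed.

Lemma eq_expect f g : f =1 g -> expect f = expect g.
Proof. by move=> /funext ->. Qed.

Lemma expect_ge0 f : (forall x, 0 <= f x) -> 0 <= expect f.
Proof. by move=> f0; rewrite fine_ge0// integral_ge0// => x _; rewrite lee_fin. Qed.

Lemma expect_dist f g (e : R) : bounded_meas f -> bounded_meas g ->
  (forall x, `|f x - g x| <= e) -> `|expect f - expect g| <= e.
Proof.
move=> bf bg fge; have h c : bounded_meas (fun=> c) := bounded_meas_cst c.
rewrite -expectB// ler_norml; apply/andP; split.
  rewrite -[leLHS]expect_cst; apply: le_expect => // [|x]; first exact: bounded_measB.
  by have := fge x; rewrite ler_norml => /andP[].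
rewrite -[leRHS]expect_cst; apply: le_expect => // [|x]; first exact: bounded_measB.
by have := fge x; rewrite ler_norml => /andP[].
Qed.

Lemma expect_cvg (F : nat -> T -> R) f (M : R) :
  (forall n, bounded_meas (F n)) -> (forall n x, `|F n x| <= M) ->
  (forall x, F n x @[n --> \oo] --> f x) ->
  bounded_meas f /\ expect (F n) @[n --> \oo] --> expect f.
Proof.
move=> bF FM Ff.
have mf : measurable_fun setT f.
  apply: (@measurable_fun_cvg _ _ _ setT F) => // n.
  by have [] := bF n.
have bf : bounded_meas f.
  split => //; exists M => x.
  have : `|F n x| @[n --> \oo] --> `|f x| by apply: cvg_norm; exact: Ff.
  move=> h; rewrite -(cvg_lim _ h)//; apply: limr_le; first by apply/cvg_ex; eexists; exact: h.
  by near=> n; exact: FM.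
split => //.
have [] := @dominated_convergence _ _ _ mu setT measurableT
  (fun n x => (F n x)%:E) (fun x => (f x)%:E) (fun=> M%:E).
- by move=> n; apply/measurable_EFinP; have [] := bF n.
- exact/measurable_EFinP.
- by apply: aeW => x _; apply: cvg_EFin; [near=> n|exact: Ff].
- exact: (bounded_meas_integrable (bounded_meas_cst M)).
- by apply: aeW => x n _; rewrite lee_fin FM.
move=> _ _ h.
have -> : (fun n => expect (F n)) = (fun n => fine (\int[mu]_x (F n x)%:E)) by [].
apply: fine_cvg; rewrite -expectE//.
Unshelve. all: by end_near. Qed.

End expectation.

Section lower_integral.
Import HBNNSimple.
Local Open Scope ereal_scope.
Context d (T : measurableType d) (R : realType) (mu : {measure set T -> \bar R}).
Implicit Types f g : T -> \bar R.

(* The library integral of a nonnegative function is a lower integral: the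
   following facts hold without measurability. *)
Lemma le_lower_integral f g : (forall x, 0 <= f x) -> (forall x, f x <= g x) ->
  \int[mu]_x f x <= \int[mu]_x g x.
Proof.
move=> f0 fg; rewrite !ge0_integralTE//; last by move=> x; exact: le_trans (fg x).
apply: le_ereal_sup => _ [h /= hf <-]; exists h => // x.
exact: le_trans (hf x) (fg x).
Qed.


(** Without measurability only this half of additivity survives: a sum of simple minorants is a
    simple minorant of the sum. It suffices for [conditional_compl_le]. *)
Lemma lower_integralD f g : (forall x, 0 <= f x) -> (forall x, 0 <= g x) ->
  \int[mu]_x f x + \int[mu]_x g x <= \int[mu]_x (f x + g x).
Proof.
move=> f0 g0.
have key (h k : {nnsfun T >-> R}) :
    (forall x, (h x)%:E <= f x) -> (forall x, (k x)%:E <= g x) ->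
    sintegral mu h + sintegral mu k <= \int[mu]_x (f x + g x).
  move=> hf kg; rewrite ge0_integralTE; last by move=> x; rewrite adde_ge0.
  rewrite -sintegralD; apply: ereal_sup_ubound => /=.
  exists (add_nnsfun h k) => //= x.
  by rewrite EFinD leeD.
have fgE : forall x, 0 <= f x + g x by move=> x; rewrite adde_ge0.
have := integral_ge0 mu (fun x (_ : setT x) => fgE x).
have lef : \int[mu]_x f x <= \int[mu]_x (f x + g x).
  by apply: le_lower_integral => // x; rewrite leeDl.
have leg : \int[mu]_x g x <= \int[mu]_x (f x + g x).
  by apply: le_lower_integral => // x; rewrite leeDr.
have := integral_ge0 mu (fun x (_ : setT x) => f0 x).
have := integral_ge0 mu (fun x (_ : setT x) => g0 x).
(* If the integral of the sum is infinite there is nothing to prove; otherwise both terms are finite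
   and the two suprema can be bounded one after the other. *)
case: (\int[mu]_x (f x + g x)) lef leg key => // [r|] lef leg key ge0' fe0 _; last exact: leey.
have ffin : \int[mu]_x f x \is a fin_num.
  by rewrite ge0_fin_numE// (le_lt_trans lef)// ltey.
have gfin : \int[mu]_x g x \is a fin_num.
  by rewrite ge0_fin_numE// (le_lt_trans leg)// ltey.
rewrite -leeBrDr// ge0_integralTE//.
apply: ge_ereal_sup => _ [h /= hf <-].
have hfin : sintegral mu h \is a fin_num.
  rewrite ge0_fin_numE ?sintegral_ge0// (le_lt_trans _ (ltry r))// (le_trans _ lef)//.
  by rewrite ge0_integralTE//; apply: ereal_sup_ubound; exists h.
rewrite leeBrDr// addeC -leeBrDr// ge0_integralTE//.
apply: ge_ereal_sup => _ [k /= kg <-].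
by rewrite leeBrDr// addeC; exact: key.
Qed.

(** A simple minorant multiplied by the indicator of the complement of [N] keeps its integral and no
    longer sees [N]; so null sets are irrelevant even for functions that are not measurable. *)
Lemma lower_integral_null f g (N : set T) : measurable N -> mu N = 0 ->
  (forall x, 0 <= f x) -> (forall x, 0 <= g x) ->
  (forall x, ~ N x -> f x = g x) -> \int[mu]_x f x = \int[mu]_x g x.
Proof.
move=> mN N0; wlog suff : f g / (forall x, 0 <= f x) -> (forall x, 0 <= g x) ->
    (forall x, ~ N x -> f x = g x) -> \int[mu]_x f x <= \int[mu]_x g x.
  move=> H f0 g0 fg; apply/eqP; rewrite eq_le !H// => x /fg; exact: esym.
move=> f0 g0 fg; rewrite [leLHS]ge0_integralTE//.
apply: ge_ereal_sup => _ [h /= hf <-].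
pose k := proj_nnsfun h (measurableC mN).
have kE x : k x = (h x * \1_(~` N) x)%R by rewrite /k /proj_nnsfun /= mindicE indicE.
have -> : sintegral mu h = sintegral mu k.
  rewrite -!integralT_nnsfun; apply: ae_eq_integral => //.
  - exact/measurable_EFinP.
  - exact/measurable_EFinP.
  - exists N; split => // x /= /not_implyP[_]; apply: contra_notP => Nx.
    by rewrite mindicE mem_set// mulr1.
rewrite [leRHS]ge0_integralTE//; apply: ereal_sup_ubound; exists k => //= x.
rewrite mindicE; have [Nx|Nx] := pselect (N x).
  by rewrite memNset// mulr0 g0.
by rewrite mem_set// mulr1 -fg.
Qed.

Lemma integral_countable_partition (I : countType) (A : I -> set T) f :
  (forall i, measurable (A i)) -> trivIset setT A -> \bigcup_i A i = setT ->
  measurable_fun setT f -> (forall x, 0 <= f x) ->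
  \int[mu]_x f x = \esum_(i in [set: I]) \int[mu]_(x in A i) f x.
Proof.
move=> mA tA cA mf f0.
(* Integers that code no element of [I] carry the empty set, which turns the partition into a
   sequence. *)
pose F n := if pickle_inv n is Some i then A i else set0.
have mF n : measurable (F n) by rewrite /F; case: pickle_inv.
have tF : trivIset setT F.
  apply/trivIsetP => i j _ _ ij; rewrite /F.
  case Ei : (pickle_inv i) => [x|]; last by rewrite set0I.
  case Ej : (pickle_inv j) => [y|]; last by rewrite setI0.
  have xy : x != y.
    apply: contra_neq ij => xy; have := @pickle_invK I i; have := @pickle_invK I j.
    by rewrite Ei Ej /= xy => <-.
  by move/trivIsetP : tA; apply.
have FT : \bigcup_n F n = setT.
  rewrite -subTset => x _; have : (\bigcup_i A i) x by rewrite cA.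
  by move=> [i _ Aix]; exists (pickle i) => //; rewrite /F pickleK_inv.
rewrite -{1}FT ge0_integral_bigcup//; last by rewrite FT.
rewrite nneseries_esumT; last by move=> n; exact: integral_ge0.
rewrite (esumID [set n | (pickle_inv n : option I)]); last first.
  by move=> n _; exact: integral_ge0.
rewrite [X in _ + X]esum1 ?adde0; last first.
  by move=> n [_ /=]; rewrite /F; case: pickle_inv => // _; rewrite integral_set0.
rewrite setTI (@reindex_esum R I nat setT _ pickle).
  by apply: eq_esum => i _; rewrite /F pickleK_inv.
split => [i _ /=|i j _ _ /(pcan_inj pickleK_inv)//|n /=].
  by rewrite pickleK_inv.
by case E : pickle_inv => [i|]// _; exists i => //; have := @pickle_invK I n; rewrite E.
Qed.

Lemma ge0_integral_mrestr (D : set T) (mD : measurable D) f :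
  measurable_fun setT f -> (forall x, 0 <= f x) ->
  \int[mrestr mu mD]_x f x = \int[mu]_(x in D) f x.
Proof.
move=> mf f0; rewrite integral_mkcond.
have mfD : measurable_fun setT (f \_ D) by apply/(measurable_restrictT _ mD); exact: measurable_funTS.
have fD0 x : 0 <= (f \_ D) x by apply: erestrict_ge0 => ? _; exact: f0.
have mDC := measurableC mD.
transitivity (\int[measure_add (mrestr mu mD) (mrestr mu mDC)]_x (f \_ D) x); last first.
  apply: eq_measure_integral => A mA _; etransitivity; first exact: measure_addE.
  by rewrite [RHS](measureDI mu mA mD) setDE addeC.
rewrite ge0_integral_measure_add// [X in _ = _ + X](_ : _ = 0) ?adde0.
  apply: ae_eq_integral => //; exists (~` D); split => //.
    by rewrite [LHS](_ : _ = mu (~` D `&` D))// setICl measure0.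
  by move=> x /= /not_implyP[_]; apply: contra_notP => /contrapT Dx; rewrite patchE mem_set.
rewrite -(integral0 (mrestr mu mDC) setT); apply: ae_eq_integral => //.
exists D; split => //; first by rewrite [LHS](_ : _ = mu (D `&` ~` D))// setICr measure0.
by move=> x /= /not_implyP[_]; apply: contra_notP => Dx; rewrite patchE memNset.
Qed.

(** Stated for bare set functions because [conditional_law] is one; the integral reads it only on
    level sets of simple functions. *)
Lemma eq_set_fun_integral (m1 m2 : set T -> \bar R) f :
  (forall A, measurable A -> m1 A = m2 A) ->
  \int[m1]_x f x = \int[m2]_x f x.
Proof.
move=> m12; have E (h : {nnsfun T >-> R}) : sintegral m1 h = sintegral m2 h.
  by rewrite /sintegral; apply: eq_fsbigr => x _; rewrite m12//; exact: measurable_sfunP.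
by rewrite /integral; congr (ereal_sup _ - ereal_sup _); apply/seteqP;
  split => _ [h hf <-]; exists h; rewrite // E.
Qed.

End lower_integral.

Section gaussian_law.
Variables (R : realType) (s : R).

(* [normal_prob] as a measure on [R] equipped with its default sigma-algebra. *)
Definition gauss_law : set R -> \bar R := normal_prob 0 s.

Let gauss_law0 : gauss_law set0 = 0%E.
Proof. by rewrite /gauss_law measure0. Qed.

Let gauss_law_ge0 A : (0 <= gauss_law A)%E.
Proof. exact: measure_ge0. Qed.

Let gauss_law_sigma : @semi_sigma_additive default_measure_display R R gauss_law.
Proof.
exact: (@measure_semi_sigma_additive _ (measurableTypeR R) R (normal_prob 0 s)).
Qed.

HB.instance Definition _ := isMeasure.Build default_measure_display R R
  gauss_law gauss_law0 gauss_law_ge0 gauss_law_sigma.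

Let gauss_law1 : gauss_law setT = 1%E.
Proof. exact: (@probability_setT _ (measurableTypeR R) R (normal_prob 0 s)). Qed.

HB.instance Definition _ :=
  Measure_isProbability.Build default_measure_display R R gauss_law gauss_law1.

End gaussian_law.

Lemma near_divn_le (R : realType) (c e : R) : 0 < e ->
  \forall n \near \oo, c / n.+1%:R <= e.
Proof.
move=> e0; near=> n; rewrite ler_pdivrMr ?ltr0n// mulrC -ler_pdivrMr//.
rewrite (@le_trans _ _ n%:R) ?ler_nat//.
near: n; exact: nbhs_infty_ger.
Unshelve. all: by end_near. Qed.

(** * Lipschitz functions of finitely many real variables, and their discretization by cells *)

Section coordinates.
Variable R : realType.

(** The bound by the first m coordinates also encodes that [H] ignores the others, so functions of m
    variables are applied to infinite sequences and m can vary without changing types. *)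
Definition lip_coord (m : nat) (L M : R) (H : (nat -> R) -> R) :=
  (forall s, `|H s| <= M) /\
  forall s s', `|H s - H s'| <= L * \sum_(i < m) `|s i - s' i|.

Definition upd (s : nat -> R) (m : nat) (y : R) : nat -> R :=
  fun i => if i == m then y else s i.

Lemma lip_coord_upd m L M H y : lip_coord m.+1 L M H ->
  lip_coord m L M (fun s => H (upd s m y)).
Proof.
move=> [HM HL]; split=> [s|s s']; first exact: HM.
rewrite (le_trans (HL _ _))// big_ord_recr/= /upd eqxx subrr normr0 addr0.
rewrite le_eqVlt; apply/orP; left; apply/eqP; congr (_ * _); apply: eq_bigr => i _.
by rewrite /= ltn_eqF.
Qed.

Lemma lip_coord_eq m L M H s s' : lip_coord m L M H ->
  (forall i, (i < m)%N -> s i = s' i) -> H s = H s'.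
Proof.
move=> [_ HL] ss'; apply/eqP; rewrite -subr_eq0 -normr_le0 (le_trans (HL _ _))//.
by rewrite big1 ?mulr0// => i _; rewrite ss' ?subrr ?normr0.
Qed.

Lemma lip_coord_L_ge0 m L M H : lip_coord m.+1 L M H -> 0 <= L.
Proof.
move=> [_ HL]; have := HL (fun=> 1) (fun=> 0).
move/(le_trans (normr_ge0 _)); rewrite subr0 normr1 sumr_const card_ord.
by rewrite pmulr_lge0// ltr0n.
Qed.

Definition cellv (n : nat) (x : R) : int := Num.floor (n.+1%:R * x).
Definition roundv (n : nat) (z : int) : R := z%:~R / n.+1%:R.

Lemma roundv_cellv n x : `|roundv n (cellv n x) - x| <= n.+1%:R^-1.
Proof.
have n0 : (0 : R) < n.+1%:R by rewrite ltr0n.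
rewrite /roundv /cellv; have := floor_itv (n.+1%:R * x).
set z := Num.floor _; move=> /andP[h1 h2].
have -> : z%:~R / n.+1%:R - x = - ((n.+1%:R * x - z%:~R) / n.+1%:R).
  by field; rewrite gt_eqF.
rewrite normrN ger0_norm; last by rewrite divr_ge0 ?subr_ge0 ?ler0n.
rewrite -[leRHS]mul1r ler_pM2r ?invr_gt0// lerBlDl.
by move: h2; rewrite intrD /= => /ltW.
Qed.

Lemma measurable_cellv n d (T : measurableType d) (f : T -> R) (z : int) :
  measurable_fun setT f -> measurable (f @^-1` [set x | cellv n x = z]).
Proof.
move=> mf; have n0 : (0 : R) < n.+1%:R by rewrite ltr0n.
have -> : [set x | cellv n x = z] =
    [set` `[roundv n z, roundv n (z + 1)[%R].
  apply/seteqP; split => x /=; rewrite in_itv/= /roundv /cellv.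
    move=> <-; rewrite ler_pdivrMr// ltr_pdivlMr// ![x * _]mulrC.
    exact: floor_itv.
  rewrite ler_pdivrMr// ltr_pdivlMr// ![x * _]mulrC => h.
  exact: floor_def.
by rewrite -[_ @^-1` _]setTI; apply: mf => //; exact: measurable_itv.
Qed.

End coordinates.

Section cells.
Context d (T : measurableType d) (R : realType).
Variables (xi : nat -> T -> R).

Definition cells (n m : nat) (b : T) : m.-tuple int :=
  [tuple cellv n (xi i b) | i < m].

Definition cell_value (n m : nat) (v : m.-tuple int) (i : nat) : R :=
  roundv R n (nth 0 v i).

Lemma nth_cells n m b i : (i < m)%N -> nth 0 (cells n m b) i = cellv n (xi i b).
Proof.
by move=> im; rewrite -[i]/(nat_of_ord (Ordinal im)) -tnth_nth tnth_mktuple.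
Qed.

Lemma cells_value n m b i : (i < m)%N ->
  `|cell_value n (cells n m b) i - xi i b| <= n.+1%:R^-1.
Proof.
move=> im; rewrite /cell_value.
rewrite nth_cells//.
exact: roundv_cellv.
Qed.

Lemma lip_cells L n m b :
  L * \sum_(i < m) `|xi i b - cell_value n (cells n m b) i| <=
  `|L| * m%:R / n.+1%:R.
Proof.
rewrite -mulrA; apply: (@le_trans _ _ (`|L| * \sum_(i < m) `|xi i b - cell_value n (cells n m b) i|)).
  by rewrite ler_wpM2r ?ler_norm// sumr_ge0.
rewrite ler_wpM2l// mulr_natl -[X in _ *+ X]card_ord -sumr_const ler_sum// => i _.
by rewrite distrC cells_value.
Qed.

Definition box (m : nat) (B : nat -> set R) : set T :=
  [set b | forall i, (i < m)%N -> B i (xi i b)].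

Lemma cells_box n m v :
  cells n m @^-1` [set v] = box m (fun i => [set x | cellv n x = nth 0 v i]).
Proof.
apply/seteqP; split => b /=.
  move=> <- i im.
  by rewrite /cells -[i]/(nat_of_ord (Ordinal im)) -tnth_nth tnth_mktuple.
move=> h; apply: eq_from_tnth => i; rewrite tnth_mktuple (tnth_nth 0).
by rewrite -(h i (ltn_ord i)).
Qed.

Hypothesis mxi : forall i, measurable_fun setT (xi i).

Lemma measurable_box m B : (forall i, measurable (B i)) -> measurable (box m B).
Proof.
move=> mB; have -> : box m B = \bigcap_(i in `I_m) (xi i @^-1` B i).
  by apply/seteqP; split => b h i /= im; exact: h.
apply: fin_bigcap_measurable => [|i _]; first exact: finite_II.
by rewrite -[_ @^-1` _]setTI; exact: mxi.
Qed.

Lemma measurable_cells n m v : measurable (cells n m @^-1` [set v]).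
Proof.
rewrite cells_box.
have -> : box m (fun i => [set x | cellv n x = nth 0 v i]) =
  \bigcap_(i in `I_m) (xi i @^-1` [set x | cellv n x = nth 0 v i]).
  by apply/seteqP; split => b h i /= im; exact: h.
apply: fin_bigcap_measurable => [|i _]; first exact: finite_II.
exact: measurable_cellv.
Qed.

Lemma measurable_comp_cells n m (h : m.-tuple int -> R) :
  measurable_fun setT (fun b => h (cells n m b)).
Proof.
move=> _ Y mY; rewrite setTI.
have -> : (fun b => h (cells n m b)) @^-1` Y =
    \bigcup_(v in [set: m.-tuple int]) (if h v \in Y then cells n m @^-1` [set v] else set0).
  apply/seteqP; split => b /=.
    by move=> hb; exists (cells n m b) => //; rewrite mem_set.
  by move=> [v _]; case: ifPn => // /[!inE] hv /= ->.
apply: countable_bigcupT_measurable => // v; case: ifP => _ //.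
exact: measurable_cells.
Qed.

(** [H] of the rounded variables takes one value on each of countably many measurable cells, and
    converges to [H] of the variables as the mesh decreases. *)
Lemma bounded_meas_lip_coord m L M H : lip_coord m L M H ->
  bounded_meas (fun b => H (xi^~ b)).
Proof.
move=> lipH; have [HM HL] := lipH; split; last by exists M.
apply: (@measurable_fun_cvg _ _ _ setT
  (fun n b => H (cell_value n (cells n m b)))) => [n|b _].
  exact: (measurable_comp_cells n (fun v => H (cell_value n v))).
apply/cvgrPdist_le => e e0; near=> n.
rewrite (le_trans (HL _ _))//.
apply: (@le_trans _ _ (`|L| * m%:R / n.+1%:R)).
  exact: lip_cells.
near: n; exact: near_divn_le.
Unshelve. all: by end_near. Qed.

Lemma trivIset_cells n m :
  trivIset setT (fun v : m.-tuple int => cells n m @^-1` [set v]).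
Proof. by apply/trivIsetP => v w _ _ vw; apply/seteqP; split => // b /= [vb wb]; move: vw; rewrite -vb -wb eqxx. Qed.

Lemma bigcup_cells n m :
  \bigcup_(v : m.-tuple int) (cells n m @^-1` [set v]) = setT.
Proof. by rewrite -subTset => b _; exists (cells n m b). Qed.

End cells.

(** * Integrating out the last of finitely many independent variables *)

Section peel.
Context d (T : measurableType d) (R : realType) (P : probability T R).
Variables (xi : nat -> T -> R).
Hypothesis mxi : forall i, measurable_fun setT (xi i).
Variables (m : nat) (nu : probability (R : measurableType default_measure_display) R).
Hypothesis indep : forall B : nat -> set R, (forall i, measurable (B i)) ->
  P (box xi m.+1 B) = (P (box xi m B) * nu (B m))%E.

(** Independence says that the image under [xi m] of [P] restricted to the box is [nu] times the
    mass of the box. *)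
Lemma integral_indep_box (B : nat -> set R) (f : R -> R) :
  (forall i, measurable (B i)) -> measurable_fun setT f -> (forall y, 0 <= f y) ->
  (\int[P]_(b in box xi m B) (f (xi m b))%:E = P (box xi m B) * \int[nu]_y (f y)%:E)%E.
Proof.
move=> mB mf f0; have mbox := measurable_box mxi m mB.
have Pfin : P (box xi m B) \is a fin_num by rewrite fin_num_measure.
have k0 : 0 <= fine (P (box xi m B)) by rewrite fine_ge0.
pose k := NngNum k0.
have mEf : measurable_fun setT (EFin \o f) by exact/measurable_EFinP.
have mEfx : measurable_fun setT (fun b => (f (xi m b))%:E).
  by apply/measurable_EFinP; exact: measurableT_comp (mxi m).
rewrite -ge0_integral_mrestr//; last by move=> b; rewrite lee_fin.
have := @ge0_integral_pushforward _ _ _ _ R _ (mxi m) (mrestr P mbox) setT _ measurableT mEf.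
rewrite preimage_setT => <- /=; last by move=> y _; rewrite lee_fin.
transitivity (\int[mscale k nu]_y (f y)%:E)%E; last first.
  rewrite ge0_integral_mscale//=; last by move=> y _; rewrite lee_fin.
  by rewrite fineK.
apply: eq_set_fun_integral => A mA.
rewrite /pushforward /mrestr/= /mscale/= fineK//.
pose B' i := if i == m then A else B i.
have mB' i : measurable (B' i) by rewrite /B'; case: ifP.
have := indep mB'; rewrite {3}/B' eqxx.
have -> : box xi m B' = box xi m B.
  by apply/seteqP; split => b h i im; have := h i im; rewrite /B' ltn_eqF.
move=> <-; congr (P _); apply/seteqP; split => b /=.
  move=> [Ab Bb] i; rewrite ltnS leq_eqVlt /B'; case: eqP => [-> //|/= _]; exact: Bb.
move=> h; split; first by have := h m (ltnSn m); rewrite /B' eqxx.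
by move=> i im; have := h i (ltnW im); rewrite /B' ltn_eqF.
Qed.

Lemma bounded_meas_upd L M H s : lip_coord m.+1 L M H ->
  bounded_meas (fun y : R => H (upd s m y)).
Proof.
move=> lipH; have [HM HL] := lipH; split; last by exists M.
apply: (@measurable_lip _ _ L) => y z.
rewrite (le_trans (HL _ _))// big_ord_recr/= big1 ?add0r; last first.
  by move=> i _; rewrite /upd ltn_eqF// subrr normr0.
by rewrite /upd eqxx.
Qed.

Lemma lip_coord_peel L M H : lip_coord m.+1 L M H ->
  lip_coord m L M (fun s => expect nu (fun y => H (upd s m y))).
Proof.
move=> lipH; have [HM HL] := lipH; have L0 := lip_coord_L_ge0 lipH.
split=> [s|s s'].
  rewrite -[X in `|X|]subr0 -[X in _ - X](@expect_cst _ _ _ nu 0).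
  apply: expect_dist => [||y]; [exact: bounded_meas_upd lipH|exact: bounded_meas_cst|].
  by rewrite subr0.
apply: expect_dist => [||y]; [exact: bounded_meas_upd lipH|exact: bounded_meas_upd lipH|].
by have [_] := lip_coord_upd y lipH; exact.
Qed.

(** Fubini for one variable. Once the first m variables are rounded to the mesh 1 / (n + 1), they
    are constant on each cell, where [integral_indep_box] applies. Rounding is done once on each
    side and costs L m / (n + 1) each time. *)
Lemma expect_peel L M H : lip_coord m.+1 L M H ->
  expect P (fun b => H (xi^~ b)) =
  expect P (fun b => expect nu (fun y => H (upd (xi^~ b) m y))).
Proof.
(* Adding the bound [M] makes [H] nonnegative, as the sum over cells requires. *)
wlog H0 : M H / forall s, 0 <= H s.
  move=> wl lipH; have [HM HL] := lipH.
  pose H' s := H s + M.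
  have lipH' : lip_coord m.+1 L (M + M) H'.
    split=> [s|s s'].
      rewrite (le_trans (ler_normD _ _))// lerD//.
      by have := le_trans (normr_ge0 _) (HM s) => /ger0_norm ->.
    by rewrite /H' opprD addrACA subrr addr0.
  have := wl _ H' _ lipH'.
  rewrite /H' expectD; last 2 first.
    exact (bounded_meas_lip_coord mxi lipH).
    exact: bounded_meas_cst.
  have -> : expect P (fun b => expect nu (fun y => H (upd (xi^~ b) m y) + M)) =
      expect P (fun b => expect nu (fun y => H (upd (xi^~ b) m y)) + expect nu (fun=> M)).
    apply: eq_expect => b; apply: expectD; [exact: bounded_meas_upd lipH|].
    exact: bounded_meas_cst.
  rewrite expectD; [|exact (bounded_meas_lip_coord mxi (lip_coord_peel lipH))|exact: bounded_meas_cst].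
  rewrite !expect_cst => h; apply: (addIr M); apply: h => s.
  by have := HM s; rewrite ler_norml => /andP[+ _]; rewrite -subr_ge0 opprK.
move=> lipH; have [HM HL] := lipH; have L0 := lip_coord_L_ge0 lipH.
pose Hb s := expect nu (fun y => H (upd s m y)).
have lipHb : lip_coord m L M Hb := lip_coord_peel lipH.
have HbL := lipHb.2.
have Hb0 s : 0 <= Hb s by apply: expect_ge0.
rewrite -/Hb.
have close n : `|expect P (fun b => H (xi^~ b)) - expect P (fun b => Hb (xi^~ b))| <=
    2 * (L * m%:R) / n.+1%:R.
  pose c b := cell_value R n (cells xi n m b).
  have bH : bounded_meas (fun b => H (upd (c b) m (xi m b))).
    pose xi' i b := if i == m then xi m b else roundv R n (cellv n (xi i b)).
    have mxi' i : measurable_fun setT (xi' i).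
      rewrite /xi'; case: eqP => _ //.
      have := measurable_comp_cells mxi n (fun v : i.+1.-tuple int => cell_value R n v i).
      congr (measurable_fun _ _); apply/funext => b.
      rewrite /cell_value /cells -[X in nth _ _ X]/(nat_of_ord (@ord_max i)).
      by rewrite -tnth_nth tnth_mktuple.
    have := bounded_meas_lip_coord mxi' lipH.
    congr (bounded_meas _); apply/funext => b.
    apply: (lip_coord_eq lipH) => i; rewrite ltnS leq_eqVlt /upd /xi' /c /cell_value.
    by case: (eqVneq i m) => [-> //|_ im]; rewrite nth_cells.
  have bHb : bounded_meas (fun b => Hb (c b)).
    split; last by exists M => b; exact: lipHb.1.
    exact: (measurable_comp_cells mxi n (fun v => Hb (cell_value R n v))).
  have E : expect P (fun b => H (upd (c b) m (xi m b))) = expect P (fun b => Hb (c b)).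
    rewrite /expect; congr fine.
    have mA v := measurable_cells mxi n v.
    rewrite (integral_countable_partition P (mA m) (@trivIset_cells _ _ _ xi n m) (@bigcup_cells _ _ _ xi n m)); last 2 first.
    - by apply/measurable_EFinP; exact: bH.1.
    - by move=> b; rewrite lee_fin.
    rewrite [RHS](integral_countable_partition P (mA m) (@trivIset_cells _ _ _ xi n m) (@bigcup_cells _ _ _ xi n m)); last 2 first.
    - by apply/measurable_EFinP; exact: bHb.1.
    - by move=> b; rewrite lee_fin.
    apply: eq_esum => v _.
    rewrite (eq_integral (fun b => (H (upd (cell_value R n v) m (xi m b)))%:E)); last first.
      by move=> b; rewrite inE /= => <-.
    rewrite [RHS](eq_integral (fun b => (Hb (cell_value R n v))%:E)); last first.
      by move=> b; rewrite inE /= => <-.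
    rewrite cells_box (@integral_indep_box _ (fun y => H (upd (cell_value R n v) m y))); last 3 first.
    - by move=> i; exact: (@measurable_cellv _ _ _ _ id).
    - exact: (bounded_meas_upd _ lipH).1.
    - by [].
    rewrite integral_cst//; last by rewrite -cells_box.
    rewrite muleC; congr (_ * _)%E.
    exact (expectE nu (bounded_meas_upd (cell_value R n v) lipH)).
  have d1 : `|expect P (fun b => H (xi^~ b)) - expect P (fun b => H (upd (c b) m (xi m b)))| <= L * m%:R / n.+1%:R.
    apply: expect_dist => // [|b]; first exact (bounded_meas_lip_coord mxi lipH).
    rewrite (le_trans (HL _ _))// big_ord_recr/= /upd eqxx subrr normr0 addr0.
    have := lip_cells xi L n m b; rewrite (ger0_norm L0); apply: le_trans.
    rewrite le_eqVlt; apply/orP; left; apply/eqP; congr (_ * _).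
    by apply: eq_bigr => i _; rewrite ltn_eqF.
  have d2 : `|expect P (fun b => Hb (xi^~ b)) - expect P (fun b => Hb (c b))| <= L * m%:R / n.+1%:R.
    apply: expect_dist => // [|b]; first exact (bounded_meas_lip_coord mxi lipHb).
    by rewrite (le_trans (HbL _ _))//; have := lip_cells xi L n m b; rewrite (ger0_norm L0).
  rewrite (_ : 2 * (L * m%:R) / _ = L * m%:R / n.+1%:R + L * m%:R / n.+1%:R); last by rewrite -mulrDl -mulr2n mulr_natl.
  rewrite (le_trans (ler_distD (expect P (fun b => Hb (c b))) _ _))//.
  by apply: lerD; [rewrite -E|rewrite distrC].
apply/eqP; rewrite -subr_eq0 -normr_le0; apply/ler_addgt0Pr => e e0.
rewrite add0r; have [n _ /(_ n (leqnn n))] := near_divn_le (2 * (L * m%:R)) e0.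
exact: le_trans.
Qed.

End peel.

(** * Gaussian moments *)

Section density.
Local Open Scope ereal_scope.
Context d (T : measurableType d) (R : realType).
Variables (mu nu : {measure set T -> \bar R}) (p : T -> R).
Hypothesis p0 : forall x, (0 <= p x)%R.
Hypothesis mp : measurable_fun setT p.
Hypothesis nuE : forall A, measurable A -> nu A = \int[mu]_(x in A) (p x)%:E.
Import HBNNSimple.

Lemma ge0_integral_density (f : T -> \bar R) :
  (forall x, 0 <= f x) -> measurable_fun setT f ->
  \int[nu]_x f x = \int[mu]_x (f x * (p x)%:E).
Proof.
move=> f0 mf; pose h := nnsfun_approx measurableT mf.
have mEp : measurable_fun setT (EFin \o p) by exact/measurable_EFinP.
have cvh x : (h n x)%:E @[n --> \oo] --> f x by exact: cvg_nnsfun_approx.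
have ndh x : {homo (fun n => (h n x)%:E) : a b / (a <= b)%N >-> a <= b}.
  by move=> a b ab; rewrite lee_fin; exact/lefP/nd_nnsfun_approx.
have mh n : measurable_fun setT (fun x => (h n x)%:E) by exact/measurable_EFinP.
have h0 n x : 0 <= (h n x)%:E by rewrite lee_fin.
have H n : \int[nu]_x (h n x)%:E = \int[mu]_x ((h n x)%:E * (p x)%:E).
  have hE x : h n x = (\sum_(y \in range (h n)) y * \1_(h n @^-1` [set y]) x)%R.
    exact: fimfunE.
  under eq_integral do rewrite hE -fsumEFin//.
  rewrite ge0_integral_fsum//; last 2 first.
  - by move=> y; apply/measurable_EFinP; exact: measurable_funM.
  - by move=> y x _; exact: nnfun_muleindic_ge0.
  under [RHS]eq_integral => x _.
    rewrite hE -fsumEFin// ge0_mule_fsuml; last by move=> y; exact: nnfun_muleindic_ge0.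
    over.
  rewrite /= ge0_integral_fsum//; last 2 first.
  - by move=> y; apply: emeasurable_funM => //; apply/measurable_EFinP; exact: measurable_funM.
  - by move=> y x _; apply: mule_ge0; [exact: nnfun_muleindic_ge0|rewrite lee_fin].
  apply: eq_fsbigr => y /[!inE] -[t _ ty].
  have y0 : (0 <= y)%R by rewrite -ty.
  have mA : measurable (h n @^-1` [set y]) by exact: measurable_sfunP.
  under eq_integral do rewrite EFinM.
  rewrite ge0_integralZl_EFin//; try by [move=> x _; rewrite lee_fin|exact/measurable_EFinP].
  rewrite integral_indic// setIT nuE//.
  under [RHS]eq_integral do rewrite EFinM -muleA.
  rewrite [RHS]ge0_integralZl_EFin//; last 2 first.
  - by move=> x _; rewrite mule_ge0 ?lee_fin.
  - by apply: emeasurable_funM => //; exact/measurable_EFinP.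
  congr (_ * _); rewrite integral_mkcond; apply: eq_integral => x _.
  by rewrite patchE indicE; case: ifP; rewrite ?mul1e ?mul0e.
transitivity (limn (fun n => \int[nu]_x (h n x)%:E)).
  rewrite -monotone_convergence//.
  by apply: eq_integral => x _; apply/esym/cvg_lim => //; exact: cvh.
under eq_fun do rewrite H.
rewrite -monotone_convergence//.
- apply: eq_integral => x _; apply/cvg_lim => //.
  by apply: cvgeZr => //; exact: cvh.
- by move=> n; exact: emeasurable_funM.
- by move=> n x _; rewrite mule_ge0 ?lee_fin.
- by move=> x _ a b ab; rewrite lee_wpmul2r ?lee_fin//; exact: ndh.
Qed.

End density.

Section gaussian_exponential.
Variable R : realType.
Implicit Types (l u x y s : R).

Definition gexp l x : R := expR (- (l * x ^+ 2) / 2).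

Lemma gexp_ge0 l x : 0 <= gexp l x. Proof. exact: expR_ge0. Qed.

Lemma gexp_le1 l x : 0 <= l -> gexp l x <= 1.
Proof. by move=> l0; rewrite expR_le1 mulNr oppr_le0 divr_ge0// mulr_ge0// sqr_ge0. Qed.

Lemma gexpD l l' x : gexp l x * gexp l' x = gexp (l + l') x.
Proof. by rewrite -expRD; congr expR; field. Qed.

Lemma gexp_sqr_le l x : 0 <= l -> l * x ^+ 2 * gexp l x <= 2.
Proof.
move=> l0; rewrite /gexp; set z := l * x ^+ 2.
have z0 : 0 <= z by rewrite mulr_ge0// sqr_ge0.
rewrite mulNr expRN ler_pdivrMr ?expR_gt0// mulrC -ler_pdivrMr//.
by rewrite (le_trans _ (expR_ge1Dx _))// lerDr.
Qed.

Lemma is_derive_gexp l x : is_derive x 1 (gexp l) (- l * (x * gexp l x)).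
Proof.
rewrite /gexp; apply: is_derive_eq.
by rewrite /GRing.scale/= !mulr1; field.
Qed.

Lemma is_derive_xgexp l x :
  is_derive x 1 (fun x => x * gexp l x) ((1 - l * x ^+ 2) * gexp l x).
Proof.
have := is_derive_gexp l x => h.
have := is_deriveM (is_derive_id x 1) h.
by rewrite /GRing.scale/= !mulr1 => h'; apply: is_derive_eq h' _; ring.
Qed.

Lemma lip_of_derive (f df : R -> R) (C : R) :
  (forall x, is_derive x 1 f (df x)) -> (forall x, `|df x| <= C) ->
  forall x y, `|f x - f y| <= C * `|x - y|.
Proof.
move=> fdf dfC.
have wlog_lt x y : x < y -> `|f y - f x| <= C * `|y - x|.
  move=> xy; have cf : {within `[x, y], continuous f}.
    apply: continuous_subspaceT => z; apply/differentiable_continuous/derivable1_diffP.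
    by have [] := fdf z.
  have [c _ ->] := MVT xy (fun z _ => fdf z) cf.
  by rewrite normrM ler_wpM2r.
move=> x y; have [xy|yx|->] := ltgtP x y.
- by rewrite distrC [`|x - y|]distrC wlog_lt.
- exact: wlog_lt.
- by rewrite !subrr normr0 mulr0.
Qed.

Lemma lip_xgexp l x y : 0 <= l ->
  `|x * gexp l x - y * gexp l y| <= 3 * `|x - y|.
Proof.
move=> l0; apply: (lip_of_derive (is_derive_xgexp l)) => {}x.
rewrite mulrBl mul1r (le_trans (ler_normB _ _))//.
rewrite (ger0_norm (gexp_ge0 _ _)) ger0_norm; last first.
  by apply: mulr_ge0; [apply: mulr_ge0 => //; exact: sqr_ge0|exact: gexp_ge0].
by have := gexp_sqr_le x l0; have := gexp_le1 x l0; lra.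
Qed.

Lemma xgexp_le l x : 0 < l -> `|x * gexp l x| <= (1 + 2 / l) / 2.
Proof.
move=> l0; rewrite normrM (ger0_norm (gexp_ge0 _ _)).
have h1 := gexp_sqr_le x (ltW l0); have h2 := gexp_le1 x (ltW l0).
have h3 : x ^+ 2 * gexp l x <= 2 / l by rewrite ler_pdivlMr// mulrC mulrA.
have h4 : `|x| <= (1 + x ^+ 2) / 2.
  by rewrite -real_normK ?num_real//; have := sqr_ge0 (`|x| - 1); nra.
have h5 := gexp_ge0 l x; rewrite (le_trans (ler_wpM2r h5 h4))//; lra.
Qed.

Lemma lip_gexp l x y : 0 <= l -> `|gexp l x - gexp l y| <= (l + 2) / 2 * `|x - y|.
Proof.
rewrite le_eqVlt => /predU1P[<-|l0].
  by rewrite /gexp !mul0r subrr normr0 mulr_ge0//; lra.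
apply: (lip_of_derive (is_derive_gexp l)) => {}x.
rewrite normrM normrN (gtr0_norm l0) (le_trans (ler_wpM2l (ltW l0) (xgexp_le x l0)))//.
by rewrite le_eqVlt; apply/orP; left; apply/eqP; field; rewrite gt_eqF.
Qed.

Lemma gexp_taylor l x (e : R) : 0 <= l ->
  `|gexp l (x + e) - gexp l x + e * (l * (x * gexp l x))| <= 3 * l * e ^+ 2.
Proof.
move=> l0.
have [e0|/eqP e0] := eqVneq e 0; first by rewrite e0 addr0 subrr mul0r addr0 normr0 expr0n/= mulr0.
have cf a b : {within `[a, b], continuous (gexp l)}.
  apply: continuous_subspaceT => z; apply/differentiable_continuous/derivable1_diffP.
  by have [] := is_derive_gexp l z.
have [c cx ->] : exists2 c, `|c - x| <= `|e| & gexp l (x + e) - gexp l x = - l * (c * gexp l c) * e.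
  have [e1|e1|//] := ltgtP e 0.
    have xe : x + e < x by rewrite gtrDl.
    have [c] := MVT xe (fun z _ => is_derive_gexp l z) (cf _ _).
    rewrite in_itv/= => /andP[c1 c2] h; exists c.
      by rewrite !ltr0_norm ?subr_lt0//; lra.
    by rewrite -opprB h; ring.
  have xe : x < x + e by rewrite ltrDl.
  have [c] := MVT xe (fun z _ => is_derive_gexp l z) (cf _ _).
  rewrite in_itv/= => /andP[c1 c2] h; exists c.
    by rewrite !gtr0_norm ?subr_gt0//; lra.
  by rewrite h; ring.
rewrite (_ : _ + _ = (- l * e) * (c * gexp l c - x * gexp l x)); last by ring.
rewrite !normrM normrN (ger0_norm l0).
rewrite -[e ^+ 2]real_normK ?num_real//.
have := normr_ge0 e; move: cx; set E := `|e| => cx E0.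
rewrite (le_trans (ler_wpM2l _ (lip_xgexp c x l0)))//; first exact: mulr_ge0.
rewrite (@le_trans _ _ (l * E * (3 * E)))//; last by nra.
by apply: ler_wpM2l; [exact: mulr_ge0|exact: ler_wpM2l].
Qed.

Lemma gauss_density s (f : R -> R) : (forall x, 0 <= f x) ->
  measurable_fun setT f ->
  (\int[gauss_law s]_x (f x)%:E =
   \int[lebesgue_measure]_x (f x * normal_pdf 0 s x)%:E)%E.
Proof.
move=> f0 mf.
have f0' (x : measurableTypeR R) : (0 <= (f x)%:E)%E by rewrite lee_fin.
have mf' : measurable_fun setT (fun x : measurableTypeR R => (f x)%:E).
  by apply/measurable_EFinP; exact: mf.
have h := (@ge0_integral_density _ (measurableTypeR R) R lebesgue_measure
  (normal_prob 0 s) (normal_pdf 0 s) (normal_pdf_ge0 0 s)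
  (measurable_normal_pdf 0 s) (fun A _ => erefl) _ f0' mf').
pose i (x : measurableTypeR R) : R := x.
have mi : measurable_fun setT i by move=> _ Y mY; rewrite setTI; exact: mY.
have E := @ge0_integral_pushforward _ _ (measurableTypeR R) R R i mi
  (normal_prob 0 s) setT (EFin \o f) measurableT.
transitivity (\int[pushforward (normal_prob 0 s) i]_x (f x)%:E)%E.
  by apply: eq_set_fun_integral.
rewrite [LHS]E ?preimage_setT; [|exact/measurable_EFinP|by move=> y _ /=; rewrite lee_fin].
exact h.
Qed.

Section integrals.
Variables (s l : R).
Hypotheses (s0 : 0 < s) (l0 : 0 <= l).
Let D := 1 + l * s ^+ 2.
Let D0 : 0 < D. Proof. by rewrite /D ltr_pwDl// mulr_ge0// sqr_ge0. Qed.

Definition gfactor : R := (Num.sqrt D)^-1.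
Definition grate : R := l / D.

Lemma gfactor_gt0 : 0 < gfactor.
Proof. by rewrite invr_gt0 sqrtr_gt0. Qed.

Lemma grate_ge0 : 0 <= grate.
Proof. by rewrite divr_ge0// ltW. Qed.

Lemma gfactor_sqr : gfactor ^+ 2 = D^-1.
Proof. by rewrite exprVn sqr_sqrtr// ltW. Qed.

Lemma bounded_meas_gexp u : bounded_meas (fun y : R => gexp l (u + y)).
Proof.
split; last by exists 1 => y; rewrite ger0_norm ?gexp_ge0 ?gexp_le1.
apply: (@measurable_lip _ _ ((l + 2) / 2)) => x y.
by rewrite (le_trans (lip_gexp _ _ l0))// opprD addrACA subrr add0r.
Qed.

Lemma expect_gexp u :
  expect (gauss_law s) (fun y => gexp l (u + y)) = gfactor * gexp grate u.
Proof.
have sn0 : s != 0 by rewrite gt_eqF.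
(* Completing the square: up to a constant factor the integrand is the normal density with mean [m]
   and standard deviation [s']. *)
pose s' := s * gfactor; pose m := - (l * u * s ^+ 2 / D).
have s'n0 : s' != 0 by rewrite gt_eqF// mulr_gt0// gfactor_gt0.
have s'2 : s' ^+ 2 = s ^+ 2 / D by rewrite exprMn gfactor_sqr.
have E y : gexp l (u + y) * normal_pdf 0 s y =
    gfactor * gexp grate u * normal_pdf m s' y.
  rewrite !normal_pdfE// /normal_fun.
  have -> : normal_peak s = gfactor * normal_peak s'.
    rewrite /normal_peak s'2.
    have -> : s ^+ 2 / D * pi *+ 2 = s ^+ 2 * pi *+ 2 * D^-1.
      by rewrite mulrnAl [s ^+ 2 / D * pi]mulrAC.
    rewrite sqrtrM; last by rewrite mulrn_wge0// mulr_ge0// ?sqr_ge0// pi_ge0.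
    rewrite invfM sqrtrV ?ltW// invrK mulrCA mulVf ?mulr1//.
    by rewrite gt_eqF// sqrtr_gt0.
  rewrite mulrCA -!mulrA [X in _ = _ * X]mulrCA; congr (_ * (_ * _)).
  rewrite -!expRD; congr expR; rewrite s'2 /m /grate.
  rewrite -[s ^+ 2 *+ 2]mulr_natr -[(s ^+ 2 / D) *+ 2]mulr_natr /D.
  by field; rewrite sn0 -/D gt_eqF.
apply/eqP; rewrite -(@eqe R) -expectE; last exact: bounded_meas_gexp; apply/eqP.
have mN := measurable_normal_pdf.
rewrite gauss_density//; [|by move=> y; exact: gexp_ge0|exact: (bounded_meas_gexp u).1].
under eq_integral do rewrite E EFinM.
rewrite ge0_integralZl_EFin//.
- by rewrite integral_normal_pdf mule1.
- by move=> y _; rewrite lee_fin normal_pdf_ge0.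
- by apply/measurable_EFinP; exact: measurable_normal_pdf.
- by rewrite mulr_ge0 ?gexp_ge0// ltW// gfactor_gt0.
Qed.

Lemma bounded_meas_xgexp u : 0 < l -> bounded_meas (fun y : R => (u + y) * gexp l (u + y)).
Proof.
move=> lp; split; last by exists ((1 + 2 / l) / 2) => y; exact: xgexp_le.
apply: (@measurable_lip _ _ 3) => x y.
by rewrite (le_trans (lip_xgexp _ _ l0))// opprD addrACA subrr add0r.
Qed.

(** This is the derivative in u of [expect_gexp]. Differentiation under the integral is replaced by
    [gexp_taylor] on both sides: the first order terms differ by at most a constant times e^2 for
    every e, hence agree. The power 3 arises because [grate] contributes a further factor [gfactor]
    ^+ 2. *)
Lemma expect_xgexp u : 0 < l ->
  expect (gauss_law s) (fun y => (u + y) * gexp l (u + y)) =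
  gfactor ^+ 3 * (u * gexp grate u).
Proof.
move=> lp; set G := expect _ _.
have bG := bounded_meas_xgexp u lp.
have key e : `|e * (l * G - gfactor * grate * (u * gexp grate u))| <=
    (3 * l + gfactor * (3 * grate)) * e ^+ 2.
  have h1 : `|gfactor * gexp grate (u + e) - gfactor * gexp grate u + e * (l * G)| <= 3 * l * e ^+ 2.
    rewrite -!expect_gexp /G -expectZ// -expectZ; last exact: bounded_measZ.
    rewrite -expectB; [|exact: bounded_meas_gexp|exact: bounded_meas_gexp].
    rewrite -expectD; last 2 first.
    - by apply: bounded_measB; exact: bounded_meas_gexp.
    - by do 2 apply: bounded_measZ.
    rewrite -[X in `|X|]subr0 -[X in _ - X](expect_cst (gauss_law s) 0).
    apply: expect_dist => [||y].
    - apply: bounded_measD; last by do 2 apply: bounded_measZ.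
      by apply: bounded_measB; exact: bounded_meas_gexp.
    - exact: bounded_meas_cst.
    - by rewrite subr0 [u + e + y]addrAC; exact (gexp_taylor (u + y) e l0).
  have h2 : `|gfactor * (gexp grate (u + e) - gexp grate u + e * (grate * (u * gexp grate u)))| <= gfactor * (3 * grate * e ^+ 2).
    rewrite normrM (gtr0_norm gfactor_gt0) ler_wpM2l ?(ltW gfactor_gt0)//.
    exact: gexp_taylor grate_ge0.
  rewrite (_ : e * _ = (gfactor * gexp grate (u + e) - gfactor * gexp grate u + e * (l * G)) -
     (gfactor * (gexp grate (u + e) - gexp grate u + e * (grate * (u * gexp grate u))))); last by ring.
  by rewrite (le_trans (ler_normB _ _))// (le_trans (lerD h1 h2))// le_eqVlt; apply/orP; left; apply/eqP; ring.
have : l * G - gfactor * grate * (u * gexp grate u) = 0.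
  apply/eqP; rewrite -normr_le0; apply/ler_addgt0Pr => e e0; rewrite add0r.
  set K := 3 * l + _ in key.
  have K0 : 0 <= K by rewrite addr_ge0// mulr_ge0// ?(ltW gfactor_gt0)// mulr_ge0// grate_ge0.
  have K1 : 0 < K + 1 by rewrite ltr_wpDl.
  pose e' := e / (K + 1); have e'0 : 0 < e' by rewrite divr_gt0.
  have := key e'; rewrite normrM (gtr0_norm e'0) expr2 [K * _]mulrCA ler_pM2l// => h.
  by rewrite (le_trans h)// /e' mulrA ler_pdivrMr// mulrC ler_wpM2l ?(ltW e0)// lerDl.
move=> /eqP; rewrite subr_eq0 => /eqP h.
have lN0 : l != 0 by rewrite gt_eqF.
apply: (mulfI lN0); rewrite h exprS gfactor_sqr /grate /D.
by field; rewrite -/D gt_eqF.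
Qed.

End integrals.

End gaussian_exponential.

(** * Iterated Gaussian integrals *)

Section lipc.
Variable R : realType.
Implicit Types (H G : (nat -> R) -> R).

Definition lipc (m : nat) H := exists L M, lip_coord m L M H.

Lemma lip_coord_M_ge0 m L M H : lip_coord m L M H -> 0 <= M.
Proof. by move=> [HM _]; exact: le_trans (normr_ge0 _) (HM (fun=> 0)). Qed.

Lemma lipc_comp m (g : (nat -> R) -> R) (f : R -> R) (L M : R) :
  0 <= L -> (forall x, `|f x| <= M) ->
  (forall x y, `|f x - f y| <= L * `|x - y|) ->
  (forall s s', `|g s - g s'| <= \sum_(i < m) `|s i - s' i|) ->
  lipc m (fun s => f (g s)).
Proof.
move=> L0 fM fL gm; exists L, M; split=> // s s'.
by rewrite (le_trans (fL _ _))// ler_wpM2l.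
Qed.

Lemma lipc_cst m c : lipc m (fun=> c).
Proof.
by exists 0, `|c|; split=> // s s'; rewrite subrr normr0 mul0r.
Qed.

Lemma lipc_mul m H G : lipc m H -> lipc m G -> lipc m (fun s => H s * G s).
Proof.
move=> [L [M lH]] [L' [M' lG]].
have M0 := lip_coord_M_ge0 lH; have M'0 := lip_coord_M_ge0 lG.
move: lH lG => [HM HL] [GM GL].
exists (M' * L + M * L'), (M * M'); split=> [s|s s'].
  by rewrite normrM ler_pM.
rewrite (_ : H s * G s - H s' * G s' = G s * (H s - H s') + H s' * (G s - G s')); last by ring.
rewrite (le_trans (ler_normD _ _))// !normrM mulrDl -!mulrA lerD//.
  by rewrite (le_trans (ler_wpM2r _ (GM s)))// ler_wpM2l.
by rewrite (le_trans (ler_wpM2r _ (HM s')))// ler_wpM2l.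
Qed.

Lemma lipc_prod m n (F : nat -> (nat -> R) -> R) :
  (forall j, (j < n)%N -> lipc m (F j)) -> lipc m (fun s => \prod_(j < n) F j s).
Proof.
elim: n => [_|n ih h].
  by under eq_fun do rewrite big_ord0; exact: lipc_cst.
under eq_fun do rewrite big_ord_recr/=.
by apply: lipc_mul; [apply: ih => j jn; exact/h/ltnW|exact: h].
Qed.

Lemma lipcW m n H : (m <= n)%N -> lipc m H -> lipc n H.
Proof.
move=> mn [L [M lH]]; have [HM HL] := lH; case: m mn lH HL => [|m] mn lH HL.
  exists 0, M; split => // s s'.
  by have := HL s s'; rewrite big_ord0 mulr0 mul0r.
have L0 := lip_coord_L_ge0 lH; exists L, M; split => // s s'.
rewrite (le_trans (HL s s'))// ler_wpM2l//.
by rewrite -(subnKC mn) big_split_ord/= lerDl sumr_ge0.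
Qed.

Lemma lipc_shift m n H : lipc n H -> lipc (m + n) (fun s => H (fun i => s (m + i)%N)).
Proof.
move=> [L [M lH]]; have [HM HL] := lH; case: n lH HL => [|n] lH HL.
  exists 0, M; split => // s s'.
  by have := HL (fun i => s (m + i)%N) (fun i => s' (m + i)%N); rewrite big_ord0 mulr0 mul0r.
have L0 := lip_coord_L_ge0 lH; exists L, M; split => // s s'.
by rewrite (le_trans (HL _ _))// ler_wpM2l// big_split_ord/= lerDr sumr_ge0.
Qed.

End lipc.

Section iterated_gaussian.
Variable R : realType.
Implicit Types (H G : (nat -> R) -> R) (sd : nat -> R).

(** The integral against a product of k centred Gaussian laws, the last variable being integrated
    first; the variables from k on are frozen at 0. *)
Fixpoint iterg sd (k : nat) H : R :=
  if k is k'.+1 then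
    iterg sd k' (fun s => expect (gauss_law (sd k')) (fun y => H (upd s k' y)))
  else H (fun=> 0).

Lemma lipc_peel sd k H : lipc k.+1 H ->
  lipc k (fun s => expect (gauss_law (sd k)) (fun y => H (upd s k y))).
Proof.
by move=> [L [M lH]]; exists L, M; exact: (lip_coord_peel (gauss_law (sd k)) lH).
Qed.

Lemma bounded_meas_lipc_upd k s H : lipc k.+1 H ->
  bounded_meas (fun y : R => H (upd s k y)).
Proof. by move=> [L [M lH]]; exact (bounded_meas_upd s lH). Qed.

Lemma eq_iterg sd k H G : H =1 G -> iterg sd k H = iterg sd k G.
Proof. by move=> /funext ->. Qed.

Lemma itergZ sd k c H : lipc k H -> iterg sd k (fun s => c * H s) = c * iterg sd k H.
Proof.
elim: k H => [//|k ih] H lH /=; rewrite -ih; last exact: lipc_peel.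
apply: eq_iterg => s; apply: expectZ; exact: bounded_meas_lipc_upd.
Qed.

Lemma iterg_prod sd m k H G : lipc m H -> lipc k G ->
  iterg sd (m + k) (fun s => H s * G (fun i => s (m + i)%N)) =
  iterg sd m H * iterg (fun i => sd (m + i)%N) k G.
Proof.
move=> lH; elim: k G => [|k ih] G lG.
  rewrite addn0 /= mulrC -itergZ//; apply: eq_iterg => s; rewrite mulrC; congr (_ * _).
  by have [L [M lG']] := lG; exact: (lip_coord_eq lG').
rewrite addnS /= -(ih _ (lipc_peel (fun i => sd (m + i)%N) lG)).
apply: eq_iterg => s.
have [L [M lH']] := lH.
rewrite -expectZ; last by exact: bounded_meas_lipc_upd.
apply: eq_expect => y; congr (_ * G _).
  by apply: (lip_coord_eq lH') => i im; rewrite /upd ltn_eqF// (leq_trans im)// leq_addr.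
by apply/funext => i; rewrite /upd eqn_add2l.
Qed.

Section expect_iter.
Context d (T : measurableType d) (P : probability T R) (xi : nat -> T -> R).
Hypothesis mxi : forall i, measurable_fun setT (xi i).

(** All initial segments are included because [expect_iter] peels off one variable at a time. *)
Definition gauss_indep sd k := forall m (B : nat -> set R), (m <= k)%N ->
  (forall i, measurable (B i)) ->
  P (box xi m B) = (\prod_(i < m) fine (gauss_law (sd i) (B i)))%:E.

Lemma expect_iter sd k H : gauss_indep sd k -> lipc k H ->
  expect P (fun b => H (xi^~ b)) = iterg sd k H.
Proof.
elim: k H => [|k ih] H ind lH /=.
  have [L [M lH']] := lH; rewrite -[RHS](expect_cst P); apply: eq_expect => b.
  exact: (lip_coord_eq lH').
rewrite -ih; last 2 first.
- by move=> m B mk; apply: ind; exact: leqW.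
- exact: lipc_peel.
have [L [M lH']] := lH.
apply: (expect_peel mxi (m := k) (nu := gauss_law (sd k)) _ lH') => B mB.
rewrite (ind k.+1 B (leqnn _) mB) (ind k B (leqnSn _) mB).
rewrite big_ord_recr EFinM/= fineK// fin_num_measure//; exact: mB.
Qed.

End expect_iter.

Definition walk_from (x : R) (s : nat -> R) (j : nat) : R := x + \sum_(i < j) s i.

Lemma lip_walk_from x m j s s' : (j <= m)%N ->
  `|walk_from x s j - walk_from x s' j| <= \sum_(i < m) `|s i - s' i|.
Proof.
move=> jm; rewrite /walk_from opprD addrACA subrr add0r -sumrB.
rewrite (le_trans (ler_norm_sum _ _ _))// -(subnKC jm) big_split_ord/= lerDl.
exact: sumr_ge0.
Qed.

Lemma walk_from_upd x s k y j : (j <= k)%N ->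
  walk_from x (upd s k y) j = walk_from x s j.
Proof.
move=> jk; congr (_ + _); apply: eq_bigr => i _.
by rewrite /upd ltn_eqF// (leq_trans (ltn_ord i)).
Qed.

Lemma walk_from_updS x s k y :
  walk_from x (upd s k y) k.+1 = walk_from x s k + y.
Proof.
rewrite -[in RHS](walk_from_upd x s y (leqnn k)) /walk_from big_ord_recr/= addrA.
by rewrite [X in _ + X]/upd eqxx.
Qed.

Definition gexp_path (lam : nat -> R) (k : nat) (p : nat -> R) : R :=
  \prod_(j < k.+1) gexp (lam j) (p j).

Lemma lipc_gexp_walk m l x j : 0 <= l -> (j <= m)%N ->
  lipc m (fun s => gexp l (walk_from x s j)).
Proof.
move=> l0 jm; apply: (@lipc_comp _ _ (fun s => walk_from x s j) (gexp l) ((l + 2) / 2) 1).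
- by lra.
- by move=> y; rewrite ger0_norm ?gexp_ge0 ?gexp_le1.
- by move=> y z; exact: lip_gexp.
- by move=> s s'; exact: lip_walk_from.
Qed.

Lemma lipc_xgexp_walk m l x j : 0 < l -> (j <= m)%N ->
  lipc m (fun s => walk_from x s j * gexp l (walk_from x s j)).
Proof.
move=> l0 jm; apply: (@lipc_comp _ _ (fun s => walk_from x s j)
  (fun y => y * gexp l y) 3 ((1 + 2 / l) / 2)) => //.
- by move=> y; exact: xgexp_le.
- by move=> y z; exact/lip_xgexp/ltW.
- by move=> s s'; exact: lip_walk_from.
Qed.

Lemma lipc_gexp_path lam m k x : (forall j, 0 <= lam j) -> (k <= m)%N ->
  lipc m (fun s => gexp_path lam k (walk_from x s)).
Proof.
move=> lam0 km; apply: (lipc_prod (F := fun j s => gexp (lam j) (walk_from x s j))) => j jk.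
by apply: lipc_gexp_walk => //; exact: leq_trans km.
Qed.

Lemma lipc_xgexp_path lam m k x : (forall j, 0 <= lam j) -> 0 < lam k -> (k <= m)%N ->
  lipc m (fun s => walk_from x s k * gexp_path lam k (walk_from x s)).
Proof.
move=> lam0 lamk km.
have -> : (fun s => walk_from x s k * gexp_path lam k (walk_from x s)) =
  (fun s => (\prod_(j < k) gexp (lam j) (walk_from x s j)) *
     (walk_from x s k * gexp (lam k) (walk_from x s k))).
  by apply/funext => s; rewrite /gexp_path big_ord_recr/= mulrCA.
apply: lipc_mul; last exact: lipc_xgexp_walk.
apply: (lipc_prod (F := fun j s => gexp (lam j) (walk_from x s j))) => j jk.
by apply: lipc_gexp_walk => //; exact: leq_trans (ltnW jk) km.
Qed.

(* Both the weighted and the unweighted Gaussian functionals of a Gaussian walk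
   satisfy the same recursion, with factors [c] and [c ^+ 3]: this is where the
   three-dimensional Bessel process meets the linear Brownian motion. *)
Lemma iterg_gexp_path sd k (lam : nat -> R) : (forall i, 0 < sd i) ->
  (forall j, 0 <= lam j) ->
  exists c Q, forall x, iterg sd k (fun s => gexp_path lam k (walk_from x s)) = c * gexp Q x /\
   (0 < lam k -> iterg sd k (fun s => walk_from x s k * gexp_path lam k (walk_from x s)) =
     c ^+ 3 * (x * gexp Q x)).
Proof.
move=> sd0; elim: k lam => [|k ih] lam lam0.
  exists 1, (lam 0%N) => x.
  by rewrite /= /gexp_path big_ord_recr big_ord0/= /walk_from big_ord0 addr0 expr1n !mul1r.
pose c := gfactor (sd k) (lam k.+1); pose q := grate (sd k) (lam k.+1).
(* Integrating the last step leaves a factor [gexp q] of the position k, which is merged into the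
   weight of that position. *)
pose lam' j := if j == k then lam k + q else lam j.
have q0 : 0 <= q by exact: grate_ge0.
have lam'0 j : 0 <= lam' j by rewrite /lam'; case: ifP => // _; rewrite addr_ge0.
have [c' [Q cQ]] := ih lam' lam'0.
have lam'E s x : gexp_path lam k (walk_from x s) * gexp q (walk_from x s k) =
    gexp_path lam' k (walk_from x s).
  rewrite /gexp_path !big_ord_recr/= -mulrA gexpD /lam' eqxx; congr (_ * _).
  by apply: eq_bigr => j _; rewrite ltn_eqF.
have updE s y x : gexp_path lam k.+1 (walk_from x (upd s k y)) =
    gexp_path lam k (walk_from x s) * gexp (lam k.+1) (walk_from x s k + y).
  rewrite /gexp_path big_ord_recr/= walk_from_updS; congr (_ * _).
  by apply: eq_bigr => j _; rewrite walk_from_upd// -ltnS.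
exists (c * c'), Q => x; have [h1 h2] := cQ x; split.
  rewrite /= -mulrA -h1 -itergZ; last exact: lipc_gexp_path.
  apply: eq_iterg => s; under eq_expect do rewrite updE.
  rewrite expectZ; last exact: bounded_meas_gexp.
  by rewrite expect_gexp// mulrCA lam'E.
move=> lamk1.
have qp : 0 < q by rewrite divr_gt0// ltr_pwDl// mulr_ge0// sqr_ge0.
have lam'k : 0 < lam' k by rewrite /lam' eqxx ltr_wpDl.
rewrite /= exprMn -mulrA -(h2 lam'k) -itergZ; last exact: lipc_xgexp_path.
apply: eq_iterg => s; under eq_expect do rewrite updE walk_from_updS mulrCA.
rewrite expectZ; last exact: bounded_meas_xgexp.
by rewrite expect_xgexp// -lam'E mulrCA; congr (_ * _); rewrite mulrCA.
Qed.

End iterated_gaussian.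

Section independence.
Context d (T : measurableType d) (R : realType) (P : probability T R).
Variables (J : finType) (X : J -> T -> R).

Lemma mutually_independent_box (e : nat -> J) (m : nat) (B : nat -> set R) :
  mutually_independent P X ->
  (forall i j, (i < m)%N -> (j < m)%N -> e i = e j -> i = j) ->
  (forall i, measurable (B i)) ->
  P (box (fun i => X (e i)) m B) = (\prod_(i < m) fine (P (X (e i) @^-1` B i)))%:E.
Proof.
move=> ind inj mB.
pose B' p := if [pick i : 'I_m | e i == p] is Some i then B i else setT.
have B'e (i : 'I_m) : B' (e i) = B i.
  rewrite /B'; case: pickP => [j /eqP/inj ->//|/(_ i)]; by rewrite eqxx.
have mB' p : measurable (B' p) by rewrite /B'; case: pickP.
have -> : box (fun i => X (e i)) m B = \bigcap_p (X p @^-1` B' p).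
  apply/seteqP; split => b h.
    move=> p _; rewrite /= /B'; case: pickP => // i /eqP <-; exact: h.
  move=> i im; have := h (e i) I; rewrite /= -[i]/(nat_of_ord (Ordinal im)) B'e; exact.
rewrite ind//; congr EFin.
rewrite (bigID (mem [set e i | i : 'I_m]%SET))/= [X in _ * X]big1 ?mulr1; last first.
  move=> p pI; rewrite /B'; case: pickP => [i /eqP ep|_].
    by move/negP: pI; case; apply/imsetP; exists i.
  by rewrite preimage_setT probability_setT.
rewrite big_imset/=; last by move=> i j _ _ /inj/val_inj; exact.
by apply: eq_bigr => i _; rewrite B'e.
Qed.

End independence.

(** * Lipschitz functionals of paths *)

Section uniform_continuity.
Variable R : realType.
Implicit Types (z : R -> R) (K h r : R).

Definition modulus z K h r := forall s t, 0 <= s <= K -> 0 <= t <= K ->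
  `|s - t| <= h -> `|z s - z t| <= r.

Lemma modulus_le z K h h' r r' : h' <= h -> r <= r' -> modulus z K h r ->
  modulus z K h' r'.
Proof.
move=> hh' rr' m s t sK tK st; apply: le_trans rr'; apply: m => //.
exact: le_trans hh'.
Qed.

Lemma continuous_modulus z K r : continuous z -> 0 < r ->
  exists2 h, 0 < h & modulus z K h r.
Proof.
move=> cz r0.
have /compact_near_coveringP ncK := @segment_compact R 0 K.
have := ncK R (0^'+) (fun h x => forall t, `|x - t| <= h -> `|z x - z t| <= r) _.
case.
  move=> x _.
  have r2 : 0 < r / 2 by rewrite divr_gt0.
  have /cvgrPdist_le/(_ _ r2)/nbhs_ballP[e /= e0 He] := cz x.
  near=> x' h => t x't.
  have xx' : `|x - x'| < e / 2 by near: x'; apply: (@nbhsx_ballx _ _ x (e / 2)); rewrite divr_gt0.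
  have he : h < e / 2 by near: h; apply: nbhs_right_lt; rewrite divr_gt0.
  have h1 : `|z x - z x'| <= r / 2 by apply: He => /=; rewrite /ball/= (lt_trans xx')// ltr_pdivrMr// ltr_pMr// ltr1n.
  have h2 : `|z x - z t| <= r / 2.
    apply: He => /=; rewrite /ball/= (le_lt_trans (ler_distD x' _ _))//.
    by rewrite (splitr e) ltrD// (le_lt_trans x't).
  by rewrite (le_trans (ler_distD (z x) _ _))// (splitr r) lerD// distrC.
move=> e /= e0 He; exists (e / 2); first by rewrite divr_gt0.
move=> s t s01 _; apply: (He (e / 2)).
- by rewrite /= sub0r normrN gtr0_norm ?divr_gt0// ltr_pdivrMr// ltr_pMr// ltr1n.
- by rewrite divr_gt0.
- by rewrite /= in_itv.
Unshelve. all: by end_near. Qed.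

End uniform_continuity.

Section infimum.
Variable R : realType.
Implicit Types (A : set R) (x v : R).

(** The extra element 1 keeps the set nonempty and the infimum at most 1, so that envelopes of
    functions with values in [0, 1] have values in [0, 1]. *)
Definition inf1 A : R := inf [set v | v = 1 \/ A v].

Lemma inf1_has_inf A : (forall v, A v -> 0 <= v) -> has_inf [set v | v = 1 \/ A v].
Proof. by move=> A0; split; [exists 1; left|exists 0 => v [->|/A0]]. Qed.

Lemma inf1_le A v : (forall v, A v -> 0 <= v) -> A v -> inf1 A <= v.
Proof. by move=> A0 Av; apply: ge_inf; [exact: (inf1_has_inf A0).2|right]. Qed.

Lemma inf1_le1 A : (forall v, A v -> 0 <= v) -> inf1 A <= 1.
Proof. by move=> A0; apply: ge_inf; [exact: (inf1_has_inf A0).2|left]. Qed.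

Lemma inf1_ge A x : x <= 1 -> (forall v, A v -> x <= v) -> x <= inf1 A.
Proof. by move=> x1 xA; apply: lb_le_inf; [exists 1; left|move=> v [->|/xA]]. Qed.

Lemma inf1_ge0 A : (forall v, A v -> 0 <= v) -> 0 <= inf1 A.
Proof. exact: inf1_ge. Qed.

End infimum.

Section path_functionals.
Variable R : realType.
Implicit Types (z : R -> R) (Phi H : (R -> R) -> R) (K L r : R).

Definition close K r z z' := forall t, 0 <= t <= K -> `|z t - z' t| <= r.

Lemma close_sym K r z z' : close K r z z' -> close K r z' z.
Proof. by move=> c t tK; rewrite distrC; exact: c. Qed.

Lemma close_refl K r z : 0 <= r -> close K r z z.
Proof. by move=> r0 t _; rewrite subrr normr0. Qed.

Lemma close_trans K r r' z z' z'' : close K r z z' -> close K r' z' z'' ->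
  close K (r + r') z z''.
Proof. by move=> c c' t tK; rewrite (le_trans (ler_distD (z' t) _ _))// lerD ?c ?c'. Qed.

Lemma close_le K K' r r' z z' : K' <= K -> r <= r' -> close K r z z' -> close K' r' z z'.
Proof.
move=> KK rr c t /andP[t0 tK]; apply: le_trans rr; apply: c.
by rewrite t0 (le_trans tK).
Qed.

(** Required of all functions z, continuous or not, so that step functions can be inserted; what z
    does outside of [0, K] is invisible to [Phi]. The one-sided bound is two-sided by symmetry of
    [close]. *)
Definition lipf K L Phi := [/\ 0 <= K, 0 <= L, forall z, 0 <= Phi z <= 1 &
  forall z z' r, 0 <= r -> close K r z z' -> Phi z <= Phi z' + L * r].

Lemma lipf_dist K L Phi z z' r : lipf K L Phi -> 0 <= r -> close K r z z' ->
  `|Phi z - Phi z'| <= L * r.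
Proof.
move=> [_ _ _ lP] r0 c; have h1 := lP z z' r r0 c.
by have h2 := lP z' z r r0 (close_sym c); rewrite ler_norml; lra.
Qed.

Lemma lipf_norm K L Phi z : lipf K L Phi -> `|Phi z| <= 1.
Proof. by move=> [_ _ P01 _]; have /andP[h1 h2] := P01 z; rewrite ger0_norm. Qed.

Lemma lipf_eq K L Phi z z' : lipf K L Phi -> (forall t, 0 <= t <= K -> z t = z' t) ->
  Phi z = Phi z'.
Proof.
move=> lP zz'; have := lipf_dist lP (lexx 0); move=> /(_ z z').
rewrite mulr0 normr_le0 subr_eq0 => h; apply/eqP/h => t tK.
by rewrite zz' ?subrr ?normr0.
Qed.

(** Inf-convolution of [H] with L times the uniform distance on [0, K]: the largest L-Lipschitz
    minorant of a function with values in [0, 1]. *)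
Definition reg K L H z := inf1 [set v | exists z' u,
  [/\ 0 <= u, close K u z z' & v = H z' + L * u]].

Section reg.
Variables (K L : R) (H : (R -> R) -> R).
Hypotheses (K0 : 0 <= K) (L0 : 0 <= L) (H01 : forall z, 0 <= H z <= 1).

Let reg_pos z v : (exists z' u, [/\ 0 <= u, close K u z z' & v = H z' + L * u]) -> 0 <= v.
Proof.
move=> [z' [u [u0 _ ->]]]; rewrite addr_ge0// ?mulr_ge0//.
by have /andP[] := H01 z'.
Qed.

Lemma reg_le z : reg K L H z <= H z.
Proof.
apply: inf1_le; first exact: reg_pos.
exists z, 0; split => //; [exact: close_refl|by rewrite mulr0 addr0].
Qed.

Lemma reg_ge c r z : c <= 1 -> 1 <= L * r ->
  (forall z', close K r z z' -> c <= H z') -> c <= reg K L H z.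
Proof.
move=> c1 Lr h; apply: inf1_ge => // v [z' [u [u0 zz' ->]]].
have /andP[Hz'0 _] := H01 z'.
have [ur|ru] := leP u r.
  rewrite (le_trans (h z' _))//; first exact: close_le zz'.
  by rewrite lerDl mulr_ge0.
rewrite (le_trans c1)// (le_trans Lr)// (le_trans (ler_wpM2l L0 (ltW ru)))//.
by rewrite lerDr.
Qed.

Lemma lipf_reg : lipf K L (reg K L H).
Proof.
split=> // [z|z z' r r0 c].
  by rewrite inf1_ge0 ?inf1_le1//; exact: reg_pos.
rewrite -lerBlDr; apply: inf1_ge => [|v [z1 [u [u0 c1 ->]]]].
  rewrite lerBlDr (le_trans (inf1_le1 _))//; first exact: reg_pos.
  by rewrite lerDl mulr_ge0.
rewrite lerBlDr; apply: inf1_le; first exact: reg_pos.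
exists z1, (r + u); split; first by rewrite addr_ge0.
  exact: close_trans c c1.
by rewrite mulrDr; ring.
Qed.

End reg.

(** The price charged to a path that is too rough for a grid of mesh h: by [oscf_cases] either the
    path has the modulus of continuity wanted, or it pays 1. The mean price vanishes with h by
    [expect_oscf_cvg0]. *)
Definition oscf K c h z := inf1 [set v | exists u, [/\ 0 <= u, modulus z K h u & v = c * u]].

Section oscf.
Variables (K c h : R).
Hypotheses (K0 : 0 <= K) (c0 : 0 <= c).

Let oscf_pos z v : (exists u, [/\ 0 <= u, modulus z K h u & v = c * u]) -> 0 <= v.
Proof. by move=> [u [u0 _ ->]]; rewrite mulr_ge0. Qed.

Lemma oscf_le z u : 0 <= u -> modulus z K h u -> oscf K c h z <= c * u.
Proof. by move=> u0 m; apply: inf1_le; [exact: oscf_pos|exists u]. Qed.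

Lemma lipf_oscf : lipf K (2 * c) (oscf K c h).
Proof.
split=> // [|z|z z' r r0 czz'].
- by rewrite mulr_ge0.
- by rewrite inf1_ge0 ?inf1_le1//; exact: oscf_pos.
rewrite -lerBlDr; apply: inf1_ge => [|v [u [u0 m ->]]].
  rewrite lerBlDr (le_trans (inf1_le1 _))//; first exact: oscf_pos.
  by rewrite lerDl !mulr_ge0.
rewrite lerBlDr (_ : _ + _ = c * (u + r + r)); last by ring.
apply: oscf_le => [|s t sK tK st]; first by rewrite !addr_ge0.
rewrite (_ : z s - z t = (z' s - z' t) + (z s - z' s) - (z t - z' t)); last by ring.
rewrite (le_trans (ler_normB _ _))// lerD//; last exact: czz'.
by rewrite (le_trans (ler_normD _ _))// lerD//; [exact: m|exact: czz'].
Qed.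

Lemma oscf_cases z u : 1 <= c * u -> modulus z K h u \/ oscf K c h z = 1.
Proof.
move=> cu; have [m|nm] := pselect (modulus z K h u); first by left.
right; apply/eqP; rewrite eq_le inf1_le1/=; last exact: oscf_pos.
apply: inf1_ge => // v [u' [u'0 m' ->]].
have [u'u|uu'] := leP u' u.
  by exfalso; apply: nm; exact: modulus_le m'.
by rewrite (le_trans cu)// ler_wpM2l// ltW.
Qed.

End oscf.

Definition seq_path h (y : nat -> R) : R -> R := fun t => y (Num.truncn (t / h)).
Definition step_path h z : R -> R := fun t => z (h * (Num.truncn (t / h))%:R).

Lemma step_pathE h z : step_path h z = seq_path h (fun j => z (h * j%:R)).
Proof. by []. Qed.

Lemma step_close z K h r : 0 < h -> modulus z K h r -> close K r z (step_path h z).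
Proof.
move=> h0 m t /andP[t0 tK].
have th0 : 0 <= t / h by rewrite divr_ge0// ltW.
have /andP[h1 h2] := truncn_itv th0.
have l1 : h * (Num.truncn (t / h))%:R <= t by rewrite mulrC -ler_pdivlMr.
apply: m; rewrite ?t0//.
  by rewrite mulr_ge0 ?(ltW h0)//= (le_trans l1).
rewrite ger0_norm ?subr_ge0// lerBlDl.
by move: h2; rewrite ltr_pdivrMr// -natr1 mulrDl mul1r mulrC => /ltW.
Qed.

Lemma lipc_seq_path K L Phi h : lipf K L Phi -> 0 < h ->
  lipc (Num.truncn (K / h)).+1 (fun y => Phi (seq_path h y)).
Proof.
move=> lP h0; have [K0 L0 P01 _] := lP; exists L, 1; split=> [y|y y'].
  exact: lipf_norm lP.
apply: (lipf_dist lP) => [|t /andP[t0 tK]]; first exact: sumr_ge0.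
have tKh : (Num.truncn (t / h) < (Num.truncn (K / h)).+1)%N.
  by rewrite ltnS le_truncn// ler_pM2r// invr_gt0.
by rewrite /seq_path (bigD1 (Ordinal tKh))//= lerDl sumr_ge0.
Qed.

End path_functionals.

Section continuous_process.
Context d (T : measurableType d) (R : realType) (P : probability T R).
Variables (z : R -> T -> R).
Hypothesis mz : forall t, measurable_fun setT (z t).
Hypothesis cz : forall b, continuous (z^~ b).
Implicit Types Phi : (R -> R) -> R.

Let bounded_meas_step K L Phi h : lipf K L Phi -> 0 < h ->
  bounded_meas (fun b => Phi (step_path h (z^~ b))).
Proof.
move=> lP h0; have [L' [M lH]] := lipc_seq_path lP h0.
exact (bounded_meas_lip_coord (xi := fun j b => z (h * j%:R) b) (fun j => mz _) lH).
Qed.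

Lemma lipf_step_cvg K L Phi b : lipf K L Phi ->
  Phi (step_path n.+1%:R^-1 (z^~ b)) @[n --> \oo] --> Phi (z^~ b).
Proof.
move=> lP; have [K0 L0 _ _] := lP.
apply/cvgrPdist_le => e e0.
have L1 : 0 < L + 1 by rewrite ltr_wpDl.
have e1 : 0 < e / (L + 1) by rewrite divr_gt0.
have [h h0 m] := continuous_modulus K (@cz b) e1.
near=> n.
apply: (@le_trans _ _ (L * (e / (L + 1)))).
  apply: (lipf_dist lP); first exact: ltW.
  apply: step_close => //; apply: modulus_le m => //.
  by near: n; have := near_divn_le 1 h0; under eq_near do rewrite div1r.
by rewrite mulrA ler_pdivrMr// mulrC ler_wpM2l ?(ltW e0)// lerDl.
Unshelve. all: by end_near. Qed.

(** Measurability and expectations of path functionals are inherited from grids, where only finitely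
    many variables occur. *)
Lemma expect_step_cvg K L Phi : lipf K L Phi ->
  bounded_meas (fun b => Phi (z^~ b)) /\
  expect P (fun b => Phi (step_path n.+1%:R^-1 (z^~ b))) @[n --> \oo] -->
  expect P (fun b => Phi (z^~ b)).
Proof.
move=> lP; apply: (@expect_cvg _ _ _ _ _ _ 1).
- by move=> n; apply: bounded_meas_step lP _; rewrite invr_gt0.
- by move=> n b; exact: lipf_norm lP.
- by move=> b; exact: lipf_step_cvg lP.
Qed.

Lemma bounded_meas_lipf K L Phi : lipf K L Phi -> bounded_meas (fun b => Phi (z^~ b)).
Proof. by move=> /expect_step_cvg[]. Qed.

Lemma expect_oscf_cvg0 K c : 0 <= K -> 0 <= c ->
  expect P (fun b => oscf K c n.+1%:R^-1 (z^~ b)) @[n --> \oo] --> (0 : R).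
Proof.
move=> K0 c0; rewrite -[X in _ --> X](expect_cst P 0).
have [] := @expect_cvg _ _ _ P (fun n b => oscf K c n.+1%:R^-1 (z^~ b)) (fun=> 0) 1 => //.
- by move=> n; exact: bounded_meas_lipf (lipf_oscf _ K0 c0).
- by move=> n b; exact: lipf_norm (lipf_oscf _ K0 c0).
move=> b; apply/cvgrPdist_le => e e0.
have c1 : 0 < c + 1 by rewrite ltr_wpDl.
have e1 : 0 < e / (c + 1) by rewrite divr_gt0.
have [h h0 m] := continuous_modulus K (@cz b) e1.
near=> n; rewrite sub0r normrN ger0_norm; last first.
  by have [_ _ /(_ (z^~ b))/andP[]] := lipf_oscf n.+1%:R^-1 K0 c0.
apply: (@le_trans _ _ (c * (e / (c + 1)))).
  apply: oscf_le => //; first exact: ltW.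
  apply: modulus_le m => //.
  by near: n; have := near_divn_le 1 h0; under eq_near do rewrite div1r.
by rewrite mulrA ler_pdivrMr// mulrC ler_wpM2l ?(ltW e0)// lerDl.
Unshelve. all: by end_near. Qed.

End continuous_process.

(** * Brownian motion *)

Section nice_brownian_motion.
Context d (T : measurableType d) (R : realType) (P : probability T R).

(** Start at 0, measurability and continuity hold for every b and on the whole time axis; this
    removes almost sure clauses and subspace topologies from what follows. *)
Definition nice_bm (n : nat) (W : 'I_n -> R -> T -> R) :=
  [/\ forall i t, measurable_fun setT (W i t),
      forall i b, W i 0 b = 0,
      forall i b, continuous (fun t => W i t b),
      forall i (s t : R) (B : set R), 0 <= s -> s < t -> measurable B ->
        P [set b | B (W i t b - W i s b)] = normal_prob 0 (Num.sqrt (t - s)) B &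
      forall (k : nat) (t : nat -> R), 0 <= t 0%N ->
        {homo t : i j / (i < j)%N >-> i < j} ->
        mutually_independent P (fun (p : 'I_n * 'I_k) (b : T) =>
          W p.1 (t p.2.+1) b - W p.1 (t p.2) b)].

Lemma nice_bm_brownian n (W : 'I_n -> R -> T -> R) : nice_bm W -> brownian_motion P W.
Proof.
move=> [mW W0 cW lW iW]; split => //.
- by apply: aeW => b i.
- by apply: aeW => b i; apply: continuous_subspaceT; exact: cW.
Qed.

Lemma nice_bm_coord n (W : 'I_n -> R -> T -> R) (i : 'I_n) :
  nice_bm W -> nice_bm (fun _ : 'I_1 => W i).
Proof.
move=> [mW W0 cW lW iW]; split => //.
  by move=> _ s t B s0 st mB; exact: lW.
move=> k t t0 tt B mB.
pose B' (p : 'I_n * 'I_k) := if p.1 == i then B (ord0, p.2) else setT.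
have mB' p : measurable (B' p) by rewrite /B'; case: ifP.
have := iW k t t0 tt B' mB'.
have -> : \bigcap_(p : 'I_n * 'I_k) ((fun b => W p.1 (t p.2.+1) b - W p.1 (t p.2) b) @^-1` B' p) =
  \bigcap_(p : 'I_1 * 'I_k) ((fun b => W i (t p.2.+1) b - W i (t p.2) b) @^-1` B p).
  apply/seteqP; split => b h.
    by move=> [u j] _ /=; have := h (i, j) I; rewrite /= /B' eqxx (ord1 u).
  move=> [i' j] _ /=; rewrite /B'/=; case: eqP => // ->; exact: (h (ord0, j) I).
move=> ->; congr EFin.
rewrite [LHS](bigID (fun p => p.1 == i))/= [X in _ * X]big1 ?mulr1; last first.
  by move=> [i' j] /= /negbTE ii'; rewrite /B'/= ii' preimage_setT probability_setT.
rewrite (reindex (fun p : 'I_1 * 'I_k => (i, p.2)))/=; last first.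
  exists (fun p => (ord0, p.2)) => [[u j] _|[i' j]] /=; first by rewrite (ord1 u).
  by rewrite unfold_in /= => /eqP ->.
by apply: eq_big => [p|[u j] _]; rewrite ?eqxx// /B'/= eqxx (ord1 u).
Qed.

Lemma prob_off_null (N A A' : set T) : measurable N -> P N = 0%E ->
  measurable A -> measurable A' ->
  (forall b, ~ N b -> A b <-> A' b) -> P A = P A'.
Proof.
move=> mN N0 mA mA' AA'.
have null B : measurable B -> P B = P (B `\` N).
  move=> mB; rewrite [LHS](measureDI P mB mN) [X in (_ + X)%E](_ : _ = 0%E) ?adde0//.
  exact: (subset_measure0 (measurableI _ _ mB mN) mN (@subIsetr _ _ _) N0).
rewrite null// [RHS]null//; congr (P _); apply/seteqP; split => b [h Nb]; split => //;
  exact/(AA' b Nb).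
Qed.

Lemma dist_max0 (s t : R) : `|Num.max s 0 - Num.max t 0| <= `|s - t|.
Proof.
have := ler_norm (t - s); have := ler_norm (s - t); rewrite (distrC t s) => h1 h2.
by rewrite /Num.max; case: ltP => ?; case: ltP => ?; rewrite ler_norml; apply/andP; lra.
Qed.

Lemma continuous_max0 (f : R -> R) :
  {within [set t : R | 0 <= t], continuous f} -> continuous (fun t : R => f (Num.max t 0)).
Proof.
move=> /subspace_continuousP cf t; apply/cvgrPdist_le => e e0.
have t0 : 0 <= Num.max t 0 by rewrite le_max lexx orbT.
have /cvgrPdist_le/(_ _ e0) := cf _ t0.
rewrite near_withinE => /nbhs_ballP[r /= r0 Hr].
near=> s; apply: Hr; last by rewrite /= le_max lexx orbT.
rewrite /ball/=.
have st : `|t - s| < r by near: s; exact: (@nbhsx_ballx _ _ t r).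
exact: le_lt_trans (dist_max0 _ _) st.
Unshelve. all: by end_near. Qed.

Lemma nice_version n (W : 'I_n -> R -> T -> R) : brownian_motion P W ->
  exists N W', [/\ measurable N, P N = 0%E, nice_bm W' &
    forall b, ~ N b -> forall i t, 0 <= t -> W' i t b = W i t b].
Proof.
move=> [mW [N1 [mN1 N10 sN1]] lW iW [N2 [mN2 N20 sN2]]].
pose N := N1 `|` N2.
have mN : measurable N by exact: measurableU.
have N0 : P N = 0%E.
  by apply/eqP; rewrite -measure_le0 -(adde0 0%E) -[X in (X + _)%E]N10 -[X in (_ + X)%E]N20; exact: measureU2.
(* Negative times receive the value at 0, and on the exceptional null set the path is replaced by
   0. *)
pose W' i (t : R) b := W i (Num.max t 0) b * \1_(~` N) b.
have W'N b : ~ N b -> forall i t, 0 <= t -> W' i t b = W i t b.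
  by move=> Nb i t t0; rewrite /W' indicE mem_set// mulr1 max_l.
have mx0 (t : R) : 0 <= Num.max t 0 by rewrite le_max lexx orbT.
have mW' i t : measurable_fun setT (W' i t).
  by apply: measurable_funM; [exact: mW|exact: measurable_indic (measurableC mN)].
have N_ W'' b : N b -> W' W''.1 W''.2 b = 0.
  by move=> Nb; rewrite /W' indicE memNset ?mulr0// => h; exact: h.
have minc i s t B : measurable B -> measurable ((fun b => W' i t b - W' i s b) @^-1` B).
  by move=> mB; rewrite -[_ @^-1` _]setTI; apply: measurable_funB.
have minc' i s t B : 0 <= s -> 0 <= t -> measurable B -> measurable ((fun b => W i t b - W i s b) @^-1` B).
  by move=> s0 t0 mB; rewrite -[_ @^-1` _]setTI; apply: measurable_funB => //; exact: mW.
exists N, W'; split => //; split => //.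
- move=> i b; have [Nb|Nb] := pselect (N b); first exact: (N_ (i, 0)).
  rewrite W'N//; apply: contrapT => h; apply: Nb; left; apply: sN1 => /= h'.
  exact/h/h'.
- move=> i b; have [Nb|Nb] := pselect (N b).
    rewrite (_ : (fun _ => _) = fun=> 0); last by apply/funext => t; exact: (N_ (i, t)).
    by move=> t; exact: cvg_cst.
  have cW : {within [set t : R | 0 <= t], continuous (fun t => W i t b)}.
    apply: contrapT => h; apply: Nb; right; apply: sN2 => /= h'; exact/h/h'.
  have -> : (W' i)^~ b = fun t : R => W i (Num.max t 0) b.
    by apply/funext => t; rewrite /W' indicE mem_set// mulr1.
  exact: (@continuous_max0 (fun t => W i t b)).
- move=> i s t B s0 st mB; rewrite -(lW i s t B)//.
  apply: (prob_off_null mN N0); first exact: minc.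
    by apply: minc' => //; exact: le_trans (ltW st).
  by move=> b Nb; rewrite /= !W'N//; exact: le_trans (ltW st).
move=> k t t0 tt B mB.
have tge j : 0 <= t j.
  by case: j => // j; rewrite (le_trans t0)// ltW// tt.
transitivity (P (\bigcap_(p : 'I_n * 'I_k) ((fun b => W p.1 (t p.2.+1) b - W p.1 (t p.2) b) @^-1` B p))).
  apply: (prob_off_null mN N0).
  - by apply: fin_bigcap_measurable => // p _; exact: minc.
  - by apply: fin_bigcap_measurable => // p _; exact: minc'.
  - by move=> b Nb; split => h p pT; have := h p pT; rewrite /= !W'N.
rewrite iW//; congr EFin; apply: eq_bigr => p _; congr fine.
apply: (prob_off_null mN N0); [exact: minc'|exact: minc|].
by move=> b Nb; rewrite /= !W'N.
Qed.

End nice_brownian_motion.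

Lemma eq_iterg_sd (R : realType) (sd sd' : nat -> R) k H :
  (forall j, (j < k)%N -> sd j = sd' j) -> iterg sd k H = iterg sd' k H.
Proof.
elim: k H => [//|k IH] H sdE /=; rewrite (sdE k)//.
by apply: IH => j jk; apply: sdE; exact: ltnW.
Qed.

Section increments.
Context d (T : measurableType d) (R : realType) (P : probability T R).
Variables (n : nat) (W : 'I_n -> R -> T -> R).
Hypothesis bmW : nice_bm P W.

Let mW i t : measurable_fun setT (W i t). Proof. by have [] := bmW. Qed.

Lemma bm_gauss_indep (k m : nat) (t : nat -> R) (e : nat -> 'I_n * 'I_k) :
  0 <= t 0%N -> {homo t : i j / (i < j)%N >-> i < j} ->
  (forall i j, (i < m)%N -> (j < m)%N -> e i = e j -> i = j) ->
  gauss_indep P (fun j b => W (e j).1 (t (e j).2.+1) b - W (e j).1 (t (e j).2) b)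
    (fun j => Num.sqrt (t (e j).2.+1 - t (e j).2)) m.
Proof.
move=> t0 tt inj m' B m'm mB; have [_ _ _ lW iW] := bmW.
have tge j : 0 <= t j.
  by case: j => // j; rewrite (le_trans t0)// ltW// tt.
rewrite (mutually_independent_box (iW k t t0 tt) (e := e) (m := m'))//; last first.
  by move=> i j im jm; apply: inj; exact: leq_trans m'm.
congr EFin; apply: eq_bigr => i _; congr fine.
by rewrite /gauss_law -(lW (e i).1 _ _ _ (tge _) (tt _ _ (ltnSn _)) (mB i)).
Qed.

Lemma bm_expect_increments (i : 'I_n) (m : nat) (t : nat -> R) H :
  0 <= t 0%N -> {homo t : i j / (i < j)%N >-> i < j} -> lipc m H ->
  expect P (fun b => H (fun j => W i (t j.+1) b - W i (t j) b)) =
  iterg (fun j => Num.sqrt (t j.+1 - t j)) m H.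
Proof.
move=> t0 tt lH; pose e (j : nat) : 'I_n * 'I_m.+1 := (i, inord j).
have inj j j' : (j < m)%N -> (j' < m)%N -> e j = e j' -> j = j'.
  by move=> jm j'm [] /(congr1 val); rewrite /= !inordK// ltnS ltnW.
pose xi j b := W (e j).1 (t (e j).2.+1) b - W (e j).1 (t (e j).2) b.
have mxi j : measurable_fun setT (xi j) by apply: measurable_funB; exact: mW.
have [L [M lH']] := lH.
have -> : expect P (fun b => H (fun j => W i (t j.+1) b - W i (t j) b)) =
    expect P (fun b => H (xi^~ b)).
  apply: eq_expect => b; apply: (lip_coord_eq lH') => j jm.
  by rewrite /xi /e /= inordK// ltnS ltnW.
rewrite (expect_iter mxi (bm_gauss_indep t0 tt inj) lH).
apply: eq_iterg_sd => j jm; by rewrite /e /= inordK// ltnS ltnW.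
Qed.

End increments.

Lemma lipc_walk_path (R : realType) (K L h x : R) Phi k : lipf K L Phi -> 0 < h ->
  (Num.truncn (K / h) <= k)%N ->
  lipc k (fun s => Phi (seq_path h (walk_from x s))).
Proof.
move=> lP h0 Kk; exists (L), 1; split; first by move=> s; exact: lipf_norm lP.
move=> s s'; apply: (lipf_dist lP); first exact: sumr_ge0.
move=> t /andP[t0 tK]; apply: lip_walk_from; apply: leq_trans Kk.
by apply: le_truncn; rewrite ler_pdivrMr// divfK// gt_eqF.
Qed.

Lemma walk_telescope (R : realType) (x : R) (w : nat -> R) j :
  walk_from x (fun i => w i.+1 - w i) j = x + (w j - w 0%N).
Proof.
rewrite /walk_from; congr (_ + _); elim: j => [|j IH]; first by rewrite big_ord0 subrr.
by rewrite big_ord_recr/= IH; ring.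
Qed.

Section brownian_markov.
Context d (T : measurableType d) (R : realType) (P : probability T R).
Variables (n : nat) (W : 'I_n -> R -> T -> R).
Hypothesis bmW : nice_bm P W.

Let mW i t : measurable_fun setT (W i t). Proof. by have [] := bmW. Qed.

Lemma bm_grid (i : 'I_n) (h u : R) (m : nat) H : 0 < h -> lipc m H ->
  expect P (fun b => H (fun j => W i (h * j.+1%:R) b - W i (h * j%:R) b)) =
  iterg (fun=> Num.sqrt h) m H.
Proof.
move=> h0 lH; rewrite (@bm_expect_increments _ _ _ _ _ _ bmW i m (fun j => h * j%:R))//.
- by apply: eq_iterg_sd => j _; rewrite -mulrBr -natrB// subSnn mulr1.
- by rewrite mulr0.
- by move=> j j' jj'; rewrite ltr_pM2l// ltr_nat.
Qed.

Let step_markov (i : 'I_n) (g : R -> R) K L Phi (Lg Mg h : R) : lipf K L Phi -> 0 < h ->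
  0 <= Lg -> (forall x, `|g x| <= Mg) -> (forall x y, `|g x - g y| <= Lg * `|x - y|) ->
  expect P (fun b => g (W i 1 b) * Phi (step_path h (fun t => W i (1 + t) b - W i 1 b))) =
  expect P (fun b => g (W i 1 b)) * expect P (fun b => Phi (step_path h (W i ^~ b))).
Proof.
move=> lP h0 Lg0 gM gL; pose k := Num.truncn (K / h).
have [_ W0 _ _ _] := bmW.
(* Grid 0, 1, 1 + h, 1 + 2 h, ...: the first increment is W_1, and the following ones build the path
   restarted at time 1. *)
pose t (j : nat) := if j is j'.+1 then 1 + h * j'%:R else 0.
have tt : {homo t : i j / (i < j)%N >-> i < j}.
  move=> [|j] [|j'] //= jj'; first by apply: ltr_pwDl => //; rewrite mulr_ge0// ltW.
  by rewrite ltrD2l ltr_pM2l// ltr_nat.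
have lg : lipc 1 (fun s => g (s 0%N)).
  apply: (lipc_comp (g := fun s => s 0%N)) gM gL _ => // s s'; by rewrite big_ord1.
have lPhi := lipc_walk_path 0 lP h0 (leqnn k).
have lH : lipc (1 + k) (fun s => g (s 0%N) *
    Phi (seq_path h (walk_from 0 (fun i => s (1 + i)%N)))).
  by apply: lipc_mul; [exact: lipcW lg|exact: (lipc_shift _ lPhi)].
transitivity (expect P (fun b => (fun s => g (s 0%N) *
    Phi (seq_path h (walk_from 0 (fun i => s (1 + i)%N))))
    (fun j => W i (t j.+1) b - W i (t j) b))).
  apply: eq_expect => b /=; rewrite W0 subr0 mulr0 addr0; congr (_ * _).
  rewrite step_pathE; congr Phi; congr seq_path; apply/funext => j.
  by rewrite (walk_telescope 0 (fun j => W i (t (1 + j)%N) b))/= mulr0 addr0 add0r.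
rewrite (bm_expect_increments bmW i (lexx 0) tt lH) (iterg_prod _ lg lPhi); congr (_ * _).
  rewrite -(@eq_iterg_sd _ (fun j => Num.sqrt (t j.+1 - t j)))//.
  rewrite -(bm_expect_increments bmW i _ tt lg)//=; apply: eq_expect => b.
  by rewrite W0 subr0 mulr0 addr0.
rewrite -(@eq_iterg_sd _ (fun=> Num.sqrt h)); last first.
  by move=> j _; congr Num.sqrt; rewrite /t /= -(natr1 j); ring.
rewrite -(bm_grid i 0 h0 lPhi); apply: eq_expect => b; rewrite step_pathE; congr Phi.
congr seq_path; apply/funext => j.
by rewrite (walk_telescope 0 (fun j => W i (h * j%:R) b)) add0r mulr0 W0 subr0.
Qed.

Lemma bm_markov (i : 'I_n) (g : R -> R) K L Phi (Lg Mg : R) : lipf K L Phi ->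
  0 <= Lg -> (forall x, `|g x| <= Mg) -> (forall x y, `|g x - g y| <= Lg * `|x - y|) ->
  expect P (fun b => g (W i 1 b) * Phi (fun t => W i (1 + t) b - W i 1 b)) =
  expect P (fun b => g (W i 1 b)) * expect P (fun b => Phi (W i ^~ b)).
Proof.
move=> lP Lg0 gM gL; have [_ W0 cW _ _] := bmW.
have bg : bounded_meas (fun b => g (W i 1 b)).
  split; last by exists Mg.
  by apply: measurableT_comp => //; exact: measurable_lip gL.
pose z t b := W i (1 + t) b - W i 1 b.
have mz t : measurable_fun setT (z t) by apply: measurable_funB.
have cz b : continuous (z^~ b).
  move=> t; apply: cvgB; last exact: cvg_cst.
  have c1 : continuous (fun t : R => 1 + t : R).
    by move=> s; apply: cvgD; [exact: cvg_cst|exact: cvg_id].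
  exact: (continuous_comp (c1 t) (cW i b _)).
have bz h : 0 < h -> bounded_meas (fun b => Phi (step_path h (z^~ b))).
  move=> h0; have [L' [M' lH]] := lipc_seq_path lP h0.
  have := bounded_meas_lip_coord (xi := fun j => z (h * j%:R)) (fun=> mz _) lH.
  exact.
have N0 N : 0 < N.+1%:R^-1 :> R by rewrite invr_gt0.
have leM N b : `|g (W i 1 b) * Phi (step_path N.+1%:R^-1 (z^~ b))| <= Mg.
  by rewrite normrM (le_trans _ (gM (W i 1 b)))// ler_piMr// (lipf_norm _ lP).
have [_ h1] := expect_cvg P (fun N => bounded_measM bg (bz _ (N0 N))) leM
  (fun b => cvgMr (lipf_step_cvg cz lP)).
have [_ h2] := expect_step_cvg P (mW i) (cW i) lP.
have h3 : (fun N => expect P (fun b => g (W i 1 b) * Phi (step_path N.+1%:R^-1 (z^~ b)))) @ \oo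
    --> expect P (fun b => g (W i 1 b)) * expect P (fun b => Phi (W i ^~ b)).
  rewrite (_ : (fun N => _) = fun N => expect P (fun b => g (W i 1 b)) *
    expect P (fun b => Phi (step_path N.+1%:R^-1 (W i ^~ b)))); first exact: cvgMr.
  by apply/funext => N; exact: (step_markov i lP (N0 N) Lg0 gM gL).
exact: (cvg_unique _ h1 h3).
Qed.

End brownian_markov.

Section radial_path.
Context d (T : measurableType d) (R : realType) (P : probability T R).
Variables (W : 'I_3 -> R -> T -> R).
Hypothesis bmW : nice_bm P W.

Definition radial (x t : R) (b : T) : R :=
  Num.sqrt (\sum_(i < 3) (x * (i == ord0)%:R + W i t b) ^+ 2).

Lemma gexp_norm l (y : 'I_3 -> R) :
  gexp l (Num.sqrt (\sum_i y i ^+ 2)) = \prod_i gexp l (y i).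
Proof.
rewrite /gexp sqr_sqrtr; last by apply: sumr_ge0 => i _; exact: sqr_ge0.
by rewrite !big_ord_recl !big_ord0 !mulr1 -!expRD; congr expR; field.
Qed.

(** Exponentials of squared radii factor over the three coordinates. By [iterg_gexp_path] the
    coordinate started at x gives c exp(- Q x^2 / 2) and the two started at 0 give c each; the
    weighted linear functional gives c^3 x exp(- Q x^2 / 2), which is the same. *)
Lemma radial_gexp (x h : R) (k : nat) (lam : nat -> R) : 0 < h ->
  (forall j, 0 <= lam j) -> 0 < lam k.+1 ->
  x * expect P (fun b => gexp_path lam k.+1 (fun j => radial x (h * j%:R) b)) =
  expect P (fun b => (x + W ord0 (h * k.+1%:R) b) *
    gexp_path lam k.+1 (fun j => x + W ord0 (h * j%:R) b)).
Proof.
move=> h0 lam0 lamk; have [mW W0 _ _ _] := bmW.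
have sh0 : forall i : nat, 0 < Num.sqrt h by move=> _; rewrite sqrtr_gt0.
have [c [Q cQ]] := @iterg_gexp_path R (fun=> Num.sqrt h) k.+1 lam sh0 lam0.
pose A y s := gexp_path lam k.+1 (walk_from y s).
have lA y : lipc k.+1 (A y) by exact: lipc_gexp_path.
have walkE i y b j : walk_from y (fun j => W i (h * j.+1%:R) b - W i (h * j%:R) b) j =
    y + W i (h * j%:R) b.
  by rewrite (walk_telescope y (fun j => W i (h * j%:R) b)) mulr0 W0 subr0.
pose H s := A x s * ((fun s => A 0 s * A 0 (fun i => s (k.+1 + i)%N)) (fun i => s (k.+1 + i)%N)).
have lA2 : lipc (k.+1 + k.+1) (fun s => A 0 s * A 0 (fun i => s (k.+1 + i)%N)).
  by apply: lipc_mul; [apply: lipcW (lA 0); exact: leq_addr|exact: (lipc_shift _ (lA 0))].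
have lH : lipc (k.+1 + (k.+1 + k.+1)) H.
  by apply: lipc_mul; [apply: lipcW (lA x); exact: leq_addr|exact: (lipc_shift _ lA2)].
pose t (j : nat) := h * j%:R.
have tt : {homo t : i j / (i < j)%N >-> i < j}.
  by move=> j j' jj'; rewrite ltr_pM2l// ltr_nat.
(* The 3 (k + 1) increments are listed coordinate after coordinate: index i (k + 1) + j is the
   increment j of the coordinate i. *)
pose e (j : nat) : 'I_3 * 'I_k.+1 := (inord (j %/ k.+1), inord (j %% k.+1)).
have inj j j' : (j < k.+1 + (k.+1 + k.+1))%N -> (j' < k.+1 + (k.+1 + k.+1))%N ->
    e j = e j' -> j = j'.
  move=> jm j'm [] /(congr1 val) + /(congr1 val); rewrite /= !inordK ?ltn_pmod//.
  - by move=> h1 h2; rewrite (divn_eq j k.+1) h1 h2 -divn_eq.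
  - by rewrite ltn_divLR//; lia.
  - by rewrite ltn_divLR//; lia.
pose xi j b := W (e j).1 (t (e j).2.+1) b - W (e j).1 (t (e j).2) b.
have mxi j : measurable_fun setT (xi j) by apply: measurable_funB; exact: mW.
have t0 : 0 <= t 0%N by rewrite /t mulr0.
have := expect_iter mxi (bm_gauss_indep bmW t0 tt inj) lH.
rewrite (@eq_iterg_sd _ _ (fun=> Num.sqrt h)); last first.
  by move=> j _; rewrite /t -mulrBr -natrB// subSnn mulr1.
rewrite /H (iterg_prod _ (lA x) lA2) (iterg_prod _ (lA 0) (lA 0)) => E3.
have -> : expect P (fun b => gexp_path lam k.+1 (fun j => radial x (h * j%:R) b)) =
    expect P (fun b => H (xi^~ b)).
  apply: eq_expect => b.
  have blk (i j : nat) : (i < 3)%N -> (j < k.+1)%N ->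
      xi (i * k.+1 + j)%N b = W (inord i) (h * j.+1%:R) b - W (inord i) (h * j%:R) b.
    by move=> i3 jk; rewrite /xi /e /t /= divnMDl// divn_small// addn0 modnMDl modn_small// inordK.
  have AE (i : nat) y : (i < 3)%N -> A y (fun j => xi (i * k.+1 + j)%N b) =
      \prod_(j < k.+2) gexp (lam j) (y + W (inord i) (h * j%:R) b).
    move=> i3; have [L [M lAy]] := lA y.
    rewrite (lip_coord_eq (s' := fun j => W (inord i) (h * j.+1%:R) b - W (inord i) (h * j%:R) b) lAy).
      by apply: eq_bigr => j _; rewrite walkE.
    by move=> j jk; rewrite blk.
  have H0 := AE 0%N x isT; have H1 := AE 1%N 0 isT; have H2 := AE 2%N 0 isT.
  rewrite /H.
  have -> : A x (xi^~ b) = A x (fun j => xi (0 * k.+1 + j)%N b) by [].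
  have -> : A 0 (fun i => xi (k.+1 + i)%N b) = A 0 (fun j => xi (1 * k.+1 + j)%N b).
    by congr A; apply/funext => j; rewrite mul1n.
  have -> : A 0 (fun i => xi (k.+1 + (k.+1 + i))%N b) = A 0 (fun j => xi (2 * k.+1 + j)%N b).
    by congr A; apply/funext => j; congr (xi _ b); lia.
  rewrite H0 H1 H2 /gexp_path -!big_split/=; apply: eq_bigr => j _.
  rewrite /radial gexp_norm !big_ord_recl big_ord0 !mulr1 ?mulr0.
  have E0 : inord 0 = ord0 :> 'I_3 by apply/val_inj; rewrite /= inordK.
  have E1 : inord 1 = lift ord0 ord0 :> 'I_3 by apply/val_inj; rewrite /= inordK.
  have E2 : inord 2 = lift ord0 (lift ord0 ord0) :> 'I_3 by apply/val_inj; rewrite /= inordK.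
  by rewrite E0 E1 E2.
rewrite E3 !(eq_iterg _ _ (fun s => erefl (A _ s))).
rewrite (cQ x).1 (cQ 0).1.
have -> : expect P (fun b => (x + W ord0 (h * k.+1%:R) b) *
    gexp_path lam k.+1 (fun j => x + W ord0 (h * j%:R) b)) =
  expect P (fun b => (fun s => walk_from x s k.+1 * A x s)
     (fun j => W ord0 (h * j.+1%:R) b - W ord0 (h * j%:R) b)).
  by apply: eq_expect => b /=; rewrite walkE; congr (_ * _); apply: eq_bigr => j _; rewrite walkE.
rewrite (bm_grid bmW ord0 0 h0 (lipc_xgexp_path x lam0 lamk (leqnn _))) (cQ x).2//.
have -> : gexp Q 0 = 1 by rewrite /gexp expr0n/= mulr0 oppr0 mul0r expR0.
by rewrite mulr1 !exprS expr0; ring.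
Qed.

End radial_path.

(** * Three-dimensional and linear Brownian motion *)

Section bernstein.
Variable R : realType.
Implicit Types (u c : R) (f g : nat -> R).

(* The Bernstein operator: the mean of [f (a + S)] for [S] binomial. *)
Fixpoint bern N u f (a : nat) : R :=
  if N is N'.+1 then u * bern N' u f a.+1 + (1 - u) * bern N' u f a else f a.

Lemma bernD N u f g a : bern N u (fun i => f i + g i) a = bern N u f a + bern N u g a.
Proof. by elim: N a => //= N IH a; rewrite !IH; ring. Qed.

Lemma bernZ N u c f a : bern N u (fun i => c * f i) a = c * bern N u f a.
Proof. by elim: N a => //= N IH a; rewrite !IH; ring. Qed.

Lemma bern_cst N u c a : bern N u (fun=> c) a = c.
Proof. by elim: N a => //= N IH a; rewrite !IH; ring. Qed.

Lemma le_bern N u f g a : 0 <= u <= 1 -> (forall i, f i <= g i) ->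
  bern N u f a <= bern N u g a.
Proof.
move=> /andP[u0 u1] fg; elim: N a => //= N IH a.
by apply: lerD; apply: ler_wpM2l; rewrite // subr_ge0.
Qed.

Lemma bern_variance N u c a :
  bern N u (fun i => (i%:R - c) ^+ 2) a = (a%:R + N%:R * u - c) ^+ 2 + N%:R * (u * (1 - u)).
Proof.
elim: N a => [|N IH] a /=; first by rewrite !mul0r !addr0.
by rewrite !IH -!natr1; ring.
Qed.

Lemma bern_dist N u f c (L e : R) : 0 <= u <= 1 -> 0 <= L -> 0 < e ->
  (forall i, `|f i - c| <= L * `|i%:R / N.+1%:R - u|) -> e ^- 2 <= N.+1%:R ->
  `|bern N.+1 u f 0 - c| <= L * e.
Proof.
move=> u01 L0 e0 fc eN; have /andP[u0 u1] := u01.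
set n : R := N.+1%:R; have n0 : 0 < n by rewrite ltr0n.
(* The inequality 2 e |y| <= e^2 + y^2 replaces the Chebyshev inequality, so only the binomial
   variance is needed; e^-2 <= n makes the variance term at most e / 2. *)
have ub i : `|i%:R / n - u| <= e / 2 + (n ^- 2 / (2 * e)) * (i%:R - n * u) ^+ 2.
  set y := i%:R / n - u.
  have -> : i%:R - n * u = n * y by rewrite /y; field; rewrite gt_eqF.
  have -> : e / 2 + n ^- 2 / (2 * e) * (n * y) ^+ 2 = (e ^+ 2 + y ^+ 2) / (2 * e).
    by field; rewrite !gt_eqF.
  rewrite ler_pdivlMr ?mulr_gt0// -[y ^+ 2]real_normK ?num_real//.
  by have := sqr_ge0 (e - `|y|); rewrite sqrrB; lra.
pose h i := L * (e / 2) + L * (n ^- 2 / (2 * e)) * (i%:R - n * u) ^+ 2.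
have hE : bern N.+1 u h 0 = L * (e / 2) + L * (n ^- 2 / (2 * e)) * (n * (u * (1 - u))).
  rewrite /h bernD bern_cst bernZ bern_variance add0r subrr expr0n/= add0r//.
have fh i : `|f i - c| <= h i.
  by apply: le_trans (fc i) _; rewrite /h -mulrA -mulrDr; apply: ler_wpM2l.
have hle : bern N.+1 u h 0 <= L * e.
  rewrite hE -mulrA -mulrDr; apply: ler_wpM2l => //.
  have -> : n ^- 2 / (2 * e) * (n * (u * (1 - u))) = (u * (1 - u)) / (n * (2 * e)).
    by field; rewrite !gt_eqF.
  set X := u * (1 - u) / (n * (2 * e)).
  have : X <= e / 2; last by move=> ?; lra.
  rewrite /X ler_pdivrMr ?mulr_gt0//.
  have -> : e / 2 * (n * (2 * e)) = n * e ^+ 2 by field.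
  have : 1 <= n * e ^+ 2 by rewrite -ler_pdivrMr ?exprn_gt0// mul1r.
  by have := sqr_ge0 u; rewrite expr2; nra.
apply: le_trans hle.
have -> : bern N.+1 u f 0 - c = bern N.+1 u (fun i => f i + - c) 0.
  by rewrite bernD bern_cst.
rewrite ler_norml; apply/andP; split.
  rewrite -mulN1r -bernZ; apply: le_bern => // i.
  by have := fh i; rewrite ler_norml => /andP[+ _]; lra.
by apply: le_bern => // i; have := fh i; rewrite ler_norml => /andP[_].
Qed.

End bernstein.

Section bernstein_extension.
Context d (T : measurableType d) (R : realType) (P : probability T R).
Variables (p q : nat -> T -> R) (v w : T -> R) (n : nat).
Hypotheses (mp : forall j, measurable_fun setT (p j)) (mq : forall j, measurable_fun setT (q j)).
Hypotheses (p01 : forall j b, 0 <= p j b <= 1) (q01 : forall j b, 0 <= q j b <= 1).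
Hypotheses (bv : bounded_meas v) (bw : bounded_meas w).

Let mono (z : nat -> T -> R) (m : nat -> nat) b := \prod_(j < n) z j b ^+ m j.

Hypothesis moments : forall m : nat -> nat,
  expect P (fun b => v b * mono p m b) = expect P (fun b => w b * mono q m b).

Let bz (z : nat -> T -> R) : (forall j, measurable_fun setT (z j)) ->
  (forall j b, 0 <= z j b <= 1) -> forall j, bounded_meas (z j).
Proof.
move=> mz z01 j; split => //; exists 1 => b.
by have /andP[z0 z1] := z01 j b; rewrite ger0_norm.
Qed.

Let bmono (z : nat -> T -> R) m : (forall j, bounded_meas (z j)) -> bounded_meas (mono z m).
Proof.
move=> bz'; rewrite /mono; elim: (index_enum _) => [|j s IH].
  under eq_fun do rewrite big_nil; exact: bounded_meas_cst.
under eq_fun do rewrite big_cons; apply: bounded_measM => //.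
elim: (m j) => [|l IHl]; first by under eq_fun do rewrite expr0; exact: bounded_meas_cst.
by under eq_fun do rewrite exprS; exact: bounded_measM.
Qed.

Let mono01 (z : nat -> T -> R) m b : (forall j b, 0 <= z j b <= 1) -> 0 <= mono z m b <= 1.
Proof.
move=> z01; apply/andP; split; first by apply: prodr_ge0 => j _; have /andP[z0 _] := z01 j b; exact: exprn_ge0.
apply: prodr_ile1 => j _; have /andP[z0 z1] := z01 j b.
by rewrite exprn_ge0//= exprn_ile1.
Qed.

Let bbern (z f : nat -> T -> R) j N a : (forall j, bounded_meas (z j)) ->
  (forall i, bounded_meas (f i)) ->
  bounded_meas (fun b => bern N (z j b) (f^~ b) a).
Proof.
move=> bz' bf; elim: N a => //= N IH a.
apply: bounded_measD; apply: bounded_measM => //.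
by apply: bounded_measB => //; exact: bounded_meas_cst.
Qed.

(** Induction on the number of variables of [g]. In its last variable [g] is replaced by a Bernstein
    polynomial, whose coefficients depend on one variable less; the powers created are absorbed by
    the monomial, which is why the statement carries arbitrary exponents [m]. *)
Lemma expect_bernstein_ext j (g : (nat -> R) -> R) (m : nat -> nat) : (j <= n)%N -> lipc j g ->
  expect P (fun b => v b * mono p m b * g (p^~ b)) =
  expect P (fun b => w b * mono q m b * g (q^~ b)).
Proof.
have bp := bz mp p01; have bq := bz mq q01.
elim: j g m => [|j IH] g m jn [L [M lg]].
  have g0 s : g s = g (fun=> 0) by apply: (lip_coord_eq lg).
  under eq_expect do rewrite g0 mulrC; under [RHS]eq_expect do rewrite g0 mulrC.
  rewrite !expectZ ?moments//; by apply: bounded_measM => //; exact: bmono.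
have L0 := lip_coord_L_ge0 lg.
have lgu y : lipc j (fun s => g (upd s j y)) by exists L, M; exact: lip_coord_upd.
have bg z y : (forall j, measurable_fun setT (z j)) -> bounded_meas (fun b => g (upd (z^~ b) j y)).
  by move=> mz; exact (bounded_meas_lip_coord mz (lip_coord_upd y lg)).
have id_bern N (f : nat -> R) a (m' : nat -> nat) :
  expect P (fun b => v b * mono p m' b * bern N (p j b) (fun i => g (upd (p^~ b) j (f i))) a) =
  expect P (fun b => w b * mono q m' b * bern N (q j b) (fun i => g (upd (q^~ b) j (f i))) a).
  elim: N a m' => [|N IHN] a m' /=; first exact: IH (ltnW jn) (lgu _).
  (* One step of the Bernstein recursion multiplies by the variable j, that is, raises one
     exponent. *)
  pose m1 i := if i == j then (m' i).+1 else m' i.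
  have monoS z b : mono z m1 b = z j b * mono z m' b.
    rewrite /mono (bigD1 (Ordinal jn))//= [in RHS](bigD1 (Ordinal jn))//= /m1 eqxx exprS -mulrA.
    congr (_ * (_ * _)); apply: eq_bigr => i ij; case: eqP => // ij'.
    by case/eqP: ij; apply: val_inj.
  have expand (z : nat -> T -> R) (v' : T -> R) : bounded_meas v' -> (forall j, bounded_meas (z j)) ->
      (forall j, measurable_fun setT (z j)) ->
    expect P (fun b => v' b * mono z m' b *
      (z j b * bern N (z j b) (fun i => g (upd (z^~ b) j (f i))) a.+1 +
      (1 - z j b) * bern N (z j b) (fun i => g (upd (z^~ b) j (f i))) a)) =
    expect P (fun b => v' b * mono z m1 b * bern N (z j b) (fun i => g (upd (z^~ b) j (f i))) a.+1) +
    (expect P (fun b => v' b * mono z m' b * bern N (z j b) (fun i => g (upd (z^~ b) j (f i))) a) -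
    expect P (fun b => v' b * mono z m1 b * bern N (z j b) (fun i => g (upd (z^~ b) j (f i))) a)).
    move=> bv' bz' mz; have bb a' m2 : bounded_meas (fun b => v' b * mono z m2 b *
        bern N (z j b) (fun i => g (upd (z^~ b) j (f i))) a').
      apply: bounded_measM; first by apply: bounded_measM => //; exact: bmono.
      by apply: (bbern (f := fun i b => g (upd (z^~ b) j (f i)))) => // i; exact: bg.
    rewrite -expectB// -expectD//; last exact: bounded_measB.
    by apply: eq_expect => b; rewrite monoS; ring.
  by rewrite !expand// !IHN.
have [Mv vM] := bv.2; have [Mw wM] := bw.2.
have Mv0 : 0 <= Mv by apply: le_trans (vM point).
have Mw0 : 0 <= Mw by apply: le_trans (wM point).
apply/eqP; rewrite -subr_eq0 -normr_le0; apply/ler_addgt0Pr => e e0; rewrite add0r.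
pose e' := e / ((Mv + Mw) * L + 1).
have D0 : 0 < (Mv + Mw) * L + 1 by rewrite ltr_wpDl// mulr_ge0// addr_ge0.
have e'0 : 0 < e' by rewrite divr_gt0.
pose N := Num.truncn (e' ^- 2).
have eN : e' ^- 2 <= N.+1%:R.
  by rewrite ltW// /N truncnS_gt.
pose f (i : nat) : R := i%:R / N.+1%:R.
have approx (z : nat -> T -> R) (v' : T -> R) Mv' : (forall b, `|v' b| <= Mv') ->
   bounded_meas v' -> (forall j, bounded_meas (z j)) -> (forall j b, 0 <= z j b <= 1) ->
   `|expect P (fun b => v' b * mono z m b * g (z^~ b)) -
     expect P (fun b => v' b * mono z m b * bern N.+1 (z j b) (fun i => g (upd (z^~ b) j (f i))) 0)|
   <= Mv' * (L * e').
  move=> vM' bv' bz' z01; have bvm : bounded_meas (fun b => v' b * mono z m b).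
    by apply: bounded_measM => //; exact: bmono.
  apply: expect_dist.
  - apply: bounded_measM => //; exact (bounded_meas_lip_coord (fun j => (bz' j).1) lg).
  - apply: bounded_measM => //.
    by apply: (bbern (f := fun i b => g (upd (z^~ b) j (f i)))) => // i; apply: bg => j'; exact: (bz' j').1.
  move=> b; rewrite -mulrBr !normrM; have /andP[m0 m1] := mono01 m b z01.
  have Mv'0 : 0 <= Mv' by apply: le_trans (vM' point).
  apply: ler_pM => //.
    by rewrite -[leRHS]mulr1 ler_pM// ger0_norm.
  rewrite distrC; apply: bern_dist => //.
  move=> i; apply: le_trans (lg.2 _ _) _; apply: ler_wpM2l => //.
  rewrite (bigD1 (Ordinal (ltnSn j)))//= /upd eqxx big1 ?addr0// => i' i'j.
  by rewrite ifN ?subrr ?normr0//; apply: contra i'j => /eqP i'j; apply/eqP/val_inj.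
have h1 := approx p v Mv vM bv bp p01.
have h2 := approx q w Mw wM bw bq q01.
rewrite id_bern in h1.
set X := expect P (fun b => _ * bern _ _ _ _) in h1 h2.
have : `|expect P (fun b => v b * mono p m b * g (p^~ b)) -
   expect P (fun b => w b * mono q m b * g (q^~ b))| <= Mv * (L * e') + Mw * (L * e').
  apply: le_trans (ler_distD X _ _) _; apply: lerD => //; by rewrite distrC.
move=> /le_trans; apply; rewrite -mulrDl mulrA /e' mulrA ler_pdivrMr//.
by rewrite [leRHS]mulrC; apply: ler_wpM2r; [exact: ltW|rewrite lerDl].
Qed.

Lemma expect_bernstein (g : (nat -> R) -> R) : lipc n g ->
  expect P (fun b => v b * g (p^~ b)) = expect P (fun b => w b * g (q^~ b)).
Proof.
move=> lg; have := @expect_bernstein_ext n g (fun=> 0%N) (leqnn n) lg.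
have m1 z b : mono z (fun=> 0%N) b = 1 by apply: big1 => j _; rewrite expr0.
under eq_expect do rewrite m1 mulr1; by under [in RHS]eq_expect do rewrite m1 mulr1.
Qed.

End bernstein_extension.

(** * Recovering the radius from exp(- r^2 / 2) *)

Section radial_identity.
Variable R : realType.
Implicit Types (r u del A : R).

Definition clip del A r := Num.min (Num.max r del) A.

Lemma clip_le del A r : clip del A r <= A.
Proof. by rewrite /clip ge_min lexx orbT. Qed.

Lemma clip_ge del A r : del <= A -> del <= clip del A r.
Proof. by move=> dA; rewrite /clip le_min le_max lexx orbT. Qed.

Lemma clip_id del A r : del <= r <= A -> clip del A r = r.
Proof. by move=> /andP[dr rA]; rewrite /clip max_l// min_l. Qed.

Lemma dist_max (x y c : R) : `|Num.max x c - Num.max y c| <= `|x - y|.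
Proof.
have := ler_norm (x - y); have := ler_norm (y - x); rewrite (distrC y x) => h1 h2.
by rewrite /Num.max; case: ltP => ?; case: ltP => ?; rewrite ler_norml; apply/andP; lra.
Qed.

Lemma lip_clip del A r r' : `|clip del A r - clip del A r'| <= `|r - r'|.
Proof.
have dist_min x y c : `|Num.min x c - Num.min y c| <= `|x - y| :> R.
  have := ler_norm (x - y); have := ler_norm (y - x); rewrite (distrC y x) => h1 h2.
  by rewrite /Num.min; case: ltP => ?; case: ltP => ?; rewrite ler_norml; apply/andP; lra.
exact: le_trans (dist_min _ _ _) (dist_max _ _ _).
Qed.

Lemma clip_lo del A r : del <= A -> r <= del -> clip del A r = del.
Proof. by move=> dA rd; rewrite /clip max_r// min_l. Qed.

Lemma clip_hi del A r : A <= r -> clip del A r = A.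
Proof. by move=> Ar; rewrite /clip min_r// le_max Ar. Qed.

(** Inverse of r |-> exp(- r^2 / 2) on [del, A]. The true inverse has infinite slope at r = 0 and as
    r tends to infinity; the clipping makes it Lipschitz on the line. *)
Definition gexp_inv del A u : R :=
  Num.sqrt (- (2 * ln (clip (gexp 1 A) (gexp 1 del) u))).

Section inv.
Variables (del A : R).
Hypotheses (del0 : 0 < del) (delA : del <= A).

Let le_gexp r r' : 0 <= r -> 0 <= r' -> (gexp 1 r' <= gexp 1 r) = (r <= r').
Proof.
move=> r0 r'0; rewrite ler_expR -[RHS](@ler_pXn2r R 2)// ?nnegrE//.
by apply/idP/idP; lra.
Qed.

Let A0 : 0 <= A. Proof. exact: le_trans (ltW del0) delA. Qed.

Let gA0 : gexp 1 A <= gexp 1 del.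
Proof. by rewrite le_gexp// ltW. Qed.

Let cge u : 0 < clip (gexp 1 A) (gexp 1 del) u.
Proof. by apply: lt_le_trans (expR_gt0 _) (clip_ge u gA0). Qed.

Lemma gexp_invK u : gexp 1 (gexp_inv del A u) = clip (gexp 1 A) (gexp 1 del) u.
Proof.
rewrite /gexp_inv {1}/gexp sqr_sqrtr; last first.
  rewrite oppr_ge0 mulr_ge0_le0// ln_le0// (le_trans (clip_le _ _ _))//.
  by rewrite gexp_le1.
rewrite (_ : - (1 * _) / 2 = ln (clip (gexp 1 A) (gexp 1 del) u)); last by field.
by rewrite lnK// posrE.
Qed.

Let inv_range u : del <= gexp_inv del A u <= A.
Proof.
have s0 : 0 <= gexp_inv del A u by exact: sqrtr_ge0.
rewrite -(le_gexp (ltW del0) s0) -(le_gexp s0 A0) gexp_invK clip_le/=.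
exact: clip_ge.
Qed.

Lemma gexp_inv_gexp r : 0 <= r -> gexp_inv del A (gexp 1 r) = clip del A r.
Proof.
move=> r0; have inv y : 0 <= y -> Num.sqrt (- (2 * ln (gexp 1 y))) = y.
  move=> y0; rewrite expRK (_ : - _ = y ^+ 2); last by field.
  by rewrite sqrtr_sqr ger0_norm.
have d0 := ltW del0; rewrite /gexp_inv.
have [rd|/ltW dr] := leP r del; first by rewrite clip_hi ?le_gexp// clip_lo// inv.
have [rA|/ltW Ar] := leP r A; first by rewrite !clip_id ?inv ?dr// !le_gexp// rA dr.
by rewrite clip_lo ?le_gexp// clip_hi// inv.
Qed.

Lemma lip_gexp_inv u u' :
  `|gexp_inv del A u - gexp_inv del A u'| <= (del * gexp 1 A)^-1 * `|u - u'|.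
Proof.
have c0 : 0 < del * gexp 1 A by rewrite mulr_gt0// expR_gt0.
rewrite mulrC ler_pdivlMr// mulrC; apply: le_trans (lip_clip (gexp 1 A) (gexp 1 del) u u').
rewrite -!gexp_invK.
have main y y' : del <= y <= A -> del <= y' <= A -> y <= y' ->
    del * gexp 1 A * `|y - y'| <= `|gexp 1 y - gexp 1 y'|.
  move=> /andP[dy yA] /andP[dy' y'A] yy'.
  have y0 : 0 <= y by exact: le_trans (ltW del0) dy.
  have y'0 : 0 <= y' by exact: le_trans y0 yy'.
  rewrite distrC !ger0_norm ?subr_ge0 ?le_gexp//.
  have gE : gexp 1 y = gexp 1 y' * expR ((y' ^+ 2 - y ^+ 2) / 2).
    by rewrite /gexp -expRD; congr expR; field.
  have h1 := expR_ge1Dx ((y' ^+ 2 - y ^+ 2) / 2).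
  have h2 : gexp 1 A <= gexp 1 y' by rewrite le_gexp.
  have h3 : del * (y' - y) <= (y' ^+ 2 - y ^+ 2) / 2 by nra.
  rewrite gE; set e' := expR _ in h1 *.
  have : gexp 1 A * (del * (y' - y)) <= gexp 1 y' * (e' - 1); last by move=> ?; lra.
  apply: ler_pM => //.
  - exact: gexp_ge0.
  - by rewrite mulr_ge0 ?(ltW del0)// subr_ge0.
  - by lra.
have [yy'|/ltW yy'] := leP (gexp_inv del A u) (gexp_inv del A u').
  exact: main.
by rewrite distrC (distrC (gexp 1 _)); exact: main.
Qed.

End inv.
End radial_identity.

Section radial_linear.
Context d (T : measurableType d) (R : realType) (P : probability T R).
Variables (W : 'I_3 -> R -> T -> R).
Hypothesis bmW : nice_bm P W.

Lemma measurable_radial x t : measurable_fun setT (radial W x t).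
Proof.
have [mW _ _ _ _] := bmW.
rewrite /radial; apply: (@measurableT_comp _ _ _ _ _ _ (@Num.sqrt R)).
  by apply: continuous_measurable_fun; exact: sqrt_continuous.
apply: measurable_sum => i; apply: measurable_funX.
by apply: measurable_funD => //; exact: mW.
Qed.

Lemma continuous_radial x b : continuous (fun t => radial W x t b).
Proof.
have [_ _ cW _ _] := bmW.
move=> t; apply: (@continuous_comp _ _ _ (fun t => \sum_(i < 3) (x * (i == ord0)%:R + W i t b) ^+ 2)
  Num.sqrt); last exact: sqrt_continuous.
have c i : (fun t => (x * (i == ord0)%:R + W i t b) ^+ 2) @ t -->
    (x * (i == ord0)%:R + W i t b) ^+ 2.
  by apply: cvgM; (apply: cvgD; [exact: cvg_cst|exact: cW]).
rewrite /prop_for /continuous_at !big_ord_recl big_ord0 addr0.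
under eq_fun do rewrite !big_ord_recl big_ord0 addr0.
by apply: cvgD => //; apply: cvgD.
Qed.

(* Extension of the identity between Gaussian moments from exponentials to
   Lipschitz functions, by polynomial approximation in the variables
   [exp(- r_j^2 / 2)]; [x] may be negative. *)
Lemma radial_linear (x h del A : R) (k : nat) (G : (nat -> R) -> R) :
  0 < h -> 0 < del -> del <= A -> lipc k.+2 G -> (forall s, A <= s k.+1 -> G s = 0) ->
  x * expect P (fun b => G (fun j => clip del A (radial W x (h * j%:R) b))) =
  expect P (fun b => (x + W ord0 (h * k.+1%:R) b) *
    G (fun j => clip del A `|x + W ord0 (h * j%:R) b|)).
Proof.
move=> h0 d0 dA [L [M lG]] GA; have [mW W0 _ _ _] := bmW.
(* The last factor cancels the weight [gexp 1] present in [v] and [w]. The cancellation is exact as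
   long as the last radius is at most A, and beyond A the function [G] vanishes. *)
pose g (u : nat -> R) := G (fun j => gexp_inv del A (u j)) *
   (Num.max (u k.+1) (gexp 1 A))^-1.
pose rr j b := radial W x (h * j%:R) b.
pose ll j b := x + W ord0 (h * j%:R) b.
have mll j : measurable_fun setT (ll j) by apply: measurable_funD.
pose p j b := gexp 1 (rr j b); pose q j b := gexp 1 (ll j b).
have mgexp : measurable_fun setT (@gexp R 1).
  by apply: (@measurable_lip _ _ ((1 + 2) / 2)) => y y'; exact: lip_gexp.
have mp j : measurable_fun setT (p j) by apply: measurableT_comp => //; exact: measurable_radial.
have mq j : measurable_fun setT (q j) by apply: measurableT_comp => //; exact: mll.
have p01 j b : 0 <= p j b <= 1 by rewrite gexp_ge0 gexp_le1.
have q01 j b : 0 <= q j b <= 1 by rewrite gexp_ge0 gexp_le1.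
(* The additional factor at the last time keeps [w] bounded and gives the last exponent the
   positivity required by [radial_gexp]. *)
pose v b := x * p k.+1 b; pose w b := ll k.+1 b * q k.+1 b.
have bp : bounded_meas (p k.+1).
  by split => //; exists 1 => b; have /andP[p0 p1] := p01 k.+1 b; rewrite ger0_norm.
have bv : bounded_meas v by exact: bounded_measZ.
have bw : bounded_meas w.
  split; first exact: measurable_funM.
  by exists ((1 + 2 / 1) / 2) => b; exact: xgexp_le.
have gX l (y : R) : gexp 1 y ^+ l = gexp l%:R y.
  elim: l => [|l IH]; first by rewrite expr0 /gexp mul0r oppr0 mul0r expR0.
  by rewrite exprS IH gexpD (_ : 1 + l%:R = l.+1%:R)// -natr1 addrC.
have pathE (y : nat -> R) (m : nat -> nat) : gexp 1 (y k.+1) * \prod_(j < k.+2) gexp 1 (y j) ^+ m j =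
    gexp_path (fun j => (m j)%:R + (j == k.+1)%:R) k.+1 y.
  rewrite /gexp_path big_ord_recr [in RHS]big_ord_recr/= eqxx !gX -gexpD.
  rewrite mulrCA [X in _ * X]mulrC; congr (_ * _).
  by apply: eq_bigr => j _; rewrite gX (ltn_eqF (ltn_ord j)) addr0.
have moments (m : nat -> nat) : expect P (fun b => v b * \prod_(j < k.+2) p j b ^+ m j) =
    expect P (fun b => w b * \prod_(j < k.+2) q j b ^+ m j).
  have lam0 j : 0 <= (m j)%:R + (j == k.+1)%:R :> R by rewrite addr_ge0.
  have lamk : 0 < (m k.+1)%:R + (k.+1 == k.+1)%:R :> R by rewrite eqxx ltr_wpDl.
  have := radial_gexp bmW x h0 lam0 lamk.
  rewrite -expectZ; last first.
    have -> : (fun b => gexp_path (fun j => (m j)%:R + (j == k.+1)%:R) k.+1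
       (fun j => radial W x (h * j%:R) b)) =
       fun b => \prod_(j < k.+2) gexp ((m j)%:R + (j == k.+1 :> nat)%:R) (rr j b) by [].
    elim: (index_enum _) => [|j s IH].
      under eq_fun do rewrite big_nil; exact: bounded_meas_cst.
    under eq_fun do rewrite big_cons; apply: bounded_measM => //; split.
      apply: measurableT_comp; last exact: measurable_radial.
      by apply: (@measurable_lip _ _ (((m j)%:R + (j == k.+1 :> nat)%:R + 2) / 2)) => y y'; exact: lip_gexp.
    by exists 1 => b; rewrite ger0_norm ?gexp_le1// gexp_ge0.
  move=> E; etransitivity; [etransitivity; [|exact: E]|]; apply: eq_expect => b.
    by rewrite -(pathE (fun j => rr j b)) mulrA.
  by rewrite -(pathE (fun j => ll j b)) mulrA.
have lg : lipc k.+2 g.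
  apply: lipc_mul.
    exists (L * (del * gexp 1 A)^-1), M; split; first by move=> s; exact: lG.1.
    have Lge0 := lip_coord_L_ge0 lG.
    move=> s s'; apply: le_trans (lG.2 _ _) _; rewrite -mulrA; apply: ler_wpM2l => //.
    by rewrite mulr_sumr; apply: ler_sum => i _; exact: lip_gexp_inv.
  apply: (@lipc_comp _ _ (fun s => s k.+1) (fun u => (Num.max u (gexp 1 A))^-1)
     (gexp 1 A ^- 2) (gexp 1 A)^-1).
  - by rewrite invr_ge0 exprn_ge0// gexp_ge0.
  - move=> u; have c0 : 0 < Num.max u (gexp 1 A) by rewrite lt_max expR_gt0 orbT.
    rewrite ger0_norm ?invr_ge0 ?(ltW c0)// lef_pV2 ?posrE// ?expR_gt0//.
    by rewrite le_max lexx orbT.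
  - move=> u u'; set a := Num.max u _; set a' := Num.max u' _.
    have aA : gexp 1 A <= a by rewrite le_max lexx orbT.
    have a'A : gexp 1 A <= a' by rewrite le_max lexx orbT.
    have gA : 0 < gexp 1 A by exact: expR_gt0.
    have a0 : 0 < a by exact: lt_le_trans aA.
    have a'0 : 0 < a' by exact: lt_le_trans a'A.
    have -> : a^-1 - a'^-1 = (a * a')^-1 * (a' - a).
      by field; rewrite !gt_eqF.
    rewrite normrM; apply: ler_pM => //.
      rewrite ger0_norm ?invr_ge0 ?mulr_ge0 ?(ltW a0) ?(ltW a'0)//.
      by rewrite lef_pV2 ?posrE ?mulr_gt0 ?exprn_gt0// expr2 ler_pM// ltW.
    rewrite distrC.
    exact: dist_max.
  - move=> s s'; rewrite big_ord_recr/= lerDr; exact: sumr_ge0.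
have := expect_bernstein mp mq p01 q01 bv bw moments lg.
have vanish (y : nat -> R) : (forall j, 0 <= y j) -> gexp 1 (y k.+1) * g (fun j => gexp 1 (y j)) =
    G (fun j => clip del A (y j)).
  move=> y0; rewrite /g.
  have -> : G (fun j => gexp_inv del A (gexp 1 (y j))) = G (fun j => clip del A (y j)).
    by congr G; apply/funext => j; rewrite gexp_inv_gexp.
  have [yA|/ltW Ay] := leP (y k.+1) A; last first.
    by rewrite GA ?mul0r ?mulr0// clip_hi.
  rewrite max_l; last first.
    rewrite ler_expR; have : y k.+1 ^+ 2 <= A ^+ 2 by rewrite lerXn2r ?nnegrE// (le_trans (y0 _) yA).
    by lra.
  by rewrite mulrCA mulfV ?mulr1// gt_eqF// expR_gt0.
rewrite -expectZ; last first.
  have lc : lip_coord k.+2 L M (fun s => G (fun j => clip del A (s j))).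
    split; first by move=> s; exact: lG.1.
    move=> s s'; apply: le_trans (lG.2 _ _) _; apply: ler_wpM2l; first exact: lip_coord_L_ge0 lG.
    by apply: ler_sum => i _; exact: lip_clip.
  exact (bounded_meas_lip_coord (xi := rr) (fun j => measurable_radial x _) lc).
move=> E; etransitivity; [etransitivity; [|exact: E]|]; apply: eq_expect => b.
  by rewrite /v -mulrA vanish// => j; exact: sqrtr_ge0.
rewrite /w -mulrA; congr (_ * _); rewrite -(vanish (fun j => `|ll j b|))//.
have gN y : gexp 1 `|y| = gexp 1 y by rewrite /gexp real_normK ?num_real.
by rewrite gN; congr (_ * g _); apply/funext => j; rewrite gN.
Qed.

End radial_linear.

(** * Stopped paths *)

Section stopped_functionals.
Variables (R : realType) (a : R) (Gam : (R -> R) -> R).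
Hypothesis Gam01 : forall z, 0 <= Gam z <= 1.
Implicit Types (z : R -> R) (e r s t u : R).

(* [z'] starts close to 0 on a short interval [0, h] and then follows [z] up to
   the hitting time of [a]. *)
Definition delayed e r z z' := C0 z' /\ exists h, [/\ 0 <= h <= e,
  forall t, 0 <= t <= h -> `|z' t| <= e &
  forall u, 0 <= u <= r^-1 -> (forall v, 0 <= v -> v < u + h -> z' v < a) ->
    `|z' (u + h) - z u| <= r].

(** Worst value of [Gam] over the paths that may have preceded and perturbed z: e bounds the length
    and the height of the initial piece, r the error afterwards, and r^-1 is the horizon. *)
Definition gfun e r z := inf1 [set v | exists2 z', delayed e r z z' & v = Gam z'].

(** Reaching a before 0, with margins: unlike the event itself, this one survives uniform
    perturbations at the price of a smaller r. *)
Definition above r z t := [/\ 0 <= t <= r^-1, a + r <= z t &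
  forall u, 0 <= u <= t -> r < z u].

Definition hfun e r z : R := if `[< exists t, above r z t >] then gfun e r z else 0.

(** Lipschitz version of [hfun], between [hfun] with parameter 2 r and [hfun] with parameter r. *)
Definition phif e r := reg r^-1 r^-1 (hfun e r).

Let gpos e r z v : (exists2 z', delayed e r z z' & v = Gam z') -> 0 <= v.
Proof. by move=> [z' _ ->]; have /andP[] := Gam01 z'. Qed.

Lemma gfun01 e r z : 0 <= gfun e r z <= 1.
Proof. by rewrite inf1_ge0 ?inf1_le1//; exact: gpos. Qed.

Lemma hfun01 e r z : 0 <= hfun e r z <= 1.
Proof. by rewrite /hfun; case: ifP => _; [exact: gfun01|rewrite lexx ler01]. Qed.

Lemma hfun_gfun e r z : hfun e r z <= gfun e r z.
Proof. by rewrite /hfun; case: ifP => // _; have /andP[] := gfun01 e r z. Qed.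

Lemma gfun_delayed e r z z' : delayed e r z z' -> gfun e r z <= Gam z'.
Proof. by move=> zz'; apply: inf1_le; [exact: gpos|exists z']. Qed.

Lemma gfun_close e r s z z' : 0 < r -> 0 <= s -> close (r + s)^-1 s z z' ->
  gfun e (r + s) z <= gfun e r z'.
Proof.
move=> r0 s0 zz'; apply: inf1_ge; first by have /andP[] := gfun01 e (r + s) z.
move=> v [y [Cy [h [he yh yz']]] ->]; apply: gfun_delayed; split => //.
exists h; split => // u /andP[u0 ur] yu.
have ur' : u <= r^-1.
  by apply: le_trans ur _; rewrite lef_pV2 ?posrE ?lerDl// ltr_wpDr.
apply: le_trans (ler_distD (z' u) _ _) _; apply: lerD; first by apply: yz'; rewrite ?u0.
by rewrite distrC; apply: zz'; rewrite u0.
Qed.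

(** Closeness is needed only up to the time t at which z is well above a, since a delayed path has
    reached a by then and the later part is not compared. *)
Lemma gfun_shift e r s z z' t : 0 < r -> 0 <= s -> above (r + s) z t ->
  close t s z z' -> gfun e (r + s) z <= hfun e r z'.
Proof.
move=> r0 s0 [/andP[t0 tr] zt zu] zz'.
have tr' : t <= r^-1.
  by apply: le_trans tr _; rewrite lef_pV2 ?posrE ?lerDl// ltr_wpDr.
have z't : a + r <= z' t.
  have := zz' t; rewrite t0 lexx => /(_ isT); rewrite ler_norml => /andP[_]; lra.
rewrite /hfun asboolT; last first.
  exists t; split; rewrite ?t0// => u /andP[u0 ut].
  have := zz' u; rewrite u0 ut => /(_ isT); rewrite ler_norml => /andP[_].
  by have := zu u; rewrite u0 ut => /(_ isT); lra.
apply: inf1_ge; first by have /andP[] := gfun01 e (r + s) z.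
move=> v [y [Cy [h [he yh yz']]] ->]; apply: gfun_delayed; split => //.
exists h; split => // u /andP[u0 ur] yu.
(* Otherwise the delayed path, within r + s of z at time t, would already be at least a before its
   time u + h. *)
have ut : u <= t.
  rewrite leNgt; apply/negP => tu.
  have yt : forall v, 0 <= v -> v < t + h -> y v < a.
    by move=> w w0 wt; apply: yu => //; lra.
  have := yz' t; rewrite t0 tr' => /(_ isT yt); rewrite ler_norml => /andP[h1 _].
  have h0 : 0 <= h by have /andP[] := he.
  by have := yu (t + h) (addr_ge0 t0 h0); rewrite ltrD2r => /(_ tu); lra.
apply: le_trans (ler_distD (z' u) _ _) _; apply: lerD.
  by apply: yz' => //; rewrite u0 (le_trans ut).
by rewrite distrC; apply: zz'; rewrite u0.
Qed.

Lemma hfun_close e r s z z' : 0 < r -> 0 <= s -> close (r + s)^-1 s z z' ->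
  hfun e (r + s) z <= hfun e r z'.
Proof.
move=> r0 s0 zz'; rewrite [leLHS]/hfun.
case: asboolP => [[t zt]|_]; last by have /andP[] := hfun01 e r z'.
apply: (gfun_shift e r0 s0 zt); apply: close_le zz' => //; by case: zt => /andP[].
Qed.

Lemma gfun_le e r r' z : 0 < r -> r <= r' -> gfun e r' z <= gfun e r z.
Proof.
move=> r0 rr'; rewrite -(subrKC r r'); apply: gfun_close; rewrite ?subr_ge0//.
by apply: close_refl; rewrite subr_ge0.
Qed.

Lemma phif_le e r z : 0 < r -> phif e r z <= hfun e r z.
Proof. by move=> r0; apply: reg_le => // [|z']; [rewrite invr_ge0 ltW|exact: hfun01]. Qed.

Lemma phif_ge e r z : 0 < r -> hfun e (r + r) z <= phif e r z.
Proof.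
move=> r0; apply: (@reg_ge _ _ _ _ _ _ _ r) => //.
- by rewrite invr_ge0 ltW.
- exact: hfun01.
- by have /andP[] := hfun01 e (r + r) z.
- by rewrite mulVf ?gt_eqF.
- move=> z' zz'; apply: hfun_close => //; first exact: ltW.
  by apply: close_le zz' => //; rewrite lef_pV2 ?posrE ?lerDl ?addr_gt0// ltW.
Qed.

Lemma lipf_phif e r : 0 < r -> lipf r^-1 r^-1 (phif e r).
Proof.
by move=> r0; apply: lipf_reg; rewrite ?invr_ge0 ?(ltW r0)//; exact: hfun01.
Qed.

(** The analogue of [phif] without the escape event, to be evaluated on the radial process; it lies
    between [gfun] with tolerances 4 e and 2 e. *)
Definition phig e := reg (2 * e)^-1 (2 * e)^-1 (gfun e (2 * e)).

Lemma phig_le e z : 0 < e -> phig e z <= gfun e (2 * e) z.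
Proof.
by move=> e0; apply: reg_le => // [|z']; [rewrite invr_ge0 mulr_ge0// ltW|exact: gfun01].
Qed.

Lemma phig_ge e z : 0 < e -> gfun e (4 * e) z <= phig e z.
Proof.
move=> e0; have e20 : 0 < 2 * e by rewrite mulr_gt0.
apply: (@reg_ge _ _ _ _ _ _ _ (2 * e)) => //.
- by rewrite invr_ge0 ltW.
- exact: gfun01.
- by have /andP[] := gfun01 e (4 * e) z.
- by rewrite mulVf ?gt_eqF.
- move=> z' zz'; rewrite (_ : 4 * e = 2 * e + 2 * e); last by ring.
  apply: gfun_close => //; first exact: ltW.
  by apply: close_le zz' => //; rewrite lef_pV2 ?posrE ?lerDl ?addr_gt0// ltW.
Qed.

Lemma lipf_phig e : 0 < e -> lipf (2 * e)^-1 (2 * e)^-1 (phig e).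
Proof.
move=> e0; apply: lipf_reg; rewrite ?invr_ge0 ?mulr_ge0 ?(ltW e0)//; exact: gfun01.
Qed.

End stopped_functionals.

(** * Piecewise linear cut-offs and first passage weights *)

Section ramp.
Variable R : realType.
Implicit Types (b r v : R).

Definition ramp b r v := clip 0 1 ((b + r - v) / r).

Lemma ramp01 b r v : 0 <= ramp b r v <= 1.
Proof. by rewrite /ramp clip_ge// clip_le. Qed.

Lemma ramp1 b r v : 0 < r -> v <= b -> ramp b r v = 1.
Proof. by move=> r0 vb; rewrite /ramp clip_hi// ler_pdivlMr// mul1r; lra. Qed.

Lemma ramp0 b r v : 0 < r -> b + r <= v -> ramp b r v = 0.
Proof. by move=> r0 vb; rewrite /ramp clip_lo// ler_pdivrMr// mul0r; lra. Qed.

Lemma lip_ramp b r v v' : 0 < r -> `|ramp b r v - ramp b r v'| <= r^-1 * `|v - v'|.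
Proof.
move=> r0; apply: le_trans (lip_clip _ _ _ _) _.
rewrite -mulrBl normrM mulrC [X in X * _]ger0_norm ?invr_ge0 ?(ltW r0)//.
by rewrite (_ : b + r - v - (b + r - v') = - (v - v')) ?normrN//; ring.
Qed.

(** A soft indicator that no step before j has passed the level; as a running minimum it has the
    Lipschitz constant r^-1 whatever j. *)
Fixpoint prod_ramp b r (s : nat -> R) (j : nat) : R :=
  if j is j'.+1 then Num.min (prod_ramp b r s j') (ramp b r (s j')) else 1.

Lemma prod_ramp01 b r s j : 0 <= prod_ramp b r s j <= 1.
Proof.
elim: j => [|j /andP[IH0 IH1]] /=; first by rewrite ler01 lexx.
by have /andP[h0 h1] := ramp01 b r (s j); rewrite le_min IH0 h0 ge_min IH1.
Qed.

Lemma prod_ramp0 b r s i j : (i < j)%N -> ramp b r (s i) = 0 -> prod_ramp b r s j = 0.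
Proof.
move=> + si; elim: j => // j IH; rewrite ltnS leq_eqVlt => /predU1P[<-|/IH E] /=.
  by rewrite si min_r//; have /andP[] := prod_ramp01 b r s i.
by rewrite E min_l//; have /andP[] := ramp01 b r (s j).
Qed.

Lemma prod_ramp_gt0 b r s i j : (i < j)%N -> 0 < r -> 0 < prod_ramp b r s j -> s i < b + r.
Proof.
move=> ij r0 h; rewrite ltNge; apply/negP => si.
by move: h; rewrite (prod_ramp0 ij) ?ltxx// ramp0.
Qed.

(* The soft first passage weight: positive only if step [j] is the first to
   enter the level region [b, b + r]. *)
Definition passage b r s j := prod_ramp b r s j - prod_ramp b r s j.+1.

Lemma passage_ge0 b r s j : 0 <= passage b r s j.
Proof. by rewrite subr_ge0 /= ge_min lexx. Qed.

Lemma passage_sum b r s k : \sum_(j < k) passage b r s j = 1 - prod_ramp b r s k.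
Proof.
elim: k => [|k IH]; first by rewrite big_ord0 subrr.
by rewrite big_ord_recr IH /passage /=; ring.
Qed.

Lemma passage_gt0 b r s j : 0 < r -> 0 < passage b r s j ->
  b < s j /\ forall i, (i < j)%N -> s i < b + r.
Proof.
move=> r0 h; split; last first.
  move=> i ij; apply: (prod_ramp_gt0 ij r0); apply: lt_le_trans h _.
  by rewrite /passage gerBl (andP (prod_ramp01 _ _ _ j.+1)).1.
rewrite ltNge; apply/negP => sb; move: h.
rewrite /passage /= ramp1// min_l ?subrr ?ltxx//.
by have /andP[] := prod_ramp01 b r s j.
Qed.

Lemma lipc_prod_ramp b r j m : 0 < r -> (j <= m)%N -> lipc m (fun s => prod_ramp b r s j).
Proof.
move=> r0 jm; exists r^-1, 1; split.
  by move=> s; have /andP[h0 h1] := prod_ramp01 b r s j; rewrite ger0_norm.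
move=> s s'; have ri : 0 <= r^-1 by rewrite invr_ge0 ltW.
elim: j jm => [|j IH] jm /=.
  by rewrite subrr normr0 mulr_ge0// sumr_ge0.
have min_lip (x y x' y' e : R) : `|x - x'| <= e -> `|y - y'| <= e ->
    `|Num.min x y - Num.min x' y'| <= e.
  by rewrite !ler_norml /Num.min => /andP[? ?] /andP[? ?]; case: ltP => ?; case: ltP => ?; lra.
apply: min_lip; first exact: IH (ltnW jm).
apply: le_trans (lip_ramp _ _ _ r0) _; apply: ler_wpM2l => //.
by rewrite (bigD1 (Ordinal jm))//= lerDl sumr_ge0.
Qed.

Lemma lipc_passage b r j m : 0 < r -> (j < m)%N -> lipc m (fun s => passage b r s j).
Proof.
move=> r0 jm.
have [L [M [b1 l1]]] := lipc_prod_ramp b r0 (ltnW jm).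
have [L' [M' [b2 l2]]] := lipc_prod_ramp b r0 jm.
exists (L + L'), (M + M'); split => [s|s s'].
  by apply: le_trans (ler_normB _ _) _; exact: lerD.
rewrite /passage mulrDl (_ : _ - _ - _ = (prod_ramp b r s j - prod_ramp b r s' j) -
  (prod_ramp b r s j.+1 - prod_ramp b r s' j.+1)); last by ring.
by apply: le_trans (ler_normB _ _) _; exact: lerD.
Qed.

End ramp.

Lemma le_limit (R : realType) (a b x y : R) (u v : nat -> R) :
  u @ \oo --> 0 -> v @ \oo --> 0 ->
  (forall n, a * (x - u n) <= b * (y + v n)) -> a * x <= b * y.
Proof.
move=> u0 v0 h; rewrite -[x]subr0 -[y]addr0.
apply: (@ler_cvg_to _ \oo _ _ (fun n => a * (x - u n)) (fun n => b * (y + v n))).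
- by apply: cvgM; [exact: cvg_cst|apply: cvgB => //; exact: cvg_cst].
- by apply: cvgM; [exact: cvg_cst|apply: cvgD => //; exact: cvg_cst].
- by near=> n; exact: h.
Unshelve. all: by end_near. Qed.

Lemma passage_sumS (R : realType) (b r : R) s k :
  \sum_(j < k) passage b r s j.+1 = 1 - prod_ramp b r s k.+1 - passage b r s 0.
Proof.
by rewrite -passage_sum big_ord_recl addrC addKr.
Qed.

Lemma passage_sumS_le (R : realType) (b r : R) s k :
  \sum_(j < k) passage b r s j.+1 <= 1.
Proof.
rewrite passage_sumS; have p0 := passage_ge0 b r s 0.
by have /andP[q0 _] := prod_ramp01 b r s k.+1; lra.
Qed.

(** * First passages of the radial process compared with those of the linear one *)

Section radial_comparison.
Context d (T : measurableType d) (R : realType) (P : probability T R).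
Variables (W : 'I_3 -> R -> T -> R).
Hypothesis bmW : nice_bm P W.
Implicit Types (x h r del A : R).

Lemma continuous_line x b : continuous (fun t => x + W ord0 t b).
Proof. by have [_ _ cW _ _] := bmW; move=> t; apply: cvgD; [exact: cvg_cst|exact: cW]. Qed.

Lemma measurable_line x t : measurable_fun setT (fun b => x + W ord0 t b).
Proof. by have [mW _ _ _ _] := bmW; apply: measurable_funD. Qed.

Let th x : R := Num.sg x.

Lemma measurable_sline x t : measurable_fun setT (fun b => th x * (x + W ord0 t b)).
Proof. by apply: measurable_funM => //; exact: measurable_line. Qed.

Lemma continuous_sline x b : continuous (fun t => th x * (x + W ord0 t b)).
Proof. by move=> t; apply: cvgM; [exact: cvg_cst|exact: continuous_line]. Qed.

Let bounded_comp (z : nat -> T -> R) m G del A : (forall j, measurable_fun setT (z j)) ->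
  lipc m G -> bounded_meas (fun b => G (fun j => clip del A (z j b))).
Proof.
move=> mz [L [M lG]].
have mc j : measurable_fun setT (fun b => clip del A (z j b)).
  apply: measurableT_comp => //.
  by apply: (@measurable_lip _ _ 1) => y y'; rewrite mul1r; exact: lip_clip.
exact (bounded_meas_lip_coord mc lG).
Qed.

(** Optional stopping by hand: the functional is distributed over the possible passage steps j, and
    [radial_linear] is used at each of them. The sign of x is allowed because x < 0 will serve for
    downward exits, in place of the symmetry of Brownian motion. *)
Lemma radial_stop_le x h del A k (G : nat -> (nat -> R) -> R) (X Y : T -> R) :
  0 < h -> 0 < del -> del <= A ->
  (forall j, lipc j.+2 (G j)) -> (forall j s, A <= s j.+1 -> G j s = 0) ->
  bounded_meas X -> bounded_meas Y ->
  (forall b, X b <= \sum_(j < k) G j (fun i => clip del A (radial W x (h * i%:R) b))) ->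
  (forall b, \sum_(j < k) th x * (x + W ord0 (h * j.+1%:R) b) *
     G j (fun i => clip del A `|x + W ord0 (h * i%:R) b|) <= Y b) ->
  `|x| * expect P X <= expect P Y.
Proof.
move=> h0 d0 dA lG GA bX bY hX hY.
have mabs i : measurable_fun setT (fun b => `|x + W ord0 (h * i%:R) b|).
  apply: (@measurableT_comp _ _ _ _ _ _ (@Num.norm R R)); last exact: measurable_line.
  by apply: continuous_measurable_fun; exact: norm_continuous.
have bG j : bounded_meas (fun b => G j (fun i => clip del A (radial W x (h * i%:R) b))).
  exact (bounded_comp (z := fun i => radial W x (h * i%:R)) del A (fun i => measurable_radial bmW x _) (lG j)).
have bl j : bounded_meas (fun b => (x + W ord0 (h * j.+1%:R) b) *
     G j (fun i => clip del A `|x + W ord0 (h * i%:R) b|)).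
  have [mG [M GM]] := bounded_comp (z := fun i b => `|x + W ord0 (h * i%:R) b|) del A mabs (lG j).
  split; first by apply: measurable_funM => //; exact: measurable_line.
  exists (A * M) => b; have [Ab|/ltW bA] := leP A `|x + W ord0 (h * j.+1%:R) b|.
    rewrite GA ?mulr0 ?normr0 ?clip_hi//.
    by rewrite mulr_ge0 ?(le_trans (ltW d0) dA)//; exact: le_trans (normr_ge0 _) (GM point).
  by rewrite normrM ler_pM.
have -> : `|x| = th x * x by rewrite -normrEsg.
apply: le_trans (_ : th x * x * \sum_(j < k) expect P
    (fun b => G j (fun i => clip del A (radial W x (h * i%:R) b))) <= _).
  rewrite -expect_sum//; apply: ler_wpM2l; first by rewrite -normrEsg.
  by apply: le_expect => //; exact: bounded_meas_sum.
rewrite -mulrA mulr_sumr.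
under eq_bigr => j _ do rewrite (radial_linear bmW x h0 d0 dA (lG j) (@GA j)).
rewrite -expect_sum// -expectZ; last exact: bounded_meas_sum.
apply: le_expect => //; first by apply: bounded_measZ; exact: bounded_meas_sum.
move=> b; apply: le_trans (hY b); rewrite mulr_sumr; apply: ler_sum => j _.
by rewrite mulrA.
Qed.

Section first_passage.
Variables (a e r : R) (Gam : (R -> R) -> R).
Hypothesis Gam01 : forall z, 0 <= Gam z <= 1.
Hypotheses (a0 : 0 < a) (r0 : 0 < r).

(** The passage is looked for in [b, b + r]. The cut-off in [G] excludes positions beyond b + 3 r =
    A, which gives the vanishing at A demanded by [radial_linear]; the weight of the linear process
    is then at most A, close to a. *)
Let b := a + 4 * r.
Let A := b + 3 * r.
Let stop h j (s : nat -> R) := seq_path h (fun i => s (minn i j)).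
Let G h j s := passage b r s j * (ramp (b + 2 * r) r (s j) * phif a Gam e r (stop h j s)).

Let lipc_stop K L Phi h j : lipf K L Phi -> lipc j.+1 (fun s => Phi (stop h j s)).
Proof.
move=> lP; have [_ L0 _ _] := lP; exists L, 1; split; first by move=> s; exact: lipf_norm lP.
move=> s s'; apply: (lipf_dist lP); first exact: sumr_ge0.
move=> t _; rewrite /stop /seq_path; set i := minn _ j.
have ij : (i < j.+1)%N by rewrite ltnS geq_minr.
by rewrite (bigD1 (Ordinal ij))//= lerDl sumr_ge0.
Qed.

Let lipc_G h j m : (j < m)%N -> lipc m (G h j).
Proof.
move=> jm; apply: lipc_mul; first exact: lipc_passage.
apply: lipc_mul.
  apply: (@lipc_comp _ _ (fun s => s j) (ramp (b + 2 * r) r) r^-1 1).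
  - by rewrite invr_ge0 ltW.
  - by move=> y; have /andP[y0 y1] := ramp01 (b + 2 * r) r y; rewrite ger0_norm.
  - by move=> y y'; exact: lip_ramp.
  - by move=> s s'; rewrite (bigD1 (Ordinal jm))//= lerDl sumr_ge0.
by apply: lipcW jm _; apply: lipc_stop; exact: lipf_phif.
Qed.

Let G_ge0 h j s : 0 <= G h j s.
Proof.
rewrite mulr_ge0 ?passage_ge0 ?mulr_ge0//; first by have /andP[] := ramp01 (b + 2 * r) r (s j).
by have [_ _ /(_ (stop h j s))/andP[]] := lipf_phif a Gam01 e r0.
Qed.

Let phif_ge0 r' z : 0 < r' -> 0 <= phif a Gam e r' z <= 1.
Proof. by move=> r'0; have [_ _ /(_ z)] := lipf_phif a Gam01 e r'0. Qed.

Let G_passage h j s : G h j s <= passage b r s j.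
Proof.
rewrite /G -[leRHS]mulr1; apply: ler_wpM2l; first exact: passage_ge0.
have /andP[h0 h1] := ramp01 (b + 2 * r) r (s j).
have /andP[h2 h3] := phif_ge0 (stop h j s) r0.
by rewrite -[leRHS]mulr1 ler_pM.
Qed.

Let truncn_mul h j : 0 < h -> Num.truncn (h * j%:R / h) = j.
Proof. by move=> h0; rewrite mulrAC mulfV ?gt_eqF// mul1r natrK. Qed.

Let grid_le h t : 0 < h -> 0 <= t -> h * (Num.truncn (t / h))%:R <= t.
Proof.
move=> h0 t0; rewrite mulrC -ler_pdivlMr//.
by have /andP[] := truncn_itv (divr_ge0 t0 (ltW h0)).
Qed.

Let grid_gt h t : 0 < h -> 0 <= t -> t - h * (Num.truncn (t / h))%:R <= h.
Proof.
move=> h0 t0; have /andP[_] := truncn_itv (divr_ge0 t0 (ltW h0)).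
by rewrite ltr_pdivrMr// -natr1 => ?; lra.
Qed.

(** A path that gets above a + 8 r has a grid value at least A, so the passage weights sum to 1. At
    a step of positive weight z satisfies [above] with margin 3 r, and passing to the stopped grid
    path costs r of it. *)
Let upper (z : R -> R) K h : 0 < h -> (forall t, 0 <= z t) -> z 0 <= a -> modulus z K h r ->
  (8 * r)^-1 <= K ->
  hfun a Gam e (8 * r) z <=
  \sum_(j < Num.truncn (K / h)) G h j.+1 (fun i => clip r A (z (h * i%:R))).
Proof.
move=> h0 z0 z0a mz rK; have a0' := a0; have r0' := r0; rewrite {1}/hfun.
have SG : 0 <= \sum_(j < Num.truncn (K / h)) G h j.+1 (fun i => clip r A (z (h * i%:R))).
  by apply: sumr_ge0 => j _; exact: G_ge0.
case: asboolP => [[t [/andP[t0 tr] zt zu]]|//].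
set s := fun i => clip r A (z (h * i%:R)); set k := Num.truncn (K / h).
pose J := Num.truncn (t / h).
have tK : t <= K by exact: le_trans tr rK.
have hJt : h * J%:R <= t by exact: grid_le.
have hJ0 j : 0 <= h * j%:R by rewrite mulr_ge0// ltW.
have zJ : a + 7 * r <= z (h * J%:R).
  have := mz (h * J%:R) t; rewrite hJ0 t0 tK (le_trans hJt tK) => /(_ isT isT).
  rewrite distrC ger0_norm ?subr_ge0// => /(_ (grid_gt h0 t0)).
  by rewrite ler_norml; lra.
have sJ : s J = A by rewrite /s clip_hi// /A /b; lra.
have Jk : (J <= k)%N.
  by rewrite /J /k le_truncn// ler_pM2r// invr_gt0.
(* The grid value at J lies beyond b + r, so no mass is left after it. *)
have pk : prod_ramp b r s k.+1 = 0.
  by apply: (@prod_ramp0 _ _ _ _ J); rewrite ?ltnS// sJ ramp0// /A; lra.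
have rA : r <= A by rewrite /A /b; lra.
have p0 : passage b r s 0 = 0.
  apply/eqP; rewrite eq_le passage_ge0 andbT leNgt; apply/negP => /(passage_gt0 r0)[+ _].
  rewrite /s mulr0 ltNge => /negP; apply.
  by rewrite /clip ge_min ge_max (_ : z 0 <= b) 1?(_ : r <= b)// /b; lra.
have := passage_sum b r s k.+1; rewrite pk subr0 big_ord_recl/= p0 add0r => psum.
rewrite -[leLHS]mul1r -[X in X * _]psum mulr_suml; apply: ler_sum => j _ /=.
rewrite /bump leq0n add1n.
have [pj|] := ltP 0 (passage b r s j.+1); last first.
  by move=> pj; apply: le_trans (G_ge0 _ _ _); rewrite mulr_le0_ge0// (andP (gfun01 _ Gam01 _ _ _)).1.
have [sj si] := passage_gt0 r0 pj.
have jJ : (j.+1 <= J)%N.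
  rewrite leqNgt; apply/negP => Jj; have := si J Jj; rewrite sJ /A; lra.
have hjt : h * j.+1%:R <= t.
  by apply: le_trans hJt; rewrite ler_pM2l// ler_nat.
have zi i : (i <= j.+1)%N -> 8 * r < z (h * i%:R).
  move=> ij; apply: zu; rewrite hJ0/= (le_trans _ hjt)// ler_pM2l// ler_nat//.
have sE i : (i <= j)%N -> s i = z (h * i%:R).
  move=> ij; have := si i ij; have := zi i (leqW ij).
  rewrite /s => zgt; have [zA _|/ltW Az] := leP (z (h * i%:R)) A.
    by rewrite clip_id// zA andbT; lra.
  by rewrite clip_hi// /A; lra.
have zjj : z (h * j.+1%:R) <= z (h * j%:R) + r.
  have := mz (h * j.+1%:R) (h * j%:R); rewrite !hJ0 (le_trans hjt tK) => /(_ isT).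
  have hjj : h * j%:R <= h * j.+1%:R by rewrite ler_pM2l// ler_nat.
  rewrite (le_trans hjj (le_trans hjt tK)) -mulrBr -natrB// subSnn mulr1 ger0_norm ?(ltW h0)//.
  by move=> /(_ isT (lexx _)); rewrite ler_norml; lra.
have zjb : z (h * j.+1%:R) < b + 2 * r.
  by have := si j (ltnSn j); rewrite sE//; lra.
have sEj : s j.+1 = z (h * j.+1%:R).
  by rewrite /s clip_id//; have := zi j.+1 (leqnn _); rewrite /A; lra.
have sEi i : (i <= j.+1)%N -> s i = z (h * i%:R).
  by rewrite leq_eqVlt => /predU1P[->//|]; rewrite ltnS; exact: sE.
rewrite /G (ramp1 (b := b + 2 * r))//; last by rewrite sEj; exact: ltW.
rewrite mul1r; apply: ler_wpM2l; first exact: passage_ge0.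
apply: le_trans (phif_ge _ Gam01 _ _ r0).
have le3 : gfun a Gam e (8 * r) z <= gfun a Gam e (r + r + r) z.
  by apply: gfun_le => //; lra.
apply: le_trans le3 _; apply: (gfun_shift Gam01 _ _ (ltW r0) (t := h * j.+1%:R)); first by lra.
  split.
  - rewrite hJ0/= (le_trans hjt)// (le_trans tr)// lef_pV2 ?posrE//; lra.
  - by rewrite -sEj; move: sj; rewrite /b; lra.
  - move=> u /andP[u0 uj]; have := zu u; rewrite u0 (le_trans uj hjt) => /(_ isT); lra.
move=> u /andP[u0 uj].
have uJ : (Num.truncn (u / h) <= j.+1)%N.
  by rewrite -(truncn_mul j.+1 h0) le_truncn// ler_pM2r ?invr_gt0.
rewrite /stop /seq_path (minn_idPl uJ) sEi//.
have := mz u (h * (Num.truncn (u / h))%:R).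
rewrite hJ0 u0 (le_trans uj (le_trans hjt tK)) (le_trans (grid_le h0 u0)) ?(le_trans uj (le_trans hjt tK))//.
by rewrite ger0_norm ?subr_ge0 ?grid_le// => /(_ isT isT (grid_gt h0 u0)).
Qed.

(** When the factor [phif] is positive, the grid values of |z| stay away from 0 up to the passage;
    the modulus of continuity then keeps z itself away from 0, and |z| = z since z 0 > 0. The factor
    z is at most A because [G] vanishes once |z| reaches A. *)
Let lower (z : R -> R) K h j : 0 < h -> continuous z -> 0 < z 0 -> modulus z K h (r / 4) ->
  r^-1 <= K ->
  z (h * j%:R) * G h j (fun i => clip r A `|z (h * i%:R)|) <=
  A * (passage b r (fun i => clip r A `|z (h * i%:R)|) j * hfun a Gam e (r / 2) z).
Proof.
move=> h0 cz z00 mz rK; have a0' := a0; have r0' := r0; set s := fun i => clip r A `|z (h * i%:R)|.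
have A0 : 0 < A by rewrite /A /b; lra.
have rA : r <= A by rewrite /A /b; lra.
have hj0 i : 0 <= h * i%:R by rewrite mulr_ge0// ltW.
have RHS0 : 0 <= A * (passage b r s j * hfun a Gam e (r / 2) z).
  by rewrite mulr_ge0 ?(ltW A0)// mulr_ge0 ?passage_ge0// (andP (hfun01 _ Gam01 _ _ _)).1.
have [zj|/ltW zj] := leP (z (h * j%:R)) 0.
  by apply: le_trans RHS0; rewrite mulr_le0_ge0.
have [Az|zA] := leP A `|z (h * j%:R)|.
  rewrite /G (ramp0 (v := s j)) ?mul0r ?mulr0// /s clip_hi// /A; lra.
have zjA : z (h * j%:R) <= A by apply: ltW; apply: le_lt_trans (ler_norm _) zA.
apply: ler_pM => //.
rewrite /G; have [pj|] := ltP 0 (passage b r s j); last first.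
  by move=> pj; rewrite (_ : passage b r s j = 0) ?mul0r//; apply/eqP; rewrite eq_le pj passage_ge0.
apply: ler_wpM2l; first exact: passage_ge0.
have [_ si] := passage_gt0 r0 pj.
have /andP[c0 c1] := ramp01 (b + 2 * r) r (s j).
have /andP[f0 f1] := phif_ge0 (stop h j s) r0.
apply: le_trans (_ : phif a Gam e r (stop h j s) <= _); first by rewrite ler_piMl.
apply: le_trans (phif_le a Gam01 e _ r0) _; rewrite [leLHS]/hfun.
case: asboolP => [[t [/andP[t0 tr] st su]]|_]; last by have /andP[] := hfun01 a Gam01 e (r / 2) z.
(* The stopped path is constant from h j on, so the time of [above] can be taken at most h j. *)
pose t' := Num.min t (h * j%:R).
have t't : t' <= t by rewrite ge_min lexx.
have t'0 : 0 <= t' by rewrite le_min t0 hj0.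
have t'K : t' <= K by rewrite (le_trans t't)// (le_trans tr).
have stt' : stop h j s t' = stop h j s t.
  rewrite /t'; case: (leP t (h * j%:R)) => // /ltW jt.
  rewrite /stop /seq_path truncn_mul// minnn; congr s; apply/esym/minn_idPr.
  by rewrite -(truncn_mul j h0) le_truncn// ler_pM2r ?invr_gt0.
have trj u : 0 <= u <= t' -> (Num.truncn (u / h) <= j)%N.
  move=> /andP[u0 ut]; rewrite -(truncn_mul j h0) le_truncn// ler_pM2r ?invr_gt0//.
  by rewrite (le_trans ut)// ge_min lexx orbT.
have stopE u : 0 <= u <= t' -> stop h j s u = `|z (h * (Num.truncn (u / h))%:R)|.
  move=> ut; have tj := trj u ut; have /andP[u0 ut'] := ut.
  have := su u; rewrite u0 (le_trans ut' t't) => /(_ isT).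
  rewrite /stop /seq_path (minn_idPl tj); set i := Num.truncn _.
  have siA : s i < A.
    move: tj; rewrite -/i leq_eqVlt => /predU1P[->|/si]; last by rewrite /A; lra.
    by rewrite /s /clip gt_min gt_max zA/=; apply/orP; left; rewrite /A /b; lra.
  rewrite /s => rs; have [zi|/ltW zi] := leP `|z (h * i%:R)| A; last first.
    by move: siA; rewrite /s clip_hi// ltxx.
  rewrite clip_id// zi andbT; rewrite leNgt; apply/negP => zir.
  by move: rs; rewrite clip_lo ?ltxx// ltW.
have zdist u : 0 <= u <= t' -> `| `|z (h * (Num.truncn (u / h))%:R)| - `|z u| | <= r / 4.
  move=> /andP[u0 ut]; apply: le_trans (ler_dist_dist _ _) _.
  rewrite distrC; apply: mz; rewrite ?u0 ?(le_trans ut t'K)// ?hj0 ?(le_trans (grid_le h0 u0) (le_trans ut t'K))//.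
  by rewrite ger0_norm ?subr_ge0 ?grid_le//; exact: grid_gt.
have zne u : 0 <= u <= t' -> r / 2 < `|z u|.
  move=> ut; have := zdist u ut; rewrite -stopE//; have /andP[u0 ut'] := ut.
  have := su u; rewrite u0 (le_trans ut' t't) => /(_ isT).
  by rewrite ler_norml; lra.
(* A change of sign would produce a zero, which [zne] excludes. *)
have zpos u : 0 <= u <= t' -> 0 < z u.
  move=> /andP[u0 ut]; rewrite ltNge; apply/negP => zu0.
  have [v + zv] : exists2 v, v \in `[0, u] & z v = 0.
    apply: (@IVT R z 0 u 0) => //; first by apply: continuous_subspaceT.
    by rewrite ge_min zu0 orbT/= le_max ltW.
  rewrite in_itv/= => /andP[v0 vu]; have := zne v; rewrite v0 (le_trans vu ut) zv normr0.
  by move=> /(_ isT); lra.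
rewrite [X in gfun _ _ _ X](_ : r = r / 2 + r / 2); last by field.
have r20 : 0 < r / 2 by rewrite divr_gt0.
apply: (gfun_shift Gam01 _ r20 (ltW r20) (t := t')).
  split; rewrite -splitr.
  - by rewrite t'0 (le_trans t't).
  - by rewrite stt'.
  - by move=> u /andP[u0 ut]; apply: su; rewrite u0 (le_trans ut t't).
move=> u ut; rewrite stopE// -[X in _ - X](gtr0_norm (zpos u ut)).
apply: le_trans (zdist u ut) _; lra.
Qed.

(** [upper] on the radial side and [lower] on the linear side feed [radial_stop_le]. Rough paths are
    charged to [oscf] on both sides, and the charges vanish as the mesh tends to 0. *)
Lemma radial_first_passage x : x != 0 -> `|x| <= a ->
  `|x| * expect P (fun b => phif a Gam e (8 * r) (fun t => radial W x t b)) <=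
  A * expect P (fun b => phif a Gam e (r / 4) (fun t => Num.sg x * (x + W ord0 t b))).
Proof.
move=> x0 xa; have a0' := a0; have r0' := r0; pose K := r^-1; have K0 : 0 <= K by rewrite invr_ge0 ltW.
have r40 : 0 < r / 4 by rewrite divr_gt0.
have r80 : 0 < 8 * r by rewrite mulr_gt0.
have ri0 : 0 <= r^-1 by rewrite invr_ge0 ltW.
have r4i0 : 0 <= (r / 4)^-1 by rewrite invr_ge0 ltW.
have e1 : 1 <= r^-1 * r by rewrite mulVf ?gt_eqF.
have e2 : 1 <= (r / 4)^-1 * (r / 4) by rewrite mulVf ?gt_eqF.
have A0 : 0 < A by rewrite /A /b; lra.
have [_ W0 _ _ _] := bmW.
pose o1 n b' := oscf K r^-1 n.+1%:R^-1 (fun t => radial W x t b').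
pose o2 n b' := oscf K (r / 4)^-1 n.+1%:R^-1 (fun t => th x * (x + W ord0 t b')).
have lo1 n : lipf K (2 * r^-1) (oscf K r^-1 n.+1%:R^-1) by exact: lipf_oscf.
have lo2 n : lipf K (2 * (r / 4)^-1) (oscf K (r / 4)^-1 n.+1%:R^-1).
  by apply: lipf_oscf; rewrite // invr_ge0 ltW.
have mr := measurable_radial bmW x.
have cr b' : continuous (fun t => radial W x t b') by exact: (continuous_radial bmW).
have cs b' : continuous (fun t => th x * (x + W ord0 t b')) by exact: continuous_sline.
have bo1 n := bounded_meas_lipf P mr cr (lo1 n).
have bo2 n := bounded_meas_lipf P (measurable_sline x) cs (lo2 n).
have b1 := bounded_meas_lipf P mr cr (lipf_phif a Gam01 e r80).
have b2 := bounded_meas_lipf P (measurable_sline x) cs (lipf_phif a Gam01 e r40).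
have key n : `|x| * expect P (fun b' => phif a Gam e (8 * r) (fun t => radial W x t b') - o1 n b') <=
  expect P (fun b' => A * (phif a Gam e (r / 4) (fun t => th x * (x + W ord0 t b')) + o2 n b')).
  have h0 : 0 < n.+1%:R^-1 :> R by rewrite invr_gt0.
  apply: (@radial_stop_le x n.+1%:R^-1 r A (Num.truncn (K / n.+1%:R^-1)) (fun j => G n.+1%:R^-1 j.+1)) => //.
  - by rewrite /A /b; lra.
  - by move=> j; exact: lipc_G.
  - by move=> j s As; rewrite /G (ramp0 (v := s j.+1)) ?mul0r ?mulr0//; move: As; rewrite /A; lra.
  - exact (bounded_measB b1 (bo1 n)).
  - exact (bounded_measZ A (bounded_measD b2 (bo2 n))).
  - move=> b'; have [m|o] := @oscf_cases _ K r^-1 n.+1%:R^-1 ri0 (fun t => radial W x t b') r e1.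
      apply: le_trans (_ : phif a Gam e (8 * r) (fun t => radial W x t b') <= _).
        by rewrite gerBl; have [_ _ /(_ (fun t => radial W x t b'))/andP[]] := lo1 n.
      apply: le_trans (phif_le a Gam01 e _ r80) _; apply: upper => //.
      + by move=> t; exact: sqrtr_ge0.
      + rewrite /radial !big_ord_recl big_ord0 !W0 eqxx !mulr0 !addr0 !expr0n/= mulr1 !addr0.
        by rewrite sqrtr_sqr.
      + by rewrite lef_pV2 ?posrE//; lra.
    rewrite /o1 o; apply: le_trans (_ : 0 <= _); last exact: sumr_ge0.
    by rewrite subr_le0; have /andP[] := phif_ge0 (fun t => radial W x t b') r80.
  - move=> b'; set z := fun t => th x * (x + W ord0 t b').
    have absz t : `|x + W ord0 t b'| = `|z t|.
      by rewrite /z normrM normr_sg x0 mul1r.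
    have sE : (fun i => clip r A `|x + W ord0 (n.+1%:R^-1 * i%:R) b'|) =
       (fun i => clip r A `|z (n.+1%:R^-1 * i%:R)|) by apply/funext => i; rewrite absz.
    under eq_bigr => j _ do rewrite sE -/(z (n.+1%:R^-1 * j.+1%:R)).
    have psum : \sum_(j < Num.truncn (K / n.+1%:R^-1)) passage b r (fun i => clip r A `|z (n.+1%:R^-1 * i%:R)|) j.+1 <= 1.
      exact: passage_sumS_le.
    have p2 := phif_ge0 z r40; have /andP[v20 v21] : 0 <= o2 n b' <= 1.
      by have [_ _ /(_ z)] := lo2 n.
    have [m|o] := @oscf_cases _ K (r / 4)^-1 n.+1%:R^-1 r4i0 z (r / 4) e2.
      apply: le_trans (_ : A * hfun a Gam e (r / 2) z <= _).
        have cz : continuous z by exact: cs.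
        have z00 : 0 < z 0 by rewrite /z W0 addr0 /th -normrEsg normr_gt0.
        apply: le_trans (_ : \sum_(j < Num.truncn (K / n.+1%:R^-1)) A * (passage b r
          (fun i => clip r A `|z (n.+1%:R^-1 * i%:R)|) j.+1 * hfun a Gam e (r / 2) z) <= _).
          by apply: ler_sum => j _; exact: (lower j.+1 h0 cz z00 m (lexx _)).
        rewrite -mulr_sumr -mulr_suml; apply: ler_wpM2l; first exact: ltW.
        by rewrite ler_piMl// (andP (hfun01 _ Gam01 _ _ _)).1.
      apply: ler_wpM2l; first exact: ltW.
      rewrite [X in hfun _ _ _ X](_ : r / 2 = r / 4 + r / 4); last by field.
      by apply: le_trans (phif_ge a Gam01 e _ r40) _; rewrite lerDl.
    apply: le_trans (_ : A * 1 <= _); last first.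
      by apply: ler_wpM2l; [exact: ltW|rewrite /o2 o; have /andP[] := p2; lra].
    apply: le_trans (ler_wpM2l (ltW A0) psum); rewrite mulr_sumr; apply: ler_sum => j _.
    have [zj|/ltW zj] := leP (z (n.+1%:R^-1 * j.+1%:R)) 0.
      apply: le_trans (_ : 0 <= _); first by rewrite mulr_le0_ge0.
      by rewrite mulr_ge0 ?passage_ge0// ltW.
    have [Az|zA] := leP A `|z (n.+1%:R^-1 * j.+1%:R)|.
      rewrite /G (ramp0 (v := clip r A _)) ?mul0r ?mulr0 ?mulr_ge0 ?passage_ge0 ?(ltW A0)//.
      by rewrite clip_hi// /A; lra.
    by apply: ler_pM => //; apply: ltW; apply: le_lt_trans (ler_norm _) zA.
have c1 := expect_oscf_cvg0 P mr cr K0 ri0.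
have c2 := expect_oscf_cvg0 P (measurable_sline x) cs K0 r4i0.
have {}key n : `|x| * (expect P (fun b' => phif a Gam e (8 * r) (fun t => radial W x t b')) - expect P (o1 n)) <=
  A * (expect P (fun b' => phif a Gam e (r / 4) (fun t => th x * (x + W ord0 t b'))) + expect P (o2 n)).
  have := key n; rewrite (expectZ P A (bounded_measD b2 (bo2 n))).
  by rewrite (expectB P b1 (bo1 n)) (expectD P b2 (bo2 n)).
exact: (le_limit c1 c2 key).
Qed.

End first_passage.

(** The threshold exceeds del by del / 4 so that the regularization of this radius still detects a
    descent to del. *)
Definition dips K del (z : R -> R) : R :=
  `[< exists2 t, 0 <= t <= K & z t <= del + del / 4 >]%:R.

Definition lowf K del := reg K (del / 4)^-1 (dips K del).

Section low.
Variables (K del : R).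
Hypotheses (K0 : 0 <= K) (del0 : 0 < del).

Let d40 : 0 < del / 4. Proof. by rewrite divr_gt0. Qed.

Let dips01 z : 0 <= dips K del z <= 1.
Proof. by rewrite /dips; case: asboolP; rewrite ?lexx ?ler01. Qed.

Lemma lipf_lowf : lipf K (del / 4)^-1 (lowf K del).
Proof. by apply: lipf_reg => //; rewrite invr_ge0 ltW// divr_gt0. Qed.

Lemma lowf_hit z t : 0 <= t <= K -> z t <= del -> 1 <= lowf K del z.
Proof.
move=> tK zt; apply: (@reg_ge _ _ _ _ _ _ _ (del / 4)) => //.
- by rewrite invr_ge0 ltW.
- by rewrite mulVf// gt_eqF.
- move=> z' zz'; rewrite /dips asboolT//; exists t => //.
  by have := zz' t tK; rewrite ler_norml => /andP[]; lra.
Qed.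

(** Optional stopping at the downward passage of 2 del: there the linear process has absolute value
    below 2 del, and the passage weights sum to at most 1. *)
Lemma radial_low x : 2 * del <= `|x| ->
  `|x| * expect P (fun b => lowf K del (fun t => radial W x t b)) <= 2 * del.
Proof.
move=> xd; have d0' := del0; have d40' := d40.
(* A descent of s is an ascent of - s; the soft region is [3 del / 2, 2 del]. *)
pose G (j : nat) (s : nat -> R) := passage (- (2 * del)) (del / 2) (fun i => - s i) j.+1.
have d20 : 0 < del / 2 by rewrite divr_gt0.
have dd : del <= 2 * del by lra.
have [_ W0 _ _ _] := bmW.
have lG j : lipc j.+2 (G j).
  have [L [M [bG l]]] := lipc_passage (- (2 * del)) d20 (ltnSn j.+1).
  exists L, M; split => [s|s s']; first exact: bG.
  apply: le_trans (l _ _) _; rewrite le_eqVlt; apply/orP; left; apply/eqP; congr (_ * _).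
  by apply: eq_bigr => i _; rewrite -opprD normrN.
have Gpos j s : 0 < G j s -> s j.+1 < 2 * del.
  by move=> /(passage_gt0 d20)[+ _]; lra.
have GA j s : 2 * del <= s j.+1 -> G j s = 0.
  move=> sA; apply/eqP; rewrite eq_le passage_ge0 andbT leNgt; apply/negP => /Gpos.
  by rewrite ltNge sA.
have mr := measurable_radial bmW x.
have cr b' : continuous (fun t => radial W x t b') by exact: (continuous_radial bmW).
have bl := bounded_meas_lipf P mr cr lipf_lowf.
have c0 : 0 <= (del / 4)^-1 by rewrite invr_ge0 ltW.
have lo n : lipf K (2 * (del / 4)^-1) (oscf K (del / 4)^-1 n.+1%:R^-1) by exact: lipf_oscf.
have bo n := bounded_meas_lipf P mr cr (lo n).
have key n : `|x| * expect P (fun b => lowf K del (fun t => radial W x t b) -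
    oscf K (del / 4)^-1 n.+1%:R^-1 (fun t => radial W x t b)) <= expect P (fun=> 2 * del).
  set h : R := n.+1%:R^-1; have h0 : 0 < h by rewrite invr_gt0.
  apply: (@radial_stop_le x h del (2 * del) (Num.truncn (K / h)) G) => //.
  - exact (bounded_measB bl (bo n)).
  - exact: bounded_meas_cst.
  - move=> b; set z := fun t => radial W x t b.
    have S0 : 0 <= \sum_(j < Num.truncn (K / h)) G j (fun i => clip del (2 * del) (z (h * i%:R))).
      by apply: sumr_ge0 => j _; exact: passage_ge0.
    have e1 : 1 <= (del / 4)^-1 * (del / 4) by rewrite mulVf// gt_eqF.
    have [m|o1] := @oscf_cases _ K (del / 4)^-1 h c0 z (del / 4) e1; last first.
      apply: le_trans S0; rewrite o1 subr_le0.
      by have [_ _ /(_ z)/andP[]] := lipf_lowf.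
    apply: le_trans (_ : lowf K del z <= _).
      by rewrite gerBl; have [_ _ /(_ z)/andP[]] := lo n.
    apply: le_trans (reg_le K c0 dips01 z) _; rewrite /dips.
    case: asboolP => [[t /andP[t0 tK] zt]|//].
    pose J := Num.truncn (t / h).
    have zJ : z (h * J%:R) <= del + del / 2.
      have /andP[t1 t2] := truncn_itv (divr_ge0 t0 (ltW h0)).
      have hJt : h * J%:R <= t by rewrite mulrC -ler_pdivlMr.
      have hJ0 : 0 <= h * J%:R by rewrite mulr_ge0// ltW.
      have tJ : t - h * J%:R <= h.
        by move: t2; rewrite ltr_pdivrMr// -natr1 -/J; lra.
      have := m (h * J%:R) t; rewrite hJ0 t0 tK (le_trans hJt tK) => /(_ isT isT).
      by rewrite distrC ger0_norm ?subr_ge0// => /(_ tJ); rewrite ler_norml; lra.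
    rewrite passage_sumS (@prod_ramp0 _ _ _ _ J).
    + have -> : passage (- (2 * del)) (del / 2) (fun i => - clip del (2 * del) (z (h * i%:R))) 0 = 0.
        apply/eqP; rewrite eq_le passage_ge0 andbT leNgt; apply/negP => /(passage_gt0 d20)[+ _].
        rewrite mulr0 clip_hi ?ltxx//.
        rewrite /z /radial !big_ord_recl big_ord0 !W0 eqxx !mulr0 !addr0 !expr0n/= mulr1 !addr0.
        by rewrite sqrtr_sqr.
      by rewrite !subr0.
    + by rewrite ltnS /J le_truncn// ler_pM2r// invr_gt0.
    + rewrite ramp0// (_ : - (2 * del) + del / 2 = - (del + del / 2)); last by field.
      by rewrite lerN2 /clip ge_min ge_max zJ/= (_ : del <= _)//; lra.
  - move=> b; set s := fun i => clip del _ _.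
    apply: le_trans (_ : \sum_(j < Num.truncn (K / h)) 2 * del *
       passage (- (2 * del)) (del / 2) (fun i => - s i) j.+1 <= _).
      apply: ler_sum => j _; have [Gp|G0] := ltP 0 (G j s); last first.
        have -> : G j s = 0 by apply/eqP; rewrite eq_le G0 passage_ge0.
        by rewrite mulr0 mulr_ge0 ?passage_ge0 ?mulr_ge0// ltW.
      apply: ler_wpM2r; first exact: passage_ge0.
      apply: le_trans (ler_norm _) _; rewrite normrM normr_sg.
      have sd := Gpos _ _ Gp.
      have -> : `|x + W ord0 (h * j.+1%:R) b| <= 2 * del -> (x != 0)%:R * `|x + W ord0 (h * j.+1%:R) b| <= 2 * del.
        by case: eqP => _; rewrite ?mul0r ?mul1r//; lra.
      by [].
      rewrite leNgt; apply/negP => /ltW xl; by move: sd; rewrite /s clip_hi// ltxx.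
    rewrite -mulr_sumr -[leRHS]mulr1; apply: ler_wpM2l; first by rewrite mulr_ge0// ltW.
    exact: passage_sumS_le.
have c1 := expect_oscf_cvg0 P mr cr K0 c0.
have {}key n : `|x| * (expect P (fun b => lowf K del (fun t => radial W x t b)) -
    expect P (fun b => oscf K (del / 4)^-1 n.+1%:R^-1 (fun t => radial W x t b))) <= 2 * del.
  by have := key n; rewrite (expectB P bl (bo n)) expect_cst.
have {}key n := le_trans (key n) (_ : _ <= 1 * (2 * del + 0)).
by rewrite -[leRHS]mul1r; apply: (le_limit c1 (cvg_cst 0)) => n; apply: key; rewrite addr0 mul1r.
Qed.

End low.

Lemma expect_gexp_line l x t : 0 <= l -> 0 < t ->
  expect P (fun b => gexp l (x + W ord0 t b)) =
  (Num.sqrt (1 + l * t))^-1 * gexp (l / (1 + l * t)) x.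
Proof.
move=> l0 t0; have [_ W0 _ _ _] := bmW.
have lH : lipc 1 (fun s => gexp l (walk_from x s 1)) by exact: lipc_gexp_walk.
have -> : expect P (fun b => gexp l (x + W ord0 t b)) =
    expect P (fun b => (fun s => gexp l (walk_from x s 1))
      (fun j => W ord0 (t * j.+1%:R) b - W ord0 (t * j%:R) b)).
  apply: eq_expect => b /=.
  by rewrite (walk_telescope x (fun j => W ord0 (t * j%:R) b)) mulr0 mulr1 W0 subr0.
rewrite (bm_grid bmW ord0 0 t0 lH)/=.
have -> : expect (gauss_law (Num.sqrt t)) (fun y => gexp l (walk_from x (upd (fun=> 0) 0 y) 1)) =
    expect (gauss_law (Num.sqrt t)) (fun y => gexp l (x + y)).
  by apply: eq_expect => y; rewrite /walk_from big_ord1 /upd eqxx.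
by rewrite expect_gexp ?sqrtr_gt0// /gfactor /grate sqr_sqrtr ?(ltW t0).
Qed.

Lemma expect_gexp_line_le l x t : 0 <= l -> 0 < t ->
  expect P (fun b => gexp l (x + W ord0 t b)) <= (Num.sqrt (1 + l * t))^-1.
Proof.
move=> l0 t0; rewrite expect_gexp_line// ler_piMr ?invr_ge0 ?sqrtr_ge0// gexp_le1// divr_ge0//.
by rewrite addr_ge0// mulr_ge0// ltW.
Qed.

(** [Phi] may exceed [phif] only on paths that come down to del, or are below a + 1 at time t. The
    first are bounded by [radial_low]. For the second the first coordinate lies in
    [- (a + 1), a + 1], and a Markov inequality with the exponential [gexp 1] bounds them by order
    (1 + t)^(-1/2). *)
Lemma bessel_lower_bound (a e r del t x : R) (Gam Phi : (R -> R) -> R) K L :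
  (forall z, 0 <= Gam z <= 1) -> lipf K L Phi ->
  (forall z, Phi z <= gfun a Gam e (16 * r) z) ->
  0 < a -> 0 < r -> x != 0 -> `|x| <= a -> 16 * r <= del -> 2 * del <= `|x| ->
  16 * r <= 1 -> 0 < t -> t <= (16 * r)^-1 ->
  `|x| * (expect P (fun b => Phi (fun t => radial W x t b)) -
     (gexp 1 (a + 1))^-1 * (Num.sqrt (1 + t))^-1) - 2 * del <=
  (a + 7 * r) * expect P (fun b => phif a Gam e (r / 4) (fun t => Num.sg x * (x + W ord0 t b))).
Proof.
move=> Gam01 lP PhiG a0 r0 x0 xa rd dx r1 t0 tr.
have r160 : 0 < 16 * r by rewrite mulr_gt0.
have r80 : 0 < 8 * r by rewrite mulr_gt0.
have d0 : 0 < del by exact: lt_le_trans rd.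
have mr := measurable_radial bmW x.
have cr b' : continuous (fun t => radial W x t b') by exact: (continuous_radial bmW).
have bP := bounded_meas_lipf P mr cr lP.
have bl := bounded_meas_lipf P mr cr (lipf_lowf (ltW t0) d0).
have bf := bounded_meas_lipf P mr cr (lipf_phif a Gam01 e r80).
have bg : bounded_meas (fun b => gexp 1 (x + W ord0 t b)).
  split; last by exists 1 => b; rewrite ger0_norm ?gexp_le1// gexp_ge0.
  apply: measurableT_comp; last exact: measurable_line.
  by apply: (@measurable_lip _ _ ((1 + 2) / 2)) => y y'; exact: lip_gexp.
have ga0 : 0 < gexp 1 (a + 1) by exact: expR_gt0.
have le b : Phi (fun t => radial W x t b) <= (phif a Gam e (8 * r) (fun t => radial W x t b) +
    lowf t del (fun t => radial W x t b)) + (gexp 1 (a + 1))^-1 * gexp 1 (x + W ord0 t b).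
  set z := fun t => radial W x t b.
  have p0 : 0 <= phif a Gam e (8 * r) z by have [_ _ /(_ z)/andP[]] := lipf_phif a Gam01 e r80.
  have l0 : 0 <= lowf t del z by have [_ _ /(_ z)/andP[]] := lipf_lowf (ltW t0) d0.
  have g0 : 0 <= (gexp 1 (a + 1))^-1 * gexp 1 (x + W ord0 t b).
    by rewrite mulr_ge0 ?invr_ge0 ?gexp_ge0.
  have P1 : Phi z <= 1 by have [_ _ /(_ z)/andP[]] := lP.
  have [[u ut zu]|low] := pselect (exists2 u, 0 <= u <= t & z u <= del).
    by have := lowf_hit d0 ut zu; lra.
  have [zt|zt] := leP (a + 1) (z t); last first.
    have lt : `|x + W ord0 t b| <= a + 1.
      apply: le_trans (ltW zt); rewrite /z /radial -sqrtr_sqr ler_wsqrtr//.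
      rewrite big_ord_recl eqxx mulr1 lerDl; apply: sumr_ge0 => i _; exact: sqr_ge0.
    suff : 1 <= (gexp 1 (a + 1))^-1 * gexp 1 (x + W ord0 t b) by lra.
    rewrite mulrC ler_pdivlMr// mul1r ler_expR.
    have : `|x + W ord0 t b| ^+ 2 <= (a + 1) ^+ 2 by rewrite lerXn2r ?nnegrE// addr_ge0// ltW.
    by rewrite real_normK ?num_real//; lra.
  suff : Phi z <= phif a Gam e (8 * r) z by lra.
  apply: le_trans (PhiG z) _; apply: le_trans (phif_ge a Gam01 e z r80).
  rewrite (_ : 8 * r + 8 * r = 16 * r); last by ring.
  rewrite /hfun asboolT//; exists t; split.
  - by rewrite (ltW t0) tr.
  - by apply: le_trans zt; rewrite lerD2l.
  - move=> u ut; rewrite ltNge; apply/negP => zu; apply: low; exists u => //.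
    exact: le_trans zu rd.
have bfl := bounded_measD bf bl.
have := le_expect P bP (bounded_measD bfl (bounded_measZ (gexp 1 (a + 1))^-1 bg)) le.
rewrite (expectD P bfl (bounded_measZ _ bg)) (expectD P bf bl) (expectZ P _ bg) => E1.
have := expect_gexp_line_le x ler01 t0; rewrite mul1r => E2.
have E3 := radial_low (ltW t0) d0 dx.
have E4 := radial_first_passage e Gam01 a0 r0 x0 xa.
apply: le_trans (le_trans _ E4) _; last by rewrite (_ : a + 7 * r = a + 4 * r + 3 * r)//; ring.
have E5 : (gexp 1 (a + 1))^-1 * expect P (fun b => gexp 1 (x + W ord0 t b)) <=
  (gexp 1 (a + 1))^-1 * (Num.sqrt (1 + t))^-1 by apply: ler_wpM2l; rewrite ?invr_ge0 ?(ltW ga0).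
rewrite lerBlDr; apply: le_trans (lerD (lexx _) E3); rewrite -mulrDr.
by apply: ler_wpM2l => //; lra.
Qed.

End radial_comparison.

(** * Random walks *)

Notation dint := (g_sigma_algebraType (@setT (set int))).

Lemma measurable_dint (A : set dint) : measurable A.
Proof. exact: sub_sigma_algebra. Qed.

Lemma measurable_fun_dint d (T : measurableType d) (f : dint -> T) : measurable_fun setT f.
Proof. by move=> _ B _; exact: measurable_dint. Qed.

Lemma esumZl (R : realType) (I : choiceType) (c : R) (a : I -> \bar R) :
  0 < c -> (forall i, (0 <= a i)%E) ->
  (\esum_(i in [set: I]) (c%:E * a i) = c%:E * \esum_(i in [set: I]) a i)%E.
Proof.
move=> c0 a0; have half (c' : R) (a' : I -> \bar R) : 0 < c' -> (forall i, (0 <= a' i)%E) ->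
    (\esum_(i in [set: I]) (c'%:E * a' i) <= c'%:E * \esum_(i in [set: I]) a' i)%E.
  move=> c'0 a'0; apply: ge_ereal_sup => _ [X [fX XT] <-].
  rewrite -ge0_mule_fsumr//; apply: lee_wpmul2l; first by rewrite lee_fin ltW.
  by apply: esum_ge; exists X.
apply/eqP; rewrite eq_le half//=.
rewrite [X in (_ * X <= _)%E](_ : _ = \esum_(i in [set: I]) (c^-1%:E * (c%:E * a i))%E); last first.
  by apply: eq_esum => i _; rewrite muleA -EFinM mulVf ?gt_eqF// mul1e.
apply: le_trans (lee_wpmul2l _ (half _ _ _ _)) _.
- by rewrite lee_fin ltW.
- by rewrite invr_gt0.
- by move=> i; rewrite mule_ge0// lee_fin ltW.
- by rewrite muleA -EFinM mulfV ?gt_eqF// mul1e.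
Qed.

Record kernel (R : realType) := Kernel {
  ker :> int -> int -> R;
  ker_ge0 : forall x y, 0 <= ker x y;
  ker_sum : forall x, \esum_(y in [set: int]) (ker x y)%:E = 1%E }.

Section step_law.
Variables (R : realType) (p : kernel R) (x : int).

Definition step_law (A : set dint) : \bar R := \esum_(y in A) (p x y)%:E.

Let step0 : step_law set0 = 0%E. Proof. exact: esum_set0. Qed.

Let step_ge0 A : (0 <= step_law A)%E.
Proof. by apply: esum_ge0 => y _; rewrite lee_fin ker_ge0. Qed.

Let step_sigma : semi_sigma_additive step_law.
Proof.
move=> F mF tF mUF; rewrite /step_law esum_bigcupT//; last by move=> y; rewrite lee_fin ker_ge0.
rewrite -nneseries_esumT; last by move=> n; exact: step_ge0.
by apply: is_cvg_ereal_nneg_natsum => n _; exact: step_ge0.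
Qed.

HB.instance Definition _ := isMeasure.Build _ dint R step_law step0 step_ge0 step_sigma.

Let step1 : step_law setT = 1%E. Proof. exact: ker_sum. Qed.

HB.instance Definition _ := Measure_isProbability.Build _ dint R step_law step1.

Lemma integral_step_law (f : int -> R) : (forall y, 0 <= f y) ->
  (\int[step_law]_y (f y)%:E = \esum_(y in [set: int]) (p x y * f y)%:E)%E.
Proof.
move=> f0; rewrite (@integral_countable_partition _ dint R step_law int (fun y => [set y])).
- apply: eq_esum => y _; rewrite (eq_integral (fun=> (f y)%:E)); last first.
    by move=> z; rewrite inE/= => ->.
  rewrite integral_cst; last exact: measurable_dint.
  rewrite EFinM muleC; congr (_ * _)%E.
  by apply: esum_set1; rewrite lee_fin ker_ge0.
- by move=> y; exact: measurable_dint.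
- by apply/trivIsetP => i j _ _ ij; apply/seteqP; split => // z /= [-> /eqP]; rewrite (negbTE ij).
- by apply/seteqP; split => // y _; exists y.
- exact: measurable_fun_dint.
- by move=> y; rewrite lee_fin.
Qed.

End step_law.

Section chain.
Variables (R : realType) (p : kernel R).
Implicit Types (x y z : int) (h : int -> R) (f g : (nat -> int) -> R).

Definition bnd (S : Type) (f : S -> R) := exists M, forall s, `|f s| <= M.

Definition av x h := expect (step_law p x) (h : dint -> R).

Lemma bnd_meas h : bnd h -> bounded_meas (h : dint -> R).
Proof. by move=> bh; split => //; exact: measurable_fun_dint. Qed.

Lemma avD x h h' : bnd h -> bnd h' -> av x (fun y => h y + h' y) = av x h + av x h'.
Proof. by move=> b b'; apply: (expectD _ (bnd_meas b) (bnd_meas b')). Qed.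

Lemma avZ x c h : bnd h -> av x (fun y => c * h y) = c * av x h.
Proof. by move=> b; apply: (expectZ _ _ (bnd_meas b)). Qed.

Lemma av_cst x c : av x (fun=> c) = c.
Proof. exact: expect_cst. Qed.

Lemma le_av x h h' : bnd h -> bnd h' -> (forall y, h y <= h' y) -> av x h <= av x h'.
Proof. by move=> b b'; apply: (le_expect _ (bnd_meas b) (bnd_meas b')). Qed.

Lemma av_ge0 x h : (forall y, 0 <= h y) -> 0 <= av x h.
Proof. by move=> h0; exact: expect_ge0. Qed.

Lemma bnd01 (S : Type) (f : S -> R) : (forall s, 0 <= f s <= 1) -> bnd f.
Proof. by move=> h; exists 1 => s; have /andP[h0 h1] := h s; rewrite ger0_norm. Qed.

Lemma av01 x h : (forall y, 0 <= h y <= 1) -> 0 <= av x h <= 1.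
Proof.
move=> h01; rewrite av_ge0/=; last by move=> y; have /andP[] := h01 y.
rewrite -(av_cst x 1); apply: le_av => [||y]; [exact: bnd01|by exists 1 => _; rewrite normr1|].
by have /andP[] := h01 y.
Qed.

Lemma bndD (S : Type) (f g : S -> R) : bnd f -> bnd g -> bnd (fun s => f s + g s).
Proof.
move=> [M fM] [N gN]; exists (M + N) => s.
by apply: le_trans (ler_normD _ _) _; exact: lerD.
Qed.

Lemma bndZ (S : Type) c (f : S -> R) : bnd f -> bnd (fun s => c * f s).
Proof. by move=> [M fM]; exists (`|c| * M) => s; rewrite normrM ler_wpM2l. Qed.

Lemma bnd_cst (S : Type) (c : R) : bnd (fun _ : S => c).
Proof. by exists `|c|. Qed.

Lemma avE x h : (forall y, 0 <= h y) -> bnd h ->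
  (av x h)%:E = (\esum_(y in [set: int]) (p x y * h y)%:E)%E.
Proof. by move=> h0 bh; rewrite -integral_step_law// (expectE _ (bnd_meas bh)). Qed.

Definition scons x (s : nat -> int) : nat -> int := fun i => if i is i'.+1 then s i' else x.

(* [Ew k x f]: expectation of [f] for the walk started at [x] and frozen after
   [k] steps. *)
Fixpoint Ew k x f : R :=
  if k is k'.+1 then av x (fun z => Ew k' z (fun s => f (scons x s))) else f (fun=> x).

Lemma Ew_bound k x f M : (forall s, `|f s| <= M) -> `|Ew k x f| <= M.
Proof.
elim: k x f => [|k IH] x f fM /=; first exact: fM.
have b z : `|Ew k z (fun s => f (scons x s))| <= M by exact: IH.
have bb : bnd (fun z => Ew k z (fun s => f (scons x s))) by exists M.
have b' z : - M <= Ew k z (fun s => f (scons x s)) <= M by rewrite -ler_norml.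
rewrite ler_norml; apply/andP; split; [rewrite -[leLHS](av_cst x)|rewrite -[leRHS](av_cst x)].
all: by (apply: le_av => //; [exact: bnd_cst|move=> z; case/andP: (b' z)]).
Qed.

Lemma bnd_Ew k f : bnd f -> bnd (fun x => Ew k x f).
Proof. by move=> [M fM]; exists M => x; exact: Ew_bound. Qed.

Lemma bnd_Ew_scons k x f : bnd f -> bnd (fun z => Ew k z (fun s => f (scons x s))).
Proof. by move=> [M fM]; apply: bnd_Ew; exists M. Qed.

Let bnd_scons x f : bnd f -> bnd (fun s => f (scons x s)).
Proof. by move=> [M fM]; exists M. Qed.

Lemma EwD k x f g : bnd f -> bnd g -> Ew k x (fun s => f s + g s) = Ew k x f + Ew k x g.
Proof.
elim: k x f g => [//|k IH] x f g bf bg /=.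
rewrite -avD//; try exact: bnd_Ew_scons.
by congr av; apply/funext => z; rewrite IH//; exact: bnd_scons.
Qed.

Lemma EwZ k x c f : bnd f -> Ew k x (fun s => c * f s) = c * Ew k x f.
Proof.
elim: k x f => [//|k IH] x f bf /=.
rewrite -avZ; last exact: bnd_Ew_scons.
by congr av; apply/funext => z; rewrite IH//; exact: bnd_scons.
Qed.

Lemma le_Ew k x f g : bnd f -> bnd g -> (forall s, s 0%N = x -> f s <= g s) ->
  Ew k x f <= Ew k x g.
Proof.
elim: k x f g => [|k IH] x f g bf bg fg /=; first exact: fg.
apply: le_av => [||z]; try exact: bnd_Ew_scons.
by apply: IH => [||s _]; [exact: bnd_scons|exact: bnd_scons|exact: fg].
Qed.

Lemma Ew_cst k x c : Ew k x (fun=> c) = c.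
Proof. by elim: k x => [//|k IH] x /=; rewrite (_ : (fun z => _) = fun=> c) ?av_cst//; apply/funext. Qed.

Lemma eq_Ew k x f g : (forall s, s 0%N = x -> f s = g s) -> Ew k x f = Ew k x g.
Proof.
elim: k x f g => [|k IH] x f g fg /=; first exact: fg.
by congr av; apply/funext => z; apply: IH => s _; exact: fg.
Qed.

Lemma Ew_ge0 k x f : (forall s, 0 <= f s) -> 0 <= Ew k x f.
Proof. by elim: k x f => [|k IH] x f f0 /=; [exact: f0|apply: av_ge0 => z; exact: IH]. Qed.

Lemma Ew01 k x f : (forall s, 0 <= f s <= 1) -> 0 <= Ew k x f <= 1.
Proof.
move=> f01; rewrite Ew_ge0/= => [|s]; last by have /andP[] := f01 s.
rewrite -(Ew_cst k x 1); apply: le_Ew; [exact: bnd01|exact: bnd_cst|].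
by move=> s _; have /andP[] := f01 s.
Qed.

Definition depends k f := forall s s', (forall i, (i <= k)%N -> s i = s' i) -> f s = f s'.

Lemma depends_scons k x f : depends k.+1 f -> depends k (fun s => f (scons x s)).
Proof. by move=> df s s' ss'; apply: df => -[//|i] /= ik; exact: ss'. Qed.

Lemma dependsW k l f : (k <= l)%N -> depends k f -> depends l f.
Proof. by move=> kl df s s' ss'; apply: df => i ik; apply: ss'; exact: leq_trans kl. Qed.

Lemma Ew_depends k l x f : (k <= l)%N -> depends k f -> Ew l x f = Ew k x f.
Proof.
elim: k l x f => [|k IH] [|l] x f //.
  move=> _ df; rewrite -[RHS](Ew_cst l.+1 x); apply: eq_Ew => s s0.
  by apply: df => -[|//] _.
move=> kl df /=; congr av; apply/funext => z; apply: IH => //; exact: depends_scons.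
Qed.

Definition splice j (s s' : nat -> int) : nat -> int :=
  fun i => if (i < j)%N then s i else s' (i - j)%N.

Lemma Ew_markov j l x f :
  Ew (j + l) x f = Ew j x (fun s => Ew l (s j) (fun s' => f (splice j s s'))).
Proof.
elim: j x f => [|j IH] x f.
  by rewrite add0n /=; congr Ew; apply/funext => s; congr f; apply/funext => i; rewrite /splice subn0.
rewrite addSn /=; congr av; apply/funext => z; rewrite IH; apply: eq_Ew => s _ /=.
by congr Ew; apply/funext => s'; congr f; apply/funext => -[|i]; rewrite /splice.
Qed.

End chain.

Section hitting.
Variables (R : realType) (p : kernel R).
Implicit Types (x y z : int) (h v : int -> R) (f : (nat -> int) -> R) (A B : pred int).

Definition shift i (s : nat -> int) : nat -> int := fun l => s (i + l)%N.

Lemma av_pred1 x z : av p x (fun y => (y == z)%:R) = p x z.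
Proof.
apply: EFin_inj; rewrite avE; [|by move=> y|by apply: bnd01 => y; case: (_ == _); rewrite ?lexx ?ler01].
rewrite (esumID [set z])/=; last by move=> y _; rewrite lee_fin mulr_ge0 ?ker_ge0.
rewrite setTI esum_set1 ?lee_fin ?mulr_ge0 ?ker_ge0// eqxx mulr1.
rewrite esum1 ?adde0// => y [_ /= /eqP/negbTE ->]; by rewrite mulr0.
Qed.

Lemma av_fsum x n (c : 'I_n -> R) (g : 'I_n -> int) :
  av p x (fun y => \sum_(i < n) c i * (y == g i)%:R) = \sum_(i < n) c i * p x (g i).
Proof.
have b (i : 'I_n) : bounded_meas ((fun y => c i * (y == g i)%:R) : dint -> R).
  by apply: bnd_meas; apply: bndZ; apply: bnd01 => y; case: (_ == _); rewrite ?lexx ?ler01.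
rewrite /av expect_sum//; apply: eq_bigr => i _.
rewrite -av_pred1; apply: avZ; apply: bnd01 => y; case: (_ == _); rewrite ?lexx ?ler01//.
Qed.

Lemma av_cvg x (hn : nat -> int -> R) h M : (forall n y, `|hn n y| <= M) ->
  (forall y, hn n y @[n --> \oo] --> h y) -> av p x (hn n) @[n --> \oo] --> av p x h.
Proof.
move=> b c; have [_] := @expect_cvg _ dint _ (step_law p x) (hn : nat -> dint -> R) (h : dint -> R) M
  (fun n => bnd_meas (ex_intro _ M (b n))) b c.
exact.
Qed.

(** A point of both sets counts as a success: A is tested before B. *)
Fixpoint reach A B k (s : nat -> int) : bool :=
  A (s 0%N) || (if k is k'.+1 then ~~ B (s 0%N) && reach A B k' (shift 1 s) else false).

Fixpoint hitn A B k x : R :=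
  if A x then 1 else
  if k is k'.+1 then (if B x then 0 else av p x (hitn A B k')) else 0.

Lemma Ew_reach A B k x : Ew p k x (fun s => (reach A B k s)%:R) = hitn A B k x.
Proof.
elim: k x => [|k IH] x /=; first by case: (A x).
case: (A x) => /=; first by rewrite -[RHS](Ew_cst p k.+1 x).
case: (B x) => /=; first by rewrite -[RHS](Ew_cst p k.+1 x).
by congr av; apply/funext => z; rewrite -IH.
Qed.

Lemma hitn01 A B k x : 0 <= hitn A B k x <= 1.
Proof.
elim: k x => [|k IH] x /=; first by case: (A x); rewrite ?lexx ?ler01.
by case: (A x); case: (B x); rewrite ?lexx ?ler01//; exact: av01.
Qed.

Lemma hitn_nondecreasing A B x : nondecreasing_seq (fun k => hitn A B k x).
Proof.
apply/nondecreasing_seqP => k; elim: k x => [|k IH] x /=.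
  by case: (A x) => //; case: (B x) => //; have /andP[] := av01 p x (hitn01 A B 0).
case: (A x) => //; case: (B x) => //.
by apply: le_av => [||y]; [exact: bnd01 (hitn01 _ _ _)|exact: bnd01 (hitn01 _ _ k.+1)|exact: IH].
Qed.

Definition hit A B x : R := limn (fun k => hitn A B k x).

Lemma hit_cvg A B x : hitn A B k x @[k --> \oo] --> hit A B x.
Proof.
apply: nondecreasing_is_cvgn; first exact: hitn_nondecreasing.
by exists 1 => _ [k _ <-]; have /andP[] := hitn01 A B k x.
Qed.

Lemma hitn_le_hit A B k x : hitn A B k x <= hit A B x.
Proof.
by apply: (nondecreasing_cvgn_le (hitn_nondecreasing A B x)); apply/cvg_ex; eexists; exact: hit_cvg.
Qed.

Lemma hit_le A B x c : (forall k, hitn A B k x <= c) -> hit A B x <= c.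
Proof.
by move=> h; apply: limr_le; [apply/cvg_ex; eexists; exact: hit_cvg|apply: nearW].
Qed.

Lemma hit01 A B x : 0 <= hit A B x <= 1.
Proof.
rewrite (le_trans _ (hitn_le_hit A B 0 x)) ?hit_le// => [k|].
  by have /andP[] := hitn01 A B k x.
by have /andP[] := hitn01 A B 0 x.
Qed.

Lemma hit_A A B x : A x -> hit A B x = 1.
Proof.
move=> Ax; apply/eqP; rewrite eq_le (andP (hit01 A B x)).2/=.
by apply: le_trans (hitn_le_hit A B 0 x); rewrite /= Ax.
Qed.

Lemma hit_B A B x : ~~ A x -> B x -> hit A B x = 0.
Proof.
move=> Ax Bx; apply/eqP; rewrite eq_le (andP (hit01 A B x)).1 andbT.
by apply: hit_le => -[|k] /=; rewrite (negbTE Ax) ?Bx.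
Qed.

Lemma hit_harmonic A B x : ~~ A x -> ~~ B x -> hit A B x = av p x (hit A B).
Proof.
move=> Ax Bx.
have h1 : hitn A B k.+1 x @[k --> \oo] --> hit A B x.
  by have := @hit_cvg A B x; rewrite -(cvg_shiftS (fun k => hitn A B k x)).
have h2 : hitn A B k.+1 x @[k --> \oo] --> av p x (hit A B).
  rewrite /= (negbTE Ax) (negbTE Bx); apply: (@av_cvg _ _ _ 1) => [k y|y]; last exact: hit_cvg.
  by have /andP[h0 h1'] := hitn01 A B k y; rewrite ger0_norm.
exact: (cvg_unique _ h1 h2).
Qed.

Lemma hit_le_super A B v x : bnd v -> (forall y, 0 <= v y) -> (forall y, A y -> 1 <= v y) ->
  (forall y, ~~ A y -> ~~ B y -> av p y v <= v y) -> hit A B x <= v x.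
Proof.
move=> bv v0 vA vs; apply: hit_le => k; elim: k x => [|k IH] x /=.
  by case: ifP => [/vA|].
case: ifPn => [/vA//|Ax]; case: ifPn => // Bx.
apply: le_trans (vs _ Ax Bx); apply: le_av => //.
exact: bnd01 (hitn01 A B k).
Qed.

Fixpoint first_hit y J f (s : nat -> int) : R :=
  if s 0%N == y then f s else if J is J'.+1 then first_hit y J' f (shift 1 s) else 0.

Lemma first_hit_cases y J f s :
  (exists2 i, (i <= J)%N & s i = y /\ first_hit y J f s = f (shift i s)) \/
  (forall i, (i <= J)%N -> s i != y) /\ first_hit y J f s = 0.
Proof.
elim: J s => [|J IH] s /=.
  case: eqP => sy; [left; exists 0%N => //; split => //; congr f; apply/funext => l //|right].
  by split => // -[|//] _; apply/eqP.
case: eqP => [sy|/eqP sy]; first by left; exists 0%N => //.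
have [[i iJ [si ->]]|[no ->]] := IH (shift 1 s).
  by left; exists i.+1 => //.
by right; split => // -[//|i] iJ; exact: no.
Qed.

Lemma bnd_first_hit y J f : (forall s, 0 <= f s <= 1) -> forall s, 0 <= first_hit y J f s <= 1.
Proof.
move=> f01; elim: J => [|J IH] s /=; case: ifP => // _; by rewrite lexx ler01.
Qed.

(** Strong Markov property at the first visit to y; it transfers expectations from the starting
    point x to y. *)
Lemma Ew_first_hit y J K f x : (forall s, 0 <= f s <= 1) -> depends K f ->
  Ew p (J + K) x (first_hit y J f) <= Ew p K y f.
Proof.
move=> f01 df; have E0 : 0 <= Ew p K y f by have /andP[] := Ew01 p K y f01.
elim: J x => [|J IH] x.
  rewrite add0n; case: (eqVneq x y) => [->|xy].
    by rewrite (@eq_Ew _ _ _ _ _ (f))// => s /= ->; rewrite eqxx.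
  rewrite (@eq_Ew _ _ _ _ _ (fun=> 0)) ?Ew_cst// => s /= ->; by rewrite (negbTE xy).
case: (eqVneq x y) => [->|xy].
  rewrite (@eq_Ew _ _ _ _ _ (f)); last by move=> s /= ->; rewrite eqxx.
  by rewrite (Ew_depends _ _ (leq_addl _ _) df).
rewrite addSn /= -[leRHS](av_cst p x).
have bf := bnd_first_hit y J f01.
apply: le_av => [||z]; last 1 first.
- rewrite (negbTE xy); apply: le_trans (IH z); rewrite le_eqVlt; apply/orP; left; apply/eqP.
  exact: eq_Ew.
- rewrite (negbTE xy); apply: bnd_Ew; exact: bnd01 (bf).
- exact: bnd_cst.
Qed.

Section exit.
Variable In : pred int.

(* Exit from [In], at times at least 1: [exitn phi T x] is the expectation of
   [phi] at the exit point on the event that the exit occurs within [T] steps. *)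
Fixpoint exitn (phi : int -> R) T x : R :=
  if T is T'.+1 then av p x (fun y => if In y then exitn phi T' y else phi y) else 0.

Definition killed h x := av p x (fun y => if In y then h y else 0).

Fixpoint exit_path (Go : pred int) T f (s : nat -> int) : R :=
  if T is T'.+1 then
    if Go (s 1%N) then f (shift 1 s)
    else if In (s 1%N) then exit_path Go T' f (shift 1 s) else 0
  else 0.

Lemma exit_path_cases (Go : pred int) T f s :
  (exists i, [/\ (0 < i <= T)%N, Go (s i), forall j, (0 < j < i)%N -> In (s j) /\ ~~ Go (s j)
     & exit_path Go T f s = f (shift i s)]) \/ exit_path Go T f s = 0.
Proof.
elim: T s => [|T IH] s /=; first by right.
case: ifP => [G1|/negbT G1].
  by left; exists 1%N; split => // j /andP[j0]; rewrite ltnS leqn0 => /eqP j1; rewrite j1 in j0.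
case: ifP => [I1|]; last by right.
have [[i [/andP[i0 iT] Gi Ii ->]]|->] := IH (shift 1 s); last by right.
left; exists i.+1; split => // -[//|j] /= ; rewrite ltnS => ji.
by case: j ji => [|j] ji; [split|apply: Ii].
Qed.

Lemma exit_path01 (Go : pred int) T f : (forall s, 0 <= f s <= 1) -> forall s, 0 <= exit_path Go T f s <= 1.
Proof.
move=> f01; elim: T => [|T IH] s /=; first by rewrite lexx ler01.
by case: ifP => // _; case: ifP => // _; rewrite lexx ler01.
Qed.

Lemma depends_exit_path (Go : pred int) T K f : depends K f -> depends (T + K) (exit_path Go T f).
Proof.
move=> df; elim: T => [|T IH] s s' ss' //=.
have s1 : s 1%N = s' 1%N by apply: ss'.
rewrite -s1; case: ifP => _; first by apply: df => i iK; apply: ss'; rewrite addSn ltnS (leq_trans iK)// leq_addl.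
by case: ifP => // _; apply: IH => i iK; apply: ss'; rewrite addSn ltnS.
Qed.

Lemma exitn_bnd phi T x M : 0 <= M -> (forall y, 0 <= phi y <= M) -> 0 <= exitn phi T x <= M.
Proof.
move=> M0 h; elim: T x => [|T IH] x /=; first by rewrite lexx.
have b y : 0 <= (if In y then exitn phi T y else phi y) <= M by case: ifP.
rewrite av_ge0/=; last by move=> y; have /andP[] := b y.
rewrite -[leRHS](av_cst p x); apply: le_av => [||y]; last by have /andP[] := b y.
  by exists M => y; have /andP[b0 b1] := b y; rewrite ger0_norm.
exact: bnd_cst.
Qed.

Let bnd_if phi T M : 0 <= M -> (forall y, 0 <= phi y <= M) ->
  bnd (fun y => if In y then exitn phi T y else phi y).
Proof.
move=> M0 h; exists M => y; case: ifP => _.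
  by have /andP[b0 b1] := exitn_bnd T y M0 h; rewrite ger0_norm.
by have /andP[b0 b1] := h y; rewrite ger0_norm.
Qed.

Lemma Ew_exit_path_ge (Go : pred int) T K f c x : 0 <= c -> (forall s, 0 <= f s <= 1) -> depends K f ->
  (forall y, Go y -> ~~ In y) ->
  (forall y, Go y -> c <= Ew p K y f) ->
  c * exitn (fun y => (Go y)%:R) T x <= Ew p (T + K) x (exit_path Go T f).
Proof.
move=> c0 f01 df GI cf; elim: T x => [|T IH] x; first by rewrite mulr0; apply: Ew_ge0.
have g01 y : 0 <= ((Go y)%:R : R) <= 1 by case: (Go y); rewrite ?lexx ?ler01.
rewrite addSn /= -avZ; last exact: bnd_if ler01 g01.
apply: le_av => [||z].
- apply: bndZ; exact: bnd_if ler01 g01.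
- apply: bnd_Ew; apply: bnd01 => s; case: ifP => // _; case: ifP => // _; last by rewrite lexx ler01.
  exact: (exit_path01 Go T f01).
have [Gz|nGz] := boolP (Go z).
  rewrite (negbTE (GI _ Gz)) mulr1 (@eq_Ew _ _ _ _ _ (f)) => [|s /= ->]; last by rewrite Gz.
  by rewrite (Ew_depends _ _ (leq_addl _ _) df) cf.
case: ifP => [Iz|nIz]; last by rewrite mulr0; apply: Ew_ge0 => s; case: ifP => // _; [have /andP[] := f01 (shift 1 (scons x s))|case: ifP => // _; have /andP[] := exit_path01 Go T f01 (shift 1 (scons x s))].
apply: le_trans (IH z) _; rewrite le_eqVlt; apply/orP; left; apply/eqP.
by apply: eq_Ew => s /= ->; rewrite (negbTE nGz) Iz.
Qed.

Lemma le_exitn phi psi T x M : 0 <= M -> (forall y, 0 <= phi y <= M) -> (forall y, 0 <= psi y <= M) ->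
  (forall y, ~~ In y -> phi y <= psi y) -> exitn phi T x <= exitn psi T x.
Proof.
move=> M0 h1 h2 le; elim: T x => [//|T IH] x /=.
by apply: le_av => [||y]; [exact: bnd_if M0 h1|exact: bnd_if M0 h2|case: ifPn => // /le].
Qed.

Lemma exitnD phi psi T x M : 0 <= M -> (forall y, 0 <= phi y <= M) -> (forall y, 0 <= psi y <= M) ->
  exitn (fun y => phi y + psi y) T x = exitn phi T x + exitn psi T x.
Proof.
move=> M0 h1 h2; elim: T x => [|T IH] x /=; first by rewrite addr0.
rewrite -avD; [|exact: bnd_if M0 h1|exact: bnd_if M0 h2].
by congr av; apply/funext => y; case: ifP.
Qed.

Lemma exitnZ phi c T x M : 0 <= M -> (forall y, 0 <= phi y <= M) ->
  exitn (fun y => c * phi y) T x = c * exitn phi T x.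
Proof.
move=> M0 h1; elim: T x => [|T IH] x /=; first by rewrite mulr0.
rewrite -avZ; last exact: bnd_if M0 h1.
by congr av; apply/funext => y; case: ifP.
Qed.

Definition survive T := iter T killed (fun=> 1).

Lemma survive01 T x : 0 <= survive T x <= 1.
Proof.
elim: T x => [|T IH] x /=; first by rewrite ler01 lexx.
by apply: av01 => y; case: ifP => // _; rewrite lexx ler01.
Qed.

(** An exit at step j + 1 is j steps inside followed by one jump out; exits are thus controlled by
    occupation times. *)
Lemma exitn_sum phi T x : (forall y, 0 <= phi y <= 1) ->
  exitn phi T x = \sum_(j < T) iter j killed (fun z => av p z (fun y => if In y then 0 else phi y)) x.
Proof.
move=> h; pose b z := av p z (fun y => if In y then 0 else phi y).
have b01 z : 0 <= b z <= 1 by apply: av01 => y; case: ifP => // _; rewrite lexx ler01.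
have k01 j z : 0 <= iter j killed b z <= 1.
  elim: j z => [|j IH] z //=; apply: av01 => y; case: ifP => // _; by rewrite lexx ler01.
elim: T x => [|T IH] x; first by rewrite big_ord0.
rewrite big_ord_recl /=.
transitivity (av p x (fun y => (if In y then 0 else phi y) +
   \sum_(j < T) (if In y then iter j killed b y else 0))).
  by congr av; apply/funext => y; case: ifP => _; rewrite ?add0r ?IH// big1 ?addr0.
rewrite avD.
- congr (_ + _); rewrite /av expect_sum//.
  move=> j; apply: bnd_meas; apply: bnd01 => y; case: ifP => _ //; by rewrite lexx ler01.
- by apply: bnd01 => y; case: ifP => // _; rewrite lexx ler01.
- elim: (index_enum _) => [|j s IHs].
    by under eq_fun do rewrite big_nil; exact: bnd_cst.
  under eq_fun do rewrite big_cons; apply: bndD => //.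
  by apply: bnd01 => y; case: ifP => _ //; rewrite lexx ler01.
Qed.

Lemma survive_nincr T x : survive T.+1 x <= survive T x.
Proof.
elim: T x => [|T IH] x /=; first by have /andP[] := survive01 1 x.
apply: le_av => [||y].
- by apply: bnd01 => y; case: ifP => _; [exact: (survive01 T.+1)|rewrite lexx ler01].
- by apply: bnd01 => y; case: ifP => _; [exact: (survive01 T)|rewrite lexx ler01].
- by case: ifP => // _; exact: IH.
Qed.

Lemma survive_mul T x : T%:R * survive T x <= \sum_(j < T) survive j x.
Proof.
have mono i j : (i <= j)%N -> survive j x <= survive i x.
  move=> /subnKC <-; elim: (j - i)%N => [|l IH]; first by rewrite addn0.
  by rewrite addnS; apply: le_trans (survive_nincr _ _) IH.
rewrite mulr_natl (_ : _ *+ T = \sum_(j < T) survive T x); last by rewrite sumr_const card_ord.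
by apply: ler_sum => j _; exact/mono/ltnW.
Qed.

End exit.
End hitting.

(** * Networks and exit estimates *)

Section finite_network.
Variables (R : realType) (N : nat) (c : nat -> nat -> R).
Hypotheses (c_sym : forall i j, c i j = c j i) (c_ge0 : forall i j, 0 <= c i j).
Implicit Types (f g : nat -> R).

Definition energy f g : R :=
  \sum_(i < N.+1) \sum_(j < N.+1) c i j * (f i - f j) * (g i - g j).

Definition flow f i : R := \sum_(j < N.+1) c i j * (f i - f j).

Lemma flow_sum0 f : \sum_(i < N.+1) flow f i = 0.
Proof.
have E : \sum_(i < N.+1) flow f i = - \sum_(i < N.+1) flow f i.
  rewrite [in LHS]/flow [LHS]exchange_big/= -sumrN; apply: eq_bigr => i _.
  rewrite /flow -sumrN; apply: eq_bigr => j _; rewrite (c_sym j i); ring.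
lra.
Qed.

Lemma energy_flow f g : energy f g = 2 * \sum_(i < N.+1) g i * flow f i.
Proof.
rewrite /energy.
have -> : \sum_(i < N.+1) \sum_(j < N.+1) c i j * (f i - f j) * (g i - g j) =
   \sum_(i < N.+1) \sum_(j < N.+1) g i * (c i j * (f i - f j)) +
   \sum_(i < N.+1) \sum_(j < N.+1) g j * (c j i * (f j - f i)).
  rewrite -big_split; apply: eq_bigr => i _; rewrite -big_split; apply: eq_bigr => j _ /=.
  by rewrite (c_sym j i); ring.
rewrite [X in _ + X]exchange_big/= -mulr2n mulr_natl.
by congr (_ *+ _); apply: eq_bigr => i _; rewrite mulr_sumr.
Qed.

Lemma energyC f g : energy f g = energy g f.
Proof. by apply: eq_bigr => i _; apply: eq_bigr => j _; ring. Qed.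

Lemma energy_ge0 f : 0 <= energy f f.
Proof.
by apply: sumr_ge0 => i _; apply: sumr_ge0 => j _; rewrite -mulrA mulr_ge0 ?c_ge0// -expr2 sqr_ge0.
Qed.

Lemma energyB f g : energy (fun i => g i - f i) (fun i => g i - f i) =
  energy g g - 2 * energy f g + energy f f.
Proof.
rewrite /energy mulr_sumr -sumrB -big_split; apply: eq_bigr => i _ /=.
rewrite mulr_sumr -sumrB -big_split; apply: eq_bigr => j _ /=; ring.
Qed.

(** Where the flow of f is not 0 the two functions agree, hence energy(f, g) = energy(f, f), and the
    energy of g - f is nonnegative. *)
Lemma dirichlet_principle f g : (forall i, (i <= N)%N -> g i != f i -> flow f i = 0) ->
  energy f f <= energy g g.
Proof.
move=> h; have E : energy f g = energy f f.
  rewrite !energy_flow; congr (_ * _); apply: eq_bigr => i _.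
  have iN : (i <= N)%N by rewrite -ltnS ltn_ord.
  by case: (eqVneq (g i) (f i)) => [->//|/(h _ iN) ->]; rewrite !mulr0.
by have := energy_ge0 (fun i => g i - f i); rewrite energyB E; lra.
Qed.

Variable kap : R.
Hypotheses (kap0 : 0 < kap) (c_nn : forall i, (i < N)%N -> kap <= c i i.+1).

(** The factor 2 appears because [energy] counts every edge in both directions. *)
Lemma energy_nn f : 2 * kap * \sum_(i < N) (f i.+1 - f i) ^+ 2 <= energy f f.
Proof.
have row1 : \sum_(i < N) c i i.+1 * (f i - f i.+1) * (f i - f i.+1) +
   \sum_(i < N) c i.+1 i * (f i.+1 - f i) * (f i.+1 - f i) <= energy f f.
  pose G (i j : nat) := c i j * (f i - f j) * (f i - f j).
  have G0 i j : 0 <= G i j by rewrite /G -mulrA mulr_ge0 ?c_ge0// -expr2 sqr_ge0.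
  rewrite /energy -/(G _ _).
  have up : \sum_(i < N.+1) \sum_(j < N.+1 | (i < j)%N) G i j >= \sum_(i < N) G i i.+1.
    rewrite [leRHS]big_ord_recr/=; apply: ler_wpDr; first by apply: sumr_ge0.
    apply: ler_sum => i _; have iN : (i.+1 < N.+1)%N by rewrite ltnS.
    by rewrite (bigD1 (Ordinal iN))//= lerDl sumr_ge0.
  have dn : \sum_(i < N.+1) \sum_(j < N.+1 | ~~ (i < j)%N) G i j >= \sum_(i < N) G i.+1 i.
    rewrite [leRHS]big_ord_recl/=; apply: ler_wpDl; first by apply: sumr_ge0.
    apply: ler_sum => i _; have iN : (i < N.+1)%N by rewrite ltnS ltnW.
    rewrite (bigD1 (Ordinal iN))//=; last by rewrite -leqNgt /bump leq0n add1n.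
    by rewrite lerDl sumr_ge0.
  apply: le_trans (lerD up dn) _; rewrite -big_split le_eqVlt; apply/orP; left; apply/eqP.
  by apply: eq_bigr => i _; rewrite [RHS](bigID (fun j : 'I__ => (i < j)%N)).
apply: le_trans row1; rewrite -big_split mulr_sumr; apply: ler_sum => i _ /=.
have -> : c i i.+1 * (f i - f i.+1) * (f i - f i.+1) + c i.+1 i * (f i.+1 - f i) * (f i.+1 - f i) =
    2 * c i i.+1 * (f i.+1 - f i) ^+ 2 by rewrite (c_sym i.+1 i); ring.
by apply: ler_wpM2r; [exact: sqr_ge0|rewrite ler_pM2l// c_nn].
Qed.

Lemma sqr_sum_le n (a : nat -> R) : (\sum_(i < n) a i) ^+ 2 <= n%:R * \sum_(i < n) a i ^+ 2.
Proof.
elim: n => [|[|n] IH]; first by rewrite !big_ord0 mul0r expr0n.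
  by rewrite !big_ord1 mul1r.
rewrite big_ord_recr [in leRHS]big_ord_recr/=.
set s := \sum_(i < n.+1) a i in IH *; set q := \sum_(i < n.+1) a i ^+ 2 in IH *.
rewrite -(natr1 n.+1); set k : R := n.+1%:R in IH *; have k0 : 0 < k by rewrite ltr0n.
have : 0 <= k * (q + k * a n.+1 ^+ 2 - 2 * s * a n.+1).
  by have := sqr_ge0 (s - k * a n.+1); rewrite sqrrB; move: IH; rewrite !expr2; lra.
by rewrite pmulr_rge0// !expr2; lra.
Qed.

(** Cauchy-Schwarz along the nearest neighbour edges from m to n, a chain of resistance at most (n -
    m) / kap. *)
Lemma energy_path f m n : (m <= n)%N -> (n <= N)%N ->
  2 * kap * (f n - f m) ^+ 2 <= (n - m)%:R * energy f f.
Proof.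
move=> mn nN; have -> : f n - f m = \sum_(i < n - m) (f (m + i).+1 - f (m + i)%N).
  have := walk_telescope 0 (fun i => f (m + i)%N) (n - m).
  rewrite /walk_from !add0r addn0 subnKC// => <-.
  by apply: eq_bigr => i _; rewrite addnS.
have h : \sum_(i < n - m) (f (m + i).+1 - f (m + i)%N) ^+ 2 <= \sum_(i < N) (f i.+1 - f i) ^+ 2.
  pose G i := (f i.+1 - f i) ^+ 2; have G0 i : 0 <= G i by exact: sqr_ge0.
  have E : \sum_(i < n - m) G (m + i)%N = \sum_(m <= i < n) G i.
    have := big_addn 0 n m xpredT G; rewrite add0n => ->; rewrite big_mkord.
    by apply: eq_bigr => i _; rewrite addnC.
  rewrite -/(G _) E -(big_mkord xpredT G) (big_cat_nat (leq0n m) (leq_trans mn nN)) (big_cat_nat mn nN)/=.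
  by rewrite -[leLHS]add0r -[leLHS]addr0 -addrA; apply: lerD; [exact: sumr_ge0|rewrite lerD2l; exact: sumr_ge0].
apply: le_trans (_ : 2 * kap * ((n - m)%:R * \sum_(i < N) (f i.+1 - f i) ^+ 2) <= _).
  apply: ler_wpM2l; first by rewrite mulr_ge0// ltW.
  by apply: le_trans (sqr_sum_le _ (fun i => f (m + i).+1 - f (m + i)%N)) _; exact: ler_wpM2l.
by rewrite mulrCA; apply: ler_wpM2l => //; exact: energy_nn.
Qed.

End finite_network.

(* [q] and [t] bound the conductance of a jump and the total conductance of the
   jumps beyond a given distance, as functions of that distance. *)
Record nice (R : realType) (w : int -> int -> R) (p : kernel R) (C : int -> R)
    (kap D : R) (q t : nat -> R) : Prop := Nice {
  nice_sym : forall x y, w x y = w y x;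
  nice_kap : 0 < kap;
  nice_nn : forall x, kap <= w x (x + 1);
  nice_ker : forall x y, C x * p x y = w x y;
  nice_C : forall x, kap <= C x <= D;
  nice_q : forall x y, w x y <= q `|x - y|%N;
  nice_q2 : forall n, \sum_(k < n) k%:R ^+ 2 * q k <= D;
  nice_left : forall x (j : nat), C x * av p x (fun z => (z <= x - j%:Z)%R%:R) <= t j;
  nice_right : forall x (j : nat), C x * av p x (fun z => (x + j%:Z <= z)%R%:R) <= t j;
  nice_t1 : forall n, \sum_(j < n) j%:R * t j <= D }.

(** * Reduction of the walk on an interval to a finite network *)

Section lumped_network.
Variables (R : realType) (w : int -> int -> R) (p : kernel R) (C : int -> R).
Variables (kap D : R) (q t : nat -> R).
Hypothesis Hn : nice w p C kap D q t.
Variables (b : int) (N : nat).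

(* The half lines beyond [b] and [b + N] are lumped into the nodes 0 and N. *)
Definition node (z : int) : nat := if z <= b then 0%N else if b + N%:Z <= z then N else `|z - b|%N.

Definition inner (i : nat) := (0 < i < N)%N.

Definition lump (i j : nat) : R := C (b + i%:Z) * av p (b + i%:Z) (fun z => (node z == j)%:R).

(** The total conductance towards a half line is read from the inner end of the edge, which makes
    the network symmetric. The two end nodes are not joined; the flow at inner nodes does not see
    the difference. *)
Definition cnet (i j : nat) : R :=
  if inner i then lump i j else if inner j then lump j i else 0.

Let C0 x : 0 < C x.
Proof. by have /andP[h _] := nice_C Hn x; exact: lt_le_trans (nice_kap Hn) h. Qed.

Lemma nice_w_ge0 x y : 0 <= w x y.
Proof. by rewrite -(nice_ker Hn) mulr_ge0 ?ker_ge0// ltW. Qed.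

Let ind01 (P : pred int) : forall z, 0 <= ((P z)%:R : R) <= 1.
Proof. by move=> z; case: (P z); rewrite ?lexx ?ler01. Qed.

Lemma bnd_pred (P : pred int) : bnd (fun z => ((P z)%:R : R)).
Proof. exact: bnd01 (ind01 P). Qed.

Lemma lump_ge0 i j : 0 <= lump i j.
Proof. by rewrite /lump mulr_ge0 ?(ltW (C0 _))// av_ge0. Qed.

Lemma cnet_ge0 i j : 0 <= cnet i j.
Proof. by rewrite /cnet; case: ifP => _; [|case: ifP => _ //]; exact: lump_ge0. Qed.

Lemma node_eq_inner z j : inner j -> (node z == j) = (z == b + j%:Z).
Proof.
move=> /andP[j0 jN]; rewrite /node; case: ifP => h1; first by lia.
by case: ifP => h2; lia.
Qed.

Lemma lump_inner i j : inner j -> lump i j = w (b + i%:Z) (b + j%:Z).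
Proof.
move=> ij; rewrite /lump -(nice_ker Hn) -av_pred1; congr (_ * av _ _ _).
by apply/funext => z; rewrite node_eq_inner.
Qed.

Lemma cnet_sym i j : cnet i j = cnet j i.
Proof.
rewrite /cnet; case: (boolP (inner i)) => ii; case: (boolP (inner j)) => ij //.
by rewrite !lump_inner// (nice_sym Hn).
Qed.

Lemma node_le z : (node z <= N)%N.
Proof.
rewrite /node; case: ifP => // h1; case: ifP => // h2; lia.
Qed.

Hypothesis N1 : (1 < N)%N.

Lemma cnet_nn i : (i < N)%N -> kap <= cnet i i.+1.
Proof.
move=> iN; have nn := nice_nn Hn.
case: (boolP (inner i)) => ii.
  rewrite /cnet ii; have [iN1|iN1] := eqVneq i.+1 N; last first.
    rewrite lump_inner; last by rewrite /inner; lia.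
    by rewrite (_ : b + i.+1%:Z = b + i%:Z + 1)//; lia.
  rewrite /lump; apply: le_trans (nn (b + i%:Z)) _; rewrite -(nice_ker Hn).
  apply: ler_wpM2l; first exact: ltW.
  rewrite -av_pred1; apply: le_av => [||z]; [exact: bnd_pred|exact: bnd_pred|].
  case: eqP => // ->; rewrite (_ : node _ = i.+1) ?eqxx// /node ifF; last by lia.
  by rewrite ifT; lia.
have i0 : i = 0%N by move: ii; rewrite /inner iN andbT -leqNgt leqn0 => /eqP.
rewrite i0 /cnet /inner ltnn/= N1 /lump; apply: le_trans (nn b) _.
rewrite (nice_sym Hn) -(nice_ker Hn); apply: ler_wpM2l; first exact: ltW.
rewrite -av_pred1; apply: le_av => [||z]; [exact: bnd_pred|exact: bnd_pred|].
by case: eqP => // ->; rewrite ler_nat /node lexx.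
Qed.

Lemma av_node i (f : nat -> R) : inner i ->
  C (b + i%:Z) * av p (b + i%:Z) (fun z => f (node z)) = \sum_(j < N.+1) cnet i j * f j.
Proof.
move=> ii; rewrite (_ : (fun z => f (node z)) = fun z => \sum_(j < N.+1) f j * (node z == j)%:R).
  rewrite /av expect_sum.
    rewrite mulr_sumr; apply: eq_bigr => j _; rewrite /cnet ii /lump -mulrA; congr (_ * _).
    by rewrite mulrC; apply: avZ; exact: bnd_pred.
  by move=> j; apply: bnd_meas; apply: bndZ; exact: bnd_pred.
apply/funext => z; have zN : (node z < N.+1)%N by rewrite ltnS node_le.
rewrite (bigD1 (Ordinal zN))//= eqxx mulr1 big1 ?addr0// => j jz.
by case: eqP => [h|]; [case/eqP: jz; apply: val_inj|rewrite mulr0].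
Qed.

Lemma flow_harmonic i (f : nat -> R) : inner i -> f i = av p (b + i%:Z) (fun z => f (node z)) ->
  flow N cnet f i = 0.
Proof.
move=> ii fi; rewrite /flow; under eq_bigr do rewrite mulrBr.
rewrite sumrB -mulr_suml -(av_node _ ii) -fi.
have := av_node (fun=> 1) ii; rewrite av_cst mulr1.
under eq_bigr do rewrite mulr1; move=> <-; by rewrite subrr.
Qed.

Let D0 : 0 < D.
Proof.
by have /andP[h1 h2] := nice_C Hn 0; apply: lt_le_trans (nice_kap Hn) (le_trans h1 h2).
Qed.

Let q0 k : 0 <= q k.
Proof.
by apply: le_trans (nice_w_ge0 k%:Z 0) _; rewrite -[k in q k](absz_nat k) -{2}[k%:Z]subr0 (nice_q Hn).
Qed.

Let t0 k : 0 <= t k.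
Proof.
by apply: le_trans (nice_left Hn 0 k); rewrite mulr_ge0 ?(ltW (C0 _))// av_ge0.
Qed.

Lemma sum_pred1_le (n m : nat) (e : 'I_n -> nat) : injective e ->
  \sum_(j < n) ((e j == m)%:R : R) <= 1.
Proof.
move=> inj; case: (pickP (fun j => e j == m)) => [j0 /eqP j0m|no]; last first.
  by rewrite big1 ?ler01// => j _; rewrite no.
rewrite (bigD1 j0)//= j0m eqxx big1 ?addr0// => j jj0.
by case: eqP => // ejm; case/eqP: jj0; apply: inj; rewrite ejm.
Qed.

Lemma sum_dist_le (a : nat -> R) (i : 'I_N.+1) : (forall k, 0 <= a k) ->
  \sum_(j < N.+1) a `|i%:Z - j%:Z|%N <= 2 * \sum_(k < N.+1) a k.
Proof.
move=> a0; apply: le_trans (_ : \sum_(j < N.+1) \sum_(k < N.+1)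
    a k * ((j == (i + k)%N :> nat)%:R + ((j + k)%N == i)%:R) <= _).
  apply: ler_sum => j _; have jN := ltn_ord j; have iN := ltn_ord i.
  have kN : (`|i%:Z - j%:Z|%N < N.+1)%N by lia.
  rewrite (bigD1 (Ordinal kN))//=; apply: ler_wpDr.
    by apply: sumr_ge0 => k _; rewrite mulr_ge0 ?addr_ge0.
  rewrite -[leLHS]mulr1; apply: ler_wpM2l => //.
  have [h|h] := leqP i j.
    by rewrite (_ : (j == _ :> nat)) ?lerDl//; apply/eqP; lia.
  by rewrite [(j + _)%N == i](_ : _ = true) ?lerDr//; apply/eqP; lia.
rewrite exchange_big/= mulr_sumr; apply: ler_sum => k _; rewrite -mulr_sumr mulrC.
apply: ler_wpM2r => //; rewrite big_split/=; apply: lerD.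
  by apply: sum_pred1_le => j j' /val_inj.
by apply: (@sum_pred1_le _ _ (fun j => (j + k)%N)) => j j' /addIn /val_inj.
Qed.

(** Between inner nodes each row costs at most a second moment of q. A jump from i to an end node at
    distance i has total conductance at most t i, and i^2 t i <= N (i t i), whose sum over i is at
    most N D. *)
Lemma cnet_moment : \sum_(i < N.+1) \sum_(j < N.+1) cnet i j * (i%:R - j%:R) ^+ 2 <= 8 * N%:R * D.
Proof.
have D0' := D0; have NR : 1 <= N%:R :> R by rewrite ler1n; lia.
pose g (k : nat) : R := N%:R * (k%:R * t k).
have g0 k : 0 <= g k by rewrite !mulr_ge0.
pose a k := k%:R ^+ 2 * q k; have a0 k : 0 <= a k by rewrite mulr_ge0// sqr_ge0.
have left i : (0 < i < N)%N -> lump i 0 <= t i.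
  move=> /andP[i0 iN]; apply: le_trans (nice_left Hn (b + i%:Z) i); apply: ler_wpM2l; first exact: ltW.
  apply: le_av => [||z]; [exact: bnd_pred|exact: bnd_pred|].
  by rewrite ler_nat /node; case: ifP => h1; [|case: ifP => h2]; lia.
have right i : (0 < i < N)%N -> lump i N <= t (N - i)%N.
  move=> /andP[i0 iN]; apply: le_trans (nice_right Hn (b + i%:Z) (N - i)); apply: ler_wpM2l; first exact: ltW.
  apply: le_av => [||z]; [exact: bnd_pred|exact: bnd_pred|].
  by rewrite ler_nat /node; case: ifP => h1; [|case: ifP => h2]; lia.
have sq0 i : (i <= N)%N -> (i%:R : R) ^+ 2 <= N%:R * i%:R.
  by move=> iN; rewrite expr2 ler_wpM2r// ler_nat.
have bl i : (0 < i < N)%N -> lump i 0 * i%:R ^+ 2 <= g i.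
  move=> ii; rewrite /g mulrA mulrC; have /andP[_ /ltnW iN] := ii.
  by apply: ler_pM; rewrite ?sqr_ge0 ?lump_ge0// ?sq0// left.
have br i : (0 < i < N)%N -> lump i N * (N%:R - i%:R) ^+ 2 <= g (N - i)%N.
  move=> ii; rewrite /g mulrA mulrC; have /andP[_ /ltnW iN] := ii.
  by rewrite -natrB//; apply: ler_pM; rewrite ?sqr_ge0 ?lump_ge0// ?sq0 ?leq_subr// right.
have sg : \sum_(i < N.+1) g i <= N%:R * D.
  by rewrite -mulr_sumr; apply: ler_wpM2l => //; exact: nice_t1 Hn _.
have sg' : \sum_(i < N.+1) g (N - i)%N <= N%:R * D.
  by rewrite (reindex_inj rev_ord_inj)/=; apply: le_trans sg; rewrite le_eqVlt; apply/orP; left; apply/eqP;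
    apply: eq_bigr => i _; rewrite subSS subKn// -ltnS ltn_ord.
apply: le_trans (_ : \sum_(i < N.+1) \sum_(j < N.+1) (a `|i%:Z - j%:Z|%N +
   ((j == 0 :> nat)%:R * g i + (j == N :> nat)%:R * g (N - i)%N +
   ((i == 0 :> nat)%:R * g j + (i == N :> nat)%:R * g (N - j)%N))) <= _).
  apply: ler_sum => i _; apply: ler_sum => j _.
  have iN := ltn_ord i; have jN := ltn_ord j.
  have p1 : 0 <= (j == 0 :> nat)%:R * g i by rewrite mulr_ge0.
  have p2 : 0 <= (j == N :> nat)%:R * g (N - i)%N by rewrite mulr_ge0.
  have p3 : 0 <= (i == 0 :> nat)%:R * g j by rewrite mulr_ge0.
  have p4 : 0 <= (i == N :> nat)%:R * g (N - j)%N by rewrite mulr_ge0.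
  have p5 := a0 `|i%:Z - j%:Z|%N.
  have one (x y : nat) : inner x -> (y <= N)%N -> lump x y * (x%:R - y%:R) ^+ 2 <=
     a `|x%:Z - y%:Z|%N + ((y == 0 :> nat)%:R * g x + (y == N :> nat)%:R * g (N - x)%N).
    move=> ix yN; have q5 := a0 `|x%:Z - y%:Z|%N.
    have [y0|y0] := eqVneq y 0%N.
      rewrite y0 subr0; have := bl x ix; have : 0 <= (0 == N :> nat)%:R * g (N - x)%N by rewrite mulr_ge0.
      by move: q5; rewrite y0 (_ : true%:R = 1 :> R)//; lra.
    have [yN'|yN'] := eqVneq y N.
      have := br x ix; have : 0 <= (N == 0 :> nat)%:R * g x by rewrite mulr_ge0.
      by move: q5; rewrite yN' -[(x%:R - _) ^+ 2]sqrrN opprB (_ : true%:R = 1 :> R)// (_ : false%:R = 0 :> R)//; lra.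
    have iy : inner y by rewrite /inner lt0n y0 ltn_neqAle yN' yN.
    rewrite lump_inner// !mul0r !addr0 /a mulrC; apply: ler_pM; rewrite ?sqr_ge0 ?nice_w_ge0//.
      rewrite -real_normK ?num_real// -[leRHS]real_normK ?num_real//.
      rewrite lerXn2r ?nnegrE// (ger0_norm (ler0n _ _)).
      have -> : x%:R - y%:R = (x%:Z - y%:Z)%:~R :> R by rewrite intrB.
      by rewrite natr_absz intr_norm.
    by apply: le_trans (nice_q Hn _ _) _; rewrite (_ : b + x%:Z - (b + y%:Z) = x%:Z - y%:Z)//; ring.
  rewrite /cnet; case: (boolP (inner i)) => ii.
    by have := one i j ii (ltnSE jN); lra.
  case: (boolP (inner j)) => ij; last by rewrite mul0r; lra.
  have := one j i ij (ltnSE iN); rewrite -sqrrN opprB distnC; lra.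
rewrite -[X in _ <= X](_ : 4 * N%:R * D + 4 * N%:R * D = _); last by ring.
under eq_bigr do rewrite big_split/=.
rewrite big_split/=; apply: lerD.
  apply: le_trans (_ : \sum_(i < N.+1) 2 * D <= _).
    apply: ler_sum => i _; apply: le_trans (sum_dist_le i a0) _.
    by rewrite ler_pM2l//; exact: nice_q2 Hn _.
  by rewrite sumr_const card_ord -mulr_natl -natr1; nra.
have e0 (h : nat -> R) m : (forall k, 0 <= h k) -> \sum_(j < N.+1) (j == m :> nat)%:R * h j <= \sum_(j < N.+1) h j.
  by move=> h0; apply: ler_sum => j _; case: eqP => _; rewrite ?mul1r// mul0r.
have e1 (x : R) m : 0 <= x -> \sum_(j < N.+1) (j == m :> nat)%:R * x <= x.
  move=> x0; rewrite -mulr_suml -[leRHS]mul1r; apply: ler_wpM2r => //.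
  by apply: sum_pred1_le; exact: val_inj.
have A1 : \sum_(i < N.+1) \sum_(j < N.+1) ((j == 0 :> nat)%:R * g i + (j == N :> nat)%:R * g (N - i)%N) <= N%:R * D + N%:R * D.
  apply: le_trans (lerD sg sg'); rewrite -big_split; apply: ler_sum => i _; rewrite big_split/=.
  by apply: lerD; exact: e1.
have A2 : \sum_(i < N.+1) \sum_(j < N.+1) ((i == 0 :> nat)%:R * g j + (i == N :> nat)%:R * g (N - j)%N) <= N%:R * D + N%:R * D.
  by rewrite exchange_big/=; exact: A1.
under eq_bigr do rewrite big_split/=.
rewrite big_split/=; lra.
Qed.

Lemma energy_lip (g : nat -> R) (M : R) : 0 < M ->
  (forall i j, (i <= N)%N -> (j <= N)%N -> `|g i - g j| <= `|i%:R - j%:R| / M) ->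
  energy N cnet g g <= 8 * N%:R * D / M ^+ 2.
Proof.
move=> M0 gl; rewrite ler_pdivlMr ?exprn_gt0// mulrC; apply: le_trans cnet_moment.
rewrite /energy mulr_sumr; apply: ler_sum => i _; rewrite mulr_sumr; apply: ler_sum => j _.
rewrite -mulrA mulrCA; apply: ler_wpM2l; first exact: cnet_ge0.
rewrite -expr2 -exprMn -real_normK ?num_real// -[leRHS]real_normK ?num_real//.
rewrite lerXn2r ?nnegrE// normrM (gtr0_norm M0) mulrC -ler_pdivlMr//.
by apply: gl; rewrite -ltnS ltn_ord.
Qed.

Section hit.
Variables (A B : pred int).
Hypotheses (Al : forall z, z <= b -> A z = A b /\ B z = B b)
  (Ar : forall z, b + N%:Z <= z -> A z = A (b + N%:Z) /\ B z = B (b + N%:Z)).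
Hypotheses (ABl : A b || B b) (ABr : A (b + N%:Z) || B (b + N%:Z)).

Lemma hit_node z : hit p A B z = hit p A B (b + (node z)%:Z).
Proof.
have same x y : A x = A y -> B x = B y -> A y || B y -> hit p A B x = hit p A B y.
  move=> AE BE; case: (boolP (A y)) => [Ay _|Ay /= By]; first by rewrite !hit_A ?AE.
  by rewrite !hit_B ?AE ?BE.
rewrite /node; case: ifPn => [zb|zb]; first by case: (Al zb) => e1 e2; rewrite addr0; exact: (same _ _ e1 e2 ABl).
case: ifPn => [Nz|Nz]; first by case: (Ar Nz) => e1 e2; exact: (same _ _ e1 e2 ABr).
by congr hit; lia.
Qed.

Lemma flow_hit i : inner i -> ~~ A (b + i%:Z) -> ~~ B (b + i%:Z) ->
  flow N cnet (fun i => hit p A B (b + i%:Z)) i = 0.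
Proof.
move=> ii nA nB; apply: flow_harmonic => //.
by rewrite hit_harmonic//; congr av; apply/funext => z; exact: hit_node.
Qed.

End hit.

End lumped_network.

(** * Hitting probabilities of intervals and half lines *)

Section hitting_bounds.
Variables (R : realType) (w : int -> int -> R) (p : kernel R) (C : int -> R).
Variables (kap D : R) (q t : nat -> R).
Hypothesis Hn : nice w p C kap D q t.

Let kap0 : 0 < kap := nice_kap Hn.

Lemma nice_D_gt0 : 0 < D.
Proof.
by have /andP[h1 h2] := nice_C Hn 0; apply: lt_le_trans (nice_kap Hn) (le_trans h1 h2).
Qed.

Definition outside (y : int) (L : nat) : pred int := fun z => (z <= y - L%:Z) || (y + L%:Z <= z).

(** The hitting probability vanishes at y and has minimal energy, at most that of a tent function,
    of order 1 / L. By [energy_path] it is Hoelder continuous of exponent 1/2 at y. *)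
Lemma hit_outside_le (y y' : int) (L : nat) : (`|y' - y|%N < L)%N ->
  hit p (outside y L) (pred1 y) y' ^+ 2 <= `|y' - y|%:R * (8 * D / kap) / L%:R.
Proof.
move=> yL; have L0 : (0 < L)%N by exact: leq_ltn_trans yL.
have LR : 0 < L%:R :> R by rewrite ltr0n.
pose b := y - L%:Z; pose N := (2 * L)%N; have N1 : (1 < N)%N by rewrite /N; lia.
set A := outside y L; set B := pred1 y; pose f i := hit p A B (b + i%:Z).
have Al z : z <= b -> A z = A b /\ B z = B b.
  by rewrite /A /B /outside /b /= => zb; split; [rewrite zb lexx|lia].
have Ar z : b + N%:Z <= z -> A z = A (b + N%:Z) /\ B z = B (b + N%:Z).
  by rewrite /A /B /outside /b /N /= => zb; split; lia.
have Ab : A b by rewrite /A /outside lexx.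
have AN : A (b + N%:Z) by rewrite /A /outside /b /N; lia.
(* The competitor: the tent equal to 0 at y, which is the node L, and to 1 at both ends. *)
pose g i : R := `|i%:R - L%:R| / L%:R.
have dir : energy N (cnet p C b N) f f <= energy N (cnet p C b N) g g.
  apply: dirichlet_principle => [i j|i j|i iN]; [exact: cnet_sym Hn _ _ _ _|exact: cnet_ge0 Hn _ _ _ _|].
  have [->|i0] := eqVneq i 0%N.
    have -> : g 0%N = f 0%N; last by rewrite eqxx.
    by rewrite /f /g addr0 hit_A// sub0r normrN ger0_norm// divff// gt_eqF.
  have [->|iN'] := eqVneq i N.
    have -> : g N = f N; last by rewrite eqxx.
    by rewrite /f /g hit_A// /N natrM mulr_natl mulr2n addrK ger0_norm// divff// gt_eqF.
  have [->|iL] := eqVneq i L.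
    have -> : g L = f L; last by rewrite eqxx.
    by rewrite /f /g subrr normr0 mul0r hit_B// /A /B /outside /b/= ?subrK//; lia.
  move=> _; apply: (flow_hit Hn (b := b)) => //.
  - by rewrite Ab. - by rewrite AN.
  - by rewrite /inner; lia.
  - by rewrite /A /outside /b; lia.
  - by rewrite /B /b /=; lia.
have gE : energy N (cnet p C b N) g g <= 8 * N%:R * D / L%:R ^+ 2.
  apply: (energy_lip Hn) => // i j _ _; rewrite /g -mulrBl normrM [X in _ * X]ger0_norm ?invr_ge0//.
  rewrite ler_pM2r ?invr_gt0//; apply: le_trans (ler_dist_dist _ _) _.
  by rewrite (_ : i%:R - L%:R - (j%:R - L%:R) = i%:R - j%:R)//; ring.
have path m n : (m <= n)%N -> (n <= N)%N ->
    2 * kap * (f n - f m) ^+ 2 <= (n - m)%:R * (16 * D / L%:R).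
  move=> mn nN; apply: le_trans (energy_path (cnet_sym Hn b N) (cnet_ge0 Hn b N) kap0
    (cnet_nn Hn b N1) f mn nN) _; apply: ler_wpM2l => //; apply: le_trans dir (le_trans gE _).
  rewrite /N natrM le_eqVlt; apply/orP; left; apply/eqP; field; by rewrite gt_eqF.
have fL : f L = 0.
  by rewrite /f hit_B//; [rewrite /A /outside /b; lia|rewrite /B /b /= subrK].
pose i := `|y' - b|%N; have fi : f i = hit p A B y' by rewrite /f; congr hit; rewrite /i /b; lia.
rewrite -fi ler_pdivlMr// mulrA ler_pdivlMr//.
suff : 2 * kap * f i ^+ 2 <= `|y' - y|%:R * (16 * D / L%:R).
  by rewrite mulrA ler_pdivlMr//; lra.
have [h|h] := leqP L i.
  have := path L i h; rewrite fL subr0 (_ : (i - L)%N = `|y' - y|%N); last by rewrite /i /b; lia.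
  by apply; rewrite /i /N /b; lia.
have := path i L (ltnW h); rewrite fL sub0r sqrrN (_ : (L - i)%N = `|y' - y|%N); last by rewrite /i /b; lia.
by apply; rewrite /N; lia.
Qed.

Section strip.
Variable N : nat.
Hypothesis N1 : (1 < N)%N.

Let up : pred int := fun z => N%:Z <= z.
Let dn : pred int := fun z => z <= 0.
Let v := hit p up dn.

Let c := cnet p C 0 N.
Let csym := cnet_sym Hn 0 N.
Let cge0 := cnet_ge0 Hn 0 N.
Let cnn := cnet_nn Hn 0 N1.

(** The flux out of 0 equals the flux into N, which is half the energy of v; and v rises from 0 to 1
    over N edges, so its energy is at least 2 kap / N. *)
Lemma hit_strip_flux : kap / N%:R <= \sum_(j < N.+1) c 0 j * v j%:Z.
Proof.
have NR : 0 < N%:R :> R by rewrite ltr0n; lia.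
pose f i := v (0 + i%:Z).
have f0 : f 0%N = 0 by rewrite /f /v hit_B// /up /dn /=; lia.
have fN : f N = 1 by rewrite /f /v hit_A// /up/= add0r.
have fin i : (i <= N)%N -> i != 0%N -> i != N -> flow N c f i = 0.
  move=> iN i0 iN'; apply: (flow_hit Hn (b := 0)) => //=.
  - by move=> z z0; rewrite /up /dn; split; lia.
  - by move=> z z0; rewrite /up /dn; split; lia.
  - by rewrite /dn lexx orbT.
  - by rewrite /up add0r lexx.
  - by rewrite /inner; lia.
  - by rewrite /up; lia.
  - by rewrite /dn; lia.
have E : energy N c f f = 2 * flow N c f N.
  rewrite (energy_flow N csym); congr (_ * _).
  rewrite big_ord_recr/= fN mul1r big1 ?add0r// => i _.
  have [->|i0] := eqVneq (i : nat) 0%N; first by rewrite f0 mul0r.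
  by rewrite fin ?mulr0// ?ltn_eqF// ltnW.
have S0 : flow N c f 0 + flow N c f N = 0.
  rewrite -[RHS](flow_sum0 N csym f) big_ord_recr/= (bigD1 (Ordinal (ltnW N1)))//= big1 ?addr0//.
  move=> i i0; apply: fin; [exact: ltnW|by apply: contra i0 => /eqP h; apply/eqP/val_inj|].
  by rewrite ltn_eqF.
have F0 : flow N c f 0 = - \sum_(j < N.+1) c 0 j * v j%:Z.
  rewrite /flow -sumrN; apply: eq_bigr => j _; rewrite f0 sub0r mulrN /f add0r//.
have := energy_path csym cge0 kap0 cnn f (leq0n N) (leqnn N).
rewrite fN f0 subr0 expr1n mulr1 subn0 (E : energy N (cnet p C 0 N) f f = _) => h.
have SF : \sum_(j < N.+1) c 0 j * v j%:Z = flow N c f N by lra.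
by rewrite SF ler_pdivrMr//; lra.
Qed.

(** Reciprocity with h, the probability of visiting y before leaving the strip, writes v y as a
    quotient of fluxes of h. The denominator is at least kap / y by [energy_path]. The numerator is
    at most the flux of h' at N, half the energy of h', and a test function bounds this energy. *)
Lemma hit_strip_le (y : nat) : (0 < y)%N -> (2 * y <= N)%N ->
  v y%:Z <= 16 * D / kap * (y%:R / N%:R).
Proof.
move=> y0 yN; have NR : 0 < N%:R :> R by rewrite ltr0n; lia.
have yR : 0 < y%:R :> R by rewrite ltr0n.
pose out : pred int := fun z => dn z || up z.
pose h i := hit p (pred1 y%:Z) out (0 + i%:Z).
pose lo : pred int := fun z => (z == y%:Z) || dn z.
pose h' i := hit p lo up (0 + i%:Z).
pose f i := v (0 + i%:Z).
have f0 : f 0%N = 0 by rewrite /f /v hit_B// /up /dn /=; lia.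
have fN : f N = 1 by rewrite /f /v hit_A// /up/= add0r.
have h0 : h 0%N = 0 by rewrite /h hit_B// /out /dn /=; lia.
have hy : h y = 1 by rewrite /h hit_A//= add0r.
have hN : h N = 0 by rewrite /h hit_B// /out /up /=; lia.
have h'0 : h' 0%N = 1 by rewrite /h' hit_A// /lo /dn /=; lia.
have h'y : h' y = 1 by rewrite /h' hit_A// /lo /dn /=; lia.
have h'N : h' N = 0 by rewrite /h' hit_B// /lo /up /dn /=; lia.
have fin i : (i <= N)%N -> i != 0%N -> i != N -> flow N c f i = 0.
  move=> iN i0 iN'; apply: (flow_hit Hn (b := 0)) => //=.
  - by move=> z z0; rewrite /up /dn; split; lia.
  - by move=> z z0; rewrite /up /dn; split; lia.
  - by rewrite /dn lexx orbT.
  - by rewrite /up add0r lexx.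
  - by rewrite /inner; lia.
  - by rewrite /up; lia.
  - by rewrite /dn; lia.
have hin i : (i <= N)%N -> i != 0%N -> i != y -> i != N -> flow N c h i = 0.
  move=> iN i0 iy iN'; apply: (flow_hit Hn (b := 0)) => //=.
  - by move=> z z0; rewrite /out /up /dn; split; lia.
  - by move=> z z0; rewrite /out /up /dn; split; lia.
  - by rewrite /out /dn lexx orbT.
  - by rewrite /out /up add0r lexx !orbT.
  - by rewrite /inner; lia.
  - by rewrite /out /up /dn; lia.
have h'in i : (i <= N)%N -> i != 0%N -> i != y -> i != N -> flow N c h' i = 0.
  move=> iN i0 iy iN'; apply: (flow_hit Hn (b := 0)) => //=.
  - by move=> z z0; rewrite /lo /up /dn; split; lia.
  - by move=> z z0; rewrite /lo /up /dn; split; lia.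
  - by rewrite /lo /dn lexx orbT.
  - by rewrite /up add0r lexx orbT.
  - by rewrite /inner; lia.
  - by rewrite /lo /dn; lia.
  - by rewrite /up; lia.
have three (F : nat -> R) : (forall i, (i <= N)%N -> i != 0%N -> i != y -> i != N -> F i = 0) ->
    \sum_(i < N.+1) F i = F 0%N + F y + F N.
  move=> F0; rewrite big_ord_recr/= (bigD1 (Ordinal (ltnW N1)))//=.
  have yN' : (y < N)%N by lia.
  rewrite (bigD1 (Ordinal yN'))/=; last by apply/eqP => /(congr1 val) /=; lia.
  rewrite big1 ?addr0// => i /andP[i0 iy]; apply: F0; first exact: ltnW.
  - by apply: contra i0 => /eqP e; apply/eqP/val_inj.
  - by apply: contra iy => /eqP e; apply/eqP/val_inj.
  - by rewrite ltn_eqF.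
have Eh : energy N c h h = 2 * flow N c h y.
  rewrite (energy_flow N csym) (three (fun i => h i * flow N c h i)) ?h0 ?hy ?hN ?mul0r ?mul1r ?add0r ?addr0//.
  by move=> i iN i0 iy iN'; rewrite hin ?mulr0.
have Eh' : energy N c h' h' = - (2 * flow N c h' N).
  rewrite (energy_flow N csym) (three (fun i => h' i * flow N c h' i)) ?h'0 ?h'y ?h'N ?mul0r ?mul1r ?addr0//; last first.
    by move=> i iN i0 iy iN'; rewrite h'in ?mulr0.
  have := flow_sum0 N csym h'; rewrite (three (flow N c h'))//.
  by lra.
(* The mixed energy of h and f is computed twice: with the flow of f it is 0, since h vanishes at
   both ends; with the flow of h only the nodes y and N remain. *)
have key : f y * flow N c h y = - flow N c h N.
  have e1 : energy N c h f = 0.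
    rewrite energyC (energy_flow N csym) (three (fun i => h i * flow N c f i)).
      by rewrite h0 hN (fin y) ?mulr0 ?mul0r ?addr0 ?mulr0//; lia.
    by move=> i iN i0 iy iN'; rewrite fin ?mulr0.
  move: e1; rewrite (energy_flow N csym) (three (fun i => f i * flow N c h i)) ?f0 ?fN ?mul0r ?add0r ?mul1r; last first.
    by move=> i iN i0 iy iN'; rewrite hin ?mulr0.
  by lra.
have hh' i : h i <= h' i.
  apply: hit_le_super; rewrite -?/(hit _ _ _).
  - exact: bnd01 (hit01 p lo up).
  - by move=> z; have /andP[] := hit01 p lo up z.
  - by move=> z /= zy; rewrite hit_A// /lo zy.
  - move=> z nA nB; rewrite -hit_harmonic//; move: nA nB; rewrite /lo /out /up /dn /=; lia.
have NN : c N N = 0 by rewrite /c /cnet /inner ltnn andbF.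
have fl : - flow N c h N <= - flow N c h' N.
  rewrite /flow -!sumrN; apply: ler_sum => j _; rewrite hN h'N !sub0r !mulrN !opprK.
  by apply: ler_wpM2l => //; exact: cge0.
(* Equal to 1 up to N / 2, hence at 0 and at y, and decreasing linearly to 0 at N, it has the
   boundary values of h'. *)
pose g i : R := clip 0 1 ((N%:R - i%:R) / (N%:R / 2)).
have N2 : 0 < N%:R / 2 :> R by rewrite divr_gt0.
have Eg : energy N c h' h' <= 32 * D / N%:R.
  apply: le_trans (_ : energy N c g g <= _).
    apply: dirichlet_principle; [exact: csym|exact: cge0|] => i iN.
    have [->|i0] := eqVneq i 0%N.
      by rewrite h'0 /g clip_hi ?eqxx// ler_pdivlMr//; lra.
    have [->|iy] := eqVneq i y.
      rewrite h'y /g clip_hi ?eqxx// ler_pdivlMr// mul1r.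
      have : 2 * y%:R <= N%:R :> R by rewrite -natrM ler_nat.
      by lra.
    have [->|iN' _] := eqVneq i N; first by rewrite h'N /g clip_lo ?eqxx// subrr mul0r.
    exact: h'in.
  apply: le_trans (energy_lip Hn _ N1 N2 _) _.
    move=> i j _ _; apply: le_trans (lip_clip _ _ _ _) _.
    rewrite -mulrBl normrM [X in _ * X]ger0_norm ?invr_ge0 ?(ltW N2)//.
    by rewrite (_ : N%:R - i%:R - (N%:R - j%:R) = - (i%:R - j%:R)) ?normrN//; ring.
  by rewrite le_eqVlt; apply/orP; left; apply/eqP; field; rewrite gt_eqF.
have hlow : 2 * kap <= y%:R * energy N c h h.
  have yN' : (y <= N)%N by lia.
  have := energy_path csym cge0 kap0 cnn h (leq0n y) yN'.
  by rewrite hy h0 subr0 expr1n mulr1 subn0.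
have fy0 : 0 <= f y by have /andP[] := hit01 p up dn (0 + y%:Z).
have D0 := nice_D_gt0; have kap0' := kap0.
have e1 : f y * energy N c h h <= 32 * D / N%:R by rewrite Eh mulrCA key; lra.
have : f y * (2 * kap) <= y%:R * (32 * D / N%:R).
  apply: le_trans (_ : y%:R * (f y * energy N c h h) <= _); last by apply: ler_wpM2l.
  by rewrite [leRHS]mulrCA; apply: ler_wpM2l.
rewrite /f add0r => e2.
rewrite (_ : 16 * D / kap * (y%:R / N%:R) = y%:R * (32 * D / N%:R) / (2 * kap)); last first.
  by field; rewrite !gt_eqF.
by rewrite ler_pdivlMr// mulr_gt0.
Qed.

End strip.

Lemma av_ge1 x y (h : int -> R) : bnd h -> (forall z, 0 <= h z) -> p x y * h y <= av p x h.
Proof.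
move=> bh h0; rewrite mulrC -av_pred1 -avZ; last exact: bnd_pred.
apply: le_av => // [|z]; first by apply: bndZ; exact: bnd_pred.
by case: eqP => [->|_]; rewrite ?mulr1// mulr0.
Qed.

Lemma nice_step x : kap / D <= p x (x + 1).
Proof.
have D0 := nice_D_gt0; have /andP[C1 C2] := nice_C Hn x.
have C0 : 0 < C x by exact: lt_le_trans C1.
rewrite ler_pdivrMr//; apply: le_trans (nice_nn Hn x) _; rewrite -(nice_ker Hn) mulrC.
by apply: ler_wpM2l => //; exact: ker_ge0.
Qed.

Lemma small_tail (a : nat -> R) (M0 eps : R) : (forall j, 0 <= a j) ->
  (forall n, \sum_(j < n) a j <= M0) -> 0 < eps ->
  exists M : nat, forall n, \sum_(j < n) (M <= j)%:R * a j <= eps.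
Proof.
move=> a0 aM eps0; pose S n := \sum_(j < n) a j.
have ndS : nondecreasing_seq S.
  by apply/nondecreasing_seqP => n; rewrite /S big_ord_recr/= lerDl.
have cS : cvgn S by apply: nondecreasing_is_cvgn => //; exists M0 => _ [n _ <-]; exact: aM.
have /cvgrPdist_le/(_ eps eps0)[M _ hM] := cS.
exists M => n.
have -> : \sum_(j < n) (M <= j)%:R * a j = S n - S (minn n M).
  elim: n => [|n IH]; first by rewrite min0n subrr big_ord0.
  rewrite big_ord_recr/= IH /S [in RHS]big_ord_recr/=.
  have [Mn|nM] := leqP M n.
    by rewrite ?(minn_idPr Mn) (minn_idPr (leqW Mn)) mul1r; ring.
  rewrite ?(minn_idPl (ltnW nM)) (minn_idPl nM) mul0r addr0 big_ord_recr/=; ring.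
have [nM|/ltnW Mn] := leqP n M; first by rewrite subrr ltW.
have := hM M (leqnn M); have := nondecreasing_cvgn_le ndS cS n; rewrite ler_norml /=.
by move=> h1 /andP[_ h2]; lra.
Qed.

(** Long jumps carry at most half of the flux bounded by [hit_strip_flux], because of [hit_strip_le]
    and the convergence of the sum of j t j. A jump of length j <= M contributes at most a constant
    times v 1, since the walk can climb from 1 to j by unit steps. *)
Lemma hit_strip_ge : exists2 c0 : R, 0 < c0 & forall N, (1 < N)%N ->
  c0 / N%:R <= hit p (fun z => N%:Z <= z) (fun z => z <= 0) 1.
Proof.
have D0 := nice_D_gt0; have kap0' := kap0.
have kD : kap <= D by have /andP[] := nice_C Hn 0; exact: le_trans.
have t0 k : 0 <= t k.
  apply: le_trans (nice_left Hn 0 k); rewrite mulr_ge0 ?av_ge0//.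
  by have /andP[h1 _] := nice_C Hn 0; exact: le_trans (ltW kap0) h1.
pose C1 := 16 * D / kap; have C10 : 0 < C1 by rewrite divr_gt0// mulr_gt0.
have C12 : 2 <= C1 by rewrite ler_pdivlMr//; lra.
(* With this bound on the tail, jumps of length at least M contribute at most kap / (2 N). *)
have eps0 : 0 < kap / (2 * C1) by rewrite divr_gt0// mulr_gt0.
have [M hM] := small_tail (a := fun j => j%:R * t j) (fun j => mulr_ge0 (ler0n _ _) (t0 j)) (nice_t1 Hn) eps0.
exists (kap / (2 * D) * (kap / D) ^+ M).
  by rewrite mulr_gt0 ?exprn_gt0 ?divr_gt0// mulr_gt0.
move=> N N1; have NR : 0 < N%:R :> R by rewrite ltr0n; lia.
set v := hit p _ _.
have v01 z : 0 <= v z <= 1 := hit01 p _ _ z.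
have vstep (j : nat) : (0 < j < N)%N -> kap / D * v j.+1%:Z <= v j%:Z.
  move=> /andP[j0 jN]; rewrite [leRHS](@hit_harmonic _ p _ _ j%:Z); [|lia|lia].
  apply: le_trans (av_ge1 _ (j%:Z + 1) (bnd01 v01) _); last by move=> z; have /andP[] := v01 z.
  rewrite (_ : j%:Z + 1 = j.+1%:Z); last by lia.
  apply: ler_wpM2r; first by have /andP[] := v01 j.+1%:Z.
  by rewrite (_ : j.+1%:Z = j%:Z + 1) ?nice_step//; lia.
have v1 (j : nat) : (0 < j < N)%N -> (kap / D) ^+ j * v j%:Z <= v 1.
  case: j => // j; elim: j => [|j IH] jN.
    by rewrite expr1 ler_piMl// ?(andP (v01 1)).1// ler_pdivrMr// mul1r.
  apply: le_trans (IH _); last by lia.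
  rewrite exprSr -mulrA; apply: ler_wpM2l; first by rewrite exprn_ge0// divr_ge0// ltW.
  by apply: vstep; lia.
have vM (j : nat) : (0 < j < N)%N -> (j <= M)%N -> (kap / D) ^+ M * v j%:Z <= v 1.
  move=> jN jM; apply: le_trans (v1 j jN); apply: ler_wpM2r; first by have /andP[] := v01 j%:Z.
  rewrite -(subnKC jM) exprD ler_piMr ?exprn_ge0 ?divr_ge0 ?(ltW kap0) ?(ltW D0)//.
  by rewrite exprn_ile1 ?divr_ge0 ?(ltW kap0) ?(ltW D0)// ler_pdivrMr// mul1r.
have vC (j : nat) : (0 < j < N)%N -> v j%:Z <= C1 * (j%:R / N%:R).
  move=> /andP[j0 jN]; have [h|h] := leqP (2 * j) N; first exact: hit_strip_le.
  apply: le_trans (_ : 1 <= _); first by have /andP[] := v01 j%:Z.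
  rewrite mulrA ler_pdivlMr// mul1r; apply: le_trans (_ : 2 * j%:R <= _); last by rewrite ler_wpM2r.
  by rewrite -natrM ler_nat ltnW.
have ct (j : nat) : cnet p C 0 N 0 j <= (0 < j < N)%:R * t j.
  rewrite /cnet {1}/inner ltnn/= /inner; case: ifP => jN; last by rewrite mul0r.
  rewrite mul1r; apply: le_trans (nice_left Hn (0 + j%:Z) j); apply: ler_wpM2l.
    by have /andP[h1 _] := nice_C Hn (0 + j%:Z); exact: le_trans (ltW kap0) h1.
  apply: le_av => [||z]; [exact: bnd_pred|exact: bnd_pred|].
  by rewrite ler_nat /node; case: ifP => h1; [|case: ifP => h2]; lia.
have bound j : cnet p C 0 N 0 j * v j%:Z <=
    j%:R * t j * ((kap / D) ^- M * v 1) + C1 / N%:R * ((M <= j)%:R * (j%:R * t j)).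
  have v10 : 0 <= v 1 by have /andP[] := v01 1.
  have e0 : 0 < (kap / D) ^+ M by rewrite exprn_gt0// divr_gt0.
  have p1 : 0 <= j%:R * t j * ((kap / D) ^- M * v 1) by rewrite !mulr_ge0// invr_ge0 ltW.
  have p2 : 0 <= C1 / N%:R * ((M <= j)%:R * (j%:R * t j)) by apply: mulr_ge0; [apply: divr_ge0 => //; exact: ltW|rewrite !mulr_ge0].
  apply: le_trans (ler_wpM2r _ (ct j)) _; first by have /andP[] := v01 j%:Z.
  have [jN|_] := boolP (0 < j < N)%N; last by rewrite mul0r mul0r addr_ge0.
  rewrite mul1r; have j1 : 1 <= j%:R :> R by rewrite ler1n; case/andP: jN.
  have [jM|Mj] := leqP M j.
    apply: ler_wpDl => //; rewrite mul1r.
    apply: le_trans (ler_wpM2l (t0 j) (vC j jN)) _.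
    by rewrite le_eqVlt; apply/orP; left; apply/eqP; ring.
  apply: ler_wpDr; first by rewrite mul0r mulr0.
  apply: ler_pM => //; first by have /andP[] := v01 j%:Z.
    by rewrite ler_peMl.
  by rewrite mulrC ler_pdivlMr// mulrC; apply: vM => //; exact: ltnW.
have := hit_strip_flux N1; rewrite -/v => flux.
have : kap / N%:R <= D * ((kap / D) ^- M * v 1) + C1 / N%:R * (kap / (2 * C1)).
  apply: le_trans flux _; apply: le_trans (_ : \sum_(j < N.+1) (j%:R * t j * ((kap / D) ^- M * v 1) +
    C1 / N%:R * ((M <= j)%:R * (j%:R * t j))) <= _); first by apply: ler_sum => j _; exact: bound.
  rewrite big_split/= -mulr_suml -mulr_sumr; apply: lerD.
    apply: ler_wpM2r; last exact: nice_t1 Hn _.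
    by rewrite mulr_ge0 ?invr_ge0 ?exprn_ge0 ?divr_ge0 ?(ltW kap0) ?(ltW D0)//; have /andP[] := v01 1.
  by apply: ler_wpM2l; [rewrite divr_ge0// ltW|exact: hM].
have -> : C1 / N%:R * (kap / (2 * C1)) = kap / N%:R / 2 by field; rewrite !gt_eqF.
move=> h; have {}h : kap / N%:R / 2 <= D * ((kap / D) ^- M * v 1) by lra.
have e0 : 0 < (kap / D) ^+ M by rewrite exprn_gt0// divr_gt0.
rewrite (_ : _ / N%:R = kap / N%:R / 2 / D * (kap / D) ^+ M); last by field; rewrite !gt_eqF.
rewrite -ler_pdivlMr// ler_pdivrMr//; apply: le_trans h _.
by rewrite le_eqVlt; apply/orP; left; apply/eqP; rewrite mulrC [_^-1 * _]mulrC.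
Qed.

Section occupation.
Variable N : nat.

Definition strip : pred int := fun z => 0 < z < N%:Z.

Let C0 x : 0 < C x.
Proof. by have /andP[h _] := nice_C Hn x; exact: lt_le_trans kap0 h. Qed.

(* Reversibility: [C] is an excessive measure for the walk killed outside of
   the strip, so that the expected number of visits to [x] is at most
   [C x / C 0]. *)
Lemma occupation_le T (f : int -> R) : (0 < N)%N -> (forall x, 0 <= f x) ->
  C 0 * \sum_(j < T) iter j (killed p strip) f 0 <= \sum_(x < N) C x%:Z * f x%:Z.
Proof.
move=> N0; elim: T f => [|T IH] f f0.
  by rewrite big_ord0 mulr0; apply: sumr_ge0 => x _; rewrite mulr_ge0 ?(ltW (C0 _)).
have kE x : killed p strip f x = \sum_(y < N) ((0 < y)%N%:R * f y%:Z) * p x y%:Z.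
  rewrite -av_fsum /killed; congr av; apply/funext => z.
  case: ifPn => [/andP[z0 zN]|zs]; last first.
    rewrite big1// => y _; case: (eqVneq z y%:Z) => [zy|]; last by rewrite mulr0.
    have := ltn_ord y; move: zs; rewrite zy /strip => zs yN.
    by rewrite (_ : (0 < y)%N = false) ?mul0r//; lia.
  have zn : (`|z|%N < N)%N by lia.
  have zz : `|z|%N%:Z = z by lia.
  have z1 : (0 < `|z|)%N by lia.
  rewrite (bigD1 (Ordinal zn))//= big1 ?addr0; first by rewrite zz eqxx z1 mul1r mulr1.
  move=> y yz; case: (eqVneq z y%:Z) => [zy|]; last by rewrite mulr0.
  by case/eqP: yz; apply: val_inj => /=; lia.
have kf0 x : 0 <= killed p strip f x by apply: av_ge0 => y; case: ifP.
rewrite big_ord_recl mulrDr.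
have -> : \sum_(i < T) iter (lift ord0 i) (killed p strip) f 0 =
    \sum_(i < T) iter i (killed p strip) (killed p strip f) 0.
  by apply: eq_bigr => i _; rewrite -iterSr.
apply: le_trans (lerD (lexx _) (IH _ kf0)) _.
case: N N0 kE IH => // n _ kE _.
rewrite [leRHS]big_ord_recl/=; apply: lerD => //.
under eq_bigr => x _ do rewrite kE mulr_sumr.
rewrite exchange_big/= big_ord_recl/= big1 ?add0r; last by move=> x _; rewrite mul0r mul0r mulr0.
apply: ler_sum => y _; rewrite /bump leq0n add1n.
(* Detailed balance exchanges x and y; the sum over x of the transitions out of y is then at most
   1. *)
under eq_bigr => x _ do rewrite mul1r mulrCA (nice_ker Hn) (nice_sym Hn) -(nice_ker Hn).
rewrite -mulr_sumr -mulr_sumr [leRHS]mulrC; apply: ler_wpM2l => //.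
rewrite ler_piMr//; first exact: ltW.
apply: le_trans (_ : av p y.+1%:Z (fun z => \sum_(i < n.+1) 1 * (z == i%:Z)%:R) <= _).
  by rewrite av_fsum; apply: ler_sum => i _; rewrite mul1r.
rewrite -[leRHS](av_cst p y.+1%:Z); apply: le_av => [||z]; last 1 first.
- under eq_bigr do rewrite mul1r.
  apply: le_trans (_ : \sum_(j < n.+1) ((j == `|z|%N :> nat)%:R : R) <= 1); last first.
    by apply: sum_pred1_le => i j /val_inj.
  by apply: ler_sum => i _; rewrite ler_nat; case: (eqVneq z i%:Z) => [->|//]; rewrite /= eqxx.
- exists n.+1%:R => z; rewrite ger0_norm ?sumr_ge0//.
  rewrite -[X in _ <= X%:R]card_ord -sumr_const; apply: ler_sum => i _.
  by rewrite mul1r lern1 leq_b1.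
- exact: bnd_cst.
Qed.

(** T times the survival probability is at most the expected time in the strip, which
    [occupation_le] bounds by N D / kap. *)
Lemma survive_le T : (0 < N)%N -> (0 < T)%N ->
  survive p strip T 0 <= N%:R * D / (kap * T%:R).
Proof.
move=> N0 T0; have kap0' := kap0; have TR : 0 < T%:R :> R by rewrite ltr0n.
have /andP[C1 _] := nice_C Hn 0.
rewrite ler_pdivlMr ?mulr_gt0// mulrCA.
have s0 : 0 <= T%:R * survive p strip T 0.
  by rewrite mulr_ge0// (andP (survive01 p strip T 0)).1.
rewrite [_ * T%:R]mulrC; apply: le_trans (_ : C 0 * (T%:R * survive p strip T 0) <= _).
  exact: ler_wpM2r.
apply: le_trans (ler_wpM2l _ (survive_mul p strip T 0)) _; first exact: ltW.
apply: le_trans (occupation_le T N0 (fun=> ler01)) _.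
rewrite mulr_natl -[X in _ *+ X](card_ord N) -sumr_const; apply: ler_sum => x _.
by rewrite mulr1; have /andP[] := nice_C Hn x%:Z.
Qed.

End occupation.

(** Visits to x number at most C x / C 0 on average, and a jump from x beyond N + V has conductance
    at most t (N + V - x). Summing over x leaves the tail of the t j beyond V, at most 1 / V times
    the tail of the j t j: a bound small compared with 1 / V, whereas upward exits have probability
    at least of order 1 / N. *)
Lemma overshoot_le (eps : R) : 0 < eps -> exists M : nat, forall N V T : nat,
  (0 < N)%N -> (0 < V)%N -> (M <= V)%N ->
  exitn p (strip N) (fun y => ((N + V)%N%:Z <= y)%R%:R) T 0 <= eps / V%:R.
Proof.
move=> eps0; have kap0' := kap0.
have Cx x : 0 < C x by have /andP[h _] := nice_C Hn x; exact: lt_le_trans kap0 h.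
have t0 k : 0 <= t k.
  by apply: le_trans (nice_left Hn 0 k); rewrite mulr_ge0 ?av_ge0// ltW.
have ek : 0 < eps * kap by rewrite mulr_gt0.
have [M hM] := small_tail (a := fun j => j%:R * t j) (fun j => mulr_ge0 (ler0n _ _) (t0 j)) (nice_t1 Hn) ek.
exists M => N V T N0 V0 MV; have VR : 0 < V%:R :> R by rewrite ltr0n.
have phi01 (y : int) : 0 <= (((N + V)%N%:Z <= y)%R%:R : R) <= 1 by case: ((N + V)%N%:Z <= y)%R; rewrite ?lexx ?ler01.
rewrite exitn_sum//; set b := fun z => av p z _.
have b0 z : 0 <= b z by apply: av_ge0 => y; case: ifP => // _; have /andP[] := phi01 y.
have bt (x : nat) : (x < N)%N -> C x%:Z * b x%:Z <= t (N + V - x)%N.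
  move=> xN; apply: le_trans (nice_right Hn x%:Z (N + V - x)%N); apply: ler_wpM2l; first exact: ltW.
  apply: le_av => [||y]; [|exact: bnd_pred|].
    by apply: bnd01 => y; case: ifP => // _; rewrite lexx ler01.
  by case: ifP => _; [exact: ler0n|rewrite ler_nat; lia].
have occ := occupation_le T N0 b0; have /andP[C1 _] := nice_C Hn 0.
have k0 j z : 0 <= iter j (killed p (strip N)) b z.
  by elim: j z => [|j IHj] z //=; apply: av_ge0 => y; case: ifP.
set S := \sum_(j < T) _ in occ *; have S0 : 0 <= S by exact: sumr_ge0.
rewrite ler_pdivlMr// -(ler_pM2l kap0) [leRHS]mulrC.
apply: le_trans (hM (N + V).+1).
apply: le_trans (_ : (\sum_(x < N) C x%:Z * b x%:Z) * V%:R <= _).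
  by rewrite mulrA; apply: ler_wpM2r => //; apply: le_trans occ; exact: ler_wpM2r.
rewrite mulr_suml; apply: le_trans (_ : \sum_(x < N) (M <= N + V - x)%N%:R * ((N + V - x)%N%:R * t (N + V - x)%N) <= _).
  apply: ler_sum => x _; have xN := ltn_ord x.
  rewrite (_ : (M <= N + V - x)%N) ?mul1r; last by lia.
  rewrite mulrC; apply: ler_pM; rewrite ?mulr_ge0 ?(ltW (Cx _))//; last exact: bt.
  by rewrite ler_nat; lia.
pose G (j : nat) := (M <= j)%N%:R * (j%:R * t j).
have G0 j : 0 <= G j by rewrite !mulr_ge0.
rewrite -/(G _) (reindex_inj rev_ord_inj)/=.
rewrite (eq_bigr (fun j : 'I_N => G (V.+1 + j)%N)); last by move=> j _; congr G; have := ltn_ord j; lia.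
rewrite -(big_mkord xpredT (fun j => G (V.+1 + j)%N)) -(big_mkord xpredT G).
have VN : (V.+1 <= (N + V).+1)%N by lia.
rewrite [leRHS](big_cat_nat (leq0n V.+1) VN)/=.
apply: ler_wpDl; first by apply: sumr_ge0.
have := big_addn 0 (N + V).+1 V.+1 xpredT G; rewrite add0n => ->.
rewrite (_ : (N + V).+1 - V.+1 = N)%N; last by lia.
by apply: ler_sum_nat => j _; rewrite addnC.
Qed.



End hitting_bounds.


(** * The invariance principle, uniformly in the starting point *)

Section path_space.
Variable R : realType.
Implicit Types (f g z : R -> R) (K r : R).

Lemma C0_bounded f (n : nat) : {within [set t : R | 0 <= t], continuous f} ->
  exists M, forall t, 0 <= t <= n%:R -> `|f t| <= M.
Proof.
move=> cf.
have cn : {within `[0, n%:R], continuous (fun t => `|f t|)}.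
  have sub : `[0, n%:R]%classic `<=` [set t : R | 0 <= t].
    by move=> t /=; rewrite in_itv/= => /andP[].
  have cf' := continuous_subspaceW sub cf.
  by move=> t; apply: (cvg_norm (cf' t)).
have [c _ hc] := EVT_max (ler0n R n) cn.
by exists `|f c| => t tn; apply: hc; rewrite in_itv.
Qed.

Let gaps f g (n : nat) := [set `|f x - g x| | x in `[0, n%:R]].

Let gaps_sup f g n : {within [set t : R | 0 <= t], continuous f} ->
  {within [set t : R | 0 <= t], continuous g} -> has_sup (gaps f g n).
Proof.
move=> cf cg; have [M fM] := C0_bounded n cf; have [N gN] := C0_bounded n cg.
split; first by exists `|f 0 - g 0|, 0 => //=; rewrite in_itv/= lexx ler0n.
exists (M + N) => _ [t + <-]; rewrite /= in_itv/= => tn.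
by apply: le_trans (ler_normB _ _) _; apply: lerD; [exact: fM|exact: gN].
Qed.

Let term f g (n : nat) : R := 2 ^- n.-1 * Num.min 1 (sup (gaps f g n)).

Let sup_ge0 f g n : has_sup (gaps f g n) -> 0 <= sup (gaps f g n).
Proof.
move=> hs; apply: le_trans (normr_ge0 (f 0 - g 0)) (ub_le_sup hs.2 _).
by exists 0 => //=; rewrite in_itv/= lexx ler0n.
Qed.

Let geomE (N : nat) : \sum_(1 <= n < N.+1) 2 ^- n.-1 = 2 - 2 * 2 ^- N :> R.
Proof.
elim: N => [|N IH]; first by rewrite big_geq// expr0 invr1 mulr1 subrr.
by rewrite big_nat_recr//= IH exprS invfM; field; rewrite expf_neq0.
Qed.

Let geom_le (N : nat) : \sum_(1 <= n < N) 2 ^- n.-1 <= 2 :> R.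
Proof.
case: N => [|N]; first by rewrite big_geq.
by rewrite geomE lerBlDr lerDl mulr_ge0// invr_ge0 exprn_ge0.
Qed.

Let term_bound f g n : has_sup (gaps f g n) -> 0 <= term f g n <= 2 ^- n.-1.
Proof.
move=> hs; have e0 : 0 <= 2 ^- n.-1 :> R by rewrite invr_ge0 exprn_ge0.
rewrite mulr_ge0 ?le_min ?ler01 ?sup_ge0//=.
by rewrite ler_piMr// ge_min lexx.
Qed.

Section dist.
Variables (f g : R -> R).
Hypotheses (cf : {within [set t : R | 0 <= t], continuous f})
  (cg : {within [set t : R | 0 <= t], continuous g}).

Let S (N : nat) := \sum_(1 <= n < N) term f g n.

Let hs n : has_sup (gaps f g n). Proof. exact: gaps_sup. Qed.

Let ndS : nondecreasing_seq S.
Proof.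
apply/nondecreasing_seqP => -[|N]; first by rewrite /S !big_geq.
by rewrite {2}/S big_nat_recr//= lerDl; have /andP[] := term_bound (hs N.+1).
Qed.

Let cS : cvgn S.
Proof.
apply: nondecreasing_is_cvgn => //; exists 2 => _ [N _ <-].
apply: le_trans (geom_le N); apply: ler_sum => n _; by have /andP[] := term_bound (hs n).
Qed.

Lemma path_dist_close K r : 0 < r -> r <= 1 -> path_dist f g < 2 ^- (Num.truncn K) * r ->
  close K r f g.
Proof.
move=> r0 r1 d t /andP[t0 tK].
(* The first interval [0, n] of the series that contains [0, K]; its weight is 2 ^- n.-1. *)
set n := (Num.truncn K).+1.
have Sn : S n.+1 <= path_dist f g by exact: (nondecreasing_cvgn_le ndS cS).
have tn : term f g n <= S n.+1.
  rewrite /S big_nat_recr//= lerDr; apply: sumr_ge0 => i _; by have /andP[] := term_bound (hs i).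
have : term f g n < 2 ^- (Num.truncn K) * r by exact: le_lt_trans tn (le_lt_trans Sn d).
have e0 : 0 < 2 ^- (Num.truncn K) :> R by rewrite invr_gt0 exprn_gt0.
rewrite /term /= ltr_pM2l// gt_min => /orP[|sr]; first by rewrite ltNge r1.
apply: le_trans (ltW sr); apply: (ub_le_sup (hs n).2); exists t => //=.
by rewrite in_itv/= t0 (le_trans tK)// ltW// truncnS_gt.
Qed.

Lemma close_path_dist (N : nat) r : 0 <= r -> close N%:R r f g ->
  path_dist f g <= 2 * r + 2 * 2 ^- N.
Proof.
move=> r0 fg; apply: limr_le => //; apply: nearW => M.
have tr n : (n <= N)%N -> term f g n <= 2 ^- n.-1 * r.
  move=> nN; apply: ler_wpM2l; first by rewrite invr_ge0 exprn_ge0.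
  rewrite ge_min; apply/orP; right; apply: ge_sup; first by case: (hs n).
  move=> _ [t + <-]; rewrite /= in_itv/= => /andP[t0 tn]; apply: fg.
  by rewrite t0 (le_trans tn)// ler_nat.
have S1 m : (m <= N.+1)%N -> S m <= 2 * r.
  move=> mN; apply: le_trans (_ : (\sum_(1 <= n < m) 2 ^- n.-1) * r <= _); last by rewrite ler_wpM2r.
  rewrite mulr_suml; apply: ler_sum_nat => n /andP[_ nm]; apply: tr.
  by rewrite -ltnS (leq_trans nm).
have [MN|NM] := leqP M N.+1.
  by apply: le_trans (S1 _ MN) _; rewrite lerDl mulr_ge0// invr_ge0 exprn_ge0.
rewrite -/(S M) /S (big_cat_nat (n := N.+1))//=; last exact: ltnW.
apply: lerD; first exact: S1.
apply: le_trans (_ : \sum_(N.+1 <= n < M) 2 ^- n.-1 <= _).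
  by apply: ler_sum_nat => n _; have /andP[] := term_bound (hs n).
have := geom_le M; rewrite (big_cat_nat (n := N.+1))//=; last exact: ltnW.
by rewrite geomE; lra.
Qed.

End dist.

Lemma lipf_continuous_for K L Phi : lipf K L Phi ->
  continuous_for (@C0 R) (@path_dist R) Phi.
Proof.
move=> lP f [cf _] eps eps0; have [K0 L0 _ _] := lP.
pose r := Num.min 1 (eps / (2 * (L + 1))).
have L1 : 0 < 2 * (L + 1) by rewrite mulr_gt0// ltr_wpDl.
have r0 : 0 < r by rewrite lt_min ltr01 divr_gt0.
exists (2 ^- (Num.truncn K) * r); first by rewrite mulr_gt0// invr_gt0 exprn_gt0.
move=> g [cg _] d; have c := path_dist_close cf cg r0 (_ : r <= 1) d.
have {}c : close K r f g by apply: c; rewrite ge_min lexx.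
apply: le_lt_trans (lipf_dist lP (ltW r0) c) _.
have : r <= eps / (2 * (L + 1)) by rewrite ge_min lexx orbT.
rewrite ler_pdivlMr// => h; nra.
Qed.

End path_space.

Section rescaled.
Variables (R : realType) (sigma : R).
Implicit Types (s : nat -> int) (t : R).

(** In this form the interpolation is visibly Lipschitz on bounded intervals, across the grid points
    as well. *)
Lemma rescaled_sum (m n : nat) s t : 0 <= t -> m%:R * t < n%:R ->
  rescaled_path sigma m s t = ((s 0%N)%:~R + \sum_(j < n) clip 0 1 (m%:R * t - j%:R) *
     ((s j.+1)%:~R - (s j)%:~R)) / (sigma * Num.sqrt m%:R).
Proof.
move=> t0; set u := m%:R * t => un; have u0 : 0 <= u by rewrite mulr_ge0.
have /andP[k1 k2] := truncn_itv u0; rewrite /rescaled_path -/u; set k := Num.truncn u in k1 k2 *.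
congr (_ / _).
have S l : \sum_(j < l) clip 0 1 (u - j%:R) * ((s j.+1)%:~R - (s j)%:~R) =
    if (l <= k)%N then (s l)%:~R - (s 0%N)%:~R :> R
    else (s k)%:~R + (u - k%:R) * ((s k.+1)%:~R - (s k)%:~R) - (s 0%N)%:~R.
  elim: l => [|l IH]; first by rewrite big_ord0 subrr.
  rewrite big_ord_recr/= IH; have [kl|lk] := leqP l k; last first.
    rewrite leqNgt ltnS (ltnW lk)/= clip_lo ?mul0r ?addr0//.
    by rewrite subr_le0 (le_trans (ltW k2))// ler_nat.
  have [lk|kl'] := leqP l.+1 k.
    rewrite clip_hi ?mul1r; first by ring.
    by rewrite lerBrDl natr1 (le_trans _ k1)// ler_nat.
  have -> : l = k by apply/eqP; rewrite eqn_leq kl -ltnS kl'.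
  rewrite clip_id; first by ring.
  by rewrite subr_ge0 k1 lerBlDl natr1 ltW.
rewrite S ifF; first by ring.
by apply/negbTE; rewrite -ltnNge -(ltr_nat R); exact: le_lt_trans un.
Qed.

Lemma rescaled_continuous (m : nat) s : {within [set t : R | 0 <= t], continuous (rescaled_path sigma m s)}.
Proof.
apply/subspace_continuousP => t /= t0.
pose n := (Num.truncn (m%:R * (t + 1))).+1.
pose G x := ((s 0%N)%:~R + \sum_(j < n) clip 0 1 (m%:R * x - j%:R) *
     ((s j.+1)%:~R - (s j)%:~R)) / (sigma * Num.sqrt m%:R) : R.
have lG : exists L, forall x y, `|G x - G y| <= L * `|x - y|.
  exists (\sum_(j < n) `|m%:R| * `|(s j.+1)%:~R - (s j)%:~R| * `|(sigma * Num.sqrt m%:R)^-1|) => x y.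
  rewrite /G -mulrBl normrM opprD addrACA subrr add0r -sumrB.
  apply: le_trans (ler_wpM2r _ (ler_norm_sum _ _ _)) _ => //.
  rewrite !mulr_suml; apply: ler_sum => j _; rewrite -mulrBl normrM.
  rewrite [leRHS](_ : _ = `|m%:R| * `|x - y| * `|(s j.+1)%:~R - (s j)%:~R| * `|(sigma * Num.sqrt m%:R)^-1|); last by ring.
  do 2! apply: ler_wpM2r => //; apply: le_trans (lip_clip _ _ _ _) _.
  by rewrite -normrM mulrBr (_ : m%:R * x - j%:R - (m%:R * y - j%:R) = m%:R * x - m%:R * y)//; ring.
have [L hL] := lG.
have cG : continuous G := continuous_lip hL.
have fG x : 0 <= x -> x <= t + 1 -> rescaled_path sigma m s x = G x.
  move=> x0 xt; apply: rescaled_sum => //; apply: le_lt_trans (truncnS_gt _).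
  by rewrite ler_wpM2l.
rewrite /from_subspace fG//; last by rewrite lerDl.
apply/cvgrPdist_le => e e0; have /cvgrPdist_le/(_ e e0) h := cG t.
rewrite near_withinE; near=> x => x0; rewrite fG//; first by near: x; exact: h.
have : `|t - x| < 1 by near: x; exact: (@nbhsx_ballx _ _ t 1).
by rewrite ltr_norml => /andP[]; lra.
Unshelve. all: by end_near. Qed.

Lemma rescaled_at0 (m : nat) s : rescaled_path sigma m s 0 = (s 0%N)%:~R / (sigma * Num.sqrt m%:R).
Proof. by rewrite /rescaled_path mulr0 truncn0 subrr mul0r addr0. Qed.

Lemma rescaled_C0 (m : nat) s : s 0%N = 0 -> C0 (rescaled_path sigma m s).
Proof. by move=> s0; split; [exact: rescaled_continuous|rewrite rescaled_at0 s0 mul0r]. Qed.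

Lemma rescaled_shift (m i : nat) s t : (0 < m)%N -> 0 <= t ->
  rescaled_path sigma m s (i%:R / m%:R + t) = rescaled_path sigma m (shift i s) t.
Proof.
move=> m0 t0; have mR : 0 < m%:R :> R by rewrite ltr0n.
have mt : 0 <= m%:R * t by rewrite mulr_ge0.
rewrite /rescaled_path mulrDr mulrCA mulfV ?gt_eqF// mulr1.
have -> : Num.truncn (i%:R + m%:R * t) = (i + Num.truncn (m%:R * t))%N.
  apply: truncn_def; have /andP[h1 h2] := truncn_itv mt.
  by rewrite natrD lerD2l h1 -addnS natrD ltrD2l.
by rewrite /shift addnS natrD; congr (_ / _); ring.
Qed.

Lemma rescaled_grid (m i : nat) s : (0 < m)%N ->
  rescaled_path sigma m s (i%:R / m%:R) = (s i)%:~R / (sigma * Num.sqrt m%:R).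
Proof.
by move=> m0; rewrite -[i%:R / _]addr0 rescaled_shift// rescaled_at0 /shift addn0.
Qed.

Lemma depends_lipf K L Phi (m k : nat) : lipf K L Phi -> (Num.truncn (m%:R * K) < k)%N ->
  depends k (fun s => Phi (rescaled_path sigma m s)).
Proof.
move=> lP Kk s s' ss'; apply: (lipf_eq lP) => t /andP[t0 tK].
have le : (Num.truncn (m%:R * t) <= Num.truncn (m%:R * K))%N by apply: le_truncn; exact: ler_wpM2l.
by rewrite /rescaled_path !ss'//; [exact: leq_ltn_trans Kk|exact: ltnW (leq_ltn_trans le Kk)].
Qed.

(* The value of the polygonal path is a mean of the two neighbouring vertices. *)
Lemma rescaled_between (m : nat) s t (c : R) (x : int) : 0 < sigma -> (0 < m)%N -> 0 <= t ->
  let k := Num.truncn (m%:R * t) in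
  `|(s k)%:~R - x%:~R| <= c * (sigma * Num.sqrt m%:R) ->
  `|(s k.+1)%:~R - x%:~R| <= c * (sigma * Num.sqrt m%:R) ->
  `|rescaled_path sigma m s t - x%:~R / (sigma * Num.sqrt m%:R)| <= c.
Proof.
move=> s0 m0 t0 k; set X := (s k)%:~R; set Y := (s k.+1)%:~R; set D := sigma * _.
have D0 : 0 < D by rewrite mulr_gt0// sqrtr_gt0 ltr0n.
move=> hX hY; rewrite /rescaled_path -/k -/X -/Y -/D -mulrBl normrM [X in _ * X]gtr0_norm ?invr_gt0//.
rewrite ler_pdivrMr//; have /andP[k1 k2] := truncn_itv (mulr_ge0 (ler0n R m) t0).
rewrite -/k in k1 k2; set u := m%:R * t - k%:R.
have u0 : 0 <= u by rewrite subr_ge0.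
have u1 : u <= 1 by rewrite lerBlDl natr1 ltW.
rewrite (_ : X + u * (Y - X) - x%:~R = (1 - u) * (X - x%:~R) + u * (Y - x%:~R)); last by ring.
apply: le_trans (ler_normD _ _) _; rewrite !normrM (ger0_norm u0) ger0_norm ?subr_ge0//.
apply: le_trans (lerD (ler_wpM2l _ hX) (ler_wpM2l u0 hY)) _; first by rewrite subr_ge0.
by rewrite -mulrDl subrK mul1r.
Qed.

End rescaled.

Lemma outside_absz (y z : int) (L : nat) : (L <= `|z - y|%N)%N -> outside y L z.
Proof. by rewrite /outside; lia. Qed.

Lemma depends_reach (A B : pred int) k :
  forall s s' : nat -> int, (forall i, (i <= k)%N -> s i = s' i) -> reach A B k s = reach A B k s'.
Proof.
elim: k => [|k IH] s s' ss' /=; first by rewrite ss'.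
by rewrite ss'//; congr (_ || (_ && _)); apply: IH => i ik; apply: ss'.
Qed.

Lemma reachT (A B : pred int) k (s : nat -> int) i : (i <= k)%N -> A (s i) ->
  (forall j, (j < i)%N -> ~~ B (s j)) -> reach A B k s.
Proof.
elim: i k s => [|i IH] [|k] s //= ik Ai Bj; first by rewrite Ai.
  by rewrite Ai.
by rewrite Bj// (IH k (shift 1 s))// ?orbT// => j ji; exact: Bj.
Qed.

Section path_walk.
Variables (R : realType) (p : kernel R) (sigma : R).

(** One step more than the integer part of m K: the interpolation on [0, K] uses the next vertex. *)
Definition walk_exp (m : nat) (K : R) (y : int) (Phi : (R -> R) -> R) : R :=
  Ew p (Num.truncn (m%:R * K)).+1 y (fun s => Phi (rescaled_path sigma m s)).

Lemma walk_expE m K L Phi y k : lipf K L Phi -> (Num.truncn (m%:R * K) < k)%N ->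
  Ew p k y (fun s => Phi (rescaled_path sigma m s)) = walk_exp m K y Phi.
Proof.
by move=> lP kK; apply: Ew_depends => //; apply: depends_lipf lP _.
Qed.

End path_walk.

(** * Changing the starting point in the invariance principle *)

Section uniform_clt.
Context d (T : measurableType d) (R : realType) (P : probability T R).
Variables (W : 'I_3 -> R -> T -> R).
Hypothesis bmW : nice_bm P W.
Variables (w : int -> int -> R) (p : kernel R) (C : int -> R) (kap D0 : R) (q t : nat -> R).
Hypothesis Hn : nice w p C kap D0 q t.
Variable sigma : R.
Hypothesis sigma0 : 0 < sigma.
Hypothesis clt : forall K L Phi, lipf K L Phi ->
  walk_exp p sigma m K 0 Phi @[m --> \oo] --> expect P (fun b => Phi (W ord0 ^~ b)).

Let mW i u : measurable_fun setT (W i u). Proof. by have [] := bmW. Qed.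
Let cW b : continuous (W ord0 ^~ b). Proof. by have [_ _ cW _ _] := bmW; exact: cW. Qed.

Section bump.
Variables (x0 del : R).
Hypothesis del0 : 0 < del.

Definition bump1 (v : R) : R := clip 0 1 (1 - `|v - x0| / del).

Lemma bump1_01 v : 0 <= bump1 v <= 1.
Proof. by rewrite /bump1 clip_ge// clip_le. Qed.

Lemma bump1_out v : del <= `|v - x0| -> bump1 v = 0.
Proof. by move=> h; rewrite /bump1 clip_lo// subr_le0 ler_pdivlMr// mul1r. Qed.

Lemma lip_bump1 v v' : `|bump1 v - bump1 v'| <= del^-1 * `|v - v'|.
Proof.
apply: le_trans (lip_clip _ _ _ _) _.
rewrite (_ : 1 - _ - _ = del^-1 * (`|v' - x0| - `|v - x0|)); last by ring.
rewrite normrM gtr0_norm ?invr_gt0// ler_pM2l ?invr_gt0//; apply: le_trans (ler_dist_dist _ _) _.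
by rewrite (_ : v' - x0 - (v - x0) = - (v - v')) ?normrN//; ring.
Qed.

(** Positivity is extracted from the explicit mean of exponentials: a narrow exponential around x0,
    minus its value at distance del / 2, is dominated by twice the bump. *)
Lemma expect_bump1_gt0 : 0 < expect P (fun b => bump1 (W ord0 1 b)).
Proof.
have d0 := del0.
pose c := expR (x0 ^+ 2 / 2); have c0 : 0 < c := expR_gt0 _.
(* The subtracted value exp(- l del^2 / 8) decays exponentially in l while the mean decays like a
   power; this l is large enough for the mean to win. *)
pose l := 1 + 32 * c / (del / 2) ^+ 4.
have h2 : 0 < del / 2 by rewrite divr_gt0.
have l1 : 1 <= l by rewrite lerDl divr_ge0 ?mulr_ge0 ?exprn_ge0// ltW.
have l0 : 0 < l by exact: lt_le_trans l1.
pose e := gexp l (del / 2).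
have bg : bounded_meas (fun b => gexp l (- x0 + W ord0 1 b)).
  split; last by exists 1 => b; rewrite ger0_norm ?gexp_le1 ?gexp_ge0// ltW.
  apply: measurableT_comp; last by apply: measurable_funD.
  by apply: (@measurable_lip _ _ ((l + 2) / 2)) => y y'; apply: lip_gexp; exact: ltW.
have bb : bounded_meas (fun b => bump1 (W ord0 1 b)).
  split; last by exists 1 => b; have /andP[h0 h1] := bump1_01 (W ord0 1 b); rewrite ger0_norm.
  apply: measurableT_comp; last exact: mW.
  by apply: (@measurable_lip _ _ del^-1) => y y'; exact: lip_bump1.
have le b : gexp l (- x0 + W ord0 1 b) - e <= 2 * bump1 (W ord0 1 b).
  rewrite (addrC (- x0)); set v := W ord0 1 b - x0; have [h|h] := leP (del / 2) `|v|.
    apply: le_trans (_ : 0 <= _); last by have /andP[] := bump1_01 (W ord0 1 b); lra.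
    rewrite subr_le0 ler_expR; have : (del / 2) ^+ 2 <= v ^+ 2.
      by rewrite -[leRHS]real_normK ?num_real// lerXn2r ?nnegrE// ltW.
    by move=> hh; have := ler_wpM2l (ltW l0) hh; lra.
  have e0 : 0 <= e by exact: gexp_ge0.
  apply: le_trans (_ : 1 <= _); first by have := gexp_le1 v (ltW l0); lra.
  suff : 1 / 2 <= bump1 (W ord0 1 b) by lra.
  have hv : `|v| / del <= 1 / 2 by rewrite ler_pdivrMr//; lra.
  have nv : 0 <= `|v| / del by rewrite divr_ge0// ltW.
  rewrite /bump1 -/v clip_id; first lra.
  by apply/andP; split; lra.
have key := le_expect P (bounded_measB bg (bounded_meas_cst T e)) (bounded_measZ 2 bb) le.
move: key; rewrite (expectB P bg (bounded_meas_cst _ _)) (expectZ P _ bb) expect_cst.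
rewrite (expect_gexp_line bmW _ (ltW l0) ltr01) mulr1 => key.
suff : e < (Num.sqrt (1 + l))^-1 * gexp (l / (1 + l)) (- x0) by lra.
have g1 : c^-1 <= gexp (l / (1 + l)) (- x0).
  rewrite /c -expRN ler_expR sqrrN -mulNr ler_pM2r ?invr_gt0// lerN2 ler_piMl ?sqr_ge0//.
  by rewrite ler_pdivrMr; lra.
have s1 : Num.sqrt (1 + l) <= 1 + l.
  rewrite -[leRHS]ger0_norm; last by lra.
  rewrite -sqrtr_sqr ler_wsqrtr// expr2; nra.
have s0 : 0 < Num.sqrt (1 + l) by rewrite sqrtr_gt0; lra.
apply: lt_le_trans (_ : (1 + l)^-1 * c^-1 <= _); last first.
  apply: ler_pM => //; rewrite ?invr_ge0; try lra.
  by rewrite lef_pV2 ?posrE//; lra.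
rewrite -invfM /e /gexp mulNr expRN ltf_pV2 ?posrE ?expR_gt0//; last by rewrite mulr_gt0//; lra.
set y := l * (del / 2) ^+ 2 / 2.
have y0 : 0 <= y by rewrite divr_ge0// mulr_ge0 ?sqr_ge0// ltW.
have ey : (1 + y / 2) ^+ 2 <= expR y.
  rewrite [y in expR y]splitr expRD -expr2; apply: lerXn2r; rewrite ?nnegrE ?expR_ge0//.
    by rewrite addr_ge0// divr_ge0.
  exact: expR_ge1Dx.
apply: lt_le_trans ey; apply: lt_le_trans (_ : y ^+ 2 / 4 + 1 <= _); last first.
  by rewrite sqrrD expr1n; nra.
have : 2 * l * c <= y ^+ 2 / 4.
  have -> : y ^+ 2 / 4 = l * (l * (del / 2) ^+ 4) / 16 by rewrite /y; field.
  have : 32 * c <= l * (del / 2) ^+ 4.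
    by rewrite -ler_pdivrMr ?exprn_gt0// /l lerDr.
  by move=> hh; have := ler_wpM2l (ltW l0) hh; lra.
have : c * 1 <= c * l by rewrite ler_pM2l.
by lra.
Qed.

End bump.

Section local.
Variables (K L x0 s rho : R) (Phi : (R -> R) -> R).
Hypotheses (lP : lipf K L Phi) (s0 : 0 < s) (rho0 : 0 < rho).

(** The delay h stands for the unknown time at which the walk started at y' first visits y. *)
Definition inf_shift (z : R -> R) : R :=
  inf1 [set v | exists2 h, 0 <= h <= 2 * s & v = Phi (fun u => x0 + z (h + u))].

(** L del pays for the distance between x0 and the rescaled starting point. The ramp discards paths
    still near their start at time s, as happens when the walk has neither visited y nor left its
    neighbourhood. *)
Definition ftil (del : R) (z : R -> R) : R :=
  Num.max 0 (inf_shift z - L * del - ramp rho rho `|z s|).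

Let L0 : 0 <= L. Proof. by case: lP. Qed.
Let K0 : 0 <= K. Proof. by case: lP. Qed.
Let P01 z : 0 <= Phi z <= 1. Proof. by case: lP. Qed.

Let inf_pos z v : (exists2 h, 0 <= h <= 2 * s & v = Phi (fun u => x0 + z (h + u))) -> 0 <= v.
Proof. by move=> [h _ ->]; have /andP[] := P01 (fun u => x0 + z (h + u)). Qed.

Lemma inf_shift_le z h : 0 <= h <= 2 * s -> inf_shift z <= Phi (fun u => x0 + z (h + u)).
Proof. by move=> hs; apply: inf1_le; [exact: inf_pos|exists h]. Qed.

Lemma inf_shift01 z : 0 <= inf_shift z <= 1.
Proof. by rewrite inf1_ge0 ?inf1_le1//; exact: inf_pos. Qed.

Lemma inf_shift_lip z z' r : 0 <= r -> close (K + 2 * s) r z z' ->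
  inf_shift z <= inf_shift z' + L * r.
Proof.
move=> r0 c; rewrite -lerBlDr; apply: inf1_ge.
  have Lr : 0 <= L * r by rewrite mulr_ge0.
  by have /andP[] := inf_shift01 z; lra.
move=> v [h /andP[h0 hs] ->]; rewrite lerBlDr.
apply: le_trans (inf_shift_le z (_ : 0 <= h <= _)) _; first by rewrite h0.
case: lP => _ _ _; apply => // u /andP[u0 uK].
by rewrite opprD addrACA subrr add0r; apply: c; rewrite addr_ge0//=; lra.
Qed.

Lemma lipf_ftil del : 0 <= del -> lipf (K + 2 * s) (L + rho^-1) (ftil del).
Proof.
move=> d0; have s0' := s0; have K0' := K0; have L0' := L0; have ri : 0 < rho^-1 by rewrite invr_gt0.
split; [lra|by rewrite addr_ge0// ltW| |].
  move=> z; rewrite /ftil le_max lexx/= ge_max ler01/=.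
  have /andP[_ h1] := inf_shift01 z; have /andP[h2 _] := ramp01 rho rho `|z s|.
  have Ld : 0 <= L * del by rewrite mulr_ge0.
  by lra.
move=> z z' r r0 c; rewrite /ftil.
have h1 := inf_shift_lip r0 c.
have h2 : `|ramp rho rho `|z s| - ramp rho rho `|z' s| | <= rho^-1 * r.
  apply: le_trans (lip_ramp _ _ _ rho0) _; rewrite ler_pM2l//.
  apply: le_trans (ler_dist_dist _ _) _; apply: c; lra.
have Lr : 0 <= (L + rho^-1) * r by rewrite mulr_ge0// addr_ge0// ltW.
rewrite ge_max; apply/andP; split; first by rewrite addr_ge0// le_max lexx.
rewrite -lerBlDr le_max; apply/orP; right.
by move: h2; rewrite ler_norml mulrDl => /andP[]; lra.
Qed.

Lemma ftil_ge (del : R) z : Phi (fun u => x0 + z u) -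
    (oscf (K + 2 * s) L (2 * s) z + L * del + ramp rho rho `|z s|) <= ftil del z.
Proof.
have s0' := s0; have K0' := K0.
rewrite /ftil le_max; apply/orP; right.
suff : Phi (fun u => x0 + z u) - oscf (K + 2 * s) L (2 * s) z <= inf_shift z by lra.
have oscf0 : 0 <= oscf (K + 2 * s) L (2 * s) z.
  by have [_ _ /(_ z)/andP[]] := lipf_oscf (2 * s) (addr_ge0 K0 (mulr_ge0 (ler0n R 2) (ltW s0))) L0.
apply: inf1_ge; first by have /andP[_] := P01 (fun u => x0 + z u); lra.
move=> v [h /andP[h0 hs] ->].
rewrite lerBlDr -lerBlDl; apply: inf1_ge.
  have /andP[_] := P01 (fun u => x0 + z u).
  by have /andP[] := P01 (fun u => x0 + z (h + u)); lra.
move=> _ [u [u0 mod ->]]; rewrite lerBlDl.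
case: lP => _ _ _; apply => // y /andP[y0 yK].
rewrite opprD addrACA subrr add0r; apply: mod; rewrite ?y0 ?addr_ge0//=; try lra.
by rewrite (_ : y - (h + y) = - h) ?normrN ?ger0_norm//; ring.
Qed.

Variables (n : nat).
Let m := (n ^ 2)%N.
Let D := sigma * Num.sqrt (m%:R : R).
Hypothesis n0 : (0 < n)%N.

Let m0 : (0 < m)%N. Proof. by rewrite /m expn_gt0 n0. Qed.
Let mR : 0 < m%:R :> R. Proof. by rewrite ltr0n. Qed.
Let DE : D = sigma * n%:R.
Proof. by rewrite /D /m natrX sqrtr_sqr ger0_norm. Qed.
Let Dpos : 0 < D. Proof. by rewrite DE mulr_gt0// ltr0n. Qed.

(** No coupling is used. Within J steps the walk from y' visits y, where [Ew_first_hit] restarts it;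
    or it leaves the neighbourhood of y first, which is unlikely by [hit_outside_le]; or it does
    neither, and then [ftil] vanishes. *)
Lemma walk_ftil_le (del : R) (y y' : int) : 0 < del -> 8 * del < rho ->
  1 <= s * m%:R -> 4 <= rho * D ->
  `|y%:~R / D - x0| <= del -> `|y'%:~R / D - x0| <= del ->
  forall k, (Num.truncn (m%:R * (K + 2 * s)) < k)%N ->
  Ew p k y' (fun r => ftil del (fun u => rescaled_path sigma m r u - rescaled_path sigma m r 0)) <=
  walk_exp p sigma m K y Phi + Num.sqrt (64 * del * D0 / (kap * rho)).
Proof.
move=> d0 d8 sm rD yx yx' k kK.
have s0' := s0; have rho0' := rho0; have Dpos' := Dpos; have kap0 := nice_kap Hn; have D00 := nice_D_gt0 Hn.
pose J := (Num.truncn (m%:R * s)).+1.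
pose V := Num.truncn (rho * D / 2).
have /andP[V1 V2] : V%:R <= rho * D / 2 < V.+1%:R by apply: truncn_itv; lra.
rewrite -(natr1 V) in V2.
have VR : rho * D / 4 <= V%:R by lra.
have yy : `|y%:~R - y'%:~R| <= 2 * del * D.
  have -> : y%:~R - y'%:~R = ((y%:~R / D - x0) - (y'%:~R / D - x0)) * D :> R.
    by field; rewrite gt_eqF.
  rewrite normrM (gtr0_norm Dpos) ler_pM2r//; apply: le_trans (ler_normB _ _) _; lra.
have dV : 2 * del * D < V%:R.
  have h8 : 8 * del * D < rho * D by rewrite ltr_pM2r.
  by lra.
have yyV : (`|y' - y|%N < V)%N.
  by rewrite -(ltr_nat R) natr_absz intr_norm intrB distrC; exact: le_lt_trans yy dV.
pose G r := Phi (rescaled_path sigma m r).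
pose A := outside y V; pose B := pred1 y.
have G01 r : 0 <= G r <= 1 by exact: P01.
have pw r : r 0%N = y' -> ftil del (fun u => rescaled_path sigma m r u - rescaled_path sigma m r 0) <=
    first_hit y J G r + (reach A B J r)%:R.
  move=> r0; set z := fun u => _ - _.
  have [[i iJ [ri ->]]|[no ->]] := first_hit_cases y J G r.
    apply: ler_wpDr => //; have /andP[G0 _] := G01 (shift i r).
    rewrite /ftil ge_max G0/=; have /andP[q0 _] := ramp01 rho rho `|z s|.
    have h1 : 0 <= (i%:R / m%:R : R) <= 2 * s.
      rewrite divr_ge0//= ler_pdivrMr//.
      have : i%:R <= J%:R :> R by rewrite ler_nat.
      have /andP[hh _] := truncn_itv (mulr_ge0 (ltW mR) (ltW s0)).
      by rewrite /J -natr1; lra.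
    have h2 := inf_shift_le z h1.
    suff : Phi (fun u => x0 + z (i%:R / m%:R + u)) <= G (shift i r) + L * del by lra.
    case: lP => _ _ _; apply; first exact: ltW.
    move=> u /andP[u0 _]; rewrite /z rescaled_shift// rescaled_at0 r0 -/D.
    rewrite (_ : _ - _ = - (y'%:~R / D - x0)) ?normrN//; ring.
  rewrite add0r; have [hr|hr] := boolP (reach A B J r).
    by have [_ _ /(_ z)/andP[]] := lipf_ftil (ltW d0).
  have inside i : (i <= J)%N -> `|(r i)%:~R - y%:~R| <= V%:R :> R.
    move=> iJ; rewrite leNgt; apply: contra hr => hv; apply: (@reachT _ _ _ _ i) => //; last first.
      by move=> j ji; apply: no; exact: ltnW (leq_trans ji iJ).
    by apply: outside_absz; apply: ltnW; rewrite -(ltr_nat R) natr_absz intr_norm intrB.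
  rewrite /ftil ge_max lexx/=; have /andP[_ i1] := inf_shift01 z.
  have Ld : 0 <= L * del by rewrite mulr_ge0// ltW.
  rewrite ramp1//; first by lra.
  rewrite /z rescaled_at0 r0; apply: rescaled_between => //; first exact: ltW.
    have := inside _ (leqnSn _); rewrite -/D => h.
    apply: le_trans (ler_distD y%:~R _ _) _.
    have : 8 * del * D < rho * D by rewrite ltr_pM2r//; lra.
    by lra.
  have := inside _ (leqnn J); rewrite -/D => h.
  apply: le_trans (ler_distD y%:~R _ _) _.
  have h8 : 8 * del * D < rho * D by rewrite ltr_pM2r.
  by lra.
pose k0 := (Num.truncn (m%:R * K)).+1.
have dG : depends k0 G by exact: depends_lipf lP (ltnSn _).
have dF : depends k (fun r => ftil del (fun u => rescaled_path sigma m r u - rescaled_path sigma m r 0)).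
  move=> r r' rr'; apply: (lipf_eq (lipf_ftil (ltW d0))) => u /andP[u0 uK].
  have le : (Num.truncn (m%:R * u) <= Num.truncn (m%:R * (K + 2 * s)))%N.
    by apply: le_truncn; exact: ler_wpM2l.
  rewrite !rescaled_at0 (rr' 0%N)//; congr (_ - _).
  by rewrite /rescaled_path !rr'//; [exact: leq_ltn_trans kK|exact: ltnW (leq_ltn_trans le kK)].
have bF r : 0 <= ftil del (fun u => rescaled_path sigma m r u - rescaled_path sigma m r 0) <= 1.
  by have [_ _] := lipf_ftil (ltW d0); exact.
rewrite -(Ew_depends p y' (leq_addl (J + k0) k) dF).
have r01 r : 0 <= ((reach A B J r)%:R : R) <= 1 by case: (reach A B J r); rewrite ?lexx ?ler01.
have fh01 := bnd_first_hit y J G01.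
apply: le_trans (_ : Ew p (J + k0 + k) y' (fun r => first_hit y J G r + (reach A B J r)%:R) <= _).
  by apply: le_Ew; [exact: bnd01|apply: bndD; exact: bnd01|exact: pw].
rewrite EwD; [|exact: bnd01|exact: bnd01]; apply: lerD.
  rewrite -addnA; apply: le_trans (Ew_first_hit p y J y' G01 (dependsW (leq_addr k k0) dG)) _.
  by rewrite (walk_expE p sigma y lP)// ltn_addr.
have dR : depends J (fun r => ((reach A B J r)%:R : R)).
  by move=> r r' rr'; rewrite (depends_reach A B rr').
rewrite -addnA (Ew_depends p y' (leq_addr _ _) dR) Ew_reach.
apply: le_trans (hitn_le_hit p A B J y') _.
have h2 := hit_outside_le Hn yyV.
have /andP[h0 _] := hit01 p A B y'.
rewrite -[leLHS]ger0_norm// -sqrtr_sqr ler_wsqrtr//.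
apply: le_trans h2 _; have V0 : 0 < V%:R :> R by apply: lt_le_trans VR; lra.
rewrite natr_absz intr_norm intrB distrC ler_pdivrMr//.
apply: le_trans (_ : 2 * del * D * (8 * D0 / kap) <= _).
  by apply: ler_wpM2r => //; rewrite divr_ge0 ?mulr_ge0// ltW.
rewrite (_ : 2 * del * D * (8 * D0 / kap) = 64 * del * D0 / (kap * rho) * (rho * D / 4)); last first.
  by field; rewrite !gt_eqF.
by apply: ler_wpM2l => //; rewrite divr_ge0 ?mulr_ge0// ltW.
Qed.

End local.

Lemma lipf_bump1 x0 del : 0 < del -> lipf 1 del^-1 (fun z => bump1 x0 del (z 1)).
Proof.
move=> d0; split=> // [|z|z z' r r0 c]; first by rewrite invr_ge0 ltW.
  exact: bump1_01.
rewrite -lerBlDl; apply: le_trans (ler_norm _) _; apply: le_trans (lip_bump1 x0 d0 _ _) _.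
by rewrite ler_pM2l ?invr_gt0//; apply: c; rewrite ler01 lexx.
Qed.

Lemma expect_ramp_small s e : 0 < s -> 0 < e ->
  exists2 rho, 0 < rho & expect P (fun b => ramp rho rho `|W ord0 s b|) <= e.
Proof.
move=> s0 e0; pose l := 4 / (e ^+ 2 * s).
have l0 : 0 < l by rewrite divr_gt0// mulr_gt0// exprn_gt0.
pose rho := (2 * (1 + l))^-1; have rho0 : 0 < rho by rewrite invr_gt0 mulr_gt0// addr_gt0.
exists rho => //.
have bg : bounded_meas (fun b => gexp l (0 + W ord0 s b)).
  split; last by exists 1 => b; rewrite ger0_norm ?gexp_le1 ?gexp_ge0// ltW.
  apply: measurableT_comp; last by apply: measurable_funD.
  by apply: (@measurable_lip _ _ ((l + 2) / 2)) => y y'; apply: lip_gexp; exact: ltW.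
have br : bounded_meas (fun b => ramp rho rho `|W ord0 s b|).
  split; last by exists 1 => b; have /andP[h0 h1] := ramp01 rho rho `|W ord0 s b|; rewrite ger0_norm.
  apply: measurableT_comp; last by apply: measurableT_comp.
  by apply: (@measurable_lip _ _ rho^-1) => y y'; exact: lip_ramp.
have le b : ramp rho rho `|W ord0 s b| <= 2 * gexp l (0 + W ord0 s b).
  rewrite add0r; set v := W ord0 s b; have [h|h] := leP (rho + rho) `|v|.
    by rewrite ramp0// mulr_ge0// gexp_ge0.
  have /andP[_ r1] := ramp01 rho rho `|v|; apply: le_trans r1 _.
  have : 1 / 2 <= gexp l v; last lra.
  rewrite /gexp; apply: le_trans (expR_ge1Dx _).
  have : v ^+ 2 <= (rho + rho) ^+ 2.
    by rewrite -[leLHS]real_normK ?num_real// lerXn2r ?nnegrE// ?addr_ge0// ltW.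
  move=> /(ler_wpM2l (ltW l0)) hv; have : l * (rho + rho) ^+ 2 <= 1; last lra.
  have -> : l * (rho + rho) ^+ 2 = l / (1 + l) ^+ 2 by rewrite /rho; field; rewrite gt_eqF// addr_gt0.
  by rewrite ler_pdivrMr ?exprn_gt0 ?addr_gt0// sqrrD; nra.
apply: le_trans (le_expect P br (bounded_measZ 2 bg) le) _.
rewrite (expectZ P _ bg).
apply: le_trans (ler_wpM2l (ler0n R 2) (expect_gexp_line_le bmW 0 (ltW l0) s0)) _.
have ls : l * s = (2 / e) ^+ 2 by rewrite /l; field; rewrite !gt_eqF.
have h : 2 / e <= Num.sqrt (1 + l * s).
  have e2 : 0 <= 2 / e by rewrite divr_ge0// ltW.
  by rewrite -[leLHS]ger0_norm// -sqrtr_sqr ler_wsqrtr// ls lerDr.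
rewrite ler_pdivrMr ?(lt_le_trans _ h) ?divr_gt0//.
by move: h; rewrite ler_pdivrMr// mulrC.
Qed.

Lemma oscf_horizon (K K' L h : R) z : 0 <= K' <= K -> 0 <= L -> oscf K' L h z <= oscf K L h z.
Proof.
move=> /andP[K0 KK] L0; have pos A v : (exists u, [/\ 0 <= u, modulus z A h u & v = L * u]) -> 0 <= v.
  by move=> [u [u0 _ ->]]; rewrite mulr_ge0.
apply: inf1_ge; first by apply: inf1_le1; exact: pos.
move=> v [u [u0 mod ->]]; apply: inf1_le; first exact: pos.
exists u; split => // x y /andP[x0 xK] /andP[y0 yK]; apply: mod.
  by rewrite x0 (le_trans xK).
by rewrite y0 (le_trans yK).
Qed.

Definition restart (x0 del : R) (G : (R -> R) -> R) (z : R -> R) : R :=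
  bump1 x0 del (z 1) * G (fun u => z (1 + u) - z 1).

Lemma lipf_restart x0 del K L G : 0 < del -> lipf K L G ->
  lipf (1 + K) (del^-1 + L * 2) (restart x0 del G).
Proof.
move=> d0 [K0 L0 G01 GL]; split.
- by rewrite addr_ge0.
- by rewrite addr_ge0 ?mulr_ge0// invr_ge0 ltW.
- move=> z; have /andP[a0 a1] := bump1_01 x0 del (z 1).
  have /andP[b0 b1] := G01 (fun u => z (1 + u) - z 1).
  by rewrite mulr_ge0//= mulr_ile1.
move=> z z' r r0 c; rewrite /restart.
have c1 : `|z 1 - z' 1| <= r by apply: c; rewrite ler01 lerDl.
have h1 : bump1 x0 del (z 1) <= bump1 x0 del (z' 1) + del^-1 * r.
  rewrite -lerBlDl; apply: le_trans (ler_norm _) _; apply: le_trans (lip_bump1 x0 d0 _ _) _.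
  by rewrite ler_pM2l ?invr_gt0.
have h2 : G (fun u => z (1 + u) - z 1) <= G (fun u => z' (1 + u) - z' 1) + L * (r + r).
  apply: GL; first by rewrite addr_ge0.
  move=> u /andP[u0 uK]; 
  rewrite (_ : _ - _ = (z (1 + u) - z' (1 + u)) - (z 1 - z' 1)); last by ring.
  by apply: le_trans (ler_normB _ _) _; apply: lerD => //; apply: c; rewrite addr_ge0//= lerD2l.
have /andP[a0 a1] := bump1_01 x0 del (z 1); have /andP[a0' a1'] := bump1_01 x0 del (z' 1).
have /andP[b0 b1] := G01 (fun u => z (1 + u) - z 1).
have /andP[b0' b1'] := G01 (fun u => z' (1 + u) - z' 1).
have e1 : 0 <= del^-1 * r by rewrite mulr_ge0// invr_ge0 ltW.
have e2 : 0 <= L * (r + r) by rewrite mulr_ge0// addr_ge0.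
move: h1 h2 a0 a1 a0' a1' b0 b1 b0' b1' e1 e2.
move: (bump1 _ _ _) (bump1 _ _ _) (G _) (G _) => A A' B B'.
rewrite mulrDl; set E1 := del^-1 * r; have -> : L * 2 * r = L * (r + r) by ring.
set E2 := L * (r + r) => h1 h2 *.
apply: le_trans (_ : A' * (B + E2) <= _); first by rewrite ler_wpM2l.
apply: le_trans (_ : A' * B + E2 <= _); first by rewrite mulrDr lerD2l ler_piMl.
apply: le_trans (_ : (A + E1) * B + E2 <= _); first by rewrite lerD2r ler_wpM2r.
by rewrite mulrDl addrA lerD2r lerD2l ler_piMr.
Qed.

Lemma walk_restart_le x0 del K L G n c : 0 < del -> (0 < n)%N -> lipf K L G -> 0 <= c ->
  (forall y : int, `|y%:~R / (sigma * n%:R) - x0| < del ->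
    forall k, (Num.truncn ((n ^ 2)%:R * K) < k)%N -> Ew p k y (fun r =>
      G (fun u => rescaled_path sigma (n ^ 2) r u - rescaled_path sigma (n ^ 2) r 0)) <= c) ->
  walk_exp p sigma (n ^ 2) (1 + K) 0 (restart x0 del G) <=
  walk_exp p sigma (n ^ 2) 1 0 (fun z => bump1 x0 del (z 1)) * c.
Proof.
move=> d0 n0 lG c0 Gc; set m := (n ^ 2)%N.
have m0 : (0 < m)%N by rewrite /m expn_gt0 n0.
have mR : 0 < m%:R :> R by rewrite ltr0n.
have DE : sigma * Num.sqrt (m%:R : R) = sigma * n%:R by rewrite /m natrX sqrtr_sqr ger0_norm.
have K0 : 0 <= K by case: lG.
have G01 z : 0 <= G z <= 1 by case: lG.
pose l := (Num.truncn (m%:R * (1 + K))).+1.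
have one : m%:R / m%:R = 1 :> R by rewrite divff// gt_eqF.
have at1 s : rescaled_path sigma m s 1 = (s m)%:~R / (sigma * n%:R) by have := rescaled_grid sigma m s m0; rewrite one DE.
rewrite -(walk_expE p sigma 0 (lipf_restart x0 d0 lG) (_ : _ < m + l)%N); last by rewrite /l addnS ltnS leq_addl.
rewrite Ew_markov -(walk_expE p sigma 0 (lipf_bump1 x0 d0) (_ : _ < m + 1)%N); last first.
  by rewrite mulr1 natrK addn1.
have -> : Ew p (m + 1) 0 (fun s => bump1 x0 del (rescaled_path sigma m s 1)) =
    Ew p m 0 (fun s => bump1 x0 del ((s m)%:~R / (sigma * n%:R))).
  rewrite (@eq_Ew _ _ _ _ _ (fun s => bump1 x0 del ((s m)%:~R / (sigma * n%:R)))); last by move=> s _; rewrite at1.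
  by apply: Ew_depends; [exact: leq_addr|move=> s s' ss'; rewrite ss'].
rewrite mulrC -EwZ; last by apply: bnd01 => s; exact: bump1_01.
apply: le_Ew.
- apply: bnd01 => s; apply: Ew01 => s'; rewrite /restart.
  have /andP[a0 a1] := bump1_01 x0 del (rescaled_path sigma m (splice m s s') 1).
  have /andP[g0 g1] := G01 (fun u => rescaled_path sigma m (splice m s s') (1 + u) - rescaled_path sigma m (splice m s s') 1).
  by rewrite mulr_ge0//= mulr_ile1.
- by apply: bndZ; apply: bnd01 => s; exact: bump1_01.
move=> s _.
have -> : Ew p l (s m) (fun s' => restart x0 del G (rescaled_path sigma m (splice m s s'))) =
   bump1 x0 del ((s m)%:~R / (sigma * n%:R)) * Ew p l (s m) (fun r =>
      G (fun u => rescaled_path sigma m r u - rescaled_path sigma m r 0)).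
  rewrite -EwZ; last by apply: bnd01.
  apply: eq_Ew => s' s'0; rewrite /restart at1 {1}/splice ltnn subnn s'0; congr (_ * _).
  apply: (lipf_eq lG) => u /andP[u0 _].
  rewrite rescaled_at0 DE {2}/splice ltnn subnn; congr (_ - _).
  have := rescaled_shift sigma m (splice m s s') m0 u0; rewrite one => ->.
  congr rescaled_path; apply/funext => i; rewrite /shift /splice.
  by rewrite ltnNge leq_addr/= addKn.
have /andP[b0 _] := bump1_01 x0 del ((s m)%:~R / (sigma * n%:R)).
have [h|h] := ltP `|(s m)%:~R / (sigma * n%:R) - x0| del; last by rewrite bump1_out// mul0r mulr0.
rewrite [leRHS]mulrC; apply: ler_wpM2l => //; apply: Gc => //.
by rewrite /l ltnS; apply: le_truncn; apply: ler_wpM2l; rewrite ?lerDr// ltW.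
Qed.

(** A bump selects walks from 0 that are near x0 at time 1. The Brownian side factorizes by
    [bm_markov]; on the walk side every restarting point is compared with the single point y by
    [walk_ftil_le]. Division by A, the positive mean of the bump, leaves the expectation from y. *)
Lemma uniform_clt K L Phi x0 eta : lipf K L Phi -> 0 < eta ->
  exists2 del, 0 < del & \forall n \near \oo, forall y : int,
    `|y%:~R / (sigma * n%:R) - x0| <= del ->
    expect P (fun b => Phi (fun u => x0 + W ord0 u b)) - eta <= walk_exp p sigma (n ^ 2) K y Phi.
Proof.
move=> lP eta0; have [K0 L0 P01 _] := lP.
have [kap0 D00] := (nice_kap Hn, nice_D_gt0 Hn).
pose e := Num.min 1 eta / 8.
have e0 : 0 < e by rewrite divr_gt0// lt_min ltr01.
have e1 : e <= 1 / 8 by rewrite ler_pM2r ?invr_gt0// ge_min lexx.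
have e8 : 8 * e <= eta by rewrite mulrC divfK ?gt_eqF// ge_min lexx orbT.
have K10 : 0 <= K + 1 by rewrite addr_ge0.
have [N oN] : exists N, expect P (fun b => oscf (K + 1) L N.+1%:R^-1 (W ord0 ^~ b)) <= e.
  have /cvgrPdist_le/(_ _ e0)[N _ /(_ N (leqnn _))] := expect_oscf_cvg0 P (mW ord0) cW K10 L0.
  by rewrite /= sub0r normrN => h; exists N; apply: le_trans (ler_norm _) h.
pose s : R := N.+1%:R^-1 / 2; have s0 : 0 < s by rewrite divr_gt0 ?invr_gt0.
have s2 : 2 * s = N.+1%:R^-1 by rewrite mulrC divfK.
have s21 : 2 * s <= 1 by rewrite s2 invf_le1 ?ler1n.
have [rho rho0 hrho] := expect_ramp_small s0 e0.
(* The three terms make L del, the error of [walk_ftil_le], and the ratio of del to rho small, in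
   this order. *)
pose del := Num.min (e / (L + 1)) (Num.min (e ^+ 2 * (kap * rho) / (64 * D0)) (rho / 16)).
have L10 : 0 < L + 1 by rewrite ltr_wpDl.
have kr0 : 0 < kap * rho by rewrite mulr_gt0.
have D64 : 0 < 64 * D0 by rewrite mulr_gt0.
have d0 : 0 < del by rewrite !lt_min (divr_gt0 e0 L10) (divr_gt0 (mulr_gt0 (exprn_gt0 2 e0) kr0) D64) divr_gt0.
have d1 : L * del <= e.
  have : del <= e / (L + 1) by rewrite ge_min lexx.
  rewrite ler_pdivlMr// mulrDr mulr1 mulrC; have := ltW d0; lra.
have d2 : Num.sqrt (64 * del * D0 / (kap * rho)) <= e.
  rewrite -[leRHS]ger0_norm ?(ltW e0)// -sqrtr_sqr ler_wsqrtr// ler_pdivrMr//.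
  have : del <= e ^+ 2 * (kap * rho) / (64 * D0) by rewrite !ge_min lexx orbT.
  by rewrite ler_pdivlMr//; apply: le_trans; rewrite le_eqVlt; apply/orP; left; apply/eqP; ring.
have d3 : 8 * del < rho.
  have : del <= rho / 16 by rewrite !ge_min lexx !orbT.
  lra.
exists del => //.
pose G := ftil L x0 s rho Phi del.
have lG : lipf (K + 2 * s) (L + rho^-1) G by exact: lipf_ftil (ltW d0).
pose A := expect P (fun b => bump1 x0 del (W ord0 1 b)).
have A0 : 0 < A by exact: expect_bump1_gt0.
have cA := clt (lipf_bump1 x0 d0).
have := clt (lipf_restart x0 d0 lG).
rewrite /restart (bm_markov bmW ord0 lG (_ : 0 <= del^-1) (_ : forall v, `|bump1 x0 del v| <= 1)); last first.
- by move=> x y; exact: lip_bump1.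
- by move=> v; have /andP[a0 a1] := bump1_01 x0 del v; rewrite ger0_norm.
- by rewrite invr_ge0 ltW.
rewrite -/A -/(restart _ _ _) => cG.
have Ae : 0 < A * e by rewrite mulr_gt0.
have sq : (n ^ 2)%N @[n --> \oo] --> \oo.
  by apply/cvgnyPge => M; exists M => // n /= Mn; apply: leq_trans Mn _; rewrite expnS expn1; case: n => // n; rewrite mulSn leq_addr.
(* The three losses in [ftil_ge], from the delay, from L del and from the ramp, are at most e
   each. *)
have lo : expect P (fun b => Phi (fun u => x0 + W ord0 u b)) - 3 * e <= expect P (fun b => G (W ord0 ^~ b)).
  have mx u : measurable_fun setT (fun b => x0 + W ord0 u b) by exact: measurable_funD.
  have cx b : continuous (fun u => x0 + W ord0 u b) by move=> u; apply: cvgD; [exact: cvg_cst|exact: cW].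
  have bP : bounded_meas (fun b => Phi (fun u => x0 + W ord0 u b)) := bounded_meas_lipf P mx cx lP.
  have bG := bounded_meas_lipf P (mW ord0) cW lG.
  have bO := bounded_meas_lipf P (mW ord0) cW (lipf_oscf (2 * s) (addr_ge0 K0 (mulr_ge0 (ler0n R 2) (ltW s0))) L0).
  have bO1 := bounded_meas_lipf P (mW ord0) cW (lipf_oscf (2 * s) K10 L0).
  have br : bounded_meas (fun b => ramp rho rho `|W ord0 s b|).
    split; last by exists 1 => b; have /andP[h0 h1] := ramp01 rho rho `|W ord0 s b|; rewrite ger0_norm.
    apply: measurableT_comp; last by apply: measurableT_comp.
    by apply: (@measurable_lip _ _ rho^-1) => y y'; exact: lip_ramp.
  have bc := bounded_meas_cst T (L * del).
  have := le_expect P (bounded_measB bP (bounded_measD (bounded_measD bO bc) br)) bG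
    (fun b => ftil_ge x0 rho lP s0 del (W ord0 ^~ b)).
  rewrite (expectB P bP (bounded_measD (bounded_measD bO bc) br)) (expectD P (bounded_measD bO bc) br).
  rewrite (expectD P bO bc) expect_cst.
  have : expect P (fun b => oscf (K + 2 * s) L (2 * s) (W ord0 ^~ b)) <= e.
    apply: le_trans oN; rewrite -s2; apply: le_expect => // b.
    by apply: oscf_horizon => //; rewrite lerD2l s21 addr_ge0// mulr_ge0// ltW.
  lra.
have evA : \forall n \near \oo, walk_exp p sigma (n ^ 2) 1 0 (fun z => bump1 x0 del (z 1)) <= A + A * e.
  have /(cvg_comp _ _ sq)/cvgrPdist_le/(_ _ Ae) := cA.
  by apply: filterS => n; rewrite ler_norml -/A /= => /andP[]; lra.
have evG : \forall n \near \oo, A * expect P (fun b => G (W ord0 ^~ b)) - A * e <=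
    walk_exp p sigma (n ^ 2) (1 + (K + 2 * s)) 0 (restart x0 del G).
  have /(cvg_comp _ _ sq)/cvgrPdist_le/(_ _ Ae) := cG.
  by apply: filterS => n; rewrite ler_norml /= => /andP[]; lra.
have ev1 : \forall n \near \oo, (1 <= s * (n ^ 2)%:R) && (4 <= rho * (sigma * n%:R)) && (0 < n)%N.
  exists (Num.truncn (s^-1 + 4 / (rho * sigma))).+1 => // n /= hn.
  have n0 : (0 < n)%N by exact: leq_trans hn.
  have rs : 0 < rho * sigma by rewrite mulr_gt0.
  have si : 0 < s^-1 by rewrite invr_gt0.
  have fi : 0 < 4 / (rho * sigma) by rewrite divr_gt0.
  have : s^-1 + 4 / (rho * sigma) <= n%:R.
    apply: ltW; apply: lt_le_trans (truncnS_gt _) _; by rewrite ler_nat.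
  move=> h; rewrite n0 andbT; apply/andP; split.
    have n1 : 1 <= n%:R :> R by rewrite ler1n.
    have : s^-1 <= (n ^ 2)%:R.
      apply: le_trans (_ : n%:R <= _); first lra.
      by rewrite natrX expr2 ler_peMr.
    by rewrite -[X in X <= _]mulr1 ler_pdivrMl.
  rewrite mulrA [rho * sigma * _]mulrC -ler_pdivrMr//; lra.
apply: filterS3 evA evG ev1 => n hA hG /andP[/andP[h1 h2] n0] y yx.
have DE : sigma * Num.sqrt ((n ^ 2)%:R : R) = sigma * n%:R by rewrite natrX sqrtr_sqr ger0_norm.
pose wk := walk_exp p sigma (n ^ 2) K y Phi; rewrite -/wk.
have wk0 : 0 <= wk by apply: Ew_ge0 => r; have /andP[] := P01 (rescaled_path sigma (n ^ 2) r).
have wk1 : wk <= 1 by have /andP[] : 0 <= wk <= 1 by apply: Ew01 => r; exact: P01.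
have := walk_restart_le d0 n0 lG (_ : 0 <= wk + e) _.
move=> /(_ _ (addr_ge0 wk0 (ltW e0))) kk.
have : walk_exp p sigma (n ^ 2) (1 + (K + 2 * s)) 0 (restart x0 del G) <= (A + A * e) * (wk + e).
  apply: le_trans (kk x0 _) _.
    move=> y' yx' k hk; apply: le_trans (walk_ftil_le lP s0 rho0 n0 d0 d3 h1 _ _ _ hk) _; rewrite ?DE//.
      exact: yx.
      exact: ltW.
    by rewrite lerD2l.
  by rewrite ler_wpM2r// addr_ge0// ltW.
move=> /(le_trans hG).
rewrite (_ : (A + A * e) * (wk + e) = A * ((1 + e) * (wk + e))); last by ring.
rewrite -mulrBr ler_pM2l// => h.
have : e * wk <= e * 1 by rewrite ler_pM2l.
have : e * e <= e * 1 by rewrite ler_pM2l//; lra.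
by rewrite mulrDr !mulrDl !mul1r in h; lra.
Qed.

End uniform_clt.

(** * Maxima of the radial process *)

Section top.
Variable R : realType.
Implicit Types (z : R -> R) (p q c : R).

(** A Lipschitz function of the maximum of z on [p, q]. For continuous z and c = a + 1/2 it equals
    1/2 exactly when this maximum is a. *)
Definition top p q c z : R := inf1 [set v | exists2 t, p <= t <= q & v = clip 0 1 (c - z t)].

Let top_pos p q c z v : (exists2 t, p <= t <= q & v = clip 0 1 (c - z t)) -> 0 <= v.
Proof. by move=> [t _ ->]; exact: clip_ge. Qed.

Lemma top_le p q c z t : p <= t <= q -> top p q c z <= clip 0 1 (c - z t).
Proof. by move=> pq; apply: inf1_le; [exact: top_pos|exists t]. Qed.

Lemma top01 p q c z : 0 <= top p q c z <= 1.
Proof. by rewrite inf1_ge0 ?inf1_le1//; exact: top_pos. Qed.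

Lemma lipf_top p q c : 0 <= p -> 0 <= q -> lipf q 1 (top p q c).
Proof.
move=> p0 q0; split=> // [z|z z' r r0 zz']; first exact: top01.
rewrite mul1r -lerBlDr; apply: inf1_ge; first by have /andP[] := top01 p q c z; lra.
move=> v [t /andP[pt tq] ->]; rewrite lerBlDr.
apply: le_trans (top_le c z (_ : p <= t <= q)) _; first by rewrite pt.
rewrite -lerBlDl; apply: le_trans (ler_norm _) _; apply: le_trans (lip_clip _ _ _ _) _.
rewrite (_ : _ - _ = - (z t - z' t)) ?normrN; last by ring.
by apply: zz'; rewrite (le_trans p0).
Qed.

Lemma eq_top p q c z z' : (forall t, p <= t <= q -> z t = z' t) -> top p q c z = top p q c z'.
Proof.
move=> zz'; congr inf1; apply/seteqP; split => v [t pq ->]; exists t => //; by rewrite zz'.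
Qed.

Lemma top_lt p q c z v : v <= 1 -> top p q c z < v -> exists2 t, p <= t <= q & c - v < z t.
Proof.
move=> v1 zv; apply: contrapT => h; move: zv; apply/negP; rewrite -leNgt.
apply: inf1_ge => // _ [t pq ->]; have : z t <= c - v.
  by rewrite leNgt; apply: contra_notN h => h; exists t.
move=> zt; apply: le_trans (_ : clip 0 1 v <= _); first by rewrite /clip le_min le_max lexx v1.
by rewrite /clip le_min !ge_min !ge_max !le_max !lexx ?orbT ?andbT /= orbC -implyNb; apply/implyP => _; rewrite lerBrDl -lerBrDr zt.
Qed.

Lemma lt_top p q c z v t : 0 <= v -> v < top p q c z -> p <= t <= q -> z t < c - v.
Proof.
move=> v0 h pq; have := lt_le_trans h (top_le c z pq).
rewrite /clip lt_min lt_max => /andP[/orP[h1|v0'] _]; first by rewrite ltrBrDl -ltrBrDr.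
by move: v0; rewrite leNgt v0'.
Qed.

Definition near_half (del v : R) : R := clip 0 1 (2 - `|v - 1 / 2| / del).

Lemma near_half01 del v : 0 <= near_half del v <= 1.
Proof. by rewrite /near_half clip_ge// clip_le. Qed.

Lemma near_half_half del : near_half del (1 / 2) = 1.
Proof. by rewrite /near_half subrr normr0 mul0r clip_hi//; lra. Qed.

Lemma near_half_out del v : 0 < del -> 2 * del <= `|v - 1 / 2| -> near_half del v = 0.
Proof. by move=> d0 h; rewrite /near_half clip_lo// subr_le0 ler_pdivlMr. Qed.

Lemma lipf_near_half K del Phi : 0 < del -> lipf K 1 Phi -> lipf K del^-1 (fun z => near_half del (Phi z)).
Proof.
move=> d0 lP; have [K0 _ P01 _] := lP.
split=> // [|z|z z' r r0 c]; first by rewrite invr_ge0 ltW.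
  exact: near_half01.
rewrite -lerBlDl; apply: le_trans (ler_norm _) _; apply: le_trans (lip_clip _ _ _ _) _.
rewrite (_ : _ - _ = del^-1 * (`|Phi z' - 1 / 2| - `|Phi z - 1 / 2|)); last by ring.
rewrite normrM gtr0_norm ?invr_gt0// ler_pM2l ?invr_gt0//.
apply: le_trans (ler_dist_dist _ _) _.
rewrite (_ : _ - _ = - (Phi z - Phi z')) ?normrN; last by ring.
by have := lipf_dist lP r0 c; rewrite mul1r.
Qed.

End top.

(** * The maximum as a function of one Gaussian variable *)

Section gaussian_interval.
Variable R : realType.

Lemma normal_peak_le (s : R) : 0 < s -> normal_peak s <= s^-1.
Proof.
move=> s0; rewrite /normal_peak lef_pV2 ?posrE ?sqrtr_gt0//.
  rewrite -[leLHS]ger0_norm ?(ltW s0)// -sqrtr_sqr ler_wsqrtr// -mulr_natr -mulrA ler_peMr ?sqr_ge0//.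
  by have := pi_ge2 R; lra.
by rewrite mulrn_wgt0// mulr_gt0 ?pi_gt0// exprn_gt0.
Qed.

Lemma expect_gauss_itv (s u rho : R) : 0 < s -> 0 <= rho ->
  expect (gauss_law s) (\1_(`[u, u + rho]%classic)) <= rho / s.
Proof.
move=> s0 rho0.
have s00 : s != 0 by rewrite gt_eqF.
rewrite /expect integral_indic//= setIT /gauss_law /normal_prob.
have le : (\int[lebesgue_measure]_(x in `[u, (u + rho)%R]) (normal_pdf 0 s x)%:E <= (s^-1 * rho)%:E)%E.
  apply: le_trans (_ : (\int[lebesgue_measure]_(x in `[u, (u + rho)%R]) (s^-1)%:E <= _)%E); last first.
    rewrite integral_cst//= lebesgue_measure_itv/= lte_fin.
    have [h|h] := ltP u (u + rho); first by rewrite -EFinB addrAC subrr add0r -EFinM.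
    by rewrite mule0 lee_fin mulr_ge0// invr_ge0 ltW.
  apply: ge0_le_integral => //=.
  - by move=> x _; rewrite lee_fin normal_pdf_ge0.
  - by apply/measurable_EFinP; apply: measurable_funTS; exact: measurable_normal_pdf.
  - by move=> x _; rewrite lee_fin; apply: le_trans (normal_pdf_ub _ _ s00) (normal_peak_le s0).
have ge : (0 <= \int[lebesgue_measure]_(x in `[u, (u + rho)%R]) (normal_pdf 0 s x)%:E)%E.
  by apply: integral_ge0 => x _; rewrite lee_fin normal_pdf_ge0.
rewrite -lee_fin fineK; first by rewrite mulrC.
by rewrite ge0_fin_numE//; apply: le_lt_trans le _; rewrite ltry.
Qed.

(* [y |-> (y + A t)^2 + B t] is strongly convex, so the values of [y] where the
   maximum over [t] is within [2 del] of [a] lie in two short intervals. *)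
Lemma gauss_top_le (p q a del s : R) (A B : R -> R) : p <= q -> 0 < s -> 0 < del ->
  2 * del < 1 / 2 -> 2 * del <= a -> (forall t, 0 <= B t) ->
  let f y := near_half del (top p q (a + 1 / 2) (fun t => Num.sqrt ((y + A t) ^+ 2 + B t))) in
  bounded_meas f ->
  expect (gauss_law s) f <= 4 * Num.sqrt (8 * a * del) / s.
Proof.
move=> pq s0 d0 d1 da B0 f bf.
pose n y t := Num.sqrt ((y + A t) ^+ 2 + B t).
pose G y := top p q (a + 1 / 2) (n y).
pose S := [set y | `|G y - 1 / 2| < 2 * del].
have f0 y : ~ S y -> f y = 0.
  by move=> /negP; rewrite -leNgt => h; apply: near_half_out.
have n2 y t : n y t ^+ 2 = (y + A t) ^+ 2 + B t by rewrite sqr_sqrtr// addr_ge0// sqr_ge0.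
have n0 y t : 0 <= n y t by exact: sqrtr_ge0.
have up y t : S y -> p <= t <= q -> n y t < a + 2 * del.
  rewrite /S /= ltr_norml => /andP[h _] tpq.
  have := @lt_top _ p q (a + 1 / 2) (n y) (1 / 2 - 2 * del) t _ _ tpq; rewrite -/(G y).
  by move=> hh; have := hh _ _; lra.
have lo y : S y -> exists2 t, p <= t <= q & a - 2 * del < n y t.
  rewrite /S /= ltr_norml => /andP[_ h].
  have [||t tpq tt] := @top_lt _ p q (a + 1 / 2) (n y) (1 / 2 + 2 * del).
  - lra.
  - rewrite -/(G y); lra.
  - exists t => //; lra.
pose rho := Num.sqrt (8 * a * del).
have a0 : 0 < a by lra.
have rho0 : 0 < rho by rewrite sqrtr_gt0 !mulr_gt0.
have rho2 : rho ^+ 2 = 8 * a * del by rewrite sqr_sqrtr// ltW// !mulr_gt0.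
(* At a time t nearly maximal for y2, strong convexity in y would force a gap of at least rho^2 = 8
   a del between squares lying strictly between (a - 2 del)^2 and (a + 2 del)^2, whose difference is
   exactly 8 a del. *)
have three y1 y2 y3 : S y1 -> S y2 -> S y3 -> y1 + rho <= y2 -> y2 + rho <= y3 -> False.
  move=> S1 S2 S3 h1 h3; have [t tpq lt2] := lo _ S2.
  have u1 := up _ _ S1 tpq; have u3 := up _ _ S3 tpq.
  have e1 : n y1 t ^+ 2 < (a + 2 * del) ^+ 2 by rewrite ltrXn2r ?nnegrE//; lra.
  have e3 : n y3 t ^+ 2 < (a + 2 * del) ^+ 2 by rewrite ltrXn2r ?nnegrE//; lra.
  have e2 : (a - 2 * del) ^+ 2 < n y2 t ^+ 2 by rewrite ltrXn2r ?nnegrE//; lra.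
  rewrite !n2 in e1 e2 e3.
  have i1 : 0 < y2 - y1 by lra.
  have i3 : 0 < y3 - y2 by lra.
  have g1 : (y3 - y2) * ((y1 + A t) ^+ 2 + B t) < (y3 - y2) * (a + 2 * del) ^+ 2 by rewrite ltr_pM2l.
  have g3 : (y2 - y1) * ((y3 + A t) ^+ 2 + B t) < (y2 - y1) * (a + 2 * del) ^+ 2 by rewrite ltr_pM2l.
  have g2 : (y3 - y1) * (a - 2 * del) ^+ 2 < (y3 - y1) * ((y2 + A t) ^+ 2 + B t) by rewrite ltr_pM2l//; lra.
  have : (y3 - y1) * ((y2 - y1) * (y3 - y2)) < (y3 - y1) * (8 * a * del).
    rewrite (_ : 8 * a * del = (a + 2 * del) ^+ 2 - (a - 2 * del) ^+ 2); last by ring.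
    rewrite (_ : _ * (_ * _) = (y3 - y2) * ((y1 + A t) ^+ 2 + B t) +
      (y2 - y1) * ((y3 + A t) ^+ 2 + B t) - (y3 - y1) * ((y2 + A t) ^+ 2 + B t)); last by ring.
    rewrite (_ : (y3 - y1) * ((a + 2 * del) ^+ 2 - (a - 2 * del) ^+ 2) = (y3 - y2) * (a + 2 * del) ^+ 2 +
      (y2 - y1) * (a + 2 * del) ^+ 2 - (y3 - y1) * (a - 2 * del) ^+ 2); last by ring.
    lra.
  rewrite ltr_pM2l; last lra.
  apply/negP; rewrite -leNgt -rho2 expr2; apply: ler_pM; rewrite ?(ltW rho0)//; lra.
have [S0|/set0P[y0 Sy0]] := eqVneq S set0.
  have -> : f = fun=> 0 by apply/funext => y; apply: f0; rewrite S0.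
  by rewrite expect_cst !mulr_ge0 ?invr_ge0// ?(ltW s0)// sqrtr_ge0.
have bdd y : S y -> `|y + A p| < a + 2 * del.
  move=> Sy; apply: le_lt_trans (up _ p Sy _); last by rewrite lexx.
  by rewrite -sqrtr_sqr ler_wsqrtr// lerDl.
have hi : has_inf S.
  by split; [exists y0|exists (- (a + 2 * del) - A p) => y /bdd; rewrite ltr_norml => /andP[]; lra].
have hs : has_sup S.
  by split; [exists y0|exists (a + 2 * del - A p) => y /bdd; rewrite ltr_norml => /andP[]; lra].
pose I (v : R) : set R := `[v, v + 2 * rho]%classic.
have bI v : bounded_meas (\1_(I v) : R -> R).
  split; first by apply: measurable_indic; exact: measurable_itv.
  by exists 1 => y; rewrite indicE; case: (y \in I v); rewrite ?normr1 ?normr0.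
have le y : f y <= \1_(I (inf S)) y + \1_(I (sup S - 2 * rho)) y.
  have i0 (v y' : R) : 0 <= \1_(I v) y' :> R by rewrite indicE.
  have [Sy|/f0->] := pselect (S y); last by rewrite addr_ge0.
  have /andP[_ f1] := near_half01 del (G y); apply: le_trans f1 _.
  have le1 : inf S <= y by exact: ge_inf hi.2 _ Sy.
  have le2 : y <= sup S by exact: ub_le_sup hs.2 _ Sy.
  have [h|h] := leP y (inf S + 2 * rho).
    have yI : y \in I (inf S) by rewrite inE /I /= in_itv/= le1 h.
    by rewrite [X in X + _]indicE yI lerDl.
  have [h'|h'] := leP (sup S - 2 * rho) y.
    have yI : y \in I (sup S - 2 * rho) by rewrite inE /I /= in_itv/= subrK le2 h'.
    by rewrite [X in _ + X]indicE yI lerDr.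
  (* A point of [S] more than 2 rho away from both ends would form an excluded triple with points of
     [S] within rho of the ends. *)
  have [y1 S1 h1] := inf_adherent rho0 hi; have [y3 S3 h3] := sup_adherent rho0 hs.
  by exfalso; apply: (three _ _ _ S1 Sy S3); lra.
apply: le_trans (le_expect _ bf (bounded_measD (bI _) (bI _)) le) _.
rewrite (expectD _ (bI _) (bI _)) (_ : 4 * _ / s = 2 * rho / s + 2 * rho / s); last by rewrite /rho; field; rewrite gt_eqF.
by apply: lerD; apply: expect_gauss_itv => //; rewrite mulr_ge0// ltW.
Qed.

End gaussian_interval.

Section norm3.
Variable R : realType.
Implicit Types u v : 'I_3 -> R.

Definition norm3 u : R := Num.sqrt (\sum_i u i ^+ 2).

Lemma norm3_ge u i : `|u i| <= norm3 u.
Proof.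
rewrite -sqrtr_sqr ler_wsqrtr// (bigD1 i)//= lerDl.
by apply: sumr_ge0 => j _; exact: sqr_ge0.
Qed.

Let norm3_leD u v : norm3 u <= norm3 v + \sum_i `|u i - v i|.
Proof.
have S0 : 0 <= \sum_i `|u i - v i| by exact: sumr_ge0.
have n0 : 0 <= norm3 v by exact: sqrtr_ge0.
rewrite -[leRHS]ger0_norm ?addr_ge0// -sqrtr_sqr ler_wsqrtr// sqrrD.
rewrite sqr_sqrtr; last by apply: sumr_ge0 => j _; exact: sqr_ge0.
have h i : u i ^+ 2 <= v i ^+ 2 + norm3 v * `|u i - v i| *+ 2 + `|u i - v i| ^+ 2.
  rewrite real_normK ?num_real//.
  have : v i * (u i - v i) <= norm3 v * `|u i - v i|.
    by apply: le_trans (ler_norm _) _; rewrite normrM ler_wpM2r// norm3_ge.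
  by nra.
have := ler_sum (index_enum 'I_3) (fun i (_ : true) => h i).
rewrite !big_ord_recl !big_ord0 => hh; apply: le_trans hh _.
set a := `|u ord0 - _|; set b := `|u (lift ord0 ord0) - _|; set c := `|u _ - _|.
have : 0 <= a * b := mulr_ge0 (normr_ge0 _) (normr_ge0 _).
have : 0 <= a * c := mulr_ge0 (normr_ge0 _) (normr_ge0 _).
have : 0 <= b * c := mulr_ge0 (normr_ge0 _) (normr_ge0 _).
lra.
Qed.

Lemma norm3_dist u v : `|norm3 u - norm3 v| <= \sum_i `|u i - v i|.
Proof.
rewrite ler_norml lerBlDl norm3_leD andbT lerNl opprB lerBlDl (le_trans (norm3_leD v u))// lerD2l.
by apply: ler_sum => i _; rewrite distrC.
Qed.

End norm3.

Section grid_norm.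
Context d (T : measurableType d) (R : realType) (P : probability T R).
Variables (W : 'I_3 -> R -> T -> R).
Hypothesis bmW : nice_bm P W.

Let mW i u : measurable_fun setT (W i u). Proof. by have [] := bmW. Qed.
Let W00 i b : W i 0 b = 0. Proof. by have [_ W0 _ _ _] := bmW. Qed.

Lemma radial0E t b : radial W 0 t b = norm3 (fun i => W i t b).
Proof. by rewrite /radial; congr Num.sqrt; apply: eq_bigr => i _; rewrite mul0r add0r. Qed.

Section grid.
Variables (k : nat).
Let m := (3 * k.+1)%N.

(* The coordinates are enumerated backwards, so that the last one is the first
   increment of [W ord0]. *)
Definition grid_index (i l : nat) : nat := (m.-1 - (i * k.+1 + l))%N.

Definition grid_norm (l : nat) (s : nat -> R) : R :=
  norm3 (fun i => \sum_(l' < l.+1) s (grid_index i l')).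

Lemma lip_grid_norm l s s' : (l <= k)%N ->
  `|grid_norm l s - grid_norm l s'| <= m%:R * \sum_(j < m) `|s j - s' j|.
Proof.
move=> lk; apply: le_trans (norm3_dist _ _) _.
have h (i : 'I_3) : `|\sum_(l' < l.+1) s (grid_index i l') - \sum_(l' < l.+1) s' (grid_index i l')| <=
    k.+1%:R * \sum_(j < m) `|s j - s' j|.
  rewrite -sumrB; apply: le_trans (ler_norm_sum _ _ _) _.
  apply: le_trans (_ : \sum_(l' < l.+1) (\sum_(j < m) `|s j - s' j|) <= _).
    apply: ler_sum => l' _.
    have jm : (grid_index i l' < m)%N by rewrite /grid_index /m; lia.
    by rewrite (bigD1 (Ordinal jm))//= lerDl; exact: sumr_ge0.
  rewrite sumr_const card_ord -[X in X <= _]mulr_natl ler_wpM2r ?ler_nat//.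
  by apply: sumr_ge0.
apply: le_trans (ler_sum _ (fun i _ => h i)) _.
by rewrite sumr_const card_ord -[X in X <= _]mulr_natl mulrA -natrM.
Qed.

Lemma grid_norm_upd s : exists A B : nat -> R, (forall l, 0 <= B l) /\
  forall l y, (l <= k)%N -> grid_norm l (upd s m.-1 y) = Num.sqrt ((y + A l) ^+ 2 + B l).
Proof.
pose V i l y := \sum_(l' < l.+1) upd s m.-1 y (grid_index i l').
have V0 l y : (l <= k)%N -> V 0%N l y = y + V 0%N l 0.
  move=> lk; rewrite /V !big_ord_recl /upd /grid_index mul0n add0n subn0 eqxx add0r; congr (_ + _).
  apply: eq_bigr => j _; rewrite (_ : (_ == _) = false)//; apply/eqP; rewrite /m/= /bump/=.
  by have := ltn_ord j; lia.
have Vi i l y : (l <= k)%N -> (0 < i)%N -> V i l y = V i l 0.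
  move=> lk i0; apply: eq_bigr => j _; rewrite /upd /grid_index.
  rewrite (_ : (_ == _) = false)//; apply/eqP; rewrite /m.
  by have : (k.+1 <= i * k.+1)%N by [rewrite leq_pmull]; lia.
exists (fun l => V 0%N l 0), (fun l => V 1%N l 0 ^+ 2 + V 2%N l 0 ^+ 2).
split=> [l|l y lk]; first by rewrite addr_ge0// sqr_ge0.
rewrite -V0// -(Vi 1%N l y)// -(Vi 2%N l y)// /grid_norm /norm3; congr Num.sqrt.
by rewrite (big_ord_recl 2) (big_ord_recl 1) (big_ord_recl 0) big_ord0 addr0.
Qed.

Variables (h : R) (j0 : nat).
Hypotheses (h0 : 0 < h) (j00 : (0 < j0)%N).

Definition grid_time (j : nat) : R := if j is l.+1 then h * (j0 + l)%:R else 0.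
Definition grid_coord (j : nat) : 'I_3 * 'I_k.+1 := (inord ((m.-1 - j) %/ k.+1), inord ((m.-1 - j) %% k.+1)).
Definition grid_incr j b := W (grid_coord j).1 (grid_time (grid_coord j).2.+1) b -
  W (grid_coord j).1 (grid_time (grid_coord j).2) b.

Let tm_incr : {homo grid_time : i j / (i < j)%N >-> i < j}.
Proof.
move=> [|i] [|j]//= ij; first by rewrite mulr_gt0// ltr0n ltn_addr.
by rewrite ltr_pM2l// ltr_nat ltn_add2l.
Qed.

Let e_inj j j' : (j < m)%N -> (j' < m)%N -> grid_coord j = grid_coord j' -> j = j'.
Proof.
move=> jm j'm [] /(congr1 val) + /(congr1 val); rewrite /= !inordK ?ltn_pmod//.
- move=> h1 h2; have : (m.-1 - j = m.-1 - j')%N by rewrite (divn_eq (m.-1 - j) k.+1) h1 h2 -divn_eq.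
  by rewrite /m; lia.
- by rewrite ltn_divLR//; rewrite /m; lia.
- by rewrite ltn_divLR//; rewrite /m; lia.
Qed.

Let mxi j : measurable_fun setT (grid_incr j). Proof. by apply: measurable_funB; exact: mW. Qed.

Lemma expect_grid_le (L M s0 c : R) H : lip_coord m L M H -> s0 = Num.sqrt (h * j0%:R) ->
  (forall s, expect (gauss_law s0) (fun y => H (upd s m.-1 y)) <= c) ->
  expect P (fun b => H (grid_incr^~ b)) <= c.
Proof.
move=> lH s0E Hc; have m1 : m = m.-1.+1 by rewrite /m; lia.
rewrite m1 in lH.
have ind := bm_gauss_indep bmW (lexx 0 : 0 <= grid_time 0%N) tm_incr e_inj.
have last : grid_coord m.-1 = (ord0, ord0).
  by rewrite /grid_coord subnn div0n mod0n; congr (_, _); apply/val_inj; rewrite /= inordK.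
have lE : Num.sqrt (grid_time (grid_coord m.-1).2.+1 - grid_time (grid_coord m.-1).2) = s0.
  by rewrite last s0E /= addn0 subr0.
rewrite (@expect_peel _ T R P grid_incr mxi m.-1 (gauss_law s0) _ L M H lH); last first.
  move=> B mB; rewrite (ind m.-1.+1 B (eq_leq (esym m1)) mB) (ind m.-1 B (leq_pred _) mB).
  by rewrite big_ord_recr EFinM/= lE fineK// fin_num_measure//; exact: mB.
rewrite -[leRHS](expect_cst P c); apply: le_expect => //.
  exact (bounded_meas_lip_coord mxi (lip_coord_peel (gauss_law s0) lH)).
exact: bounded_meas_cst.
Qed.

Lemma grid_normE l b : (l <= k)%N -> grid_norm l (grid_incr^~ b) = radial W 0 (h * (j0 + l)%:R) b.
Proof.
move=> lk; rewrite radial0E /grid_norm; congr norm3; apply/funext => i.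
pose f l := W i (grid_time l) b.
have E (l' : 'I_l.+1) : true -> grid_incr (grid_index i l') b = f l'.+1 - f l'.
  move=> _; have l'k : (l' < k.+1)%N by apply: leq_trans (ltn_ord l') _.
  have i3 := ltn_ord i.
  have le : (i * k.+1 + l' <= m.-1)%N.
    have : (i * k.+1 <= 2 * k.+1)%N by rewrite leq_mul2r -ltnS i3 orbT.
    by rewrite /m; lia.
  rewrite /grid_incr /grid_coord /grid_index subKn// divnMDl// divn_small// addn0 modnMDl modn_small//=.
  by rewrite inord_val inordK.
rewrite (eq_bigr _ E) -(big_mkord xpredT (fun l' => f l'.+1 - f l')) telescope_sumr//.
by rewrite /f /= W00 subr0.
Qed.

End grid.

(** With all increments fixed except the first one of [W ord0], the radius at each grid time has the
    form sqrt((y + A)^2 + B) with one common Gaussian y, so [gauss_top_le] applies. The first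
    increment reaches up to time h j0, and its variance is at least p / 2. *)
Lemma expect_radial_top_le (p q a del : R) : 0 < p -> p <= q -> 0 < del -> 2 * del < 1 / 2 -> 2 * del <= a ->
  expect P (fun b => near_half del (top p q (a + 1 / 2) (radial W 0 ^~ b))) <=
  4 * Num.sqrt (8 * a * del) / Num.sqrt (p / 2).
Proof.
move=> p0 pq d0 d1 da.
have q0 : 0 < q by exact: lt_le_trans pq.
have lP := lipf_near_half d0 (lipf_top (a + 1 / 2) (ltW p0) (ltW q0)).
have cR b : continuous (radial W 0 ^~ b) by exact: (continuous_radial bmW).
have [_ cv] := expect_step_cvg P (measurable_radial bmW 0) cR lP.
apply: (cvgr_to_le cv); have := near_divn_le 1 (divr_gt0 p0 (ltr0n R 2)).
apply: filterS => n; set h : R := n.+1%:R^-1 => hp.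
have h0 : 0 < h by rewrite invr_gt0.
(* h j0 is the last grid time not after p; it is at least p / 2 when the mesh is at most p / 2. *)
pose j0 := Num.truncn (p / h).
have ph0 : 0 <= p / h by rewrite divr_ge0// ltW.
have /andP[j01 j02] := truncn_itv ph0.
have ph2 : 2 <= p / h by rewrite ler_pdivlMr//; lra.
have j00 : (0 < j0)%N by rewrite truncn_gt0; lra.
have hj : p / 2 <= h * j0%:R.
  move: j02; rewrite -natr1 ltr_pdivrMr// -/j0 mulrDl mul1r mulrC; lra.
pose k := (Num.truncn (q / h) - j0)%N.
pose idx t := (Num.truncn (t / h) - j0)%N.
have idxk t : t <= q -> (idx t <= k)%N.
  by move=> tq; rewrite leq_sub2r// le_truncn// ler_pM2r// invr_gt0.
pose H s := near_half del (top p q (a + 1 / 2) (fun t => grid_norm k (idx t) s)).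
have lH : lip_coord (3 * k.+1) (del^-1 * (3 * k.+1)%:R) 1 H.
  split=> [s|s s']; first by have [_ _ H01 _] := lP; have /andP[H0 H1] := H01 (fun t => grid_norm k (idx t) s); rewrite ger0_norm.
  rewrite -mulrA; apply: (lipf_dist lP (z := fun t => grid_norm k (idx t) s)).
    by rewrite mulr_ge0// sumr_ge0.
  by move=> t /andP[_ tq]; apply: lip_grid_norm; exact: idxk.
set s0 := Num.sqrt (h * j0%:R).
have s00 : 0 < s0 by rewrite sqrtr_gt0 mulr_gt0// ltr0n.
have ls : Num.sqrt (p / 2) <= s0 by rewrite ler_wsqrtr.
have -> : expect P (fun b => near_half del (top p q (a + 1 / 2) (step_path h (radial W 0 ^~ b)))) =
    expect P (fun b => H (grid_incr k h j0 ^~ b)).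
  apply: eq_expect => b; congr near_half; apply: eq_top => t /andP[pt tq].
  rewrite grid_normE ?idxk// /step_path subnKC//; apply: le_truncn.
  by rewrite ler_pM2r// invr_gt0.
apply: (expect_grid_le h0 j00 lH (erefl _)) => s.
have bH := bounded_meas_upd s (_ : lip_coord (3 * k.+1).-1.+1 _ _ H).
have {}bH : bounded_meas (fun y => H (upd s (3 * k.+1).-1 y)).
  by apply: bH; rewrite prednK ?muln_gt0//; exact: lH.
have [A [B [B0 AB]]] := grid_norm_upd k s.
have E : (fun y => H (upd s (3 * k.+1).-1 y)) =
    (fun y => near_half del (top p q (a + 1 / 2) (fun t => Num.sqrt ((y + A (idx t)) ^+ 2 + B (idx t))))).
  by apply/funext => y; congr near_half; apply: eq_top => t /andP[_ tq]; rewrite AB// idxk.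
rewrite E in bH *; apply: le_trans (gauss_top_le pq s00 d0 d1 da _ bH) _ => //.
rewrite ler_wpM2l ?mulr_ge0 ?sqrtr_ge0//.
by rewrite lef_pV2 ?posrE// sqrtr_gt0 divr_gt0.
Qed.

(** The bound of [expect_radial_top_le] is of order sqrt del. That the maximum over an interval
    almost surely differs from a is what prevents the path from touching the level a without
    crossing it. *)
Lemma radial_max_ne (p q a : R) : 0 < p -> p <= q -> 0 < a ->
  exists2 N, measurable N & P N = 0%E /\
    forall b, ~ N b -> top p q (a + 1 / 2) (radial W 0 ^~ b) != 1 / 2.
Proof.
move=> p0 pq a0; have q0 : 0 < q by exact: lt_le_trans pq.
have cR b : continuous (radial W 0 ^~ b) by exact: (continuous_radial bmW).
have mR := measurable_radial bmW 0.
pose f b := top p q (a + 1 / 2) (radial W 0 ^~ b).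
have [mf _] : bounded_meas f := bounded_meas_lipf P mR cR (lipf_top (a + 1 / 2) (ltW p0) (ltW q0)).
pose N := f @^-1` [set 1 / 2].
have mN : measurable N by rewrite -[N]setTI; exact: mf.
exists N => //; split; last by move=> b Nb; apply/eqP.
have bN : bounded_meas (\1_N : T -> R).
  split; first exact: measurable_indic.
  by exists 1 => y; rewrite indicE; case: (y \in N); rewrite ?normr1 ?normr0.
have PN : expect P (\1_N) = fine (P N) by rewrite /expect integral_indic// setIT.
have sp : 0 < Num.sqrt (p / 2) by rewrite sqrtr_gt0 divr_gt0.
suff : fine (P N) = 0 by move=> h; rewrite -[P N]fineK ?fin_num_measure// h.
apply/eqP; rewrite eq_le fine_ge0// andbT; apply/ler_addgt0Pl => e e0; rewrite addr0.
pose del := Num.min (1 / 8) (Num.min (a / 2) ((e * Num.sqrt (p / 2) / 4) ^+ 2 / (8 * a))).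
have es : 0 < e * Num.sqrt (p / 2) / 4 by rewrite divr_gt0// mulr_gt0.
have a8 : 0 < 8 * a by rewrite mulr_gt0.
have d0 : 0 < del by rewrite !lt_min (divr_gt0 (exprn_gt0 2 es) a8) !divr_gt0.
have d1 : del <= 1 / 8 by rewrite ge_min lexx.
have d2 : del <= a / 2 by rewrite !ge_min lexx orbT.
have d3 : 8 * a * del <= (e * Num.sqrt (p / 2) / 4) ^+ 2.
  by rewrite mulrC -ler_pdivlMr// !ge_min lexx !orbT.
rewrite -PN; apply: le_trans (_ : expect P (fun b => near_half del (f b)) <= _).
  apply: le_expect => //.
    exact: (bounded_meas_lipf P mR cR (lipf_near_half d0 (lipf_top (a + 1 / 2) (ltW p0) (ltW q0)))).
  move=> b; rewrite indicE; have [bN'|_] := boolP (b \in N).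
    by rewrite (_ : f b = 1 / 2) ?near_half_half//; move: bN'; rewrite inE.
  by have /andP[] := near_half01 del (f b).
apply: le_trans (expect_radial_top_le p0 pq d0 _ _) _; try lra.
rewrite ler_pdivrMr// mulrC -ler_pdivlMr//.
by rewrite -[leRHS]ger0_norm ?(ltW es)// -sqrtr_sqr ler_wsqrtr.
Qed.

(** One coordinate suffices: its Gaussian law at time n + 1 spreads out, and the radius dominates
    it. *)
Lemma radial_unbounded (a : R) : 0 < a ->
  exists2 N, measurable N & P N = 0%E /\ forall b, ~ N b -> exists2 t, 0 <= t & a < radial W 0 t b.
Proof.
move=> a0; pose A n := [set b | radial W 0 n.+1%:R b <= a].
have mA n : measurable (A n).
  by rewrite -[A n]setTI; apply: measurable_fun_le => //; exact: measurable_radial bmW 0 _.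
pose N := \bigcap_n A n; have mN : measurable N by exact: bigcapT_measurable.
exists N => //; split; last first.
  move=> b Nb; apply: contrapT => h; apply: Nb => n _; rewrite /A /= leNgt.
  by apply/negP => lt; apply: h; exists n.+1%:R.
pose c := expR (a ^+ 2 / 2); have c0 : 0 < c := expR_gt0 _.
have le n : fine (P N) <= c * (Num.sqrt (1 + n.+1%:R))^-1.
  have bA : bounded_meas (\1_(A n) : T -> R).
    split; first exact: measurable_indic.
    by exists 1 => y; rewrite indicE; case: (y \in A n); rewrite ?normr1 ?normr0.
  have bg : bounded_meas (fun b => gexp 1 (0 + W ord0 n.+1%:R b)).
    split; last by exists 1 => b; rewrite ger0_norm ?gexp_le1 ?gexp_ge0.
    apply: measurableT_comp; last by apply: measurable_funD.
    by apply: (@measurable_lip _ _ ((1 + 2) / 2)) => y y'; apply: lip_gexp.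
  apply: le_trans (_ : expect P (\1_(A n)) <= _).
    rewrite /expect integral_indic// setIT fine_le ?fin_num_measure//.
    by apply: le_measure; rewrite ?inE//; exact: bigcap_inf.
  have h := expect_gexp_line_le bmW 0 (ler01 : 0 <= (1 : R)) (ltr0n R n.+1).
  rewrite mul1r in h; apply: le_trans (ler_wpM2l (ltW c0) h).
  rewrite -(expectZ P c bg); apply: le_expect => //; first exact: bounded_measZ.
  move=> b; rewrite indicE; have [bA'|_] := boolP (b \in A n); last first.
    exact: mulr_ge0 (ltW c0) (gexp_ge0 _ _).
  move: bA'; rewrite inE /A /= radial0E => hb.
  rewrite add0r /c /gexp -expRD -[X in X <= _]expR0 ler_expR mul1r.
  have : `|W ord0 n.+1%:R b| <= a.
    by apply: le_trans hb; exact: (norm3_ge (fun i => W i n.+1%:R b)).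
  move=> hw; have : W ord0 n.+1%:R b ^+ 2 <= a ^+ 2.
    by rewrite -[leLHS]real_normK ?num_real// lerXn2r ?nnegrE// ltW.
  lra.
suff : fine (P N) = 0 by move=> h; rewrite -[P N]fineK ?fin_num_measure// h.
apply/eqP; rewrite eq_le fine_ge0// andbT; apply/ler_addgt0Pl => e e0; rewrite addr0.
have [n _ hn] : exists2 n, true & c / e <= Num.sqrt (1 + n.+1%:R).
  exists (Num.truncn ((c / e) ^+ 2)) => //.
  have ce : 0 <= c / e by rewrite divr_ge0// ltW.
  rewrite -[leLHS]ger0_norm// -sqrtr_sqr ler_wsqrtr//.
  by have := truncnS_gt ((c / e) ^+ 2); lra.
apply: le_trans (le n) _; have sn : 0 < Num.sqrt (1 + n.+1%:R : R).
  by apply: lt_le_trans hn; rewrite divr_gt0.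
by rewrite ler_pdivrMr// mulrC -ler_pdivrMr.
Qed.

End grid_norm.

(** * Continuity of stopping *)

Section crossing.
Variable R : realType.
Implicit Types (z y : R -> R) (a e r t u : R).

Lemma C0_eps z t e : C0 z -> 0 <= t -> 0 < e ->
  exists2 del, 0 < del & forall u, 0 <= u -> `|u - t| < del -> `|z u - z t| < e.
Proof.
move=> [cz _] t0 e0; have /subspace_continuousP/(_ t t0)/cvgrPdist_lt/(_ _ e0) := cz.
rewrite near_withinE => /nbhs_ballP[del /= del0 h]; exists del => // u u0 ut.
by rewrite distrC; apply: h => //; rewrite /ball/= distrC.
Qed.

Lemma eps_C0 z : z 0 = 0 -> (forall t e, 0 <= t -> 0 < e ->
    exists2 del, 0 < del & forall u, 0 <= u -> `|u - t| < del -> `|z u - z t| < e) -> C0 z.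
Proof.
move=> z0 h; split => //; apply/subspace_continuousP => t t0.
apply/cvgrPdist_lt => e e0; have [del del0 hd] := h t e t0 e0.
rewrite near_withinE; apply/nbhs_ballP; exists del => //= u; rewrite /ball/= => ut u0.
by rewrite distrC; apply: hd => //; rewrite distrC.
Qed.

Lemma continuous_C0 z : continuous z -> z 0 = 0 -> C0 z.
Proof. by move=> cz z0; split => //; exact: continuous_subspaceT. Qed.

Lemma dist_minl t u s : `|Num.min u s - Num.min t s| <= `|u - t|.
Proof.
have [us|us] := leP u s; have [ts|ts] := leP t s => //; rewrite ?subrr ?normr0//.
- by rewrite !ler0_norm ?subr_le0//; [lra|exact: (le_trans us (ltW ts))].
- by rewrite !ger0_norm ?subr_ge0//; [lra|exact: (le_trans ts (ltW us))].
Qed.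

Lemma stopped_C0 z s : C0 z -> 0 <= s -> C0 (fun t => z (Num.min t s)).
Proof.
move=> Cz s0; apply: eps_C0; first by have [_] := Cz; rewrite min_l.
move=> t e t0 e0; have [|del del0 h] := C0_eps Cz (_ : 0 <= Num.min t s) e0; first by rewrite le_min t0.
exists del => // u u0 ut; apply: h; first by rewrite le_min u0.
exact: le_lt_trans (dist_minl _ _ _) ut.
Qed.

Lemma first_passage z a t : C0 z -> 0 < a -> 0 <= t -> a <= z t ->
  exists s, [/\ 0 < s, s <= t, z s = a & forall u, 0 <= u -> u < s -> z u < a].
Proof.
move=> Cz a0 t0 zt; have [_ z0] := Cz.
pose E := [set u | 0 <= u /\ a <= z u].
have hE : has_inf E by split; [exists t|exists 0 => u []].
pose s := inf E; have s0 : 0 <= s by apply: lb_le_inf => [|u []//]; exists t.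
have below u : 0 <= u -> u < s -> z u < a.
  move=> u0 us; rewrite ltNge; apply/negP => zu; move: us; apply/negP; rewrite -leNgt.
  by apply: ge_inf; [exact: hE.2|split].
have st : s <= t by apply: ge_inf; [exact: hE.2|split].
have zs1 : a <= z s.
  rewrite leNgt; apply/negP => zs; have e0 : 0 < a - z s by rewrite subr_gt0.
  have [del del0 h] := C0_eps Cz s0 e0; have [u [u0 zu] us] := inf_adherent del0 hE.
  have su : s <= u by apply: ge_inf; [exact: hE.2|split].
  have := h u u0; rewrite ger0_norm ?subr_ge0// => /(_ (ltac:(rewrite ltrBlDl; exact: us))).
  by rewrite ltr_norml => /andP[_]; lra.
have sgt : 0 < s by rewrite lt_neqAle s0 andbT; apply/eqP => s0'; move: zs1; rewrite -s0' z0; lra.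
exists s; split => //; apply/eqP; rewrite eq_le zs1 andbT leNgt; apply/negP => zs.
have e0 : 0 < z s - a by rewrite subr_gt0.
have [del del0 h] := C0_eps Cz s0 e0.
pose u := s - Num.min (del / 2) (s / 2).
have m0 : 0 < Num.min (del / 2) (s / 2) by rewrite lt_min !divr_gt0.
have m1 : Num.min (del / 2) (s / 2) <= del / 2 by rewrite ge_min lexx.
have m2 : Num.min (del / 2) (s / 2) <= s / 2 by rewrite ge_min lexx orbT.
have u0 : 0 <= u by rewrite /u; lra.
have us : u < s by rewrite /u; lra.
have := h u u0; rewrite ltr0_norm ?subr_lt0// => /(_ (ltac:(rewrite /u; lra))).
by rewrite ltr_norml => /andP[h1 _]; have := below u u0 us; lra.
Qed.

(** The last clause is the continuity condition: nearby paths must then reach a soon after s. *)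
Definition crosses a z s := [/\ 0 < s, z s = a, forall u, 0 <= u -> u < s -> z u < a &
  forall e, 0 < e -> exists2 u, s < u < s + e & a < z u].

Lemma hitting_timeE a z s : 0 < s -> z s = a -> (forall u, 0 <= u -> u < s -> z u < a) ->
  hitting_time a z = s%:E.
Proof.
move=> s0 zs below; apply/eqP; rewrite eq_le; apply/andP; split.
  by apply: ereal_inf_lbound; exists s.
apply: le_ereal_inf_tmp => _ [t [t0 zt] <-]; rewrite lee_fin leNgt; apply/negP => ts.
by have := below t (ltW t0) ts; rewrite zt ltxx.
Qed.

Lemma stopped_coupleE a z s : hitting_time a z = s%:E ->
  stopped_couple a z = (fun t => z (Num.min t s), s).
Proof.
move=> E; rewrite /stopped_couple E; congr pair; apply/funext => t; congr z.
by rewrite /Order.min lte_fin; case: ifP.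
Qed.

(* A path which is close to [z] (up to a small delay) until it
   reaches [a] must reach [a] at a time close to the crossing time of [z]. *)
Lemma delayed_crosses a z s r : 0 < a -> continuous z -> z 0 = 0 -> crosses a z s -> 0 < r ->
  exists2 e0, 0 < e0 & forall e, 0 < e <= e0 -> forall y, delayed a e (4 * e) z y ->
    exists w, [/\ 0 < w, y w = a, forall u, 0 <= u -> u < w -> y u < a, `|s - w| <= r &
      forall t, 0 <= t -> `|z (Num.min t s) - y (Num.min t w)| <= 2 * r].
Proof.
move=> a0' cz z0 [s0 zs below above] r0.
have [kap0 kap00] := continuous_modulus (s + 2) cz r0; rewrite /modulus => modz.
pose kap := Num.min (Num.min (kap0 / 4) (s / 2)) (Num.min (1 / 2) (r / 2)).
have k0 : 0 < kap by rewrite !lt_min !divr_gt0.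
have k1 : kap <= kap0 / 4 by rewrite /kap !ge_min lexx.
have k2 : kap <= s / 2 by rewrite /kap !ge_min lexx !orbT.
have k3 : kap <= 1 / 2 by rewrite /kap !ge_min lexx !orbT.
have k4 : kap <= r / 2 by rewrite /kap !ge_min lexx !orbT.
clearbody kap.
(* Before s - kap the path stays below a by a margin zeta1, and at some t2 just after s it is above
   a. Up to the delay, a nearby path reaches a between these times. *)
have [zeta1 z10 hz1] : exists2 zeta, 0 < zeta & forall u, 0 <= u <= s - kap -> z u <= a - zeta.
  have sk : 0 <= s - kap by clear - k2 s0; lra.
  have [|c] := @EVT_max R z 0 (s - kap) sk; first exact: continuous_subspaceT.
  rewrite in_itv/= => /andP[c0 c1] hc; exists (a - z c); first by rewrite subr_gt0 below//; lra.
  by move=> u hu; rewrite opprB addrC subrK; apply: hc; rewrite in_itv.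
clear cz; have [t2 /andP[t21 t22] hz2] := above kap k0.
(* The tolerance 4 e must be below both margins, e below a so that the initial piece cannot reach a,
   and the horizon (4 e)^-1 at least s + 1. *)
pose e0 := Num.min (Num.min kap (zeta1 / 5)) (Num.min (Num.min ((z t2 - a) / 5) (r / 4)) (Num.min (a / 2) (4 * (s + 1))^-1)).
have e00 : 0 < e0.
  rewrite /e0 !lt_min k0 !divr_gt0// ?subr_gt0//= invr_gt0; lra.
exists e0 => // e /andP[ep]; rewrite !le_min => /andP[/andP[e1 e2] /andP[/andP[e3 e4] /andP[e5 e6]]].
have e7 : s + 1 <= (4 * e)^-1.
  rewrite -[leLHS]invrK lef_pV2 ?posrE ?invr_gt0 ?mulr_gt0//; last lra.
  by move: e6; rewrite invfM -ler_pdivlMl// mulrC.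
clear e6 e00; clearbody e0.
move=> y [Cy [h [/andP[h0 he] yh yz]]].
have fp := first_passage Cy a0'; clear Cy.
have early v : 0 <= v -> v < s - kap + h -> y v < a.
  move=> v0 vs; rewrite ltNge; apply/negP => yv.
  have [w [w0 wv yw yb]] := fp v v0 yv.
  have hw : h < w by rewrite ltNge; apply/negP => wh; have := yh w; rewrite (ltW w0) wh => /(_ isT); rewrite yw ger0_norm; clear - e5 a0'; lra.
  have := yz (w - h); rewrite subrK => /(_ _ yb); rewrite yw => h1.
  have : `|a - z (w - h)| <= 4 * e by apply: h1; clear - hw wv vs e7 k0; apply/andP; split; lra.
  rewrite ler_norml => /andP[_ h2]; have := hz1 (w - h).
  have wh : 0 <= w - h <= s - kap by clear - hw wv vs; apply/andP; split; lra.
  by move=> /(_ wh) h3; clear - h2 h3 e2 z10; lra.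
have [v v0 [vt yv]] : exists2 v, 0 <= v & v <= t2 + h /\ a <= y v.
  apply: contrapT => no.
  have yb v : 0 <= v -> v <= t2 + h -> y v < a.
    by move=> v0 vt; rewrite ltNge; apply/negP => yv; apply: no; exists v.
  have := yz t2; move=> h1; have : `|y (t2 + h) - z t2| <= 4 * e.
    by apply: h1 => [|v v0 vt]; [clear - t21 t22 k3 e7 s0; apply/andP; split; lra|apply: yb => //; exact: ltW].
  rewrite ler_norml => /andP[h2 _]; have th : 0 <= t2 + h by clear - t21 s0 h0; lra.
  by have yt := yb _ th (lexx _); clear - yt h2 e3 hz2; lra.
have [w [w0 wv yw yb]] := fp v v0 yv.
have ws : s - kap + h <= w by rewrite leNgt; apply/negP => /(early w (ltW w0)); rewrite yw ltxx.
have dws : `|s - w| <= 2 * kap.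
  by clear - ws wv vt t22 he e1 h0 k0; rewrite ler_norml; apply/andP; split; lra.
have wk : w <= s + 1 by clear - wv vt t22 he e1 k3; lra.
have ek : 4 * e <= r by clear - e4; lra.
have kk : 4 * kap <= kap0 by clear - k1; lra.
have hw : h < w by clear - ws k2 s0; lra.
have dr : `|s - w| <= r by apply: le_trans dws _; clear - k4; lra.
clear k1 k2 k3 k4 t21 t22 hz2 v0 vt wv yv v e2 e3 e4 e5 early hz1 z10.
exists w; split=> // t t0.
have ms : 0 <= Num.min t s <= s by rewrite le_min t0 (ltW s0) ge_min lexx orbT.
have [wh|wh] := leP (Num.min t w) h.
  have tw : t <= w by rewrite leNgt; apply/negP => wt; move: wh; rewrite min_r ?(ltW wt)//; clear - hw; lra.
  rewrite min_l// in wh *.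
  have h1 : `|y t| <= e by apply: yh; rewrite t0.
  have h2 : `|z (Num.min t s) - z 0| <= r.
    have mt : Num.min t s <= t by rewrite ge_min lexx.
    move: ms => /andP[ms0 ms1]; apply: modz; [clear - ms0 ms1|clear - s0|]; try by apply/andP; split; lra.
    by rewrite subr0 ger0_norm//; clear - mt wh he e1 kk k0; lra.
  rewrite z0 subr0 in h2; apply: le_trans (ler_normB _ _) _; clear - h1 h2 ek r0 ep; lra.
pose u := Num.min t w - h.
have mw : Num.min t w <= w by rewrite ge_min lexx orbT.
have h1 : `|y (Num.min t w) - z u| <= 4 * e.
  have := yz u; rewrite /u subrK; apply.
    by apply/andP; split; [rewrite subr_ge0 ltW|apply: le_trans e7; clear - mw wk h0; lra].
  by move=> v' v'0 v'w; apply: yb => //; clear - v'w mw; lra.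
have h2 : `|z (Num.min t s) - z u| <= r.
  have d : `|Num.min t s - Num.min t w| <= `|s - w|.
    by rewrite ![Num.min t _]minC; exact: dist_minl.
  move: ms => /andP[ms0 ms1].
  apply: modz; [clear - ms0 ms1|rewrite /u; clear - wh mw wk h0 s0|]; try by apply/andP; split; lra.
  rewrite /u opprB addrA addrAC; apply: le_trans (ler_normD _ _) _; rewrite (ger0_norm h0).
  clear - d dws he e1 kk k0; lra.
rewrite (_ : _ - _ = (z (Num.min t s) - z u) - (y (Num.min t w) - z u)); last by ring.
apply: le_trans (ler_normB _ _) _; clear - h1 h2 ek r0 ep; lra.
Qed.

Section continuity.
Variables (a : R) (F : (R -> R) * R -> R).
Hypotheses (a0 : 0 < a) (F01 : forall x, 0 <= F x <= 1).
Hypothesis cF : continuous_for (@C0_Rplus R) (@couple_dist R) F.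
Let Gam z := F (stopped_couple a z).

Lemma gfun_self e r z : 0 <= e -> 0 <= r -> C0 z -> gfun a Gam e r z <= Gam z.
Proof.
move=> e0 r0 Cz; have [_ z0] := Cz; apply: gfun_delayed; first by move=> z'; exact: F01.
split => //; exists 0; split => [|t /andP[t0 t0']|u _ _]; rewrite ?lexx//.
  by rewrite (_ : t = 0) ?z0 ?normr0//; apply/eqP; rewrite eq_le t0'.
by rewrite addr0 subrr normr0.
Qed.

Lemma gfun_crosses z s eta : continuous z -> z 0 = 0 -> crosses a z s -> 0 < eta ->
  exists2 e0, 0 < e0 & forall e, 0 < e <= e0 -> Gam z - eta <= gfun a Gam e (4 * e) z.
Proof.
move=> cz z0 zc eta0; have [s0 zs below _] := zc; have Cz := continuous_C0 cz z0.
have Ez := stopped_coupleE (hitting_timeE s0 zs below).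
have Sz : C0_Rplus (stopped_couple a z) by rewrite Ez; split => /=; [exact: stopped_C0 (ltW s0)|exact: ltW].
have [del del0 hF] := cF Sz eta0.
have r0 : 0 < del / 16 by rewrite divr_gt0.
have [N hN] : exists N : nat, 2 * 2 ^- N < del / 4.
  exists (Num.truncn (8 / del)).+1; rewrite ltr_pdivrMr ?exprn_gt0// mulrC -ltr_pdivrMr ?divr_gt0//.
  have -> : 2 / (del / 4) = 8 / del by field; rewrite gt_eqF.
  apply: lt_le_trans (truncnS_gt _) _.
  by rewrite -natrX ler_nat ltnW// ltn_expl.
have [e0 e00 he0] := delayed_crosses a0 cz z0 zc r0; exists e0 => // e he.
apply: inf1_ge; first by have /andP[_ Fle1] := F01 (stopped_couple a z); rewrite lerBlDr (le_trans Fle1)// lerDl ltW.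
move=> _ [y yd ->]; have Cy := yd.1; have [w [w0 yw yb sw cl]] := he0 e he y yd.
have Ey := stopped_coupleE (hitting_timeE w0 yw yb).
have Sy : C0_Rplus (stopped_couple a y) by rewrite Ey; split => /=; [exact: stopped_C0 (ltW w0)|exact: ltW].
suff /(hF _ Sy) : couple_dist (stopped_couple a z) (stopped_couple a y) < del.
  by rewrite ltr_norml /Gam ltrBlDr lerBlDr => /andP[_ /ltW]; rewrite addrC.
rewrite Ez Ey /couple_dist gt_max /=; apply/andP; split; last first.
  by apply: le_lt_trans sw _; rewrite ltr_pdivrMr// ltr_pMr// ltr1n.
have cN : close N%:R (2 * (del / 16)) (fun t => z (Num.min t s)) (fun t => y (Num.min t w)).
  by move=> t /andP[t0 _]; exact: cl.
have [Cz' _] := stopped_C0 Cz (ltW s0); have [Cy' _] := stopped_C0 Cy (ltW w0).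
have r20 : 0 <= 2 * (del / 16) by rewrite mulr_ge0 ?ltW.
apply: le_lt_trans (close_path_dist Cz' Cy' r20 cN) _.
clear cF hF Cz' Cy' Cy yd he0 Ez Ey Sz Sy Cz cz; lra.
Qed.

End continuity.
End crossing.

Section radial_crossing.
Context d (T : measurableType d) (R : realType) (P : probability T R).
Variables (W : 'I_3 -> R -> T -> R).
Hypothesis bmW : nice_bm P W.

(** If the path did not exceed a just after its first passage s, its maximum over an interval with
    rational ends around s would be a. Countably many such intervals are excluded by
    [radial_max_ne]. *)
Lemma radial_crosses (a : R) : 0 < a ->
  {ae P, forall b, exists s, crosses a (radial W 0 ^~ b) s}.
Proof.
move=> a0.
have h1 : {ae P, forall b, exists2 t, 0 <= t & a < radial W 0 t b}.
  have [N mN [N0 hN]] := radial_unbounded bmW a0; exists N; split => // b.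
  by apply: contra_notP; exact: hN.
have h2 : {ae P, forall b, forall i j : nat,
    top i.+1%:R^-1 (j.+1%:R / i.+1%:R) (a + 1 / 2) (radial W 0 ^~ b) != 1 / 2}.
  apply: ae_foralln => i; apply: ae_foralln => j.
  have p0 : (0 : R) < i.+1%:R^-1 by rewrite invr_gt0.
  have pq : (i.+1%:R^-1 : R) <= j.+1%:R / i.+1%:R by rewrite ler_peMl ?ler1n// ltW.
  have [N mN [N0 hN]] := radial_max_ne bmW p0 pq a0; exists N; split => // b.
  by apply: contra_notP; exact: hN.
apply: filterS2 h1 h2 => b [t t0 tb] h.
have cz : continuous (radial W 0 ^~ b) by exact: (continuous_radial bmW).
have z0 : radial W 0 0 b = 0.
  rewrite radial0E /norm3 big1 ?sqrtr0// => i _; have [_ -> _ _ _] := bmW; exact: expr0n.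
have [s [s0 _ zs below]] := first_passage (continuous_C0 cz z0) a0 t0 (ltW tb).
exists s; split => // e e0; apply: contrapT => no.
have ab u : s < u < s + e -> radial W 0 u b <= a.
  by move=> hu; rewrite leNgt; apply/negP => lt; apply: no; exists u.
(* The denominator i + 1 is large enough for a rational interval to start before s and to end in ]s,
   s + e[. *)
pose i := Num.truncn (s^-1 + 2 / e).
have i1 : s^-1 + 2 / e < i.+1%:R by exact: truncnS_gt.
have si : 0 < s^-1 by rewrite invr_gt0.
have ei : 0 < 2 / e by rewrite divr_gt0.
have ip : (0 : R) < i.+1%:R by [].
have p1 : i.+1%:R^-1 < s by rewrite invf_plt ?posrE//; lra.
have p2 : 2 * i.+1%:R^-1 < e.
  have : 2 / e < i.+1%:R by lra.
  by rewrite ltr_pdivrMr// => hi; rewrite ltr_pdivrMr// mulrC.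
pose j := Num.truncn (s * i.+1%:R).
have /andP[j1 j2] := truncn_itv (mulr_ge0 (ltW s0) (ltW ip)).
have q1 : s < j.+1%:R / i.+1%:R by rewrite ltr_pdivlMr.
have q2 : j.+1%:R / i.+1%:R < s + e.
  have : j%:R / i.+1%:R <= s by rewrite ler_pdivrMr.
  have -> : j.+1%:R / i.+1%:R = j%:R / i.+1%:R + i.+1%:R^-1 :> R by rewrite -(natr1 j) mulrDl mul1r.
  have h2 : i.+1%:R^-1 < e by apply: lt_trans p2; rewrite ltr_pMl ?invr_gt0// ltr1n.
  by move=> h1; exact: ler_ltD.
have /negP := h i j; apply; apply/eqP.
have half : clip 0 1 (a + 1 / 2 - radial W 0 s b) = 1 / 2 by rewrite zs clip_id; [lra|apply/andP; split; lra].
apply/eqP; rewrite eq_le; apply/andP; split.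
  by rewrite -[leRHS]half; apply: top_le; rewrite (ltW p1) (ltW q1).
rewrite leNgt; apply/negP => /top_lt[|u /andP[pu uq] hu]; first lra.
have : radial W 0 u b <= a; last lra.
have [us|su] := ltP u s; first by apply: ltW; apply: below => //; apply: le_trans pu; rewrite invr_ge0.
have [<-|su'] := eqVneq s u; first by rewrite zs.
by apply: ab; rewrite lt_neqAle su' su (le_lt_trans uq).
Qed.

End radial_crossing.

(** * The random environment *)

Section trajectories.
Variables (R : realType) (p : kernel R).
Variables (Q : probability trajectory R) (x0 : int).
Hypothesis hQ : forall (k : nat) (s : nat -> int),
  Q [set X : trajectory | forall i, (i <= k)%N -> X i = s i] =
    ((s 0%N == x0)%:R * \prod_(i < k) p (s i) (s i.+1))%:E.

Let path_of x k (u : k.-tuple int) : nat -> int := nth 0 (x :: u).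

Let weight x k (u : k.-tuple int) : R := \prod_(i < k) p (path_of x u i) (path_of x u i.+1).

Let weight_ge0 x k (u : k.-tuple int) : 0 <= weight x u.
Proof. by apply: prodr_ge0 => i _; exact: ker_ge0. Qed.

Let cyl x k (u : k.-tuple int) : set trajectory :=
  [set X | forall i, (i <= k)%N -> X i = path_of x u i].

Let measurable_coord (i : nat) (y : int) : measurable [set X : trajectory | X i = y].
Proof.
apply: sub_sigma_algebra; exists i => //; exists [set y] => //.
by apply/seteqP; split => X /=; [case|split].
Qed.

Let measurable_cyl x k (u : k.-tuple int) : measurable (cyl x u).
Proof.
rewrite (_ : cyl x u = \bigcap_(i in [set i | (i <= k)%N]) [set X : trajectory | X i = path_of x u i]).
  by apply: bigcap_measurable => [|i _]; [exists 0%N|exact: measurable_coord].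
by apply/seteqP; split => X h i; exact: h.
Qed.

Let tpair k (v : int * k.-tuple int) : k.+1.-tuple int := [tuple of v.1 :: v.2].

Let tpair_bij k : set_bij [set: int * k.-tuple int] [set: k.+1.-tuple int] (@tpair k).
Proof.
split => //.
  move=> [a u] [b v] _ _ /(congr1 val)/= [-> uv]; congr pair; exact: val_inj.
by move=> u _; exists (thead u, [tuple of behead u]) => //; rewrite /tpair/= -tuple_eta.
Qed.

Let esum_pair k (F : int -> k.-tuple int -> \bar R) : (forall a u, (0 <= F a u)%E) ->
  \esum_(a in [set: int]) \esum_(u in [set: k.-tuple int]) F a u =
  \esum_(v in [set: int * k.-tuple int]) F v.1 v.2.
Proof.
by move=> F0; rewrite esum_esum//; congr esum; apply/seteqP; split => // -[a b].
Qed.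

Let Ew_esum k x f : (forall s, 0 <= f s) -> bnd f -> depends k f ->
  (Ew p k x f)%:E = \esum_(u in [set: k.-tuple int]) (weight x u * f (path_of x u))%:E.
Proof.
elim: k x f => [|k IH] x f f0 bf df.
  rewrite (_ : [set: 0.-tuple int] = [set [tuple]]); last first.
    by apply/seteqP; split => // u _; exact: tuple0.
  rewrite esum_set1 ?lee_fin ?mulr_ge0//; congr EFin.
  rewrite /weight big_ord0 mul1r; apply: df => -[|//] _ //.
rewrite /= avE; [|by move=> z; apply: Ew_ge0|exact: bnd_Ew_scons].
transitivity (\esum_(z in [set: int]) \esum_(u in [set: k.-tuple int])
    (p x z * (weight z u * f (scons x (path_of z u))))%:E).
  apply: eq_esum => z _; rewrite EFinM (IH z (fun s => f (scons x s)))//; last exact: depends_scons; last first.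
    by have [M fM] := bf; exists M.
  have ge u : (0 <= (weight z u * f (scons x (path_of z u)))%:E)%E.
    by rewrite lee_fin mulr_ge0.
  have [->|pz] := eqVneq (p x z) 0.
    rewrite mul0e esum1// => u _; by rewrite mul0r.
  rewrite -esumZl ?lt0r ?pz ?ker_ge0//; apply: eq_esum => u _; exact: EFinM.
rewrite esum_pair; last by move=> z u; rewrite lee_fin !mulr_ge0 ?ker_ge0.
rewrite (@reindex_esum R _ _ _ _ _ (fun u => (weight x u * f (path_of x u))%:E) (tpair_bij k)); apply: eq_esum => -[z u] _ /=.
congr EFin; rewrite mulrA; congr (_ * f _).
  by rewrite /weight big_ord_recl.
by apply/funext => -[|i].
Qed.


Let tuple_path k (X : nat -> int) : k.-tuple int := [tuple X i.+1 | i < k].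

Let cylE x k (u : k.-tuple int) X : cyl x u X -> X 0%N = x /\ u = tuple_path k X.
Proof.
move=> h; split; first by rewrite (h 0%N).
by apply: eq_from_tnth => i; rewrite tnth_mktuple (h i.+1 (ltn_ord i)) /path_of/= -tnth_nth.
Qed.

Let tuple_pathP k (X : trajectory) : cyl (X 0%N) (tuple_path k X) X.
Proof. by move=> -[//|i ik]; rewrite /path_of /= (nth_map (Ordinal ik)) ?size_enum_ord// nth_enum_ord. Qed.

Let Qcyl k x (u : k.-tuple int) : Q (cyl x u) = ((x == x0)%:R * weight x u)%:E.
Proof. exact: (hQ k (path_of x u)). Qed.

Lemma measurable_depends k (f : (nat -> int) -> R) : depends k f ->
  measurable_fun setT (f : trajectory -> R).
Proof.
move=> df; pose A (v : int * k.-tuple int) := cyl v.1 v.2.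
have mA v : measurable (A v) by exact: measurable_cyl.
have fA v X : A v X -> f X = f (path_of v.1 v.2) by move=> h; apply: df.
have cover (X : trajectory) : A (X 0%N, tuple_path k X) X by exact: tuple_pathP.
move=> _ B mB; rewrite setTI.
rewrite (_ : f @^-1` B = \bigcup_(v in [set v | B (f (path_of v.1 v.2))]) A v).
  rewrite bigcup_mkcond; apply: countable_bigcupT_measurable => [|v]; first exact: countableP.
  by case: ifP => // _; exact: mA.
apply/seteqP; split => X.
  by move=> BX; exists (X 0%N, tuple_path k X); [rewrite /= -(fA _ _ (cover X))|exact: cover].
by move=> [v /= Bv /fA]; rewrite /preimage/= => ->.
Qed.

(** The first k + 1 positions split the trajectories into countably many cylinders, whose masses are
    prescribed. *)
Lemma quenched_expect k f : (forall s, 0 <= f s) -> bnd f -> depends k f ->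
  (\int[Q]_X (f X)%:E = (Ew p k x0 f)%:E)%E.
Proof.
move=> f0 bf df; pose A (v : int * k.-tuple int) := cyl v.1 v.2.
have mA v : measurable (A v) by exact: measurable_cyl.
have fA v X : A v X -> f X = f (path_of v.1 v.2) by move=> h; apply: df.
have cover (X : trajectory) : A (X 0%N, tuple_path k X) X by exact: tuple_pathP.
have mf : measurable_fun setT (fun X : trajectory => (f X)%:E).
  by apply/measurable_EFinP; exact: measurable_depends df.
rewrite (@integral_countable_partition _ _ R Q _ A _ mA)//; last 2 first.
- apply/trivIsetP => -[x u] [y v] _ _; apply: contraNeq => /set0P[X [/cylE[/= <- ->] /cylE[/= <- ->]]].
  exact: eqxx.
- by apply/seteqP; split => // X _; exists (X 0%N, tuple_path k X) => //; exact: cover.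
have w0 x (u : k.-tuple int) : 0 <= weight x u * f (path_of x u) by rewrite mulr_ge0.
transitivity (\esum_(v in [set: int * k.-tuple int])
    ((v.1 == x0)%:R * (weight v.1 v.2 * f (path_of v.1 v.2)))%:E).
  apply: eq_esum => v _; rewrite (eq_integral (fun=> (f (path_of v.1 v.2))%:E)); last first.
    by move=> X; rewrite inE => /fA ->.
  by rewrite integral_cst//= /A Qcyl -EFinM mulrC mulrA.
rewrite -(esum_pair (F := fun x u => ((x == x0)%:R * (weight x u * f (path_of x u)))%:E)); last first.
  by move=> x u; rewrite lee_fin mulr_ge0.
rewrite Ew_esum// -[RHS](@esum_set1 _ _ x0 (fun x => \esum_(u in [set: k.-tuple int]) (weight x u * f (path_of x u))%:E)); last first.
  by apply: esum_ge0 => u _; rewrite lee_fin.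
rewrite [RHS]esum_mkcond; apply: eq_esum => x _; have [->|xx0] := eqVneq x x0.
  by rewrite mem_set//; apply: eq_esum => u _; rewrite mul1r.
rewrite memNset; last exact/eqP.
by rewrite esum1// => u _; rewrite mul0r.
Qed.

End trajectories.

(** * Power sums and the moments of the conductances *)

Section power_sums.
Variable R : realType.
Implicit Types (s : R) (l j n : nat).

(** The power (l + 1)^(-s). *)
Definition pw s l : R := expR (- (s * ln l.+1%:R)).
Definition pw_cst s : R := expR ((1 + s) * ln 2) / s.

Lemma pw_gt0 s l : 0 < pw s l. Proof. exact: expR_gt0. Qed.

Lemma pw0 s : pw s 0 = 1. Proof. by rewrite /pw ln1 mulr0 oppr0 expR0. Qed.

Lemma pwS s l : l.+1%:R * pw (1 + s) l = pw s l.
Proof. by rewrite /pw mulrDl mul1r opprD expRD mulrA [expR (- ln _)]expRN lnK ?posrE// mulfV// mul1r. Qed.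

(** Makes the sums telescope. Moving the index from l to l + 1 costs 2^(1 + s); there exp x >= 1 + x
    gives the mean value bound. *)
Lemma pw_le s l : 0 < s -> pw (1 + s) l <= pw_cst s * (pw s l - pw s l.+1).
Proof.
move=> s0; set x : R := l.+1%:R; set y : R := l.+2%:R.
have x0 : 0 < x by []; have y0 : 0 < y by [].
have xy : y = x + 1 by rewrite /x /y [RHS]natr1.
have h1 : pw (1 + s) l <= expR ((1 + s) * ln 2) * pw (1 + s) l.+1.
  rewrite /pw -expRD ler_expR -/x -/y -mulrBr -mulrN ler_pM2l ?addr_gt0//.
  have : ln y <= ln (2 * x).
    have : 1 <= x by rewrite ler1n.
    by move=> x1; rewrite ler_ln ?posrE ?mulr_gt0//; lra.
  by rewrite lnM ?posrE//; lra.
have h2 : s * pw (1 + s) l.+1 <= pw s l - pw s l.+1.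
  have -> : pw (1 + s) l.+1 = pw s l.+1 / y by rewrite -(pwS s l.+1) -/y mulrAC mulfV ?gt_eqF// mul1r.
  have -> : pw s l = pw s l.+1 * expR (s * (ln y - ln x)).
    by rewrite /pw -expRD -/x -/y; congr expR; ring.
  have h : y^-1 <= ln y - ln x.
    have := expR_ge1Dx (ln (x / y)); rewrite lnK ?posrE ?divr_gt0// ln_div ?posrE//.
    have -> : x / y = 1 - y^-1 by rewrite (_ : x = y - 1) ?mulrBl ?mulfV ?mul1r ?gt_eqF// xy addrK.
    by rewrite lerD2l lerNr opprB.
  have := expR_ge1Dx (s * (ln y - ln x)); have := ler_wpM2l (ltW s0) h => hs he.
  have p0 := pw_gt0 s l.+1.
  have : pw s l.+1 * (1 + s / y) <= pw s l.+1 * expR (s * (ln y - ln x)) by rewrite ler_pM2l//; apply: le_trans he; rewrite lerD2l.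
  by rewrite mulrDr mulr1 lerBrDl => /(le_trans _); apply; rewrite lerD2l mulrCA.
apply: le_trans h1 _; rewrite /pw_cst -mulrA ler_pM2l ?expR_gt0//.
by rewrite mulrC ler_pdivlMr// mulrC.
Qed.

Lemma pw_sum s j n : 0 < s -> \sum_(l < n) pw (1 + s) (j + l) <= pw_cst s * pw s j.
Proof.
move=> s0; have c0 : 0 < pw_cst s by rewrite divr_gt0// expR_gt0.
suff : \sum_(l < n) pw (1 + s) (j + l) <= pw_cst s * (pw s j - pw s (j + n)).
  by move=> h; apply: le_trans h _; rewrite ler_pM2l// gerBl ltW// pw_gt0.
elim: n => [|n IH]; first by rewrite big_ord0 addn0 subrr mulr0.
rewrite big_ord_recr/=; apply: le_trans (lerD IH (pw_le (j + n) s0)) _.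
by rewrite -mulrDr addrA subrK addnS.
Qed.

Lemma powR_pw_le s (y : nat) : 0 < s -> (1 + y%:R `^ s)^-1 <= expR (s * ln 2) * pw s y.
Proof.
move=> s0; have p0 : 0 <= y%:R `^ s :> R by exact: powR_ge0.
rewrite /pw -expRD -[leRHS]invrK -expRN lef_pV2 ?posrE ?expR_gt0 ?ltr_pwDl//.
rewrite opprD opprK addrC -mulrBr; case: y p0 => [|y] p0.
  rewrite ln1 sub0r mulrN; apply: le_trans (_ : 1 <= _); last by rewrite lerDl.
  by rewrite -[leRHS]expR0 ler_expR oppr_le0 mulr_ge0 ?(ltW s0)// ln_ge0 ?ler1n.
apply: le_trans (_ : y.+1%:R `^ s <= _); last by rewrite lerDr.
rewrite /powR gt_eqF// ler_expR ler_pM2l// lerBlDr -lnM ?posrE// ler_ln ?posrE ?mulr_gt0//.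
by rewrite -natrM ler_nat; lia.
Qed.

End power_sums.

Section environment.
Variables (R : realType) (w : int -> int -> R) (kap K beta : R).
Hypotheses (w0 : forall x y, 0 <= w x y) (wC : forall x y, w x y = w y x).
Hypotheses (kap0 : 0 < kap) (wkap : forall x, kap <= w x (x + 1)).
Hypotheses (K0 : 0 < K) (beta0 : 0 < beta).
Hypothesis wK : forall (x : int) (y : nat), w x (x + y%:Z) <= K / (1 + y%:R `^ (3 + beta)).

Let K' := K * expR ((3 + beta) * ln 2).
Let q l := K' * pw (3 + beta) l.
Let t j := K' * pw_cst (2 + beta) * pw (2 + beta) j.
Let C := total_conductance w.

Let lefts (x : int) (j : nat) : set int := [set y : int | y <= x - j%:Z].
Let rights (x : int) (j : nat) : set int := [set y : int | x + j%:Z <= y].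

Let K'0 : 0 < K'. Proof. by rewrite mulr_gt0 ?expR_gt0. Qed.
Let b2 : 0 < 2 + beta. Proof. by rewrite addr_gt0. Qed.
Let b3 : 3 + beta = 1 + (2 + beta). Proof. by ring. Qed.

Let wq x (l : nat) : w x (x + l%:Z) <= q l.
Proof.
apply: le_trans (wK x l) _; rewrite /q /K' -mulrA ler_pM2l//.
by apply: powR_pw_le; rewrite addr_gt0.
Qed.

Let wq' x (l : nat) : w x (x - l%:Z) <= q l.
Proof. by have := wq (x - l%:Z) l; rewrite subrK wC. Qed.

Let q_sum j n : \sum_(l < n) q (j + l) <= t j.
Proof. by rewrite -mulr_sumr /t -mulrA ler_pM2l// b3; exact: pw_sum. Qed.

Let esum_le (S : set int) (e : nat -> int) (F : int -> R) B :
  (forall y, 0 <= F y) -> set_bij setT S e -> (forall n, \sum_(l < n) F (e l) <= B) ->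
  (\esum_(y in S) (F y)%:E <= B%:E)%E.
Proof.
move=> F0 Se FB; rewrite (@reindex_esum R _ _ _ _ _ (fun y => (F y)%:E) Se) -nneseries_esumT; last first.
  by move=> n; rewrite lee_fin.
apply: lime_le; first by apply: is_cvg_nneseries => n _ _; rewrite lee_fin.
by apply: nearW => n; rewrite big_mkord sumEFin lee_fin.
Qed.

Let left_sum (x : int) (j : nat) : (\esum_(y in lefts x j) (w x y)%:E <= (t j)%:E)%E.
Proof.
apply: (esum_le (e := fun l => x - (j + l)%N%:Z)) => //.
  split => [l _|l l' _ _ /= ll'|y]; rewrite /lefts /rights /=.
  - by lia.
  - by lia.
  move=> yx.
  by exists `|(x - j%:Z - y)%R|%N => //; lia.
by move=> n; apply: le_trans (q_sum j n); apply: ler_sum => l _; exact: wq'.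
Qed.

Let right_sum (x : int) (j : nat) : (\esum_(y in rights x j) (w x y)%:E <= (t j)%:E)%E.
Proof.
apply: (esum_le (e := fun l => x + (j + l)%N%:Z)) => //.
  split => [l _|l l' _ _ /= ll'|y]; rewrite /lefts /rights /=.
  - by lia.
  - by lia.
  move=> yx.
  by exists `|(y - x - j%:Z)%R|%N => //; lia.
by move=> n; apply: le_trans (q_sum j n); apply: ler_sum => l _; exact: wq.
Qed.

Let split_sum (x : int) : (\esum_(y in [set: int]) (w x y)%:E =
    \esum_(y in lefts x 0) (w x y)%:E + \esum_(y in rights x 1) (w x y)%:E)%E.
Proof.
rewrite [X in (X + _)%E]esum_mkcond [X in (_ + X)%E]esum_mkcond -esumD; last 2 first.
- by move=> y _; case: ifP => _; rewrite lee_fin.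
- by move=> y _; case: ifP => _; rewrite lee_fin.
apply: eq_esum => y _; rewrite /lefts /rights; have [yx|xy] := leP (y : int) x.
  rewrite mem_set/=; last by lia.
  by rewrite memNset ?adde0//=; apply/negP; lia.
rewrite memNset/=; last by apply/negP; lia.
by rewrite mem_set ?add0e//=; lia.
Qed.

Let CE x : (C x)%:E = \esum_(y in [set: int]) (w x y)%:E.
Proof.
rewrite /C /total_conductance fineK// ge0_fin_numE; last by apply: esum_ge0 => y _; rewrite lee_fin.
by rewrite split_sum; apply: le_lt_trans (leeD (left_sum x 0) (right_sum x 1)) _; rewrite -EFinD ltry.
Qed.

Let C_le x : C x <= t 0%N + t 1%N.
Proof.
rewrite -lee_fin CE EFinD; apply: le_trans (leeD (left_sum x 0) (right_sum x 1)).
by rewrite split_sum.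
Qed.

Let C_ge x : kap <= C x.
Proof.
apply: le_trans (wkap x) _; rewrite -lee_fin CE.
by apply: esum_ge; exists [set (x + 1)%R]; [split|rewrite fsbig_set1].
Qed.

Let C_gt0 x : 0 < C x. Proof. exact: lt_le_trans (C_ge x). Qed.

Let p_ge0 x y : 0 <= transition w x y.
Proof. by rewrite divr_ge0// ltW// C_gt0. Qed.

Let p_sum x : \esum_(y in [set: int]) (transition w x y)%:E = 1%E.
Proof.
transitivity (\esum_(y in [set: int]) ((C x)^-1%:E * (w x y)%:E))%E.
  by apply: eq_esum => y _; rewrite -EFinM mulrC.
rewrite esumZl ?invr_gt0// => [|y]; last by rewrite lee_fin.
by rewrite -CE -EFinM mulVf ?gt_eqF.
Qed.

Lemma nice_environment : exists (p : kernel R) (D : R) (q' t' : nat -> R),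
  (forall x y, p x y = transition w x y) /\ nice w p C kap D q' t'.
Proof.
exists (Kernel p_ge0 p_sum).
(* The sum of the bounds for the total conductance, for the sum of k^2 q k and for the sum of j t j.
   The terms of the last two series decay like k^(-1 - beta). *)
pose D := t 0%N + t 1%N + K' * pw_cst beta + K' * pw_cst (2 + beta) * pw_cst beta.
have c0 s : 0 < s -> 0 < pw_cst s :> R by move=> s0; rewrite divr_gt0// expR_gt0.
have t0 j : 0 < t j by rewrite /t mulr_gt0 ?pw_gt0// mulr_gt0// c0.
have a1 : 0 < K' * pw_cst beta by rewrite mulr_gt0 ?c0.
have a2 : 0 < K' * pw_cst (2 + beta) * pw_cst beta by rewrite mulr_gt0 ?c0// mulr_gt0// c0.
have t00 := t0 0%N; have t01 := t0 1%N.
have sum1 n : \sum_(k < n) pw (1 + beta) k <= pw_cst beta.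
  by have := pw_sum 0 n beta0; rewrite pw0 mulr1.
have half x (S : set int) : C x * av (Kernel p_ge0 p_sum) x (fun z => (z \in S)%:R) =
    fine (\esum_(y in S) (w x y)%:E).
  have b01 : bnd (fun z : int => (z \in S)%:R : R).
    by apply: bnd01 => z; case: (z \in S); rewrite ?lexx ?ler01.
  have := @avE R (Kernel p_ge0 p_sum) x (fun z => (z \in S)%:R) (fun z => ler0n R _) b01.
  move=> /(congr1 (fun v => (C x)%:E * v)%E); rewrite -EFinM -esumZl// => [|y]; last first.
    by rewrite lee_fin mulr_ge0//= p_ge0.
  rewrite [RHS](_ : _ = \esum_(y in S) (w x y)%:E); last first.
    rewrite [RHS]esum_mkcond; apply: eq_esum => y _ /=; rewrite -EFinM mulrA.
    rewrite /transition mulrCA mulfV ?gt_eqF// mulr1.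
    by case: ifP => h; rewrite ?mulr1 ?mulr0.
  by move=> <-.
have half_le x (S : set int) j : (\esum_(y in S) (w x y)%:E <= (t j)%:E)%E ->
    fine (\esum_(y in S) (w x y)%:E) <= t j.
  move=> h; rewrite -lee_fin fineK// ge0_fin_numE.
    by apply: le_lt_trans h _; rewrite ltry.
  by apply: esum_ge0 => y _; rewrite lee_fin.
exists D, q, t; split => //; split => //.
- by move=> x y /=; rewrite /transition mulrCA mulfV ?gt_eqF ?mulr1// C_gt0.
- by move=> x; rewrite C_ge/=; apply: le_trans (C_le x) _; rewrite /D; lra.
- move=> x y; have [xy|yx] := leP x y.
    by have := wq x `|x - y|; rewrite (_ : x + _ = y)//; lia.
  by have := wq' x `|x - y|; rewrite (_ : x - _ = y)//; lia.
- move=> n; apply: le_trans (_ : K' * pw_cst beta <= _); last by rewrite /D; lra.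
  apply: le_trans (_ : \sum_(k < n) K' * pw (1 + beta) k <= _); last by rewrite -mulr_sumr ler_pM2l.
  have b21 : 2 + beta = 1 + (1 + beta) by ring.
  apply: ler_sum => k _; rewrite /q mulrCA ler_pM2l// -(pwS (1 + beta)) -b21 -(pwS (2 + beta)) -b3 mulrA.
  rewrite ler_wpM2r ?(ltW (pw_gt0 _ _))// expr2.
  by apply: ler_pM; rewrite ?ler_nat.
- move=> x j; rewrite (_ : (fun z : int => _) = (fun z => (z \in lefts x j)%:R)); last first.
    by apply/funext => z; congr (_%:R); congr nat_of_bool; apply/idP/idP; rewrite inE.
  by rewrite half; apply: half_le; exact: left_sum.
- move=> x j; rewrite (_ : (fun z : int => _) = (fun z => (z \in rights x j)%:R)); last first.
    by apply/funext => z; congr (_%:R); congr nat_of_bool; apply/idP/idP; rewrite inE.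
  by rewrite half; apply: half_le; exact: right_sum.
- move=> n; apply: le_trans (_ : K' * pw_cst (2 + beta) * pw_cst beta <= _); last by rewrite /D; lra.
  apply: le_trans (_ : \sum_(k < n) K' * pw_cst (2 + beta) * pw (1 + beta) k <= _); last first.
    by rewrite -mulr_sumr ler_pM2l// mulr_gt0 ?c0.
  apply: ler_sum => k _; rewrite /t mulrCA ler_pM2l; last by rewrite mulr_gt0// c0.
  have b21 : 2 + beta = 1 + (1 + beta) by ring.
  rewrite -(pwS (1 + beta)) -b21.
  by rewrite ler_wpM2r ?(ltW (pw_gt0 _ _))// ler_nat.
Qed.

End environment.

(* [filterS] cannot be applied directly when [T] is the type of environments:
   the [Filter] instance is not found. *)
Lemma ae_imp d (T : measurableType d) (R : realType) (P : probability T R) (A B : T -> Prop) :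
  {ae P, forall x, A x} -> (forall x, A x -> B x) -> {ae P, forall x, B x}.
Proof. by move=> hA h; apply: filterS hA. Qed.

Lemma ae_imp2 d (T : measurableType d) (R : realType) (P : probability T R) (A B C : T -> Prop) :
  {ae P, forall x, A x} -> {ae P, forall x, B x} -> (forall x, A x -> B x -> C x) ->
  {ae P, forall x, C x}.
Proof. by move=> hA hB h; apply: filterS2 hA hB. Qed.

Section random_environment.
Variables (R : realType) (P : probability (environment R) R).
Hypothesis hs : stationary P.

Lemma measurable_conductance (x y : int) (S : set R) : measurable S ->
  measurable [set w : environment R | S (w x y)].
Proof.
move=> mS; apply: sub_sigma_algebra; exists (x, y) => //; exists S => //.
by rewrite setTI.
Qed.

(** Stationarity moves the exceptional null set from 0 to each x; the integers are covered by the
    two countable families [Posz] and [Negz]. *)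
Lemma stationary_ae (y : int) (S : set R) : measurable S -> {ae P, forall w, S (w 0 y)} ->
  {ae P, forall w, forall x, S (w x (x + y))}.
Proof.
move=> mS h0.
have h x : {ae P, forall w, S (w x (x + y))}.
  pose B : set (environment R) := [set w | (~` S) (w 0 y)].
  have mB : measurable B by apply: measurable_conductance; exact: measurableC.
  have PB : P B = 0%E by apply: measure_negligible.
  exists [set w | (~` S) (w x (x + y))]; split.
  - by apply: measurable_conductance; exact: measurableC.
  - by rewrite -PB -(hs x mB); congr (P _); apply/seteqP; split => w; rewrite /B /env_shift /= add0r addrC.
  - by [].
have h1 : {ae P, forall w, forall n : nat, S (w (Posz n) (Posz n + y))} by apply: ae_foralln.
have h2 : {ae P, forall w, forall n : nat, S (w (Negz n) (Negz n + y))} by apply: ae_foralln.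
by apply: (ae_imp2 h1 h2) => w w1 w2 [].
Qed.

Lemma ae_nice : conductances P -> condition_E P -> condition_K P ->
  {ae P, forall w, exists (p : kernel R) (C : int -> R) (kap D : R) (q t : nat -> R),
    (forall x y, p x y = transition w x y) /\ nice w p C kap D q t}.
Proof.
move=> hc [kap kap0 hE] [K [beta [K0 beta0 hK]]].
have mE : measurable [set v : R | kap <= v] by rewrite -set_itvcy; exact: measurable_itv.
have mK (y : nat) : measurable [set v : R | v <= K / (1 + y%:R `^ (3 + beta))].
  by rewrite -set_itvNyc; exact: measurable_itv.
have h1 := stationary_ae mE hE.
have h2 : {ae P, forall w, forall (y : nat) (x : int), w x (x + y%:Z) <= K / (1 + y%:R `^ (3 + beta))}.
  apply: ae_foralln => y; apply: (stationary_ae (mK y)).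
  by apply: (ae_imp hK) => w hw; exact: hw.
have h0 : {ae P, forall w, forall x y : int, 0 <= w x y /\ w x y = w y x} := hc.
have h12 := ae_imp2 h1 h2 (fun _ a b => conj a b).
apply: (ae_imp2 h0 h12) => w w1 [w2 w3].
have [p [D [q [t [pE Hn]]]]] := nice_environment (fun x y => (w1 x y).1) (fun x y => (w1 x y).2)
  kap0 w2 K0 beta0 (fun x y => w3 y x).
by exists p, (total_conductance w), kap, D, q, t.
Qed.

Section walk_clt.
Variables (w : int -> int -> R) (p : kernel R) (Q : probability trajectory R).
Hypotheses (pE : forall x y, p x y = transition w x y) (hQ : quenched_law w 0 Q).

Lemma quenched_kernel (k : nat) (s : nat -> int) :
  Q [set X : trajectory | forall i, (i <= k)%N -> X i = s i] =
    ((s 0%N == 0)%:R * \prod_(i < k) p (s i) (s i.+1))%:E.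
Proof. by rewrite hQ; congr (_ * _)%:E; apply: eq_bigr => i _; rewrite pE. Qed.

Lemma walk_clt d (T : measurableType d) (PB : probability T R) (W : 'I_3 -> R -> T -> R) sigma :
  nice_bm PB W ->
  cvg_in_law (@C0 R) (@path_dist R) (fun _ => Q) (fun m X => rescaled_path sigma m X)
    PB (fun b t => W ord0 t b) ->
  forall K L Phi, lipf K L Phi ->
    walk_exp p sigma m K 0 Phi @[m --> \oo] --> expect PB (fun b => Phi (W ord0 ^~ b)).
Proof.
move=> bmW h K L Phi lP; have [mW _ cW _ _] := bmW.
have [K0 _ P01 _] := lP.
have b1 : exists M, forall x, `|Phi x| <= M by exists 1 => x; exact: lipf_norm lP.
have := h Phi b1 (lipf_continuous_for lP).
rewrite (expectE PB (bounded_meas_lipf PB (mW ord0) (cW ord0) lP)).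
rewrite (_ : (fun n : nat => _) = (fun n => (walk_exp p sigma n K 0 Phi)%:E)); last first.
  apply/funext => m; rewrite /walk_exp; apply: (quenched_expect quenched_kernel).
  - by move=> s; have /andP[] := P01 (rescaled_path sigma m s).
  - by apply: bnd01 => s; exact: P01.
  - exact: depends_lipf lP (ltnSn _).
by move/fine_cvg.
Qed.

End walk_clt.
End random_environment.

(** * The conditioned walk *)

Section exit_decomposition.
Variables (R : realType) (p : kernel R).

(** Inside [In] the hitting probability is harmonic, so it is evaluated at the exit; walks that have
    not exited are counted with probability 1. *)
Lemma hit_exitn_le (In A B : pred int) T x :
  (forall y, In y -> ~~ A y && ~~ B y) ->
  av p x (hit p A B) <= exitn p In (hit p A B) T x + survive p In T x.
Proof.
move=> InAB; have h01 := hit01 p A B.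
elim: T x => [|T IH] x.
  by rewrite /= add0r; have /andP[] := av01 p x h01.
rewrite /= -avD.
- apply: le_av => [||y]; first exact: bnd01.
    apply: bndD.
      apply: bnd01 => y; case: ifP => _ //.
      exact: exitn_bnd ler01 h01.
    by apply: bnd01 => y; case: ifP => _; [exact: survive01|rewrite lexx ler01].
  case: ifPn => [/InAB/andP[nA nB]|_]; last by rewrite addr0.
  by rewrite (hit_harmonic p nA nB).
- by apply: bnd01 => y; case: ifP => _ //; exact: exitn_bnd ler01 h01.
- by apply: bnd01 => y; case: ifP => _; [exact: survive01|rewrite lexx ler01].
Qed.

Lemma hitn_compl (A B : pred int) k k' x : (forall y, A y -> ~~ B y) ->
  hitn p A B k x + hitn p B A k' x <= 1.
Proof.
move=> AB; rewrite -!Ew_reach.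
have dr (A' B' : pred int) j : depends j (fun s => (reach A' B' j s)%:R : R).
  by move=> s s' ss'; rewrite (depends_reach A' B' ss').
have b (A' B' : pred int) j : bnd (fun s => (reach A' B' j s)%:R : R).
  by apply: bnd01 => s; case: (reach _ _ _ _); rewrite ?lexx ?ler01.
rewrite -(Ew_depends p x (leq_addr k' k) (dr A B k)) -(Ew_depends p x (leq_addl k k') (dr B A k')).
rewrite -EwD// -[leRHS](Ew_cst p (k + k') x); apply: le_Ew; [exact: bndD|exact: bnd_cst|].
move=> s _; suff : ~~ (reach A B k s && reach B A k' s) by case: (reach A B k s); case: (reach B A k' s) => //= _; rewrite ?addr0 ?add0r ?lexx ?ler01.
elim: k k' s => [|k IH] [|k'] s /=; rewrite ?orbF.
- by apply/negP => /andP[/AB/negP].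
- by apply/negP => /andP[/[dup]/AB nB As /orP[Bs|/andP[/negP]//]]; rewrite Bs in nB.
- by apply/negP => /andP[/orP[As|/andP[/negP nB _]] Bs //]; have /negP := AB _ As.
apply/negP => /andP[/orP[As|/andP[nB h1]] /orP[Bs|/andP[nA h2]]].
- by have /negP := AB _ As.
- by move/negP: nA.
- by move/negP: nB.
- by have /negP := IH k' (shift 1 s); rewrite h1 h2.
Qed.

Lemma hit_compl (A B : pred int) k x : (forall y, A y -> ~~ B y) ->
  hit p A B x + hitn p B A k x <= 1.
Proof.
by move=> AB; rewrite -lerBrDr; apply: hit_le => k'; rewrite lerBrDr; exact: hitn_compl.
Qed.

Definition entry (N V : nat) : pred int := fun y => N%:Z <= y < (N + V)%N%:Z.

Variables (w : int -> int -> R) (C : int -> R) (kap D : R) (q t : nat -> R).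
Hypothesis Hn : nice w p C kap D q t.

Let kap0 : 0 < kap. Proof. exact: nice_kap Hn. Qed.
Let D0 : 0 < D. Proof. exact: nice_D_gt0 Hn. Qed.

Lemma exitn_entry (N V T : nat) : exitn p (strip N) (fun y => (N%:Z <= y)%R%:R) T 0 =
  exitn p (strip N) (fun y => (entry N V y)%:R) T 0 +
  exitn p (strip N) (fun y => ((N + V)%N%:Z <= y)%R%:R) T 0.
Proof.
have b01 (b : bool) : 0 <= (b%:R : R) <= 1 by case: b; rewrite ?lexx ?ler01.
rewrite -(exitnD p _ T 0 ler01 (fun y => b01 _) (fun y => b01 _)); congr exitn.
apply/funext => y; rewrite /entry; have [h|h] := leP (N + V)%N%:Z y.
  by rewrite andbF add0r (_ : (N%:Z <= y)%R)//; lia.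
by rewrite andbT addr0.
Qed.

(** The walk steps from 0 to 1 with probability at least kap / D and then [hit_strip_ge] applies;
    walks too slow to exit by time T are bounded by [survive_le]. *)
Lemma up_exit_ge : exists2 c : R, 0 < c & forall N T : nat, (1 < N)%N -> (0 < T)%N ->
  c / N%:R <= exitn p (strip N) (fun y => (N%:Z <= y)%R%:R) T 0 + N%:R * D / (kap * T%:R).
Proof.
have [c0 c00 hc] := hit_strip_ge Hn.
exists (kap / D * c0); first by rewrite mulr_gt0 ?divr_gt0.
move=> N T N1 T0; pose A : pred int := fun z => N%:Z <= z; pose B : pred int := fun z => z <= 0.
have N0 : (0 < N)%N by exact: ltnW.
have h01 := hit01 p A B.
apply: le_trans (_ : av p 0 (hit p A B) <= _).
  apply: le_trans (_ : p 0 1 * hit p A B 1 <= _); last first.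
    by apply: av_ge1 => [|z]; [exact: bnd01|have /andP[] := h01 z].
  rewrite -mulrA; apply: ler_pM; rewrite ?divr_ge0 ?(ltW kap0) ?(ltW D0) ?(ltW c00)//; last exact: hc.
  by have := nice_step Hn 0; rewrite add0r.
have InAB y : strip N y -> ~~ A y && ~~ B y by rewrite /strip /A /B; lia.
apply: le_trans (hit_exitn_le T 0 InAB) _; apply: lerD; last exact (survive_le Hn N0 T0).
have b01 (b : bool) : 0 <= (b%:R : R) <= 1 by case: b; rewrite ?lexx ?ler01.
apply: (le_exitn p T 0 ler01 h01 (fun y => b01 _)) => y; rewrite /strip => yN.
have [h|h] := boolP (N%:Z <= y)%R; first by have /andP[] := h01 y.
by rewrite hit_B// /B; move: yN h; lia.
Qed.

(** The exit point is in the window, where [beta] bounds the hitting probability, or beyond the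
    window, where 1 does, or at most 0, where it vanishes. *)
Lemma hit_up_le (n N V T : nat) (beta : R) : (0 < N)%N -> (N <= n)%N -> (0 < T)%N -> 0 <= beta ->
  (forall y, entry N V y -> hit p (fun z => n%:Z <= z) (fun z => z <= 0) y <= beta) ->
  av p 0 (hit p (fun z => n%:Z <= z) (fun z => z <= 0)) <=
  beta * exitn p (strip N) (fun y => (entry N V y)%:R) T 0 +
  (exitn p (strip N) (fun y => ((N + V)%N%:Z <= y)%R%:R) T 0 + N%:R * D / (kap * T%:R)).
Proof.
move=> N0 Nn T0 b0 hb; set A : pred int := fun z => n%:Z <= z; set B : pred int := fun z => z <= 0.
have h01 := hit01 p A B.
have InAB y : strip N y -> ~~ A y && ~~ B y by rewrite /strip /A /B; lia.
apply: le_trans (hit_exitn_le T 0 InAB) _; rewrite addrA; apply: lerD; last exact (survive_le Hn N0 T0).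
have b01 (b : bool) : 0 <= (b%:R : R) <= 1 by case: b; rewrite ?lexx ?ler01.
have bM : 0 <= beta + 1 by rewrite addr_ge0.
rewrite -(exitnZ p _ beta T 0 ler01 (fun y => b01 _)).
have bb y : 0 <= beta * (entry N V y)%:R <= beta + 1.
  by case: (entry N V y); rewrite /= ?mulr1 ?mulr0 ?b0 ?lexx ?bM ?lerDl ?ler01.
have b1 (b : bool) : 0 <= (b%:R : R) <= beta + 1 by case: b; rewrite ?lexx ?bM ?ler01 ?lerDr.
rewrite -(exitnD p _ T 0 bM bb (fun y => b1 _)).
have hM y : 0 <= hit p A B y <= beta + 1.
  by have /andP[-> h1] := h01 y; rewrite (le_trans h1)// lerDr.
have sM y : 0 <= beta * (entry N V y)%:R + ((N + V)%N%:Z <= y)%R%:R <= beta + 1.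
  rewrite addr_ge0//=; last by case/andP: (bb y).
  rewrite /entry; have [h|h] := leP (N + V)%N%:Z y; first by rewrite andbF mulr0 add0r lerDr.
  by rewrite andbT addr0; case: (N%:Z <= y)%R; rewrite /= ?mulr1 ?mulr0 ?lerDl ?ler01.
apply: (le_exitn p T 0 bM hM sM) => y; rewrite /strip => yN.
have /andP[h0 h1] := h01 y.
have [h|h] := leP (N + V)%N%:Z y; first by apply: le_trans h1 _; rewrite lerDr; case/andP: (bb y).
rewrite addr0; have [hy|hy] := boolP (entry N V y); first by rewrite mulr1; exact: hb.
rewrite mulr0 hit_B//; rewrite /A /B; move: yN hy h; rewrite /entry; lia.
Qed.

End exit_decomposition.

Lemma entry_bounds N V (y : int) : entry N V y -> 0 <= y < (N + V)%N%:Z.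
Proof. by rewrite /entry; lia. Qed.

Lemma strip_entry_bounds N V (y y' : int) : entry N V y -> strip N y' -> 0 <= y' < (N + V)%N%:Z.
Proof. by rewrite /entry /strip; lia. Qed.

Lemma entry_ge0 N V (y : int) : entry N V y -> 0 <= (0 : int) < (N + V)%N%:Z.
Proof. by rewrite /entry; lia. Qed.

Section escape_event.
Variable R : realType.

Lemma Lambda'P (n : nat) (s : nat -> int) : (0 < n)%N ->
  Lambda' R n s <-> exists k, n%:Z <= s k /\ forall j, (0 < j < k)%N -> 0 < s j.
Proof.
move=> n0; split.
  rewrite /Lambda' /= => h; have [_ [k nk <-] klt] : exists2 x, [set (k%:R)%:E | k in [set k | Posz n <= s k]] x & (x < tau_hat R s)%E.
    by have := ereal_inf_lt h => -[x xE xl]; exists x.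
  exists k; split => // j /andP[j0 jk]; rewrite ltNge; apply/negP => sj.
  have : (tau_hat R s <= (j%:R)%:E)%E by apply: ereal_inf_lbound; exists j.
  by move=> /(lt_le_trans klt); rewrite lte_fin ltr_nat ltnNge ltnW.
move=> [k [nk pos]]; rewrite /Lambda' /=.
apply: (@le_lt_trans _ _ (k%:R)%:E); first by apply: ereal_inf_lbound; exists k.
apply: (@lt_le_trans _ _ (k.+1%:R)%:E); first by rewrite lte_fin ltr_nat.
apply: le_ereal_inf_tmp => _ [j [j1 sj] <-]; rewrite lee_fin ler_nat ltnNge leq_eqVlt.
apply/negP => /orP[/eqP jk|jk]; first by move: sj; rewrite jk; lia.
by have := pos j (ltac:(rewrite j1 jk)); lia.
Qed.

Lemma reachP (A B : pred int) k (s : nat -> int) : reach A B k s ->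
  exists2 i, (i <= k)%N & A (s i) /\ forall j, (j < i)%N -> ~~ B (s j).
Proof.
elim: k s => [|k IH] s /=; first by rewrite orbF => h; exists 0%N.
move=> /orP[h|/andP[nB /IH[i ik [Ai Bi]]]]; first by exists 0%N.
by exists i.+1 => //; split => // -[|j] // ji; exact: Bi.
Qed.

Lemma Lambda'_reach (n : nat) (s : nat -> int) : s 0%N = 0 -> (0 < n)%N ->
  Lambda' R n s <-> exists k, reach (fun z => n%:Z <= z) (fun z => z <= 0) k (shift 1 s).
Proof.
move=> s0 n0; rewrite Lambda'P//; split => [[k [nk pos]]|[k /reachP[i _ [ni nB]]]].
  case: k nk pos => [|k] nk pos; first by move: nk; rewrite s0; lia.
  exists k; apply: (@reachT _ _ _ _ k) => // j jk.
  by rewrite -ltNge; apply: pos; rewrite /= ltnS.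
exists i.+1; split => // -[//|j]; rewrite ltnS => /andP[_ ji].
by rewrite ltNge; exact: nB ji.
Qed.

Variables (sigma e r : R) (Gam : (R -> R) -> R).
Hypotheses (sigma0 : 0 < sigma) (Gam01 : forall z, 0 <= Gam z <= 1).
Hypotheses (e0 : 0 < e) (r0 : 0 < r).
Let a := sigma^-1.

(** The whole rescaled path is a delayed version of the path after the entry: the piece before it
    lasts at most e and stays below e in size, so [gfun] bounds [Gam] from below. The walk is
    positive in the strip, and after the entry [above] keeps it positive until it passes n. *)
Lemma exit_path_le (n N V T : nat) (s : nat -> int) : s 0%N = 0 -> (0 < n)%N ->
  T%:R <= e * (n ^ 2)%:R -> (N + V)%:R <= e * (sigma * n%:R) ->
  let g := exit_path (strip N) (entry N V) T (fun s' => phif a Gam e r (rescaled_path sigma (n ^ 2) s')) s in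
  0 < g -> Lambda' R n s /\ g <= Gam (rescaled_path sigma (n ^ 2) s).
Proof.
move=> s0 n0 Te Ve /=; set m := (n ^ 2)%N.
have m0 : (0 < m)%N by rewrite /m expn_gt0 n0.
have mR : 0 < m%:R :> R by rewrite ltr0n.
have DE : sigma * Num.sqrt (m%:R : R) = sigma * n%:R by rewrite /m natrX sqrtr_sqr ger0_norm.
have D0 : 0 < sigma * n%:R by rewrite mulr_gt0// ltr0n.
have e0' := e0; have r0' := r0.
have [[i [/andP[i0 iT] Gi Ii ->]]|->] := exit_path_cases (strip N) (entry N V) T
  (fun s' => phif a Gam e r (rescaled_path sigma m s')) s; last by rewrite ltxx.
set z := rescaled_path sigma m (shift i s).
move=> g0; have hz : 0 < hfun a Gam e r z := lt_le_trans g0 (phif_le a Gam01 e z r0).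
have [t [/andP[t0 tr] zt zu]] : exists t, above a r z t.
  by apply: contrapT => no; move: hz; rewrite /hfun asboolF ?ltxx.
have zpos k : k%:R / m%:R <= t -> 0 < s (i + k)%N.
  move=> kt; have := zu (k%:R / m%:R); rewrite divr_ge0//= kt => /(_ isT).
  rewrite /z rescaled_grid// DE => h; have : 0 < (shift i s k)%:~R / (sigma * n%:R) by lra.
  by rewrite pmulr_lgt0 ?invr_gt0// ltr0z.
have spos j : (0 < j < i)%N -> 0 < s j.
  by move=> /Ii[]; rewrite /strip => /andP[].
pose k := Num.truncn (m%:R * t).
have /andP[k1 k2] := truncn_itv (mulr_ge0 (ltW mR) t0).
have kt : k%:R / m%:R <= t by rewrite ler_pdivrMr// mulrC.
(* The interpolated value at t exceeds a, so one of the two neighbouring vertices is at least n. *)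
have big : n%:Z <= s (i + k)%N \/ n%:Z <= s (i + k.+1)%N.
  apply: contrapT => /not_orP[/negP h1 /negP h2]; rewrite -ltNge in h1; rewrite -ltNge in h2.
  have l1 : (s (i + k)%N)%:~R <= n%:R :> R by rewrite -[n%:R]/((n%:Z)%:~R) ler_int ltW.
  have l2 : (s (i + k.+1)%N)%:~R <= n%:R :> R by rewrite -[n%:R]/((n%:Z)%:~R) ler_int ltW.
  move: zt; rewrite /z /rescaled_path -/k DE /shift ler_pdivlMr// => zt.
  have an : a * (sigma * n%:R) = n%:R by rewrite /a mulKf// gt_eqF.
  move: zt; rewrite mulrDl an => zt; have rn : 0 < r * (sigma * n%:R) by rewrite mulr_gt0.
  set x := (s (i + k)%N)%:~R in l1 zt; set y := (s (i + k.+1)%N)%:~R in l2 zt.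
  set th := m%:R * t - k%:R in zt.
  have th0 : 0 <= th by rewrite subr_ge0.
  have th1 : th <= 1 by move: k2; rewrite -natr1 /th -/k; lra.
  have : th * y <= th * n%:R by rewrite ler_wpM2l.
  have : (1 - th) * x <= (1 - th) * n%:R by rewrite ler_wpM2l// subr_ge0.
  lra.
split.
  apply/(Lambda'P _ n0); case: big => h.
    exists (i + k)%N; split => // j /andP[j0 jk].
    have [ji|ij] := ltnP j i; first by apply: spos; rewrite j0.
    rewrite -(subnKC ij); apply: zpos; apply: le_trans kt.
    by rewrite ler_pM2r ?invr_gt0// ler_nat leq_subLR ltnW.
  exists (i + k.+1)%N; split => // j /andP[j0 jk].
  have [ji|ij] := ltnP j i; first by apply: spos; rewrite j0.
  rewrite -(subnKC ij); apply: zpos; apply: le_trans kt.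
  by rewrite ler_pM2r ?invr_gt0// ler_nat leq_subLR -ltnS -addnS.
apply: le_trans (phif_le a Gam01 e z r0) _; apply: le_trans (hfun_gfun a Gam01 e r z) _.
apply: gfun_delayed => //; split; first exact: rescaled_C0.
exists (i%:R / m%:R); split.
- rewrite divr_ge0//= ler_pdivrMr//; apply: le_trans Te; by rewrite ler_nat.
- move=> u /andP[u0 ui].
  have sb j : (j <= i)%N -> `|(s j)%:~R| <= (N + V)%:R :> R.
    move=> ji; have : 0 <= s j < (N + V)%N%:Z.
      move: ji; rewrite leq_eqVlt => /orP[/eqP ->|ji].
        exact: entry_bounds Gi.
      case: j ji => [|j] ji; first by rewrite s0; exact: entry_ge0 Gi.
      by have [sj _] := Ii j.+1 ji; exact: strip_entry_bounds Gi sj.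
    move=> /andP[sj0 sjV]; rewrite -intr_norm ger0_norm// -[(N + V)%:R]/(((N + V)%N%:Z)%:~R) ler_int ltW//.
  have mu : m%:R * u <= i%:R by rewrite mulrC -ler_pdivlMr.
  have [ki|ik] := ltnP (Num.truncn (m%:R * u)) i.
    have := @rescaled_between R sigma m s u e 0 sigma0 m0 u0; rewrite /= mul0r !subr0 DE; apply.
      by apply: le_trans Ve; apply: sb; exact: ltnW.
    by apply: le_trans Ve; apply: sb.
  have -> : u = i%:R / m%:R.
    have /andP[h1 _] := truncn_itv (mulr_ge0 (ltW mR) u0).
    have : i%:R <= m%:R * u by apply: le_trans h1; rewrite ler_nat.
    by move=> h; apply/eqP; rewrite eq_le ui/= ler_pdivrMr// mulrC.
  rewrite rescaled_grid// DE normrM (gtr0_norm (_ : 0 < (sigma * n%:R)^-1)) ?invr_gt0//.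
  by rewrite ler_pdivrMr//; apply: le_trans Ve; exact: sb.
- by move=> u /andP[u0 _] _; rewrite [u + _]addrC rescaled_shift// subrr normr0 ltW.
Qed.

End escape_event.

(** * Integrals under the conditional law *)

Section conditioned_walk.
Variables (R : realType) (p : kernel R) (Q : probability trajectory R).
Hypothesis hQ : forall (k : nat) (s : nat -> int),
  Q [set X : trajectory | forall i, (i <= k)%N -> X i = s i] =
    ((s 0%N == 0)%:R * \prod_(i < k) p (s i) (s i.+1))%:E.

Lemma measurable_dependsb k (f : (nat -> int) -> bool) :
  (forall s s', (forall i, (i <= k)%N -> s i = s' i) -> f s = f s') ->
  measurable [set X : trajectory | f X].
Proof.
move=> df; have df' : depends k (fun s => (f s)%:R : R) by move=> s s' ss'; rewrite (df s s').
have := measurable_depends df' measurableT (measurable_set1 (1 : R)); rewrite setTI.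
congr measurable; apply/seteqP; split => X; rewrite /preimage/=; case: (f X) => //.
by move=> /esym/eqP; rewrite oner_eq0.
Qed.

Lemma measurable_Lambda' n : (0 < n)%N -> measurable (Lambda' R n).
Proof.
move=> n0; pose f k (X : nat -> int) := (n%:Z <= X k) && [forall j : 'I_k, (0 < j)%N ==> (0 < X j)].
rewrite (_ : Lambda' R n = \bigcup_k [set X : trajectory | f k X]).
  apply: bigcupT_measurable => k; apply: (@measurable_dependsb k) => s s' ss'.
  rewrite /f ss'//; congr (_ && _); apply: eq_forallb => j; rewrite ss'//; exact: ltnW.
apply/seteqP; split => X.
  move=> /(Lambda'P _ _ n0)[k [nk pos]]; exists k => //=; rewrite /f nk/=.
  by apply/forallP => j; apply/implyP => j0; apply: pos; rewrite j0 ltn_ord.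
move=> [k _ /andP[nk /forallP h]]; apply/(Lambda'P _ _ n0); exists k; split => // j /andP[j0 jk].
by have /implyP := h (Ordinal jk); exact.
Qed.

Let start : set trajectory := [set X | X 0%N = 0].

Let mstart : measurable start.
Proof.
rewrite (_ : start = [set X : trajectory | X 0%N == 0]).
  by apply: (@measurable_dependsb 0) => s s' ss'; rewrite ss'.
by apply/seteqP; split => X /=; [move=> ->|move/eqP].
Qed.

Let Qstart : Q (~` start) = 0%E.
Proof.
have := hQ 0 (fun=> 0); rewrite big_ord0 eqxx mulr1.
rewrite (_ : [set X | _] = start); last first.
  by apply/seteqP; split => X; [move=> /(_ 0%N (leqnn _))|move=> h i; rewrite leqn0 => /eqP ->].
move=> h; rewrite probability_setC// h; exact: subee.
Qed.

Lemma prob_Lambda'_le n : (0 < n)%N ->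
  fine (Q (Lambda' R n)) <= av p 0 (hit p (fun z => n%:Z <= z) (fun z => z <= 0)).
Proof.
move=> n0; set A : pred int := fun z => n%:Z <= z; set B : pred int := fun z => z <= 0.
pose H k : set trajectory := [set X | reach A B k (shift 1 X)].
have dH k s s' : (forall i, (i <= k.+1)%N -> s i = s' i) -> reach A B k (shift 1 s) = reach A B k (shift 1 s').
  by move=> ss'; apply: depends_reach => i ik; rewrite /shift ss'.
have mH k : measurable (H k) by apply: (@measurable_dependsb k.+1) => s s' ss'; exact: dH.
have QH k : Q (H k) = (av p 0 (hitn p A B k))%:E.
  have d : depends k.+1 (fun s => (reach A B k (shift 1 s))%:R : R).
    by move=> s s' ss'; rewrite (dH k s s').
  have E := quenched_expect hQ (fun s => ler0n _ _) _ d; rewrite /= in E.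
  have -> : Q (H k) = (\int[Q]_X ((reach A B k (shift 1 X))%:R)%:E)%E.
    have := @integral_indic _ _ _ Q setT measurableT (H k) (mH k); rewrite setIT => <-.
    by apply: eq_integral => X _; rewrite indicE /H; congr ((_ : bool)%:R%:E); apply/idP/idP; rewrite inE.
  rewrite E; last by apply: bnd01 => s; case: (reach _ _ _ _); rewrite ?lexx ?ler01.
  by congr (_%:E); apply: (congr1 (av p 0)); apply/funext => z; rewrite -Ew_reach.
have ndH : nondecreasing_seq H.
  apply/nondecreasing_seqP => k; apply/subsetPset => X; rewrite /H /= => /reachP[i ik [Ai Bi]].
  exact: (@reachT A B k.+1 (shift 1 X) i (leqW ik) Ai Bi).
have hb k : (Q (H k) <= (av p 0 (hit p A B))%:E)%E.
  rewrite QH lee_fin; apply: le_av => [||z]; try exact: bnd01 (hitn01 p A B k).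
    exact: bnd01 (hit01 p A B).
  exact: hitn_le_hit.
have mU : measurable (\bigcup_k H k) by exact: bigcupT_measurable.
have hU : (Q (\bigcup_k H k) <= (av p 0 (hit p A B))%:E)%E.
  have cv := nondecreasing_cvg_mu (mu := Q) mH mU ndH.
  by rewrite -(cvg_lim _ cv)//; apply: lime_le; [apply/cvg_ex; eexists; exact: cv|apply: nearW].
rewrite -lee_fin fineK ?fin_num_measure//; last exact: measurable_Lambda'.
apply: le_trans hU; apply: (@le_trans _ _ (Q ((\bigcup_k H k) `|` ~` start))).
  apply: le_measure; rewrite ?inE//; [exact: measurable_Lambda'|by apply: measurableU => //; exact: measurableC|].
  move=> X LX; have [X0|X0] := pselect (start X); last by right.
  by left; have [k hk] := (Lambda'_reach R X0 n0).1 LX; exists k.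
apply: le_trans (measureU2 _ _ _) _ => //; first exact: measurableC.
by rewrite [X in (_ + X)%E]Qstart adde0.
Qed.

(** The start at 0 holds only almost surely under [Q], and the pathwise estimates need it;
    multiplying by its indicator makes them hold for every trajectory. *)
Let at_start (g : (nat -> int) -> R) (X : nat -> int) : R := g X * (X 0%N == 0)%:R.

Let Ew_at_start k g : depends k g -> bnd g -> (forall X, X 0%N = 0 -> 0 <= g X) ->
  [/\ depends k (at_start g), forall X, 0 <= at_start g X &
    (\int[Q]_X (at_start g X)%:E = (Ew p k 0 g)%:E)%E].
Proof.
move=> dg [M gM] g0.
have dg' : depends k (at_start g) by move=> s s' ss'; rewrite /at_start (dg s s')// ss'.
have g'0 X : 0 <= at_start g X.
  rewrite /at_start; have [X0|_] := eqVneq (X 0%N) 0; last by rewrite mulr0.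
  by rewrite mulr1; exact: g0.
have bg' : bnd (at_start g).
  exists M => X; rewrite /at_start; apply: le_trans (gM X).
  by rewrite normrM; case: (_ == _); rewrite ?normr1 ?normr0 ?mulr1 ?mulr0.
split => //; rewrite (quenched_expect hQ g'0 bg' dg').
by rewrite (@eq_Ew _ _ _ _ _ g)// => s s0; rewrite /at_start s0 eqxx mulr1.
Qed.

Lemma Ew_le_prob (L : set trajectory) (k : nat) (g : (nat -> int) -> R) : measurable L ->
  (forall s, 0 <= g s <= 1) -> (forall X : trajectory, X 0%N = 0 -> 0 < g X -> L X) ->
  depends k g -> Ew p k 0 g <= fine (Q L).
Proof.
move=> mL g01 gL dg.
have [dg' g'0 Eg] := Ew_at_start dg (bnd01 g01) (fun X _ => (andP (g01 X)).1).
rewrite -lee_fin fineK ?fin_num_measure// -Eg.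
have := @integral_indic _ _ _ Q setT measurableT L mL; rewrite setIT => <-.
apply: le_lower_integral => X; first by rewrite lee_fin.
rewrite lee_fin indicE /at_start; have [X0|_] := eqVneq (X 0%N) 0; last by rewrite mulr0.
rewrite mulr1; have /andP[g0 g1] := g01 X; have [XL|/negP XL] := boolP (X \in L); first exact: g1.
by rewrite leNgt; apply/negP => gp; apply: XL; rewrite inE; exact: gL.
Qed.

Variable L : set trajectory.
Hypotheses (mL : measurable L) (QL : 0 < fine (Q L)).

Let c0 : 0 <= (fine (Q L))^-1. Proof. by rewrite invr_ge0 ltW. Qed.

Let m2 := mscale (NngNum c0) (mrestr Q mL).

Let cond_eq A : measurable A -> conditional_law Q L A = m2 A.
Proof.
move=> mA; rewrite /conditional_law /m2 /mscale /mrestr /= mulrC EFinM fineK//.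
by rewrite fin_num_measure//; exact: measurableI.
Qed.

(** Monotonicity of the lower integral allows an arbitrary f above the measurable g; g vanishes
    outside of [L], so its integral is not affected by the restriction. *)
Lemma conditional_ge (k : nat) (f : trajectory -> R) (g : (nat -> int) -> R) :
  (forall X : trajectory, X 0%N = 0 -> 0 <= g X <= f X) -> (forall X, 0 <= f X) -> bnd g ->
  (forall X : trajectory, X 0%N = 0 -> 0 < g X -> L X) -> depends k g ->
  ((Ew p k 0 g / fine (Q L))%:E <= \int[conditional_law Q L]_X (f X)%:E)%E.
Proof.
move=> gf f0 bg gL dg.
have g0 X : X 0%N = 0 -> 0 <= g X by move=> X0; have /andP[] := gf X X0.
have [dg' g'0 Eg] := Ew_at_start dg bg g0.
set g' := at_start g in dg' g'0 Eg.
have mg' : measurable_fun setT (fun X : trajectory => (g' X)%:E).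
  by apply/measurable_EFinP; exact: measurable_depends dg'.
have g'0E (X : trajectory) : (0 <= (g' X)%:E)%E by rewrite lee_fin.
rewrite (@eq_set_fun_integral _ _ _ (conditional_law Q L) m2 _ cond_eq).
apply: (@le_trans _ _ (\int[m2]_X (g' X)%:E)%E); last first.
  apply: le_lower_integral => X; first by [].
  rewrite lee_fin /g' /at_start; have [X0|_] := eqVneq (X 0%N) 0; last by rewrite mulr0.
  by rewrite mulr1; have /andP[] := gf X X0.
rewrite /m2 ge0_integral_mscale// ge0_integral_mrestr//.
rewrite (_ : (\int[Q]_(X in L) (g' X)%:E)%E = (\int[Q]_X (g' X)%:E)%E).
  by rewrite Eg /= -EFinM mulrC.
rewrite integral_mkcond; apply: eq_integral => X _; rewrite patchE.
case: ifPn => // /negP XL; congr EFin; apply/esym/eqP; rewrite eq_le g'0 andbT leNgt.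
apply/negP; rewrite /g' /at_start; have [X0|_] := eqVneq (X 0%N) 0; last by rewrite mulr0 ltxx.
by rewrite mulr1 => gp; apply: XL; rewrite inE; exact: gL.
Qed.

(** Turns a lower bound for M - f into an upper bound for f, by superadditivity alone. *)
Lemma conditional_compl_le (M : R) (f : trajectory -> R) : (forall X, 0 <= f X <= M) ->
  (\int[conditional_law Q L]_X (f X)%:E + \int[conditional_law Q L]_X (M - f X)%:E <= M%:E)%E.
Proof.
move=> f0M; rewrite !(@eq_set_fun_integral _ _ _ (conditional_law Q L) m2 _ cond_eq).
apply: le_trans (lower_integralD _ _ _) _.
- by move=> X; rewrite lee_fin; have /andP[] := f0M X.
- by move=> X; rewrite lee_fin subr_ge0; have /andP[] := f0M X.
under eq_integral do rewrite -EFinD addrC subrK.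
rewrite integral_cst//; change ((M%:E * ((fine (Q L))^-1%:E * Q (setT `&` L)) <= M%:E)%E).
rewrite setTI -[Q L in X in (_ * (_ * X))%E]fineK ?fin_num_measure// -EFinM.
by rewrite lee_fin mulVf ?gt_eqF// mulr1.
Qed.

Lemma conditional_ge0 (f : trajectory -> R) : (forall X, 0 <= f X) ->
  (0 <= \int[conditional_law Q L]_X (f X)%:E)%E.
Proof.
move=> f0; rewrite (@eq_set_fun_integral _ _ _ (conditional_law Q L) m2 _ cond_eq).
by apply: integral_ge0 => X _; rewrite lee_fin.
Qed.

Lemma conditional_posneg (f : trajectory -> R) :
  (\int[conditional_law Q L]_X (f X)%:E = \int[conditional_law Q L]_X (Num.max (f X) 0)%:E -
    \int[conditional_law Q L]_X (Num.max (- f X) 0)%:E)%E.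
Proof.
rewrite !(@eq_set_fun_integral _ _ _ (conditional_law Q L) m2 _ cond_eq) integralE.
by congr (_ - _)%E; apply: eq_integral => X _; rewrite ?funeposE ?funenegE -?EFinN -EFin_max.
Qed.

End conditioned_walk.

Section down_crossing.
Variables (R : realType) (p : kernel R) (sigma r : R).
Hypotheses (sigma0 : 0 < sigma) (r0 : 0 < r).
Let a := sigma^-1.

(** For a - z the event [above] says that z falls to - r while staying below a - r: the walk reaches
    0 or less before n, with margins. [Gam] is constant because only the event matters. *)
Definition downf (z : R -> R) : R := phif a (fun=> 1) 1 r (fun t => a - z t).

Let one01 (z : R -> R) : 0 <= (fun=> 1 : R) z <= 1. Proof. by rewrite ler01 lexx. Qed.

Lemma lipf_downf : lipf r^-1 r^-1 downf.
Proof.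
have [K0 L0 P01 PL] := lipf_phif a one01 1 r0.
split=> // [z|z z' u u0 zz']; first exact: P01.
apply: PL => // t tK; rewrite (_ : _ - _ = - (z t - z' t)); last by ring.
by rewrite normrN; exact: zz'.
Qed.

Lemma downf_reach (n : nat) (s : nat -> int) : (0 < n)%N ->
  downf (rescaled_path sigma (n ^ 2) s) <=
  (reach (fun z => z <= 0) (fun z => n%:Z <= z) (Num.truncn ((n ^ 2)%:R * r^-1)).+1 s)%:R.
Proof.
move=> n0; set m := (n ^ 2)%N; set z := rescaled_path sigma m s.
have m0 : (0 < m)%N by rewrite /m expn_gt0 n0.
have mR : 0 < m%:R :> R by rewrite ltr0n.
have DE : sigma * Num.sqrt (m%:R : R) = sigma * n%:R by rewrite /m natrX sqrtr_sqr ger0_norm.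
have D0 : 0 < sigma * n%:R by rewrite mulr_gt0// ltr0n.
have r0' := r0.
have [_ _ P01 _] := lipf_downf; have /andP[P0 P1] := P01 z.
case: (boolP (reach _ _ _ s)) => // nr.
have h : downf z <= hfun a (fun=> 1) 1 r (fun t => a - z t) by exact: phif_le.
apply: le_trans h _; rewrite /hfun asboolF// => -[t [/andP[t0 tr] zt zu]].
move/negP: nr; apply.
pose k := Num.truncn (m%:R * t).
have /andP[k1 k2] := truncn_itv (mulr_ge0 (ltW mR) t0).
have kt : k%:R / m%:R <= t by rewrite ler_pdivrMr// mulrC.
have kr : (k <= Num.truncn (m%:R * r^-1))%N by apply: le_truncn; rewrite ler_pM2l.
have below j : (j <= k)%N -> ~~ (n%:Z <= s j).
  move=> jk; apply/negP => nj.
  have jt : 0 <= (j%:R / m%:R : R) <= t.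
    by rewrite divr_ge0//=; apply: le_trans kt; rewrite ler_pM2r ?invr_gt0// ler_nat.
  have := zu _ jt; rewrite /z rescaled_grid// DE.
  have : a <= (s j)%:~R / (sigma * n%:R).
    rewrite ler_pdivlMr// /a mulKf ?gt_eqF//.
    by rewrite -[n%:R]/((n%:Z)%:~R) ler_int.
  lra.
have [sk|sk] := boolP (s k <= 0).
  by apply: (@reachT _ _ _ _ k) => //; [exact: leqW|move=> j jk; apply: below; exact: ltnW].
have [sk1|sk1] := boolP (s k.+1 <= 0).
  by apply: (@reachT _ _ _ _ k.+1) => // j; rewrite ltnS; exact: below.
have l1 : 0 <= (s k)%:~R :> R by rewrite ler0z ltW// ltNge.
have l2 : 0 <= (s k.+1)%:~R :> R by rewrite ler0z ltW// ltNge.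
exfalso; have : z t <= - r by lra.
rewrite /z /rescaled_path -/k DE ler_pdivrMr// => zt'.
have rn : 0 < r * (sigma * n%:R) by rewrite mulr_gt0.
set x := (s k)%:~R in l1 zt'; set y := (s k.+1)%:~R in l2 zt'.
set th := m%:R * t - k%:R in zt'.
have th0 : 0 <= th by rewrite subr_ge0.
have th1 : th <= 1 by move: k2; rewrite -natr1 /th -/k; lra.
have : 0 <= th * y by rewrite mulr_ge0.
have : 0 <= (1 - th) * x by rewrite mulr_ge0// subr_ge0.
lra.
Qed.

Lemma hit_up_down_le (n : nat) (y : int) : (0 < n)%N ->
  hit p (fun z => n%:Z <= z) (fun z => z <= 0) y <=
  1 - walk_exp p sigma (n ^ 2) r^-1 y downf.
Proof.
move=> n0; set k := (Num.truncn ((n ^ 2)%:R * r^-1)).+1.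
pose A : pred int := fun z => n%:Z <= z; pose B : pred int := fun z => z <= 0.
have AB z : A z -> ~~ B z by rewrite /A /B; lia.
rewrite -/A -/B lerBrDr; apply: le_trans (hit_compl p k y AB); rewrite lerD2l.
rewrite -Ew_reach; apply: le_Ew.
- by apply: bnd01 => s; have [_ _ P01 _] := lipf_downf; exact: P01.
- by apply: bnd01 => s; case: (reach _ _ _ _); rewrite ?lexx ?ler01.
- by move=> s _; exact: downf_reach.
Qed.

End down_crossing.

(** * Brownian estimates from a small starting level *)

Section constants.
Context d (T : measurableType d) (R : realType) (P : probability T R).
Variables (W : 'I_3 -> R -> T -> R).
Hypothesis bmW : nice_bm P W.

Let mR x := measurable_radial bmW x.

Lemma radialE x t b : radial W x t b = norm3 (fun i => x * (i == ord0)%:R + W i t b).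
Proof. by []. Qed.

Lemma radial_close x t b : `|radial W x t b - radial W 0 t b| <= `|x|.
Proof.
rewrite !radialE; apply: le_trans (norm3_dist _ _) _.
rewrite (bigD1 ord0)//= big1 ?addr0 => [|i i0]; last by rewrite (negbTE i0) !mulr0 subrr normr0.
by rewrite mulr1 mul0r add0r addrK.
Qed.

(** A choice of constants serving both uses of [bessel_lower_bound]: t is taken large for the decay
    of the Gaussian term, then del and finally r small. *)
Let parameters (c th x e : R) : 0 < c -> 0 < th -> 0 < x -> 0 < e ->
  exists t del r, [/\ 0 < t /\ c * (Num.sqrt (1 + t))^-1 <= th, del <= th /\ 2 * del <= x,
    0 < r /\ 16 * r <= del, 16 * r <= 1 /\ t <= (16 * r)^-1 & 16 * r <= 2 * e /\ 7 * r <= th].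
Proof.
move=> c0 th0 x0 e0; pose t := (c / th) ^+ 2.
have ct : 0 < c / th by rewrite divr_gt0.
have t0 : 0 < t by rewrite exprn_gt0.
pose del := Num.min th (x / 2).
have d0 : 0 < del by rewrite lt_min th0 divr_gt0.
have d1 : del <= th by rewrite ge_min lexx.
have d2 : del <= x / 2 by rewrite ge_min lexx orbT.
clearbody del.
pose u := Num.min (Num.min del 1) (Num.min t^-1 (Num.min (2 * e) th)).
have u0 : 0 < u by rewrite !lt_min d0 ltr01 invr_gt0 t0 mulr_gt0//.
have u1 : u <= del by rewrite !ge_min lexx.
have u2 : u <= 1 by rewrite !ge_min lexx !orbT.
have u3 : u <= t^-1 by rewrite !ge_min lexx !orbT.
have u4 : u <= 2 * e by rewrite !ge_min lexx !orbT.
have u5 : u <= th by rewrite !ge_min lexx !orbT.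
clearbody u.
have uE : 16 * (u / 16) = u by field.
exists t, del, (u / 16); split; split => //; rewrite ?uE//; try lra.
- have h : c / th <= Num.sqrt (1 + t).
    by rewrite -[leLHS]ger0_norm ?(ltW ct)// -sqrtr_sqr ler_wsqrtr// lerDr.
  rewrite ler_pdivrMr ?(lt_le_trans ct h)//.
  by move: h; rewrite ler_pdivrMr// mulrC.
- by rewrite -[leLHS]invrK lef_pV2 ?posrE ?invr_gt0.
Qed.

Variables (a : R).
Hypothesis a0 : 0 < a.

(** [bessel_lower_bound] with Gam = 1 and x = - (a - eps), for which sg x (x + W) = a - (eps + W):
    the gambler's ruin estimate for the distance to a. *)
Lemma expect_down_ge eps kappa : 0 < eps -> eps < a -> 0 < kappa ->
  exists2 r, 0 < r & 1 - eps / a * (1 + kappa) <=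
    expect P (fun b => phif a (fun=> 1) 1 r (fun t => a - (eps + W ord0 t b))).
Proof.
move=> e0 ea k0; have a0' := a0; pose th := kappa * eps / (4 * (a + 1)).
have a1 : 0 < a + 1 by rewrite addr_gt0.
have th0 : 0 < th by rewrite divr_gt0 ?mulr_gt0.
have c0 : 0 < (gexp 1 (a + 1))^-1 by rewrite invr_gt0 expR_gt0.
have x0 : 0 < a - eps by rewrite subr_gt0.
have xa : a - eps <= a by lra.
have [t [del [r [[t0 ct] [d1 d2] [r0 rd] [r1 tr] [re r7]]]]] := parameters c0 th0 x0 (@ltr01 R).
exists (r / 4); first by rewrite divr_gt0.
have one01 (z : R -> R) : 0 <= (fun=> 1 : R) z <= 1 by rewrite ler01 lexx.
have l1 : lipf (0 : R) (0 : R) (fun=> 1 : R).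
  by split => // z z' u _ _; rewrite mul0r addr0.
have g1 z : 1 <= gfun a (fun=> 1) 1 (16 * r) z.
  by apply: inf1_ge => // v [z' _ ->].
have nx : `| - (a - eps)| = a - eps by rewrite normrN gtr0_norm.
have := bessel_lower_bound bmW (x := - (a - eps)) one01 l1 g1 a0 r0 _ _ rd _ r1 t0 tr.
rewrite nx oppr_eq0 gt_eqF// => /(_ isT xa d2).
clear one01 l1 g1; rewrite expect_cst ltr0_sg ?oppr_lt0//.
rewrite (_ : expect P (fun b => phif a (fun=> 1) 1 (r / 4) _) =
    expect P (fun b => phif a (fun=> 1) 1 (r / 4) (fun t => a - (eps + W ord0 t b)))); last first.
  by apply: eq_expect => b; congr phif; apply/funext => u; ring.
set E := expect _ _ => key.
have h1 : (a - eps) * ((gexp 1 (a + 1))^-1 * (Num.sqrt (1 + t))^-1) <= (a + 1) * th.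
  apply: ler_pM; [exact: ltW| |lra|exact: ct].
  by apply: mulr_ge0; [exact: ltW|rewrite invr_ge0 sqrtr_ge0].
have thE : (a + 1) * th = kappa * eps / 4 by rewrite /th; field; rewrite gt_eqF.
have th1 : th <= (a + 1) * th by rewrite ler_peMl ?(ltW th0)//; lra.
have ke : 0 < kappa * eps by rewrite mulr_gt0.
have a7 : 0 < a + 7 * r by rewrite addr_gt0// mulr_gt0.
rewrite -(ler_pM2l a7); apply: le_trans key.
have -> : (a + 7 * r) * (1 - eps / a * (1 + kappa)) =
  a - eps * (1 + kappa) + 7 * r - 7 * r * (eps / a * (1 + kappa)) by field; rewrite gt_eqF.
have : 0 <= 7 * r * (eps / a * (1 + kappa)).
  have k1 : 0 <= 1 + kappa by lra.
  exact: mulr_ge0 (mulr_ge0 (ler0n R 7) (ltW r0)) (mulr_ge0 (divr_ge0 (ltW e0) (ltW a0)) k1).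
rewrite mulrBr mulr1; lra.
Qed.

Variables (Gam : (R -> R) -> R) (G : R).
Hypotheses (Gam01 : forall z, 0 <= Gam z <= 1) (G1 : G <= 1).

(** Replacing the radial process from eps by the one from 0 changes the path by at most eps, hence
    [phig] by at most eps / (2 e) <= kappa / 8. *)
Lemma expect_up_ge e kappa : 0 < e -> 0 < kappa -> kappa <= 1 ->
  G - kappa / 4 <= expect P (fun b => phig a Gam e (radial W 0 ^~ b)) ->
  forall eps, 0 < eps -> eps <= a -> eps <= kappa * e / 4 ->
  exists2 r, 0 < r & eps / a * (G - kappa) <=
    expect P (fun b => phif a Gam e r (fun t => eps + W ord0 t b)).
Proof.
move=> e0 k0 k1 hG eps ep ea ek; have a0' := a0; have G1' := G1.
pose th := Num.min (kappa / 16) (Num.min (eps * kappa / 32) (a * kappa / 8)).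
have th0 : 0 < th by rewrite !lt_min !divr_gt0 ?mulr_gt0.
have t1 : th <= kappa / 16 by rewrite ge_min lexx.
have t2 : th <= eps * kappa / 32 by rewrite !ge_min lexx !orbT.
have t3 : th <= a * kappa / 8 by rewrite !ge_min lexx !orbT.
clearbody th.
have c0 : 0 < (gexp 1 (a + 1))^-1 by rewrite invr_gt0 expR_gt0.
have [t [del [r [[t0 ct] [d1 d2] [r0 rd] [r1 tr] [re r7]]]]] := parameters c0 th0 ep e0.
exists (r / 4); first by rewrite divr_gt0.
have r16 : 0 < 16 * r by rewrite mulr_gt0.
have lP := lipf_phig a Gam01 e0.
have pg z : phig a Gam e z <= gfun a Gam e (16 * r) z.
  by apply: le_trans (phig_le a Gam01 z e0) _; exact: gfun_le.
have nx : `|eps| = eps by rewrite gtr0_norm.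
have := bessel_lower_bound bmW (x := eps) Gam01 lP pg a0 r0 _ _ rd _ r1 t0 tr.
rewrite nx gt_eqF// => /(_ isT ea d2); rewrite gtr0_sg//.
rewrite (_ : expect P (fun b => phif a Gam e (r / 4) _) =
    expect P (fun b => phif a Gam e (r / 4) (fun t => eps + W ord0 t b))); last first.
  by apply: eq_expect => b; congr phif; apply/funext => u; rewrite mul1r.
set E := expect _ _; set E1 := expect _ _ => key.
have hE : expect P (fun b => phig a Gam e (radial W 0 ^~ b)) - kappa / 8 <= E.
  have c1 b : continuous (radial W eps ^~ b) by exact: (continuous_radial bmW).
  have c2 b : continuous (radial W 0 ^~ b) by exact: (continuous_radial bmW).
  have : `|E - expect P (fun b => phig a Gam e (radial W 0 ^~ b))| <= kappa / 8.
    apply: expect_dist; [exact (bounded_meas_lipf P (mR eps) c1 lP)|exact (bounded_meas_lipf P (mR 0) c2 lP)|].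
    move=> b; apply: le_trans (lipf_dist lP (ltW ep) _) _.
      by move=> u _; apply: le_trans (radial_close _ _ _) _; rewrite nx.
    by rewrite mulrC ler_pdivrMr ?mulr_gt0//; lra.
  by rewrite ler_norml => /andP[]; lra.
have a7 : 0 < a + 7 * r by rewrite addr_gt0// mulr_gt0.
rewrite -(ler_pM2l a7); apply: le_trans key.
set s := (gexp 1 (a + 1))^-1 * _ in ct *.
have h1 : eps * (G - kappa / 4 - kappa / 8 - kappa / 16) <= eps * (E - s) by rewrite ler_pM2l//; lra.
have h2 : (a + 7 * r) * (eps / a * (G - kappa)) <= eps * (G - kappa) + eps * kappa / 8.
  have -> : (a + 7 * r) * (eps / a * (G - kappa)) = eps * (G - kappa) + 7 * r / a * (eps * (G - kappa)).
    by field; rewrite gt_eqF.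
  rewrite lerD2l; apply: le_trans (_ : 7 * r / a * eps <= _).
    rewrite ler_wpM2l ?divr_ge0 ?mulr_ge0 ?(ltW r0) ?(ltW a0)// ler_piMr ?(ltW ep)//; lra.
  have : 7 * r / a <= kappa / 8 by rewrite ler_pdivrMr//; lra.
  by move=> h; have := ler_wpM2r (ltW ep) h; lra.
lra.
Qed.

End constants.

Section stopped_limit.
Context d (T : measurableType d) (R : realType) (P : probability T R).
Variables (W : 'I_3 -> R -> T -> R).
Hypothesis bmW : nice_bm P W.
Variables (a : R) (F : (R -> R) * R -> R).
Hypotheses (a0 : 0 < a) (F01 : forall x, 0 <= F x <= 1).
Hypothesis cF : continuous_for (@C0_Rplus R) (@couple_dist R) F.
Let Gam z := F (stopped_couple a z).

(** Along e = 1 / (j + 1), [phig] lies between [gfun] with tolerance 4 e, close to [Gam] at crossing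
    paths by [gfun_crosses], and a [gfun] below [Gam] by [gfun_self]. The limit g is thus a
    measurable version of [Gam] of the radial process. *)
Lemma stopped_expectation : exists (N : set T) (g : T -> R),
  [/\ measurable N, P N = 0%E, bounded_meas g,
    forall b, 0 <= g b <= 1 /\ (~ N b -> g b = Gam (radial W 0 ^~ b)) /\
      (~ N b -> exists s, crosses a (radial W 0 ^~ b) s) &
    forall eta, 0 < eta -> exists2 e, 0 < e <= 1 &
      expect P g - eta <= expect P (fun b => phig a Gam e (radial W 0 ^~ b))].
Proof.
have [N [mN N0 hN]] := radial_crosses bmW a0.
have Gam01 z : 0 <= Gam z <= 1 by exact: F01.
have cR b : continuous (radial W 0 ^~ b) by exact: (continuous_radial bmW).
have z0 b : radial W 0 0 b = 0.
  rewrite radial0E /norm3 big1 ?sqrtr0// => i _; have [_ -> _ _ _] := bmW; exact: expr0n.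
pose e (j : nat) : R := j.+1%:R^-1.
have e0 j : 0 < e j by rewrite invr_gt0.
pose f j b := phig a Gam (e j) (radial W 0 ^~ b).
have f01 j b : 0 <= f j b <= 1 by have [_ _ h _] := lipf_phig a Gam01 (e0 j); exact: h.
have bf j : bounded_meas (f j).
  exact: (bounded_meas_lipf P (measurable_radial bmW 0) cR (lipf_phig a Gam01 (e0 j))).
have bN : bounded_meas (\1_(~` N) : T -> R).
  split; first by apply: measurable_indic; exact: measurableC.
  by exists 1 => y; rewrite indicE; case: (y \in _); rewrite ?normr1 ?normr0.
pose g b := Gam (radial W 0 ^~ b) * \1_(~` N) b.
have nN b : ~ N b -> \1_(~` N) b = 1 :> R by move=> h; rewrite indicE mem_set.
have yN b : N b -> \1_(~` N) b = 0 :> R by move=> h; rewrite indicE memNset// => /(_ h).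
have cross b : ~ N b -> exists s, crosses a (radial W 0 ^~ b) s.
  by move=> h; apply: contrapT => no; apply: h; apply: hN.
have cv b : f j b * \1_(~` N) b @[j --> \oo] --> g b.
  rewrite /g; have [Nb|Nb] := pselect (N b).
    by rewrite yN// mulr0; under eq_cvg do rewrite mulr0; exact: cvg_cst.
  rewrite nN// mulr1; under eq_cvg do rewrite mulr1.
  have [s cs] := cross b Nb; apply/cvgrPdist_le => eta eta0.
  have [e1 e10 he] := gfun_crosses a0 F01 cF (cR b) (z0 b) cs eta0.
  have := near_divn_le 1 e10; apply: filterS => j; rewrite div1r -/(e j) => ej.
  have eje : 0 < e j <= e1 by rewrite e0 ej.
  have lo := he (e j) eje.
  have hi := gfun_self a F01 (ltW (e0 j)) (mulr_ge0 (ler0n R 2) (ltW (e0 j))) (continuous_C0 (cR b) (z0 b)).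
  have l1 := phig_ge a Gam01 (radial W 0 ^~ b) (e0 j).
  have l2 := phig_le a Gam01 (radial W 0 ^~ b) (e0 j).
  rewrite ger0_norm ?subr_ge0; first by rewrite lerBlDl -lerBlDr (le_trans lo).
  exact: le_trans l2 hi.
have b1 j b : `|f j b * \1_(~` N) b| <= 1.
  have /andP[h0 h1] := f01 j b; rewrite normrM ger0_norm// indicE.
  by case: (b \in _); rewrite ?normr1 ?normr0 ?mulr1 ?mulr0.
have [bg cE] := @expect_cvg _ T R P (fun j b => f j b * \1_(~` N) b) g 1
  (fun j => bounded_measM (bf j) bN) b1 cv.
exists N, g; split => //.
- move=> b; split; last by split; [move=> Nb; rewrite /g nN// mulr1|exact: cross].
  rewrite /g; have [Nb|Nb] := pselect (N b); first by rewrite yN// mulr0 lexx ler01.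
  by rewrite nN// mulr1.
- move=> eta eta0; have /cvgrPdist_le/(_ _ eta0)[j _ /(_ j (leqnn _))] := cE.
  rewrite /= ler_norml => /andP[_ h]; exists (e j); first by rewrite e0 invf_le1// ler1n.
  apply: le_trans (_ : expect P (fun b => f j b * \1_(~` N) b) <= _); first by rewrite lerBlDr -lerBlDl.
  apply: le_expect; [exact: bounded_measM|exact: bf|move=> b].
  by have /andP[h0 h1] := f01 j b; rewrite ler_piMr// indicE; case: (_ \in _); rewrite ?ler01 ?lexx.
Qed.

End stopped_limit.

Lemma entry_nstrip N V (y : int) : entry N V y -> ~~ strip N y.
Proof. by rewrite /entry /strip; lia. Qed.

(** * Matching bounds for the numerator and the denominator *)

Section core.
Context d (T : measurableType d) (R : realType) (P : probability T R).
Variables (W : 'I_3 -> R -> T -> R).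
Hypothesis bmW : nice_bm P W.
Variables (w : int -> int -> R) (p : kernel R) (C : int -> R) (kap D : R) (q t : nat -> R).
Hypothesis Hn : nice w p C kap D q t.
Variable sigma : R.
Hypothesis sigma0 : 0 < sigma.
Hypothesis clt : forall K L Phi, lipf K L Phi ->
  walk_exp p sigma m K 0 Phi @[m --> \oo] --> expect P (fun b => Phi (W ord0 ^~ b)).
Let a := sigma^-1.

Let a0 : 0 < a. Proof. by rewrite invr_gt0. Qed.
Let kap0 : 0 < kap. Proof. exact: nice_kap Hn. Qed.
Let D0 : 0 < D. Proof. exact: nice_D_gt0 Hn. Qed.

Lemma near_large (B : R) : \forall n \near \oo, B <= sigma * n%:R.
Proof.
exists (Num.truncn (B / sigma)).+1 => // n /= hn.
rewrite mulrC -ler_pdivrMr//; apply: ltW; apply: lt_le_trans (truncnS_gt _) _.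
by rewrite ler_nat.
Qed.

Lemma scales (eps del e : R) (M : nat) : 0 < eps -> 0 < del -> 0 < e ->
  eps <= e / 4 -> del <= e / 4 -> eps * sigma <= 1 / 4 ->
  \forall n \near \oo, exists N V U : nat,
  [/\ [/\ (1 < N)%N, (N <= n)%N, (0 < V)%N, (M <= V)%N & (0 < U)%N],
      U%:R <= e * (n ^ 2)%:R /\ (N + V)%:R <= e * (sigma * n%:R),
      forall y : int, entry N V y -> `|y%:~R / (sigma * n%:R) - eps| <= del,
      N%:R <= 2 * eps * (sigma * n%:R) /\ del * (sigma * n%:R) / 4 <= V%:R &
      e * (n ^ 2)%:R / 2 <= U%:R].
Proof.
move=> e0 d0 ee0 e4 d4 es.
have h1 := near_large (2 / eps + 4 / del + 2 / e + 2 * M%:R / del).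
have h2 := near_large (sigma * (2 + 2 / e)).
apply: filterS2 h1 h2 => n; set S := sigma * n%:R.
have i1 : 0 < 2 / eps by rewrite divr_gt0.
have i2 : 0 < 4 / del by rewrite divr_gt0.
have i3 : 0 < 2 / e by rewrite divr_gt0.
have i4 : 0 <= 2 * M%:R / del by rewrite divr_ge0 ?mulr_ge0// ltW.
move=> hS hn'; have hn : 2 + 2 / e <= n%:R by move: hn'; rewrite /S ler_pM2l.
have nS : eps * S <= n%:R / 4.
  by rewrite /S mulrA; have := ler_wpM2r (ler0n R n) es; lra.
clear hn'; clearbody S.
have S0 : 0 < S by lra.
have eS : 2 <= eps * S by rewrite mulrC -ler_pdivrMr//; lra.
have dS : 4 <= del * S by rewrite mulrC -ler_pdivrMr//; lra.
have eeS : 2 <= e * S by rewrite mulrC -ler_pdivrMr//; lra.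
have dM : 2 * M%:R <= del * S by rewrite [del * S]mulrC -ler_pdivrMr//; lra.
have n2 : 2 <= n%:R :> R by lra.
have en2 : 2 <= e * (n ^ 2)%:R.
  have : 2 <= e * n%:R by rewrite mulrC -ler_pdivrMr//; lra.
  rewrite natrX expr2 mulrA => h; apply: le_trans h _; rewrite ler_peMr ?mulr_ge0 ?ler0n ?(ltW ee0)//; lra.
(* N is just above eps S and V at most del S / 2, so the rescaled window lies within del of eps. *)
pose N := (Num.truncn (eps * S)).+1; pose V := Num.truncn (del * S / 2); pose U := Num.truncn (e * (n ^ 2)%:R).
have /andP[N1 N2] : (Num.truncn (eps * S))%:R <= eps * S < N%:R by apply: truncn_itv; lra.
have /andP[V1 V2] : V%:R <= del * S / 2 < V.+1%:R by apply: truncn_itv; lra.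
have /andP[U1 U2] : U%:R <= e * (n ^ 2)%:R < U.+1%:R by apply: truncn_itv; lra.
have NE : N%:R = (Num.truncn (eps * S))%:R + 1 :> R by rewrite /N natr1.
rewrite -(natr1 V) in V2; rewrite -(natr1 U) in U2.
have VM : (M <= V)%N by rewrite /V truncn_ge_nat; lra.
have N1' : (1 < N)%N by rewrite /N ltnS truncn_gt0; lra.
clearbody V U; have V3 : 1 <= V%:R :> R by lra.
exists N, V, U; split; [split| | | |].
- by [].
- by rewrite -(ler_nat R) NE; lra.
- by rewrite -(ltr_nat R); lra.
- by [].
- by rewrite -(ltr_nat R); lra.
- split => //; rewrite natrD NE.
  have : eps * S <= e / 4 * S by rewrite ler_pM2r.
  have : del * S <= e / 4 * S by rewrite ler_pM2r.
  lra.
- move=> y; rewrite /entry => /andP[y1 y2].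
  have l1 : N%:R <= y%:~R :> R by rewrite -[N%:R]/((N%:Z)%:~R) ler_int.
  have l2 : y%:~R <= N%:R + V%:R :> R by rewrite -natrD -[(N + V)%:R]/(((N + V)%N%:Z)%:~R) ler_int ltW.
  have -> : y%:~R / S - eps = (y%:~R - eps * S) / S by field; rewrite gt_eqF.
  rewrite normrM (gtr0_norm (_ : 0 < S^-1)) ?invr_gt0// ler_pdivrMr// ler_norml.
  by apply/andP; split; lra.
- by split; [rewrite NE|]; lra.
- by lra.
Qed.

(** Overshoot and slow walks are at most half of the upward exits, so the window receives the other
    half and the error becomes relative to its probability. *)
Lemma entrance_ratio (up al ov s c1 th : R) (N : nat) : (0 < N)%N -> 0 < c1 -> 0 < th -> th <= 1 ->
  c1 / N%:R <= up + s -> up = al + ov -> ov + s <= th * (c1 / N%:R) / 2 ->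
  0 < al /\ ov + s <= th * al.
Proof.
move=> N0 c10 th0 th1 h1 h2 h3.
have x0 : 0 < c1 / N%:R by rewrite divr_gt0// ltr0n.
have hx : th * (c1 / N%:R) <= c1 / N%:R by rewrite ler_piMl ?(ltW x0).
have al1 : c1 / N%:R / 2 <= al by lra.
split; first by lra.
by have := ler_wpM2l (ltW th0) al1; lra.
Qed.

(** Both errors are compared with th c1 / N. For slow walks the ratio involves N^2 / n^2, of order
    eps^2, against th, which will be of order eps; so it is small for small eps. *)
Lemma error_bound (eps del e th c1 : R) (n N V U : nat) : 0 < eps -> 0 < del -> 0 < e -> 0 < th -> 0 < c1 ->
  (0 < n)%N -> (0 < N)%N -> N%:R <= 2 * eps * (sigma * n%:R) -> del * (sigma * n%:R) / 4 <= V%:R ->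
  e * (n ^ 2)%:R / 2 <= U%:R -> eps ^+ 2 * (32 * sigma ^+ 2 * D) <= th * c1 * (kap * e) ->
  th * c1 * del / (32 * eps) / V%:R + N%:R * D / (kap * U%:R) <= th * (c1 / N%:R) / 2.
Proof.
move=> e0 d0 ee0 th0 c10 n0 N0 hN hV hU he.
have nR : 0 < n%:R :> R by rewrite ltr0n.
have NR : 0 < N%:R :> R by rewrite ltr0n.
have S0 : 0 < sigma * n%:R by rewrite mulr_gt0.
have m0 : 0 < (n ^ 2)%:R :> R by rewrite ltr0n expn_gt0 n0.
have V0 : 0 < V%:R :> R by apply: lt_le_trans hV; rewrite divr_gt0// mulr_gt0.
have U0 : 0 < U%:R :> R by apply: lt_le_trans hU; rewrite divr_gt0// mulr_gt0.
have tc : 0 < th * c1 by rewrite mulr_gt0.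
have A : th * c1 * del / (32 * eps) / V%:R <= th * c1 / N%:R / 4.
  rewrite ler_pdivrMr// -subr_ge0.
  have -> : th * c1 / N%:R / 4 * V%:R - th * c1 * del / (32 * eps) =
    th * c1 / (32 * eps * N%:R) * (8 * eps * V%:R - del * N%:R) by field; rewrite !gt_eqF.
  have f0 : 0 <= th * c1 / (32 * eps * N%:R).
    exact: divr_ge0 (ltW tc) (mulr_ge0 (mulr_ge0 (ler0n R 32) (ltW e0)) (ler0n R N)).
  rewrite mulr_ge0// subr_ge0; apply: le_trans (ler_wpM2l (ltW d0) hN) _.
  have := ler_wpM2l (mulr_ge0 (ler0n R 8) (ltW e0)) hV; lra.
have B : N%:R * D / (kap * U%:R) <= th * c1 / N%:R / 4.
  rewrite ler_pdivrMr ?mulr_gt0// -subr_ge0.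
  have -> : th * c1 / N%:R / 4 * (kap * U%:R) - N%:R * D =
    (th * c1 * kap * U%:R - 4 * N%:R ^+ 2 * D) / (4 * N%:R) by field; rewrite gt_eqF.
  rewrite divr_ge0 ?mulr_ge0// subr_ge0.
  apply: le_trans (_ : 4 * (2 * eps * (sigma * n%:R)) ^+ 2 * D <= _).
    have x0 : 0 <= 2 * eps * (sigma * n%:R) by apply: le_trans hN; exact: ltW.
    by rewrite ler_pM2r// ler_pM2l// lerXn2r ?nnegrE// ltW.
  apply: le_trans (_ : th * c1 * kap * (e * (n ^ 2)%:R / 2) <= _); last first.
    by rewrite ler_pM2l// mulr_gt0.
  have -> : 4 * (2 * eps * (sigma * n%:R)) ^+ 2 * D = eps ^+ 2 * (32 * sigma ^+ 2 * D) * ((n ^ 2)%:R / 2).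
    by rewrite natrX; field.
  have -> : th * c1 * kap * (e * (n ^ 2)%:R / 2) = th * c1 * (kap * e) * ((n ^ 2)%:R / 2) by field.
  by rewrite ler_pM2r// divr_gt0.
have -> : th * (c1 / N%:R) / 2 = th * c1 / N%:R / 4 + th * c1 / N%:R / 4 by field; rewrite gt_eqF.
exact: lerD.
Qed.

Variables (F : (R -> R) * R -> R) (G : R).
Hypotheses (F01 : forall x, 0 <= F x <= 1) (G01 : 0 <= G <= 1).
Let Gam z := F (stopped_couple a z).
Hypothesis hG : forall eta, 0 < eta -> exists2 e, 0 < e <= 1 &
  G - eta <= expect P (fun b => phig a Gam e (radial W 0 ^~ b)).

Let Gam01 z : 0 <= Gam z <= 1. Proof. exact: F01. Qed.

Definition escape_test n k (g : (nat -> int) -> R) :=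
  [/\ depends k g, forall s, 0 <= g s <= 1 & forall s, s 0%N = 0 -> 0 < g s ->
    Lambda' R n s /\ g s <= F (stopped_couple sigma^-1 (rescaled_path sigma (n ^ 2) s))].

(** A is eps sigma times the probability [al] of entering the window. From the window [phif] gives
    the lower bound and 1 - [downf] the upper bound, both made uniform over the window by
    [uniform_clt]. *)
Lemma escape_core kappa : 0 < kappa -> kappa <= 1 ->
  \forall n \near \oo, exists A k g, [/\ 0 < A, escape_test n k g,
    A * (G - kappa) <= Ew p k 0 g &
    av p 0 (hit p (fun z => n%:Z <= z) (fun z => z <= 0)) <= A * (1 + kappa)].
Proof.
(* The upper bound has three relative errors of size [ka]: Brownian constants, invariance principle,
   and overshoot together with slow walks. *)
move=> k0 k1; pose ka := kappa / 3.
have ka0 : 0 < ka by rewrite divr_gt0.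
have ka1 : ka <= 1 by rewrite /ka; lra.
have kaE : kappa = 3 * ka by rewrite /ka; field.
have /andP[G0 G1] := G01.
have [e /andP[e0 e1] he] := hG (divr_gt0 ka0 (ltr0n R 4)).
have [c1 c10 hc1] := up_exit_ge Hn.
(* The terms serve, in order: eps sigma <= 1 / 4, the hypothesis of [expect_up_ge], the size e of
   the initial piece, and the slow walks in [error_bound]. *)
pose eps := Num.min (Num.min (a / 4) (ka * e / 4)) (Num.min (e / 4) (ka * c1 * kap * e / (32 * sigma * D))).
have eps0 : 0 < eps by rewrite !lt_min !divr_gt0 ?mulr_gt0.
have l1 : eps <= a / 4 by rewrite !ge_min lexx.
have l2 : eps <= ka * e / 4 by rewrite !ge_min lexx !orbT.
have l3 : eps <= e / 4 by rewrite !ge_min lexx !orbT.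
have l4 : eps <= ka * c1 * kap * e / (32 * sigma * D) by rewrite !ge_min lexx !orbT.
clearbody eps.
have a0' := a0.
have ea : eps / a = eps * sigma by rewrite /a invrK.
have es : eps * sigma <= 1 / 4.
  have : eps * sigma <= a / 4 * sigma by rewrite ler_pM2r.
  by rewrite mulrAC /a mulVf ?gt_eqF.
have [r r0 hr] := expect_up_ge bmW a0 Gam01 G1 e0 ka0 ka1 he eps0 (ltac:(lra)) l2.
have [r' r'0 hr'] := expect_down_ge bmW a0 eps0 (ltac:(lra)) ka0.
rewrite ea in hr hr'.
pose th := eps * sigma * ka.
have es0 : 0 < eps * sigma by rewrite mulr_gt0.
have th0 : 0 < th by rewrite mulr_gt0.
have th1 : th <= 1.
  have : eps * sigma * ka <= eps * sigma * 1 by rewrite ler_pM2l.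
  by rewrite /th; lra.
have [d1 d10 u1] := uniform_clt bmW Hn sigma0 clt eps (lipf_phif a Gam01 e r0) th0.
have [d2 d20 u2] := uniform_clt bmW Hn sigma0 clt eps (lipf_downf sigma r'0) th0.
pose del := Num.min (Num.min d1 d2) (e / 4).
have del0 : 0 < del by rewrite !lt_min d10 d20 divr_gt0.
have m1 : del <= d1 by rewrite !ge_min lexx.
have m2 : del <= d2 by rewrite !ge_min lexx !orbT.
have m3 : del <= e / 4 by rewrite !ge_min lexx !orbT.
clearbody del.
have ov0 : 0 < th * c1 * del / (32 * eps) by rewrite divr_gt0 ?mulr_gt0.
have [M hM] := overshoot_le Hn ov0.
have heps : eps ^+ 2 * (32 * sigma ^+ 2 * D) <= th * c1 * (kap * e).
  have sD : 0 < 32 * sigma * D by rewrite !mulr_gt0.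
  move: l4; rewrite ler_pdivlMr// => l4.
  have := ler_wpM2l (ltW es0) l4.
  have -> : eps ^+ 2 * (32 * sigma ^+ 2 * D) = eps * sigma * (eps * (32 * sigma * D)) by ring.
  by have -> : th * c1 * (kap * e) = eps * sigma * (ka * c1 * kap * e) by rewrite /th; ring.
have sc := scales M eps0 del0 e0 l3 m3 es.
have n1 : \forall n \near \oo, (0 < n)%N by exists 1%N.
apply: filterS2 (filterI u1 u2) (filterI sc n1) => n [v1 v2] [[N [V [U hNVU]]] n0].
move: hNVU => [[N1 Nn V0 MV U0] [Ue Ve] hy [hN hV] hU].
have N0 : (0 < N)%N by exact: ltnW.
pose al := exitn p (strip N) (fun y => (entry N V y)%:R) U 0.
pose ov := exitn p (strip N) (fun y => ((N + V)%N%:Z <= y)%R%:R) U 0.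
pose s := N%:R * D / (kap * U%:R).
have err := error_bound eps0 del0 e0 th0 c10 n0 N0 hN hV hU heps.
have hov : ov + s <= th * (c1 / N%:R) / 2.
  by apply: le_trans err; rewrite lerD2r; exact: hM.
have [al0 oval] := entrance_ratio N0 c10 th0 th1 (hc1 N U N1 U0) (exitn_entry Hn N V U) hov.
pose f s' := phif a Gam e r (rescaled_path sigma (n ^ 2) s').
pose k := (Num.truncn ((n ^ 2)%:R * r^-1)).+1.
have f01 s' : 0 <= f s' <= 1 by have [_ _ h _] := lipf_phif a Gam01 e r0; exact: h.
have df : depends k f by exact: depends_lipf (lipf_phif a Gam01 e r0) (ltnSn _).
(* The constant may be negative, and [Ew_exit_path_ge] asks for c >= 0. *)
pose c := Num.max 0 (eps * sigma * (G - 2 * ka)).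
have c0 : 0 <= c by rewrite le_max lexx.
have cf y : entry N V y -> c <= Ew p k y f.
  move=> hyy; rewrite ge_max; apply/andP; split.
    by apply: Ew_ge0 => s'; have /andP[] := f01 s'.
  apply: le_trans (v1 y (le_trans (hy y hyy) m1)).
  apply: le_trans (_ : eps * sigma * (G - ka) - th <= _); last by rewrite lerD2r.
  by rewrite (_ : _ - th = eps * sigma * (G - 2 * ka))// /th; ring.
have entN y : entry N V y -> ~~ strip N y by exact: entry_nstrip.
exists (eps * sigma * al), (U + k)%N, (exit_path (strip N) (entry N V) U f); split.
- by rewrite mulr_gt0.
- split; first exact: depends_exit_path.
    exact: exit_path01.
  by move=> s' s0; exact: (exit_path_le sigma0 Gam01 e0 r0 s0 n0 Ue Ve).
- have X := @Ew_exit_path_ge R p (strip N) (entry N V) U k f c 0 c0 f01 df entN cf; apply: le_trans X.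
  rewrite -/al mulrAC ler_pM2r//; apply: le_trans (_ : eps * sigma * (G - 2 * ka) <= _).
    by rewrite ler_pM2l// lerD2l lerN2 kaE ler_pM2r// ler_nat.
  by rewrite le_max lexx orbT.
- have b0 : 0 <= eps * sigma * (1 + 2 * ka) by exact: mulr_ge0 (ltW es0) (addr_ge0 ler01 (mulr_ge0 (ler0n R 2) (ltW ka0))).
  have hb y : entry N V y -> hit p (fun z => n%:Z <= z) (fun z => z <= 0) y <= eps * sigma * (1 + 2 * ka).
    move=> hyy; apply: le_trans (hit_up_down_le p sigma0 r'0 y n0) _.
    have := v2 y (le_trans (hy y hyy) m2).
    have -> : expect P (fun b => downf sigma r' (fun u => eps + W ord0 u b)) =
      expect P (fun b => phif a (fun=> 1) 1 r' (fun t => a - (eps + W ord0 t b))) by [].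
    move=> /(le_trans (lerD hr' (lexx (- th)))) h; rewrite lerBlDr -lerBlDl; apply: le_trans h.
    by rewrite (_ : 1 - _ = 1 - eps * sigma * (1 + ka) - th)// /th; ring.
  apply: le_trans (hit_up_le Hn N0 Nn U0 b0 hb) _; rewrite -/al -/ov -/s.
  apply: le_trans (lerD (lexx _) oval) _.
  rewrite -mulrDl (_ : eps * sigma * al * (1 + kappa) = eps * sigma * (1 + kappa) * al); last by ring.
  by rewrite ler_pM2r// /th -mulrDr ler_pM2l// kaE (_ : 1 + 2 * ka + ka = 1 + 3 * ka)//; ring.
Qed.

End core.

(** * Convergence *)

Section path_functionals.
Variable R : realType.
Implicit Types (z : R -> R) (x y : (R -> R) * R) (F : (R -> R) * R -> R).

Lemma eq_C0 z z' : C0 z -> (forall t, 0 <= t -> z' t = z t) -> C0 z'.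
Proof.
move=> Cz zz'; apply: eps_C0 => [|t e t0 e0]; first by rewrite zz'//; have [_] := Cz.
have [del del0 h] := C0_eps Cz t0 e0; exists del => // u u0 ut.
by rewrite !zz'//; exact: h.
Qed.

Lemma path_dist_eq0 z z' : C0 z -> (forall t, 0 <= t -> z' t = z t) -> path_dist z z' <= 0.
Proof.
move=> Cz zz'; have Cz' := eq_C0 Cz zz'.
have h N : path_dist z z' <= 2 * 2 ^- N.
  have c : close N%:R 0 z z' by move=> t /andP[t0 _]; rewrite zz'// subrr normr0.
  by have := close_path_dist Cz.1 Cz'.1 (lexx 0) c; rewrite mulr0 add0r.
apply/ler_addgt0Pr => e e0; rewrite add0r.
have [N hN] : exists N : nat, 2 * 2 ^- N <= e.
  exists (Num.truncn (2 / e)).+1; rewrite ler_pdivrMr ?exprn_gt0// mulrC -ler_pdivrMr//.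
  apply: le_trans (ltW (truncnS_gt _)) _.
  by rewrite -natrX ler_nat ltnW// ltn_expl.
exact: le_trans (h N) hN.
Qed.

(** [path_dist] does not separate functions that agree on [0, +oo[, so F cannot do so either. *)
Lemma continuous_for_eq F x y : continuous_for (@C0_Rplus R) (@couple_dist R) F ->
  C0_Rplus x -> x.2 = y.2 -> (forall t, 0 <= t -> y.1 t = x.1 t) -> F y = F x.
Proof.
move=> cF [Cx x0] xy2 xy1; apply/esym/eqP; rewrite -subr_eq0 -normr_le0.
apply/ler_addgt0Pr => e e0; rewrite add0r.
have [del del0 h] := cF x (conj Cx x0) e e0.
apply/ltW/h; first by split; [exact: eq_C0 Cx xy1|rewrite -xy2].
rewrite /couple_dist gt_max xy2 subrr normr0 del0 andbT.
exact: le_lt_trans (path_dist_eq0 Cx xy1) del0.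
Qed.

Lemma eq_stopped_couple F a z z' s : continuous_for (@C0_Rplus R) (@couple_dist R) F ->
  C0 z -> crosses a z s -> (forall t, 0 <= t -> z' t = z t) ->
  F (stopped_couple a z') = F (stopped_couple a z).
Proof.
move=> cF Cz [s0 zs below _] zz'; have s0' := ltW s0.
rewrite (stopped_coupleE (hitting_timeE s0 zs below)).
have hz' : hitting_time a z' = s%:E.
  by apply: hitting_timeE => [//||u u0 us]; rewrite zz'//; exact: below.
rewrite (stopped_coupleE hz'); apply: continuous_for_eq => //=.
  by split => //; exact: stopped_C0.
by move=> t t0; rewrite zz'// le_min t0.
Qed.

Lemma continuous_for_lip F (phi : R -> R) (K : R) : 0 < K ->
  (forall u v, `|phi u - phi v| <= K * `|u - v|) ->
  continuous_for (@C0_Rplus R) (@couple_dist R) F ->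
  continuous_for (@C0_Rplus R) (@couple_dist R) (phi \o F).
Proof.
move=> K0 phiL cF x Sx e e0; have [del del0 h] := cF x Sx (e / K) (divr_gt0 e0 K0).
exists del => // y Sy xy; apply: le_lt_trans (phiL _ _) _.
by rewrite mulrC -ltr_pdivlMr//; exact: h.
Qed.

End path_functionals.

Lemma lower_arith (R : realFieldType) (M G eta ka : R) : M * ka * 2 <= eta -> 0 <= eta * ka ->
  M * G * ka <= M * ka -> (M * G - eta) * (1 + ka) <= M * (G - ka).
Proof. by move=> *; lra. Qed.

Section conditional_limit.
Context d (T : measurableType d) (R : realType) (P : probability T R).
Variables (W V : 'I_3 -> R -> T -> R) (N0 : set T).
Hypotheses (mN0 : measurable N0) (PN0 : P N0 = 0%E) (bmV : nice_bm P V).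
Hypothesis VW : forall b, ~ N0 b -> forall i t, 0 <= t -> V i t b = W i t b.
Variables (w : int -> int -> R) (p : kernel R) (C : int -> R) (kap D : R) (q t : nat -> R).
Hypothesis Hn : nice w p C kap D q t.
Variable sigma : R.
Hypothesis sigma0 : 0 < sigma.
Hypothesis clt : forall K L Phi, lipf K L Phi ->
  walk_exp p sigma m K 0 Phi @[m --> \oo] --> expect P (fun b => Phi (V ord0 ^~ b)).
Variable Q : probability trajectory R.
Hypothesis hQ : forall (k : nat) (s : nat -> int),
  Q [set X : trajectory | forall i, (i <= k)%N -> X i = s i] =
    ((s 0%N == 0)%:R * \prod_(i < k) p (s i) (s i.+1))%:E.

Let a := sigma^-1.
Let a0 : 0 < a. Proof. by rewrite invr_gt0. Qed.
Let Y b := stopped_couple a (bessel3 W b).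
Let X n (s : nat -> int) := stopped_couple a (rescaled_path sigma (n ^ 2) s).
Let mu n := conditional_law Q (Lambda' R n).

(** [escape_core] for F = 1, whose test functions live on [Lambda']; this makes the division in the
    conditional law meaningful for large n. *)
Lemma prob_Lambda'_gt0 : \forall n \near \oo, 0 < fine (Q (Lambda' R n)).
Proof.
have F01 x : 0 <= (fun _ : (R -> R) * R => 1 : R) x <= 1 by rewrite ler01 lexx.
have G01 : 0 <= (1 : R) <= 1 by rewrite ler01 lexx.
have hG eta : 0 < eta -> exists2 e, 0 < e <= 1 &
    1 - eta <= expect P (fun b => phig a (fun=> 1) e (radial V 0 ^~ b)).
  move=> eta0; exists 1; first by rewrite ltr01 lexx.
  rewrite (@eq_expect _ _ _ _ _ (fun=> 1)) ?expect_cst; first by rewrite gerBl ltW.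
  have h01 (z : R -> R) : 0 <= (fun=> 1 : R) z <= 1 by rewrite ler01 lexx.
  move=> b; apply/eqP; rewrite eq_le; apply/andP; split.
    exact: le_trans (phig_le a h01 _ ltr01) (andP (gfun01 a h01 _ _ _)).2.
  apply: le_trans (phig_ge a h01 _ ltr01).
  by apply: inf1_ge => // v [z' _ ->].
have h0 : 0 < 1 / 2 :> R by rewrite divr_gt0.
have h1 : 1 / 2 <= 1 :> R by rewrite ler_pdivrMr// mul1r ler1n.
have esc := escape_core bmV Hn sigma0 clt F01 G01 hG h0 h1.
near=> n; have n0 : (0 < n)%N by near: n; exists 1%N.
have [A [k [g [A0 [dg g01 gL] Ag _]]]] : exists A k g, [/\ 0 < A,
    escape_test sigma (fun=> 1) n k g, A * (1 - 1 / 2) <= Ew p k 0 g &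
    av p 0 (hit p (fun z => n%:Z <= z) (fun z => z <= 0)) <= A * (1 + 1 / 2)].
  by near: n.
apply: lt_le_trans (_ : Ew p k 0 g <= _); first by apply: lt_le_trans Ag; rewrite mulr_gt0// subr_gt0 ltr_pdivrMr// mul1r ltr1n.
apply: (Ew_le_prob hQ (measurable_Lambda' R n0) g01 _ dg) => s s0 gs.
by have [] := gL s s0 gs.
Unshelve. all: by end_near. Qed.

Section lower_bound.
Variables (F : (R -> R) * R -> R) (M G : R).
Hypotheses (M0 : 0 < M) (F0M : forall x, 0 <= F x <= M) (G01 : 0 <= G <= 1).
Hypothesis hG : forall eta, 0 < eta -> exists2 e, 0 < e <= 1 &
  G - eta <= expect P (fun b => phig a (fun z => F (stopped_couple a z) / M) e (radial V 0 ^~ b)).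

(** The common factor A cancels between the numerator A (G - ka) and the upper bound A (1 + ka) for
    the probability of [Lambda']. *)
Lemma conditional_lower eta : 0 < eta ->
  \forall n \near \oo, ((M * G - eta)%:E <= \int[mu n]_s (F (X n s))%:E)%E.
Proof.
move=> eta0; have M0' := M0; have /andP[G0 G1] := G01.
have F01 x : 0 <= F x / M <= 1.
  by have /andP[Fx0 FxM] := F0M x; rewrite divr_ge0 ?(ltW M0)//= ler_pdivrMr// mul1r.
pose ka := Num.min 1 (eta / (2 * M)).
have ka0 : 0 < ka by rewrite lt_min ltr01 divr_gt0// mulr_gt0.
have ka1 : ka <= 1 by rewrite ge_min lexx.
have kaM : M * ka * 2 <= eta.
  have : ka <= eta / (2 * M) by rewrite ge_min lexx orbT.
  by rewrite ler_pdivlMr ?mulr_gt0//; congr (_ <= _); ring.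
clearbody ka.
have esc := escape_core bmV Hn sigma0 clt F01 G01 hG ka0 ka1.
near=> n; have n0 : (0 < n)%N by near: n; exists 1%N.
have L0 : 0 < fine (Q (Lambda' R n)) by near: n; exact: prob_Lambda'_gt0.
have mL := measurable_Lambda' R n0.
have [A [k [g [A0 [dg g01 gL] Ag hA]]]] : exists A k g, [/\ 0 < A,
    escape_test sigma (fun x => F x / M) n k g, A * (G - ka) <= Ew p k 0 g &
    av p 0 (hit p (fun z => n%:Z <= z) (fun z => z <= 0)) <= A * (1 + ka)].
  by near: n.
have [Gka|Gka] := leP (G - ka) 0.
  have h0 := @conditional_ge0 _ Q _ mL L0 (F \o X n).
  apply: le_trans (h0 _) => [|s]; last by have /andP[] := F0M (X n s).
  rewrite lee_fin subr_le0; apply: le_trans (_ : M * ka <= _).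
    by rewrite ler_pM2l// -subr_le0.
  by apply: le_trans kaM; rewrite ler_peMr ?ler1n// mulr_ge0 ?ltW.
have bg := bnd01 g01.
have gpos s : s 0%N = 0 -> 0 < M * g s -> Lambda' R n s.
  by move=> s0; rewrite pmulr_rgt0// => /(gL s s0)[].
have gF s : s 0%N = 0 -> 0 <= M * g s <= F (X n s).
  move=> s0; have /andP[gs0 _] := g01 s; rewrite mulr_ge0 ?(ltW M0)//=.
  have [gs|] := ltP 0 (g s); last first.
    by move=> gs; have -> : g s = 0 by [apply/eqP; rewrite eq_le gs]; rewrite mulr0; have /andP[] := F0M (X n s).
  by have [_] := gL s s0 gs; rewrite ler_pdivlMr// mulrC.
apply: le_trans (conditional_ge (k := k) hQ mL L0 gF _ _ gpos _); last 3 first.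
- by move=> s; have /andP[] := F0M (X n s).
- by exists M => s; have /andP[gs0 gs1] := g01 s; rewrite ger0_norm ?mulr_ge0 ?(ltW M0)// ger_pMr.
- by move=> s s' ss'; rewrite (dg s s' ss').
rewrite lee_fin EwZ// ler_pdivlMr//.
apply: le_trans (_ : M * (A * (G - ka)) <= _); last by rewrite ler_pM2l.
have hL := le_trans (prob_Lambda'_le hQ n0) hA.
have [E|E] := leP (M * G - eta) 0.
  apply: le_trans (_ : 0 <= _); first by rewrite mulr_le0_ge0 ?(ltW L0).
  by rewrite mulr_ge0 ?(ltW M0)// mulr_ge0 ?(ltW A0)// ltW.
apply: le_trans (_ : (M * G - eta) * (A * (1 + ka)) <= _); first by rewrite ler_pM2l.
have -> : (M * G - eta) * (A * (1 + ka)) = A * ((M * G - eta) * (1 + ka)) by ring.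
have -> : M * (A * (G - ka)) = A * (M * (G - ka)) by ring.
rewrite ler_pM2l//.
have h1 : 0 <= eta * ka by rewrite mulr_ge0// ltW.
have h2 : M * G * ka <= M * ka by rewrite -mulrA ler_pM2l// ger_pMl.
exact: lower_arith.
Unshelve. all: by end_near. Qed.

End lower_bound.

(** The integral of M - F is computed separately, through the same measurable g, because linearity
    is not at hand for F itself. *)
Lemma limit_integral F M : 0 < M -> (forall x, 0 <= F x <= M) ->
  continuous_for (@C0_Rplus R) (@couple_dist R) F ->
  exists G : R, (\int[P]_b (F (Y b))%:E)%E = G%:E /\
    (\int[P]_b (M - F (Y b))%:E)%E = (M - G)%:E /\
    forall eta, 0 < eta ->
      \forall n \near \oo, ((G - eta)%:E <= \int[mu n]_s (F (X n s))%:E)%E.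
Proof.
move=> M0 F0M cF.
have F01 x : 0 <= F x / M <= 1.
  by have /andP[Fx0 FxM] := F0M x; rewrite divr_ge0 ?(ltW M0)//= ler_pdivrMr// mul1r.
have cF1 : continuous_for (@C0_Rplus R) (@couple_dist R) (fun x => F x / M).
  apply: (@continuous_for_lip _ F (fun u => u / M) M^-1) cF; first by rewrite invr_gt0.
  by move=> u v; rewrite -mulrBl normrM mulrC (gtr0_norm (_ : 0 < M^-1)) ?invr_gt0.
have [N [g [mN PN bg hg hG]]] := stopped_expectation bmV a0 F01 cF1.
have g01 b : 0 <= g b <= 1 by have [] := hg b.
have G01 : 0 <= expect P g <= 1.
  rewrite -{1}(expect_cst P 0) -(expect_cst P 1).
  by apply/andP; split; apply: le_expect => //; try exact: bounded_meas_cst;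
    move=> b; have /andP[] := g01 b.
have gE b : ~ (N `|` N0) b -> F (Y b) = M * g b.
  move=> nb; have nN : ~ N b by move=> ?; apply: nb; left.
  have nN0 : ~ N0 b by move=> ?; apply: nb; right.
  have [_ [gb [//|s hs]]] := hg b; rewrite gb// mulrC divfK ?gt_eqF//.
  apply: (eq_stopped_couple cF _ hs).
    apply: continuous_C0; first exact: (continuous_radial bmV).
    have [_ V0 _ _ _] := bmV; rewrite /radial big1 ?sqrtr0// => i _.
    by rewrite V0 mul0r addr0 expr0n.
  move=> u u0; rewrite /bessel3 /radial; congr Num.sqrt; apply: eq_bigr => i _.
  by rewrite mul0r add0r (VW nN0).
have mN' : measurable (N `|` N0) by exact: measurableU.
have PN' : P (N `|` N0) = 0%E.
  by apply/eqP; rewrite -measure_le0 -(adde0 0%E) -[X in (X + _)%E]PN -[X in (_ + X)%E]PN0; exact: measureU2.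
have bMg : bounded_meas (fun b => M * g b) by exact: bounded_measZ.
exists (M * expect P g); split; last split.
- rewrite (lower_integral_null mN' PN' _ _ (_ : forall b, _ -> _ = (M * g b)%:E)).
  + by rewrite expectE// expectZ.
  + by move=> b; rewrite lee_fin; have /andP[] := F0M (Y b).
  + by move=> b; rewrite lee_fin mulr_ge0 ?(ltW M0)//; have /andP[] := g01 b.
  + by move=> b nb; rewrite gE.
- rewrite (lower_integral_null mN' PN' _ _ (_ : forall b, _ -> _ = (M - M * g b)%:E)).
  + rewrite expectE; last by apply: bounded_measB => //; exact: bounded_meas_cst.
    by rewrite expectB ?expectZ ?expect_cst//; exact: bounded_meas_cst.
  + by move=> b; rewrite lee_fin subr_ge0; have /andP[] := F0M (Y b).
  + by move=> b; rewrite lee_fin subr_ge0 ger_pMr//; have /andP[] := g01 b.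
  + by move=> b nb; rewrite gE.
- exact: conditional_lower M0 F0M G01 hG.
Qed.

Lemma cvg_conditional_nonneg F M : 0 < M -> (forall x, 0 <= F x <= M) ->
  continuous_for (@C0_Rplus R) (@couple_dist R) F ->
  exists G : R, (\int[P]_b (F (Y b))%:E)%E = G%:E /\
    (\int[mu n]_s (F (X n s))%:E)%E @[n --> \oo] --> G%:E.
Proof.
move=> M0 F0M cF; have [G [EG [EG' hG]]] := limit_integral M0 F0M cF.
exists G; split => //.
have F0M' x : 0 <= M - F x <= M.
  by have /andP[x0 xM] := F0M x; rewrite subr_ge0 xM gerBl.
have cF' : continuous_for (@C0_Rplus R) (@couple_dist R) (fun x => M - F x).
  apply: (@continuous_for_lip _ F (fun u => M - u) 1 ltr01) cF => u v.
  by rewrite mul1r distrC (_ : M - v - (M - u) = u - v)//; ring.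
(* The limit attached to M - F is M - G, so the lower bound for M - F becomes an upper bound for
   F. *)
have [G' [+ [_ hG']]] := limit_integral M0 F0M' cF'; rewrite EG' => -[E]; rewrite -{}E in hG'.
have near_bounds e : 0 < e -> \forall n \near \oo,
    exists2 r : R, (\int[mu n]_s (F (X n s))%:E)%E = r%:E & `|G - r| <= e.
  move=> e0; near=> n; have n0 : (0 < n)%N by near: n; exists 1%N.
  have L0 : 0 < fine (Q (Lambda' R n)) by near: n; exact: prob_Lambda'_gt0.
  have mL := measurable_Lambda' R n0.
  have lo : ((G - e)%:E <= \int[mu n]_s (F (X n s))%:E)%E by near: n; exact: hG.
  have lo' : ((M - G - e)%:E <= \int[mu n]_s (M - F (X n s))%:E)%E by near: n; exact: hG'.
  have up := conditional_compl_le mL L0 (fun s => F0M (X n s)).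
  have up1 := le_trans (leeD (le_refl _) lo') up.
  move: lo up1; rewrite -/(mu n); case: (\int[mu n]_s _)%E => [r| |]//.
  rewrite -EFinD !lee_fin => h1 h2; exists r => //; rewrite ler_norml; lra.
apply/fine_cvgP; split.
  by apply: filterS (near_bounds 1 ltr01) => n [r ->].
apply/cvgrPdist_le => e e0; apply: filterS (near_bounds e e0) => n [r /= ->].
exact.
Unshelve. all: by end_near. Qed.

Lemma cvg_conditional : cvg_in_law (@C0_Rplus R) (@couple_dist R)
  mu X P (fun b => stopped_couple a (bessel3 W b)).
Proof.
move=> F [M FM] cF; pose B := `|M| + 1.
have B0 : 0 < B by rewrite ltr_wpDl.
have FB x : `|F x| <= B by rewrite (le_trans (FM x))// (le_trans (ler_norm _))// lerDl.
have part (phi : R -> R) : (forall u, 0 <= phi u <= `|u|) ->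
    (forall u v, `|phi u - phi v| <= `|u - v|) ->
    exists G : R, (\int[P]_b (phi (F (Y b)))%:E)%E = G%:E /\
      (\int[mu n]_s (phi (F (X n s)))%:E)%E @[n --> \oo] --> G%:E.
  move=> phi0 phiL; apply: (@cvg_conditional_nonneg (phi \o F) _ B0).
    by move=> x; have /andP[/= -> h] := phi0 (F x); exact: le_trans h (FB x).
  by apply: (continuous_for_lip ltr01 _ cF) => u v; rewrite mul1r.
have maxL (u v : R) : `|Num.max u 0 - Num.max v 0| <= `|u - v|.
  by have [u0|u0] := leP u 0; have [v0|v0] := leP v 0; rewrite ?subrr ?subr0 ?sub0r ?normrN ?normr0//
    ?(gtr0_norm u0) ?(gtr0_norm v0); [rewrite distrC|]; apply: le_trans (ler_norm _); lra.
have [|//|Gp [Ep cp]] := part (fun u => Num.max u 0).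
  by move=> u; rewrite le_max lexx orbT/= ge_max ler_norm normr_ge0.
have [| |Gn [En cn]] := part (fun u => Num.max (- u) 0).
- by move=> u; rewrite le_max lexx orbT/= ge_max -normrN ler_norm normr_ge0.
- by move=> u v; apply: le_trans (maxL _ _) _; rewrite -opprD normrN.
(* The integral of a signed function is by definition the difference of those of its parts, so the
   two parts pass to the limit separately. *)
rewrite integralE (_ : (\int[P]_b _^\+ b)%E = Gp%:E); last first.
  by rewrite -Ep; apply: eq_integral => b _; rewrite funeposE -EFin_max.
rewrite (_ : (\int[P]_b _^\- b)%E = Gn%:E); last first.
  by rewrite -En; apply: eq_integral => b _; rewrite funenegE -EFinN -EFin_max.
apply: cvg_trans (cvgeB (_ : Gp%:E +? - Gn%:E)%E cp cn) => //; apply: near_eq_cvg.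
near=> n; have n0 : (0 < n)%N by near: n; exists 1%N.
have L0 : 0 < fine (Q (Lambda' R n)) by near: n; exact: prob_Lambda'_gt0.
exact/esym/(conditional_posneg (measurable_Lambda' R n0) L0 (fun s => F (X n s))).
Unshelve. all: by end_near. Qed.

End conditional_limit.

Theorem corollary1p1 (R : realType) (P : probability (environment R) R)
    (sigma : R)
    (d : measure_display) (T : measurableType d) (PB : probability T R)
    (W : 'I_3 -> R -> T -> R) :
  conductances P ->
  stationary P ->
  ergodic P ->
  condition_E P ->
  condition_K P ->
  diffusion_constant P sigma ->
  brownian_motion PB W ->
  {ae P, forall w, forall Q : probability trajectory R, quenched_law w 0 Q ->
    cvg_in_law (@C0_Rplus R) (@couple_dist R)
      (fun n => conditional_law Q (Lambda' R n))
      (fun n X => stopped_couple sigma^-1 (rescaled_path sigma (n ^ 2) X))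
      PB (fun b => stopped_couple sigma^-1 (bessel3 W b))}.
Proof.
move=> hc hs _ hE hK [sigma0 hclt] hB.
have [N0 [V [mN0 PN0 bmV VW]]] := nice_version hB.
apply: (ae_imp2 (ae_nice hs hc hE hK) hclt) => w [p [C [kap [D [q [t [pE Hn]]]]]]] clt Q hQ.
(* The invariance principle is needed for a single coordinate of the continuous version [V]; the
   other two enter only through the radial process. *)
have bm1 := nice_bm_brownian (nice_bm_coord ord0 bmV).
have cltV := walk_clt pE hQ bmV (clt Q hQ _ _ PB _ bm1).
exact (cvg_conditional mN0 PN0 bmV VW Hn sigma0 cltV (quenched_kernel pE hQ)).
Qed.
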